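(* Let $S_1$ and $S_2$ be two del Pezzo surfaces. Then: \begin{itemize} \item if $S_1\neq S_2$, then $\operatorname{Aut}(S_1\times S_2)=\operatorname{Aut}(S_1)\times\operatorname{Aut}(S_2)$; \item if $S_1=S_2=S\neq \mathbb{P}^1\times \mathbb{P}^1$, then $\operatorname{Aut}(S\times S)=(\operatorname{Aut}(S)\times\operatorname{Aut}(S))\rtimes \mathbb{Z}/2\mathbb{Z}$; \item if $S_1=S_2= \mathbb{P}^1\times \mathbb{P}^1$, then $\operatorname{Aut}((\mathbb{P}^1)^{4})=\operatorname{Aut}(\mathbb{P}^1)^{4}\rtimes \mathfrak{S}_4$, where $\mathfrak{S}_4$ is the symmetric group with $24$ elements. \end{itemize}
   Context: All varieties are over $\mathbb{C}$. A del Pezzo surface is a smooth, projective, simply connected complex surface $S$ whose anticanonical divisor $-K_S$ is ample; equivalently, $S$ is $\mathbb{P}^1\times\mathbb{P}^1$ or the blow-up of $\mathbb{P}^2$ in $0\le n<9$ points in general position. Equality $S_1=S_2$ of surfaces means that they are isomorphic, and $S_1\ne S_2$ means that they are not. $\operatorname{Aut}$ denotes the group of (biholomorphic) automorphisms; the products of automorphism groups act on products of surfaces factor by factor, $\mathbb{Z}/2\mathbb{Z}$ is generated by the exchange of the two copies of $S$, and $\mathfrak{S}_4$ acts by permuting the four copies of $\mathbb{P}^1$. *)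

(* Defs.v *)
From HB Require Import structures.
From mathcomp Require Import all_boot all_order all_algebra all_fingroup.
From mathcomp Require Import all_classical all_reals all_analysis.
From mathcomp Require Import complex.

Set Implicit Arguments.
Unset Strict Implicit.
Unset Printing Implicit Defensive.

Import Order.TTheory GRing.Theory Num.Theory numFieldNormedType.Exports.
Local Open Scope ring_scope.
Local Open Scope classical_set_scope.

(* The field of complex numbers. Seen as a numClosedFieldType it is a normed
   module over itself, so that [differentiable] and ['d] between spaces
   ['rV[cplx R]_n] are complex (i.e. C-linear) differentiability and the complex
   differential: a map is holomorphic on an open set iff it is differentiable
   at each of its points. *)
Definition cplx (R : realType) : numClosedFieldType := R[i].

Section DifferentiableExtra.
Variable K : numFieldType.

Lemma near_differentiable (V W : normedModType K) (f g : V -> W) (x : V) :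
  (\forall y \near x, f y = g y) -> differentiable f x -> differentiable g x.
Proof.
move=> fg df.
have fgx : f x = g x by exact: (nbhs_singleton fg).
have /diff_locallyP[dfc dfE] := df.
have fg0 : \forall h \near (0 : V), f (h + x) = g (h + x).
  by move: fg; rewrite (near_shift 0 x); apply: filterS => y /=; rewrite subr0.
have dgE : g \o shift x = cst (g x) + 'd f x +o_ (0 : V) id.
  apply/eqaddoP => e e0; move/eqaddoP: dfE => /(_ e e0) dfE.
  apply: filterS2 fg0 dfE => h fgh.
  by rewrite !fctE /= fgh fgx.
have dgf := diff_unique dfc dgE.
by apply/diff_locallyP; rewrite dgf.
Qed.

Lemma differentiable_row (V : normedModType K) n (f : V -> 'rV[K]_n) (x : V) :
  (forall j, differentiable (fun v => f v 0 j : K) x) -> differentiable f x.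
Proof.
move=> df.
have -> : f = \sum_(j < n) (fun v => f v 0 j *: (delta_mx 0 j : 'rV[K]_n)).
  by apply/funext => v; rewrite fct_sumE [LHS]row_sum_delta.
by apply: differentiable_sum => j; apply: differentiableZl.
Qed.

End DifferentiableExtra.

Section TopologyExtra.

Lemma continuous_row (K : numFieldType) (T : topologicalType) n
    (f : T -> 'rV[K]_n) (x : T) :
  (forall j, {for x, continuous (fun y => f y 0 j : K)}) -> {for x, continuous f}.
Proof.
move=> fc; apply/cvg_ballP => e e0.
have H (j : 'I_n) : \forall y \near x, ball (f x 0 j) e (f y 0 j).
  by move/cvg_ballP : (fc j) => /(_ e e0).
near=> y; split => // i j; rewrite (ord1 i); move: j; near: y.
exact: filter_forall H.
Unshelve. all: by end_near.
Qed.

Lemma near_continuous (T U : topologicalType) (f g : T -> U) (x : T) :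
  (\forall y \near x, f y = g y) -> {for x, continuous f} ->
  {for x, continuous g}.
Proof.
move=> fg fc A; rewrite -(nbhs_singleton fg) => /fc.
by apply: filterS2 fg => y /= ->.
Qed.

Lemma hausdorff_prod (T U : topologicalType) :
  hausdorff_space T -> hausdorff_space U -> hausdorff_space (T * U)%type.
Proof.
move=> hT hU [x1 x2] [y1 y2] xy; congr (_, _).
- apply: hT => A B xA yB.
  have [||[a b] [/= aA aB]] := xy (fst @^-1` A) (fst @^-1` B); last by exists a.
    exact: (@cvg_fst _ _ (nbhs x1) (nbhs x2) _ A xA).
  exact: (@cvg_fst _ _ (nbhs y1) (nbhs y2) _ B yB).
- apply: hU => A B xA yB.
  have [||[a b] [/= aA aB]] := xy (snd @^-1` A) (snd @^-1` B); last by exists b.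
    exact: (@cvg_snd _ _ (nbhs x1) (nbhs x2) _ A xA).
  exact: (@cvg_snd _ _ (nbhs y1) (nbhs y2) _ B yB).
Qed.

Lemma open_pointwise_preimage (T U : topologicalType) (f : T -> U) (D : set T)
    (A : set U) : open D -> (forall x, D x -> {for x, continuous f}) ->
  open A -> open (D `&` f @^-1` A).
Proof.
move=> oD fc oA; rewrite openE => x [Dx Afx]; apply: filterI.
  exact: open_nbhs_nbhs.
by apply: (fc _ Dx); exact: open_nbhs_nbhs.
Qed.

End TopologyExtra.

Section Charts.
Variable R : realType.
Local Notation C := (cplx R).

(* [chart_inv] is only meaningful on the image of [chart_dom], and [chart_map]
   only on [chart_dom]; both are total for convenience. *)
Record chart (n : nat) (T : topologicalType) := Chart {
  chart_dom : set T;
  chart_map :> T -> 'rV[C]_n;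
  chart_inv : 'rV[C]_n -> T;
  chart_dom_open : open chart_dom;
  chart_img_open : open (chart_map @` chart_dom);
  chart_mapK : forall x, chart_dom x -> chart_inv (chart_map x) = x;
  chart_map_continuous : forall x, chart_dom x -> {for x, continuous chart_map};
  chart_inv_continuous : forall v, (chart_map @` chart_dom) v ->
    {for v, continuous chart_inv} }.

(* Second countability is not part of the definition: it is automatic for
   compact manifolds, the only ones considered here. *)
Record cmanifold (n : nat) := CManifold {
  carrier :> topologicalType;
  manifold_hausdorff : hausdorff_space carrier;
  atlas : set (chart n carrier);
  atlas_cover : forall x, exists2 phi, atlas phi & chart_dom phi x;
  atlas_compatible : forall phi psi x, atlas phi -> atlas psi ->
    chart_dom phi x -> chart_dom psi x ->
    differentiable (psi \o chart_inv phi) (phi x) }.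

Definition holomorphic m n (M : cmanifold m) (N : cmanifold n) (f : M -> N) :=
  continuous f /\
  forall phi psi x, atlas phi -> atlas psi ->
    chart_dom phi x -> chart_dom psi (f x) ->
    differentiable (psi \o f \o chart_inv phi) (phi x).

Lemma chart_inv_cvg n (T : topologicalType) (phi : chart n T) x (A : set T) :
  chart_dom phi x -> nbhs x A -> \forall v \near phi x, A (chart_inv phi v).
Proof.
move=> dx Ax; apply: (@chart_inv_continuous _ _ phi (phi x)); first by exists x.
by rewrite chart_mapK.
Qed.

Lemma chart_dom_nbhs n (T : topologicalType) (phi : chart n T) x :
  chart_dom phi x -> nbhs x (chart_dom phi).
Proof. by move=> dx; apply: open_nbhs_nbhs; split=> //; exact: chart_dom_open. Qed.

Lemma holomorphic_id n (M : cmanifold n) : holomorphic (@idfun M).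
Proof.
by split=> [x //|phi psi x aphi apsi dx dy]; exact: atlas_compatible.
Qed.

Lemma holomorphic_comp l m n (L : cmanifold l) (M : cmanifold m)
    (N : cmanifold n) (f : L -> M) (g : M -> N) :
  holomorphic f -> holomorphic g -> holomorphic (g \o f).
Proof.
move=> [fc fd] [gc gd]; split=> [x|phi psi x aphi apsi dx dy].
  by apply: continuous_comp; [exact: fc|exact: gc].
have [theta atheta dfx] := atlas_cover (f x).
apply: (@near_differentiable _ _ _
  ((psi \o g \o chart_inv theta) \o (theta \o f \o chart_inv phi))).
  have dth : \forall y \near x, chart_dom theta (f y).
    exact: (fc x _ (chart_dom_nbhs dfx)).
  have := @chart_inv_cvg _ _ phi x _ dx dth.
  by apply: filterS => v dv /=; rewrite chart_mapK.
apply: differentiable_comp; first exact: fd.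
by rewrite /= chart_mapK//; apply: gd.
Qed.

Section Product.
Variables (m n : nat) (M : cmanifold m) (N : cmanifold n).

Section ProductChart.
Variables (phi : chart m M) (psi : chart n N).

Let pdom : set (M * N) := chart_dom phi `*` chart_dom psi.
Let pmap (p : M * N) : 'rV[C]_(m + n) := row_mx (phi p.1) (psi p.2).
Let pinv (v : 'rV[C]_(m + n)) : M * N :=
  (chart_inv phi (lsubmx v), chart_inv psi (rsubmx v)).

Fact prod_chart_dom_open : open pdom.
Proof.
rewrite openE => -[x y] [/= dx dy]; exists (chart_dom phi, chart_dom psi) => //.
by split; exact: chart_dom_nbhs.
Qed.

Fact prod_chart_imgE : pmap @` pdom =
  lsubmx @^-1` (phi @` chart_dom phi) `&` rsubmx @^-1` (psi @` chart_dom psi).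
Proof.
apply/seteqP; split=> v /=.
  by move=> [[x y] [/= dx dy] <-]; rewrite /pmap /= row_mxKl row_mxKr;
    split; [exists x|exists y].
move=> [[x dx xv] [y dy yv]]; exists (x, y) => //.
by rewrite /pmap /= xv yv hsubmxK.
Qed.

Fact prod_chart_img_open : open (pmap @` pdom).
Proof.
rewrite prod_chart_imgE; apply: openI.
  apply: open_comp; last exact: chart_img_open.
  by move=> v _; exact: continuous_lsubmx.
apply: open_comp; last exact: chart_img_open.
  by move=> v _; exact: continuous_rsubmx.
Qed.

Fact prod_chart_mapK p : pdom p -> pinv (pmap p) = p.
Proof.
case: p => x y [/= dx dy].
by rewrite /pinv /pmap row_mxKl row_mxKr /= !chart_mapK.
Qed.

Fact prod_chart_map_continuous p : pdom p -> {for p, continuous pmap}.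
Proof.
case: p => x y [/= dx dy]; apply: continuous_row => j; rewrite -(splitK j).
case: (fintype.split j) => k /=.
- have -> : (fun q => pmap q 0 (lshift n k)) = (fun v : 'rV[C]_m => v 0 k : C) \o (chart_map phi \o fst).
    by apply/funext => q /=; rewrite /pmap row_mxEl.
  apply: continuous_comp; last exact: coord_continuous.
  apply: continuous_comp; first exact: cvg_fst.
  exact: chart_map_continuous.
- have -> : (fun q => pmap q 0 (rshift m k)) = (fun v : 'rV[C]_n => v 0 k : C) \o (chart_map psi \o snd).
    by apply/funext => q /=; rewrite /pmap row_mxEr.
  apply: continuous_comp; last exact: coord_continuous.
  apply: continuous_comp; first exact: cvg_snd.
  exact: chart_map_continuous.
Qed.

Fact prod_chart_inv_continuous v : (pmap @` pdom) v -> {for v, continuous pinv}.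
Proof.
rewrite prod_chart_imgE => -[vl vr].
have lc : {for v, continuous (chart_inv phi \o lsubmx)}.
  apply: continuous_comp; first exact: continuous_lsubmx.
  exact: chart_inv_continuous.
have rc : {for v, continuous (chart_inv psi \o rsubmx)}.
  apply: continuous_comp; first exact: continuous_rsubmx.
  exact: chart_inv_continuous.
exact: cvg_pair lc rc.
Qed.

Definition prod_chart : chart (m + n) (M * N)%type :=
  Chart prod_chart_dom_open prod_chart_img_open prod_chart_mapK
    prod_chart_map_continuous prod_chart_inv_continuous.

End ProductChart.

Definition prod_atlas : set (chart (m + n) (M * N)%type) :=
  [set c | exists2 phi, atlas phi & exists2 psi, atlas psi &
    c = prod_chart phi psi].

Fact prod_atlas_cover p : exists2 phi, prod_atlas phi & chart_dom phi p.
Proof.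
have [phi aphi dphi] := atlas_cover p.1.
have [psi apsi dpsi] := atlas_cover p.2.
by exists (prod_chart phi psi) => //; exists phi => //; exists psi.
Qed.

Fact prod_atlas_compatible phi psi p : prod_atlas phi -> prod_atlas psi ->
  chart_dom phi p -> chart_dom psi p ->
  differentiable (psi \o chart_inv phi) (phi p).
Proof.
move=> [phi1 aphi1 [phi2 aphi2 ->]] [psi1 apsi1 [psi2 apsi2 ->]].
case: p => x y [/= dx1 dy1] [/= dx2 dy2]; apply: differentiable_row => j.
rewrite -(splitK j); case: (fintype.split j) => k /=.
- have -> : (fun v => row_mx (psi1 (chart_inv phi1 (lsubmx v)))
      (psi2 (chart_inv phi2 (rsubmx v))) 0 (lshift n k)) =
      (fun v : 'rV[C]_m => v 0 k : C) \o
      ((chart_map psi1 \o chart_inv phi1) \o lsubmx).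
    by apply/funext => q /=; rewrite row_mxEl.
  apply: differentiable_comp; last exact: differentiable_coord.
  apply: differentiable_comp; first exact: differentiable_lsubmx.
  by rewrite row_mxKl; exact: atlas_compatible.
- have -> : (fun v => row_mx (psi1 (chart_inv phi1 (lsubmx v)))
      (psi2 (chart_inv phi2 (rsubmx v))) 0 (rshift m k)) =
      (fun v : 'rV[C]_n => v 0 k : C) \o
      ((chart_map psi2 \o chart_inv phi2) \o rsubmx).
    by apply/funext => q /=; rewrite row_mxEr.
  apply: differentiable_comp; last exact: differentiable_coord.
  apply: differentiable_comp; first exact: differentiable_rsubmx.
  by rewrite row_mxKr; exact: atlas_compatible.
Qed.

Definition prod_manifold : cmanifold (m + n) :=
  @CManifold (m + n) (M * N)%type
    (hausdorff_prod (@manifold_hausdorff _ M) (@manifold_hausdorff _ N))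
    prod_atlas prod_atlas_cover prod_atlas_compatible.

Lemma holomorphic_fst : holomorphic (fst : prod_manifold -> M).
Proof.
split=> [p|phi psi p [phi1 aphi1 [phi2 aphi2 ->]] apsi].
  exact: cvg_fst.
move=> [/= d1 d2] d3.
apply: (@differentiable_comp _ _ _ _ lsubmx (psi \o chart_inv phi1)).
  exact: differentiable_lsubmx.
by rewrite row_mxKl; exact: atlas_compatible.
Qed.

Lemma holomorphic_snd : holomorphic (snd : prod_manifold -> N).
Proof.
split=> [p|phi psi p [phi1 aphi1 [phi2 aphi2 ->]] apsi].
  exact: cvg_snd.
move=> [/= d1 d2] d3.
apply: (@differentiable_comp _ _ _ _ rsubmx (psi \o chart_inv phi2)).
  exact: differentiable_rsubmx.
by rewrite row_mxKr; exact: atlas_compatible.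
Qed.

Lemma holomorphic_pair l (L : cmanifold l) (f : L -> M) (g : L -> N) :
  holomorphic f -> holomorphic g ->
  holomorphic ((fun x => (f x, g x)) : L -> prod_manifold).
Proof.
move=> [fc fd] [gc gd]; split=> [x|phi psi x aphi [psi1 apsi1 [psi2 apsi2 ->]]].
  exact: cvg_pair (fc x) (gc x).
move=> dx [/= d1 d2]; apply: differentiable_row => j.
rewrite -(splitK j); case: (fintype.split j) => k /=.
- have -> : (fun v => row_mx (psi1 (f (chart_inv phi v)))
      (psi2 (g (chart_inv phi v))) 0 (lshift n k)) =
      (fun v : 'rV[C]_m => v 0 k : C) \o (chart_map psi1 \o f \o chart_inv phi).
    by apply/funext => q /=; rewrite row_mxEl.
  apply: differentiable_comp; last exact: differentiable_coord.
  exact: fd.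
- have -> : (fun v => row_mx (psi1 (f (chart_inv phi v)))
      (psi2 (g (chart_inv phi v))) 0 (rshift m k)) =
      (fun v : 'rV[C]_n => v 0 k : C) \o (chart_map psi2 \o g \o chart_inv phi).
    by apply/funext => q /=; rewrite row_mxEr.
  apply: differentiable_comp; last exact: differentiable_coord.
  exact: gd.
Qed.

End Product.
End Charts.

Section Projective.
Variables (R : realType) (N : nat).
Local Notation C := (cplx R).
Local Notation V := ('rV[C]_N.+1).

(* Points of P^N are the lines through the origin of C^(N+1). *)
Definition proj := {L : {vspace V} | \dim L == 1%N}.
HB.instance Definition _ := Choice.copy proj {L : {vspace V} | \dim L == 1%N}.

Fact line_subproof (v : V) : v != 0 -> \dim <[v]>%VS == 1%N.
Proof. by move=> v0; rewrite dim_vline v0. Qed.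

Let e0 : V := delta_mx 0 0.

Fact base_line_subproof : e0 != 0.
Proof.
by apply/eqP => /matrixP/(_ 0 0)/eqP; rewrite !mxE !eqxx /= oner_eq0.
Qed.

(* The point with homogeneous coordinates v; a junk value for v = 0. *)
Definition line (v : V) : proj :=
  insubd (Sub <[e0]>%VS (line_subproof base_line_subproof) : proj)
    <[v]>%VS.

(* A choice of homogeneous coordinates. *)
Definition coords (L : proj) : V := vpick (val L).

Lemma val_line v : v != 0 -> val (line v) = <[v]>%VS.
Proof. by move=> v0; rewrite val_insubd line_subproof. Qed.

Lemma coords_neq0 L : coords L != 0.
Proof.
rewrite vpick0; apply/negP => /eqP L0.
by have := valP L; rewrite L0 dimv0.
Qed.

Lemma coordsK : cancel coords line.
Proof.
move=> L; apply/val_inj; rewrite val_line ?coords_neq0//.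
apply/eqP; rewrite eqEdim dim_vline coords_neq0 (eqP (valP L)) leqnn andbT.
by rewrite -memvE memv_pick.
Qed.

Lemma lineZ c v : c != 0 -> v != 0 -> line (c *: v) = line v.
Proof.
move=> c0 v0; apply/val_inj; rewrite !val_line ?scaler_eq0 ?negb_or ?c0//.
apply/eqP; rewrite eqEdim !dim_vline scaler_eq0 negb_or c0 v0 leqnn andbT.
by rewrite -memvE memvZ ?memv_line.
Qed.

Lemma line_inj v w : v != 0 -> w != 0 -> line v = line w ->
  exists2 c, c != 0 & v = c *: w.
Proof.
move=> v0 w0 /(congr1 val); rewrite !val_line// => vw.
have : v \in <[w]>%VS by rewrite -vw memv_line.
case/vlineP => c vE; exists c => //.
by apply: contra_neq v0 => c0; rewrite vE c0 scale0r.
Qed.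

Lemma coords_line v : v != 0 -> exists2 c, c != 0 & coords (line v) = c *: v.
Proof.
by move=> v0; apply: line_inj; rewrite ?coords_neq0 ?coordsK.
Qed.

(* The quotient topology of C^(N+1) \ {0}. *)
Definition proj_open (U : set proj) := open [set v : V | v != 0 /\ U (line v)].

Fact open_neq0 : open [set v : V | v != 0].
Proof.
have -> : [set v : V | v != 0] = ~` [set 0].
  by apply/seteqP; split=> v /= /eqP.
apply: closed_openC.
exact/accessible_closed_set1/hausdorff_accessible/norm_hausdorff.
Qed.

Fact proj_openT : proj_open setT.
Proof.
rewrite /proj_open (_ : [set v : V | _] = [set v : V | v != 0]).
  exact: open_neq0.
by apply/seteqP; split=> v //= [].
Qed.

Fact proj_openI : setI_closed proj_open.
Proof.
move=> A B oA oB; rewrite /proj_open.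
rewrite (_ : [set v : V | _] = [set v : V | v != 0 /\ A (line v)] `&`
  [set v : V | v != 0 /\ B (line v)]); first exact: openI.
by apply/seteqP; split=> v /=; [move=> [? []]|move=> [[? ?] []]].
Qed.

Fact proj_open_bigU (I : Type) (f : I -> set proj) :
  (forall i, proj_open (f i)) -> proj_open (\bigcup_i f i).
Proof.
move=> oF; rewrite /proj_open.
rewrite (_ : [set v : V | _] =
  \bigcup_i [set v : V | v != 0 /\ f i (line v)]).
  by apply: bigcup_open => i _; exact: oF.
apply/seteqP; split=> v /=; first by move=> [v0 [i _ ?]]; exists i.
by move=> [i _ [? ?]]; split=> //; exists i.
Qed.

HB.instance Definition _ :=
  isOpenTopological.Build proj proj_openT proj_openI proj_open_bigU.

Lemma proj_openE (U : set proj) :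
  open U = open [set v : V | v != 0 /\ U (line v)].
Proof. by []. Qed.

Lemma line_continuous v : v != 0 -> {for v, continuous line}.
Proof.
move=> v0 A; rewrite nbhsE => -[U [oU Uv] UA].
have : nbhs v [set v : V | v != 0 /\ U (line v)].
  by apply: open_nbhs_nbhs; split=> //; rewrite -proj_openE.
by apply: filterS => w [_ /UA].
Qed.

Lemma line_open (A : set V) : open A -> open (line @` (A `&` [set v | v != 0])).
Proof.
move=> oA; rewrite proj_openE openE => v [v0 [a [Aa /= a0] av]].
have [c c0 aE] := line_inj a0 v0 av.
have nA : nbhs v ([set w : V | A (c *: w)] `&` [set w | w != 0]).
  apply: filterI; last first.
    by apply: open_nbhs_nbhs; split=> //; exact: open_neq0.
  have sc : {for v, continuous (fun w : V => c *: w)} by exact: scaler_continuous.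
  by apply: sc; rewrite -aE; apply: open_nbhs_nbhs.
apply: filterS nA => w [/= Aw w0]; split=> //; exists (c *: w).
  by split=> //=; rewrite scaler_eq0 negb_or c0.
exact: lineZ.
Qed.

Lemma proj_continuous (T : topologicalType) (f : proj -> T) L :
  {for coords L, continuous (f \o line)} -> {for L, continuous f}.
Proof.
move=> fc A; rewrite -{1}[L]coordsK => /fc fA.
have : nbhs (coords L) ((f \o line) @^-1` A) by [].
rewrite nbhsE => -[B [oB BL] BA].
have : open_nbhs L (line @` (B `&` [set v | v != 0])).
  split; first exact: line_open.
  exists (coords L); last exact: coordsK.
  by split=> //=; exact: coords_neq0.
move=> /open_nbhs_nbhs nB; apply: (@filterS _ (nbhs L) _ _ _ _ nB).
by move=> _ [w [Bw _] <-]; exact: BA.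
Qed.

Section AffineChart.
Variable i : 'I_N.+1.

Let adom : set proj := [set L | coords L 0 i != 0].
Let amap (L : proj) : 'rV[C]_N :=
  \row_j (coords L 0 (lift i j) / coords L 0 i).
(* The vector with entry 1 in position i and those of w in the others. *)
Definition homogenize (w : 'rV[C]_N) : V :=
  \row_k (if unlift i k is Some j then w 0 j else 1).
Let ainv (w : 'rV[C]_N) : proj := line (homogenize w).

Lemma homogenize_neq0 w : homogenize w != 0.
Proof.
apply/eqP => /matrixP/(_ 0 i)/eqP; rewrite !mxE unlift_none.
by rewrite oner_eq0.
Qed.

Lemma affine_dom_line v : v != 0 -> adom (line v) <-> v 0 i != 0.
Proof.
move=> v0; rewrite /adom /=; have [c c0 ->] := coords_line v0.
by rewrite mxE mulf_eq0 (negbTE c0).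
Qed.

Lemma affine_map_line v : v != 0 ->
  amap (line v) = \row_j (v 0 (lift i j) / v 0 i).
Proof.
move=> v0; have [c c0 E] := coords_line v0; apply/rowP => j.
by rewrite !mxE E !mxE -mulf_div divff// mul1r.
Qed.

Lemma affine_inv_dom w : adom (ainv w).
Proof.
by apply/affine_dom_line; rewrite ?homogenize_neq0// mxE unlift_none oner_neq0.
Qed.

Lemma affine_invK w : amap (ainv w) = w.
Proof.
rewrite affine_map_line ?homogenize_neq0//; apply/rowP => j.
by rewrite !mxE liftK unlift_none divr1.
Qed.

Fact affine_dom_open : open adom.
Proof.
rewrite proj_openE.
rewrite (_ : [set v : V | _] = (fun v : V => v 0 i : C) @^-1` [set x | x != 0]).
  apply: open_comp; first by move=> v _; exact: coord_continuous.
  have -> : [set x : C | x != 0] = ~` [set 0].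
    by apply/seteqP; split=> v /= /eqP.
  apply: closed_openC.
  exact/accessible_closed_set1/hausdorff_accessible/norm_hausdorff.
apply/seteqP; split=> v /=.
  by move=> [v0 /affine_dom_line]; exact.
move=> vi; have v0 : v != 0 by apply: contra_neq vi => ->; rewrite mxE.
by split=> //; apply/affine_dom_line.
Qed.

Fact affine_imgE : amap @` adom = setT.
Proof.
apply/seteqP; split=> // w _; exists (ainv w); last exact: affine_invK.
exact: affine_inv_dom.
Qed.

Fact affine_img_open : open (amap @` adom).
Proof. by rewrite affine_imgE; exact: openT. Qed.

Fact affine_mapK L : adom L -> ainv (amap L) = L.
Proof.
rewrite /adom /= => Li; rewrite -[RHS]coordsK -(lineZ (invr_neq0 Li)) ?coords_neq0//.
congr line; apply/rowP => k; rewrite !mxE.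
by case: unliftP => [j|] ->; rewrite ?mxE mulrC// divff.
Qed.

Fact affine_map_continuous L : adom L -> {for L, continuous amap}.
Proof.
rewrite /adom /= => Li; apply: proj_continuous.
apply: continuous_row => j.
have c1 : {for coords L, continuous (fun v : V => v 0 (lift i j) / v 0 i : C)}.
  by apply: continuousM; [|apply: continuousV => //]; exact: coord_continuous.
have E : \forall v \near coords L,
    (v : V) 0 (lift i j) / (v : V) 0 i = (amap \o line) v 0 j.
  have : nbhs (coords L) [set v : V | v != 0].
    by apply: open_nbhs_nbhs; split; [exact: open_neq0|exact: coords_neq0].
  by apply: filterS => v v0; rewrite /= affine_map_line// mxE.
exact: near_continuous E c1.
Qed.

Lemma homogenize_continuous : continuous homogenize.
Proof.
move=> w; apply: continuous_row => k.
have -> : (fun w => homogenize w 0 k : C) =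
    fun w : 'rV[C]_N => if unlift i k is Some j then w 0 j else 1.
  by apply/funext => w'; rewrite mxE.
by case: (unlift i k) => [j|]; [exact: coord_continuous|exact: cst_continuous].
Qed.

Fact affine_inv_continuous w : (amap @` adom) w -> {for w, continuous ainv}.
Proof.
move=> _; apply: (@continuous_comp _ _ _ homogenize line).
  exact: homogenize_continuous.
by apply: line_continuous; exact: homogenize_neq0.
Qed.

Definition affine_chart : chart R N proj :=
  Chart affine_dom_open affine_img_open affine_mapK affine_map_continuous
    affine_inv_continuous.

End AffineChart.

Definition proj_atlas : set (chart R N proj) := range affine_chart.

Fact proj_atlas_cover L : exists2 phi, proj_atlas phi & chart_dom phi L.
Proof.
have /rV0Pn[i Li] := coords_neq0 L.
by exists (affine_chart i) => //; exists i.
Qed.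

Fact proj_atlas_compatible phi psi L : proj_atlas phi -> proj_atlas psi ->
  chart_dom phi L -> chart_dom psi L ->
  differentiable (psi \o chart_inv phi) (phi L).
Proof.
move=> [i _ <-] [k _ <-] Li Lk; apply: differentiable_row => j.
have -> : (fun w => (affine_chart k \o chart_inv (affine_chart i)) w 0 j : C) =
    (fun w : 'rV[C]_N => homogenize i w 0 (lift k j) * (homogenize i w 0 k)^-1).
  apply/funext => w.
  have := affine_map_line k (homogenize_neq0 i w).
  by move=> /(congr1 (fun r : 'rV[C]_N => r 0 j)) E; apply: etrans E _; rewrite mxE.
have dh l : differentiable (fun w : 'rV[C]_N => homogenize i w 0 l : C)
    (affine_chart i L).
  have -> : (fun w => homogenize i w 0 l : C) =
      fun w : 'rV[C]_N => if unlift i l is Some j then w 0 j else 1.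
    by apply/funext => w'; rewrite mxE.
  by case: (unlift i l) => [?|];
    [exact: differentiable_coord|exact: differentiable_cst].
apply: differentiableM; first exact: dh.
apply: differentiableV; first exact: dh.
apply/(affine_dom_line k); first exact: homogenize_neq0.
by have := affine_mapK Li => /= ->.
Qed.

Lemma common_form (v w : V) : v != 0 -> w != 0 ->
  exists u : 'cV[C]_N.+1, ((v *m u) 0 0 != 0) /\ (w *m u) 0 0 != 0.
Proof.
move=> /rV0Pn[i vi] /rV0Pn[j wj].
have vE k : (v *m delta_mx k 0 : 'M[C]_(1, 1)) 0 0 = v 0 k by rewrite -colE mxE.
have wE k : (w *m delta_mx k 0 : 'M[C]_(1, 1)) 0 0 = w 0 k by rewrite -colE mxE.
have [wi |wi] := eqVneq (w 0 i) 0; last by exists (delta_mx i 0); rewrite vE wE.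
have [vj |vj] := eqVneq (v 0 j) 0; last by exists (delta_mx j 0); rewrite vE wE.
have mD (x : V) (a b : 'cV[C]_N.+1) :
    (x *m (a + b)) 0 0 = (x *m a) 0 0 + (x *m b) 0 0 by rewrite mulmxDr mxE.
by exists (delta_mx i 0 + delta_mx j 0); rewrite !mD !vE !wE vj wi addr0 add0r.
Qed.

Fact proj_hausdorff : hausdorff_space proj.
Proof.
move=> L M LM; apply/eqP/negPn/negP => /eqP LneqM.
have [u [Lu Mu]] := common_form (coords_neq0 L) (coords_neq0 M).
pose g (P : proj) : V := ((coords P *m u) 0 0)^-1 *: coords P.
have gline v : v != 0 -> g (line v) = ((v *m u) 0 0)^-1 *: v.
  move=> v0; rewrite /g; have [c c0 ->] := coords_line v0.
  by rewrite -scalemxAl mxE scalerA invfM mulrAC mulVf ?mul1r.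
have uc (v : V) : {for v, continuous (fun w : V => (w *m u) 0 0 : C)}.
  apply: differentiable_continuous.
  have -> : (fun w : V => (w *m u) 0 0 : C) =
      \sum_(k < N.+1) (fun w : V => w 0 k * u k 0 : C).
    by apply/funext => w; rewrite fct_sumE mxE.
  apply: differentiable_sum => k; apply: differentiableM.
    exact: differentiable_coord.
  exact: differentiable_cst.
have gc P : (coords P *m u) 0 0 != 0 -> {for P, continuous g}.
  move=> Pu; apply: proj_continuous.
  have c1 : {for coords P, continuous (fun v : V => ((v *m u) 0 0)^-1 *: v)}.
    by apply: continuousZ; [apply: continuousV => //; exact: uc|exact: cvg_id].
  have E : \forall v \near coords P, (((v : V) *m u) 0 0)^-1 *: v = (g \o line) v.
    have : nbhs (coords P) [set v : V | v != 0].
      by apply: open_nbhs_nbhs; split; [exact: open_neq0|exact: coords_neq0].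
    by apply: filterS => v v0; rewrite /= gline.
  exact: near_continuous E c1.
apply: LneqM; have gLM : g L = g M.
  apply: (@norm_hausdorff _ V) => A B LA MB.
  have [P [/= PA PB]] := LM _ _ (gc L Lu A LA) (gc M Mu B MB).
  by exists (g P).
have lineg P : (coords P *m u) 0 0 != 0 -> P = line (g P).
  by move=> Pu; rewrite lineZ ?coordsK ?invr_neq0// coords_neq0.
by rewrite (lineg L Lu) (lineg M Mu) gLM.
Qed.

Definition proj_manifold : cmanifold R N :=
  CManifold proj_hausdorff proj_atlas_cover proj_atlas_compatible.

End Projective.

Section DelPezzo.
Variable R : realType.
Local Notation C := (cplx R).

(* A closed embedding when M is compact. *)
Definition holomorphic_embedding m n (M : cmanifold R m) (N : cmanifold R n)
    (f : M -> N) :=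
  [/\ holomorphic f, injective f &
    forall phi psi x, atlas phi -> atlas psi ->
      chart_dom phi x -> chart_dom psi (f x) ->
      injective ('d (psi \o f \o chart_inv phi) (phi x))].

Definition projective n (M : cmanifold R n) :=
  compact [set: M] /\
  exists (N : nat) (f : M -> proj_manifold R N), holomorphic_embedding f.

(* Global holomorphic sections of the k-th tensor power of the anticanonical
   line bundle, the top exterior power of the holomorphic tangent bundle. Such
   a section is written s_phi (d/dz_1 /\ ... /\ d/dz_n)^k in a chart
   phi = (z_1, ..., z_n), and [s phi x] stands for s_phi at the point x. If
   psi = (w_1, ..., w_n) is another chart, then d/dz_1 /\ ... /\ d/dz_n =
   det (dw_i / dz_j) d/dw_1 /\ ... /\ d/dw_n, hence the transition rule. *)
Definition anticanonical_section n (M : cmanifold R n) (k : nat)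
    (s : chart R n M -> M -> C) :=
  (forall phi x, atlas phi -> chart_dom phi x ->
     differentiable (s phi \o chart_inv phi) (phi x)) /\
  (forall phi psi x, atlas phi -> atlas psi ->
     chart_dom phi x -> chart_dom psi x ->
     s psi x = \det (jacobian (psi \o chart_inv phi) (phi x)) ^+ k * s phi x).

(* The sections s_0, ..., s_N of -kK have no common zero and
   x |-> [s_0(x) : ... : s_N(x)] is an embedding into P^N. *)
Definition anticanonical_very_ample n (M : cmanifold R n) (k : nat) :=
  exists (N : nat) (s : 'I_N.+1 -> chart R n M -> M -> C)
    (f : M -> proj_manifold R N),
  [/\ forall i, anticanonical_section k (s i),
      forall phi x, atlas phi -> chart_dom phi x ->
        \row_i s i phi x != 0 /\ f x = line (\row_i s i phi x)
    & holomorphic_embedding f].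

Definition anticanonical_ample n (M : cmanifold R n) :=
  exists2 k : nat, (0 < k)%N & anticanonical_very_ample M k.

Local Notation I01 := (`[0, 1]%classic : set R).

Definition simply_connected (T : topologicalType) :=
  [/\ [set: T] !=set0,
      forall x y : T, exists g : R -> T,
        [/\ {within I01, continuous g}, g 0 = x & g 1 = y]
    & forall g : R -> T, {within I01, continuous g} -> g 0 = g 1 ->
        exists H : R * R -> T,
        [/\ {within I01 `*` I01, continuous H},
            forall t, I01 t -> H (0, t) = g t /\ H (1, t) = g 0
          & forall u, I01 u -> H (u, 0) = g 0 /\ H (u, 1) = g 0]].

Definition del_pezzo (S : cmanifold R 2) :=
  [/\ projective S, simply_connected S & anticanonical_ample S].

Definition biholomorphic m n (M : cmanifold R m) (N : cmanifold R n) :=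
  exists (f : M -> N) (g : N -> M),
    [/\ holomorphic f, holomorphic g, cancel f g & cancel g f].

End DelPezzo.

Section AutomorphismGroup.
Variables (R : realType) (n : nat) (M : cmanifold R n).

Record autgroup := MkAut {
  aut_fun :> M -> M;
  aut_inv : M -> M;
  aut_holomorphic : holomorphic aut_fun;
  aut_inv_holomorphic : holomorphic aut_inv;
  autK : cancel aut_fun aut_inv;
  aut_invK : cancel aut_inv aut_fun }.

HB.instance Definition _ := gen_eqMixin autgroup.
HB.instance Definition _ := gen_choiceMixin autgroup.

Lemma aut_eq (f g : autgroup) : f =1 g -> f = g.
Proof.
case: f g => [f f' hf hf' fK f'K] [g g' hg hg' gK g'K] /= /funext fg.
subst g; have fg' : f' = g' by apply/funext => x; rewrite -{1}(g'K x) fK.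
by subst g'; congr MkAut; exact: Prop_irrelevance.
Qed.

Definition aut_id : autgroup :=
  MkAut (holomorphic_id M) (holomorphic_id M) (fun=> erefl) (fun=> erefl).

Definition aut_comp (f g : autgroup) : autgroup :=
  MkAut (holomorphic_comp (aut_holomorphic g) (aut_holomorphic f))
    (holomorphic_comp (aut_inv_holomorphic f) (aut_inv_holomorphic g))
    (can_comp (autK f) (autK g)) (can_comp (aut_invK g) (aut_invK f)).

Definition aut_inverse (f : autgroup) : autgroup :=
  MkAut (aut_inv_holomorphic f) (aut_holomorphic f) (aut_invK f) (autK f).

Fact aut_compA : associative aut_comp.
Proof. by move=> f g h; exact: aut_eq. Qed.
Fact aut_comp1f : left_id aut_id aut_comp.
Proof. by move=> f; exact: aut_eq. Qed.
Fact aut_compf1 : right_id aut_id aut_comp.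
Proof. by move=> f; exact: aut_eq. Qed.
Fact aut_compVf : left_inverse aut_id aut_inverse aut_comp.
Proof. by move=> f; apply: aut_eq => x /=; rewrite autK. Qed.
Fact aut_compfV : right_inverse aut_id aut_inverse aut_comp.
Proof. by move=> f; apply: aut_eq => x /=; rewrite aut_invK. Qed.

HB.instance Definition _ :=
  isGroup.Build autgroup aut_compA aut_comp1f aut_compf1 aut_compVf aut_compfV.

End AutomorphismGroup.

Section GroupNotions.
Local Open Scope group_scope.

Definition group_isomorphism (G H : groupType) (f : G -> H) :=
  {morph f : x y / x * y} /\ bijective f.

(* G is the internal semidirect product i(N) ><| j(H), where i and j identify
   N and H with subgroups of G, the first of which is normal. *)
Definition internal_semidirect (G N H : groupType) (i : N -> G) (j : H -> G) :=
  [/\ {morph i : x y / x * y} /\ injective i,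
      {morph j : x y / x * y} /\ injective j,
      forall g x, exists y, g * i x * g^-1 = i y,
      forall x y, i x = j y -> i x = 1
    & forall g, exists x y, g = i x * j y].

End GroupNotions.

Section ProductAutomorphisms.
Variable R : realType.

Section Pair.
Variables (m n : nat) (M : cmanifold R m) (N : cmanifold R n).
Local Notation MN := (prod_manifold M N).

Fact prod_fun_holomorphic (f : M -> M) (g : N -> N) :
  holomorphic f -> holomorphic g ->
  holomorphic (fun x : MN => (f x.1, g x.2) : MN).
Proof.
move=> hf hg; apply: holomorphic_pair.
  exact: holomorphic_comp (@holomorphic_fst _ _ _ M N) hf.
exact: holomorphic_comp (@holomorphic_snd _ _ _ M N) hg.
Qed.

Fact prod_funK (f f' : M -> M) (g g' : N -> N) :
  cancel f f' -> cancel g g' ->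
  cancel (fun x : MN => (f x.1, g x.2) : MN) (fun x => (f' x.1, g' x.2)).
Proof. by move=> fK gK [x y] /=; rewrite fK gK. Qed.

Definition prod_aut (h : autgroup M * autgroup N) : autgroup MN :=
  MkAut (prod_fun_holomorphic (aut_holomorphic h.1) (aut_holomorphic h.2))
    (prod_fun_holomorphic (aut_inv_holomorphic h.1) (aut_inv_holomorphic h.2))
    (prod_funK (@autK _ _ _ h.1) (@autK _ _ _ h.2))
    (prod_funK (@aut_invK _ _ _ h.1) (@aut_invK _ _ _ h.2)).

Lemma prod_autM : {morph prod_aut : h k / (h * k)%g}.
Proof. by move=> h k; exact: aut_eq. Qed.

End Pair.

Section Copies.
Variables (n : nat) (M : cmanifold R n).
Local Notation MM := (prod_manifold M M).

Fact swap_holomorphic : holomorphic (fun x : MM => (x.2, x.1) : MM).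
Proof.
by apply: holomorphic_pair; [exact: holomorphic_snd|exact: holomorphic_fst].
Qed.

Fact swapK : involutive (fun x : MM => (x.2, x.1) : MM).
Proof. by case. Qed.

Definition swap_aut : autgroup MM :=
  MkAut swap_holomorphic swap_holomorphic swapK swapK.

(* The group ['Z_2] is additive: its product, as a group, is +. *)
Definition swap_action (e : 'Z_2) : autgroup MM := (swap_aut ^+ e)%g.

Lemma swap_actionM : {morph swap_action : d e / (d * e)%g}.
Proof.
have swap2 : (swap_aut ^+ 2 = 1)%g by apply: aut_eq => -[x y].
move=> d e; rewrite /swap_action -expgnDr /= -[X in _ = (_ ^+ X)%g]/(d + e)%N.
by rewrite [in RHS](divn_eq (d + e) 2) expgnDr mulnC expgM swap2 expg1n mul1g.
Qed.

Definition fourfold : cmanifold R (n + n + (n + n)) := prod_manifold MM MM.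

Definition fourfold_coord (x : fourfold) (i : 'I_4) : M :=
  nth x.1.1 [:: x.1.1; x.1.2; x.2.1; x.2.2] i.

Definition fourfold_of (x : 'I_4 -> M) : fourfold :=
  ((x (inord 0), x (inord 1)), (x (inord 2), x (inord 3))).

Lemma fourfold_ofK (x : 'I_4 -> M) : fourfold_coord (fourfold_of x) =1 x.
Proof.
by move=> [[|[|[|[|k]]]] klt] //=; congr x; apply/val_inj; rewrite /= inordK.
Qed.

Lemma fourfold_coordK : cancel fourfold_coord fourfold_of.
Proof.
by move=> [[a b] [c d]]; rewrite /fourfold_of /fourfold_coord !inordK.
Qed.

Definition fourfold_aut (f : {ffun 'I_4 -> autgroup M}) : autgroup fourfold :=
  prod_aut (prod_aut (f (inord 0), f (inord 1)),
            prod_aut (f (inord 2), f (inord 3))).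

Lemma fourfold_autE f x i :
  fourfold_coord (fourfold_aut f x) i = f i (fourfold_coord x i).
Proof.
by case: i => [[|[|[|[|k]]]] klt] //=;
  (congr (aut_fun (f _) _); apply/val_inj; rewrite /= inordK).
Qed.

Lemma holomorphic_fourfold_coord i : holomorphic (fourfold_coord^~ i).
Proof.
have h1 := @holomorphic_fst R _ _ MM MM; have h2 := @holomorphic_snd R _ _ MM MM.
have k1 := @holomorphic_fst R _ _ M M; have k2 := @holomorphic_snd R _ _ M M.
case: i => [[|[|[|[|k]]]] klt] //=.
- exact: holomorphic_comp h1 k1.
- exact: holomorphic_comp h1 k2.
- exact: holomorphic_comp h2 k1.
- exact: holomorphic_comp h2 k2.
Qed.

Definition fourfold_perm_fun (s : 'S_4) (x : fourfold) : fourfold :=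
  fourfold_of (fourfold_coord x \o s).

Fact fourfold_perm_holomorphic s : holomorphic (fourfold_perm_fun s).
Proof.
by apply: holomorphic_pair; apply: holomorphic_pair;
  exact: holomorphic_fourfold_coord.
Qed.

Fact fourfold_permK s : cancel (fourfold_perm_fun s) (fourfold_perm_fun s^-1%g).
Proof.
move=> x; rewrite /fourfold_perm_fun -[RHS]fourfold_coordK; congr fourfold_of.
by apply/funext => i /=; rewrite fourfold_ofK /= permKV.
Qed.

Fact fourfold_permVK s : cancel (fourfold_perm_fun s^-1%g) (fourfold_perm_fun s).
Proof. by move=> x; have := fourfold_permK s^-1%g x; rewrite invgK. Qed.

(* s * t is the permutation t \o s in ['S_4], so that the contravariant action
   x |-> x \o s on coordinates makes this a group morphism. *)
Definition fourfold_perm (s : 'S_4) : autgroup fourfold :=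
  MkAut (fourfold_perm_holomorphic s) (fourfold_perm_holomorphic s^-1%g)
    (fourfold_permK s) (fourfold_permVK s).

Lemma fourfold_permM : {morph fourfold_perm : s t / (s * t)%g}.
Proof.
move=> s t; apply: aut_eq => x /=; congr fourfold_of.
by apply/funext => i /=; rewrite fourfold_ofK /= permM.
Qed.

End Copies.
End ProductAutomorphisms.

(* Main.v *)
Require Import Defs.
From HB Require Import structures.
From mathcomp Require Import all_boot all_order all_algebra all_fingroup.
From mathcomp Require Import all_classical all_reals all_analysis.
From mathcomp Require Import complex ring lra.

Set Implicit Arguments.
Unset Strict Implicit.
Unset Printing Implicit Defensive.

Import Order.TTheory GRing.Theory Num.Theory numFieldNormedType.Exports.
Local Open Scope ring_scope.
Local Open Scope classical_set_scope.
Local Notation Re := (@complex.Re _).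
Local Notation Im := (@complex.Im _).

(* A del Pezzo surface has no nonzero holomorphic 1-form w: the k-th power of dw
   times a section of a very ample -kK is a constant function, which vanishes if
   the section has a zero, so that dw = 0; then w has a primitive by simple
   connectedness, which is constant by compactness.  Let g be an automorphism of
   S1 x S2, with jacobian blocks A, B, C, D, those of the inverse being primed.
   Products such as A B', along a factor, are 1-forms with values in a fixed
   space, so they vanish; hence A A' is idempotent, and its rank is constant.  If
   the rank is 2 then g is a product map, and if it is 0 then g exchanges the
   factors.  If it is 1, a map (x, x') |-> h (f x, g x') is a rectangular band law
   on S1, by which S1 is the product of two curves, the images of holomorphic
   idempotents of rank 1; the same holds for S2.

   These curves are compact, embedded in a projective space and without nonzero
   holomorphic 1-forms, hence isomorphic to P^1.  For, let x be a quotient of two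
   linear forms with simple poles P_j.  The functions with poles among the P_j
   form a free C[x]-module.  In a basis of minimal total pole order there is no
   element of order at least 2, because the corresponding element of the dual
   basis for the trace, times dx, would be a holomorphic 1-form.  So there are
   functions with simple poles at the P_j only, and the relations between them
   produce one with a single simple pole, which is an isomorphism to P^1.

   For (P^1)^4 the rank, 0 or 1, of the entries of the jacobian tells which output
   coordinate depends on which input coordinate. *)

(** * One complex variable *)

(** The analysis rests on the maximum principle, drawn from Goursat's lemma without Cauchy's
    formula; Schwarz's estimate, Taylor remainders, differentiability of derivatives and
    factorization at zeros follow from it. Of a del Pezzo surface [rigid] is kept. It descends to
    holomorphic retracts, so that the curves of the rank 1 case inherit the absence of 1-forms, and
    so does P^1, as a retract of P^1 x P^1 when this is a given surface. The form A B' has values in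
    a fixed space because, along a factor, one component of the inverse composed with g is constant.
    The rank is constant as the trace of an idempotent, a continuous function with integer values.
    No genus or degree is computed for the curves: the matrix of leading coefficients of a basis at
    the poles replaces such counts. If a basis element has order a at least 2, the dual element
    vanishes to order a at the poles, which absorbs the double pole of dx. As the resulting form is
    zero, a column of the adjugate of that matrix vanishes, against its invertibility. *)

Section RealNorm.
Variable R : realType.
Local Notation C := (cplx R).

(* Norms of complex spaces are C-valued; [rn] is their real value. *)
Definition rn (V : normedModType C) (v : V) : R := Re `|v|.

Lemma rnE (V : normedModType C) (v : V) : `|v| = (rn v)%:C%C.
Proof. by rewrite /rn RRe_real// normr_real. Qed.

Lemma rn_ge0 (V : normedModType C) (v : V) : 0 <= rn v.
Proof. by rewrite -lecR -rnE normr_ge0. Qed.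

Lemma rnD (V : normedModType C) (v w : V) : rn (v + w) <= rn v + rn w.
Proof. by rewrite -lecR rmorphD/= -!rnE ler_normD. Qed.

Lemma rnN (V : normedModType C) (v : V) : rn (- v) = rn v.
Proof. by rewrite /rn normrN. Qed.

Lemma rnB (V : normedModType C) (v w : V) : rn (v - w) <= rn v + rn w.
Proof. by rewrite -(rnN w) rnD. Qed.

Lemma rnBC (V : normedModType C) (v w : V) : rn (v - w) = rn (w - v).
Proof. by rewrite -opprB rnN. Qed.

Lemma rn_tri (V : normedModType C) (u v w : V) : rn (v - w) <= rn (v - u) + rn (u - w).
Proof. by apply: le_trans (rnD _ _); rewrite addrA subrK. Qed.

Lemma rn0 (V : normedModType C) : rn (0 : V) = 0.
Proof. by rewrite /rn normr0. Qed.

Lemma rn_eq0 (V : normedModType C) (v : V) : (rn v == 0) = (v == 0).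
Proof.
apply/eqP/eqP => [h|->]; last exact: rn0.
by apply/eqP; rewrite -normr_eq0 rnE h.
Qed.

Lemma rn_gt0 (V : normedModType C) (v : V) : (0 < rn v) = (v != 0).
Proof. by rewrite lt_def rn_ge0 rn_eq0 andbT. Qed.

Lemma rnZ (V : normedModType C) (a : C) (v : V) : rn (a *: v) = rn (a : C) * rn v.
Proof.
by apply: complexI; rewrite rmorphM/= -!rnE normrZ.
Qed.

Lemma rnM (a b : C) : rn (a * b) = rn a * rn b.
Proof. by apply: complexI; rewrite rmorphM/= -!rnE normrM. Qed.

Lemma rnV (a : C) : rn a^-1 = (rn a)^-1.
Proof. by apply: complexI; rewrite fmorphV/= -!rnE normfV. Qed.

Lemma rnX (a : C) n : rn (a ^+ n) = rn a ^+ n.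
Proof. by apply: complexI; rewrite rmorphXn/= -!rnE normrX. Qed.

Lemma rn1 : rn (1 : C) = 1.
Proof. by rewrite /rn normr1. Qed.

Lemma rnR (x : R) : rn (x%:C%C : C) = `|x|.
Proof.
apply: complexI; rewrite -rnE normc_def/= expr0n addr0 sqrtr_sqr//.
Qed.

Lemma rn_i : rn ('i%C : C) = 1.
Proof. by apply: complexI; rewrite -rnE normc_def/= expr0n add0r expr1n sqrtr1. Qed.

Lemma Re_le (z : C) : `|Re z| <= rn z.
Proof. by rewrite -lecR -rnE normc_ge_Re. Qed.

Lemma Im_le (z : C) : `|Im z| <= rn z.
Proof.
apply: le_trans (_ : rn (z * 'i%C) <= _).
  by have := Re_le (z * 'i%C); rewrite ReiNIm normrN.
by rewrite rnM rn_i mulr1.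
Qed.

Lemma ReIm_le (z : C) : rn z <= `|Re z| + `|Im z|.
Proof.
rewrite {1}(complexE z); apply: le_trans (rnD _ _) _.
by rewrite rnM rn_i mul1r !rnR.
Qed.

Lemma posC (e : C) : 0 < e -> exists2 r : R, 0 < r & e = r%:C%C.
Proof.
move=> e0; exists (Re e); last by rewrite RRe_real// gtr0_real.
by rewrite -ltcR RRe_real// gtr0_real.
Qed.

Lemma nearP (V : normedModType C) (x : V) (P : V -> Prop) :
  (\forall y \near x, P y) <->
  exists2 d : R, 0 < d & forall y, rn (y - x) < d -> P y.
Proof.
split.
  move=> /nbhs_ballP [e /= /posC[d d0 ->]] H; exists d => // y yx.
  by apply: H; rewrite -ball_normE /= rnE ltcR rnBC.
move=> [d d0 H]; apply/nbhs_ballP; exists d%:C%C; first by rewrite /= ltcR.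
by move=> y; rewrite -ball_normE /= rnE ltcR rnBC; exact: H.
Qed.

Lemma contP (V W : normedModType C) (f : V -> W) (x : V) :
  {for x, continuous f} <->
  forall e : R, 0 < e -> exists2 d, 0 < d & forall y, rn (y - x) < d -> rn (f y - f x) < e.
Proof.
split.
  move=> fc e e0; apply/(@nearP V x (fun y => rn (f y - f x) < e)).
  have : \forall w \near f x, rn (w - f x) < e by apply/nearP; exists e.
  by move=> /fc.
move=> H A /nearP[e e0 eA]; apply/nearP; have [d d0 dH] := H e e0.
by exists d => // y /dH /eA.
Qed.

Lemma diff_eps (V W : normedModType C) (f : V -> W) (x : V) : differentiable f x ->
  forall e : R, 0 < e -> exists2 d, 0 < d & forall h, rn h < d ->
    rn (f (x + h) - f x - 'd f x h) <= e * rn h.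
Proof.
move=> /diff_locally /eqaddoP fE e e0.
have e0' : 0 < (e%:C%C : C) by rewrite ltcR.
have /nearP[d d0 H] := fE _ e0'; exists d => // h hd.
have := H h; rewrite subr0 => /(_ hd); rewrite !fctE /= !rnE -rmorphM lecR.
by rewrite opprD addrA [h + x]addrC.
Qed.

Lemma eps_diff (V W : normedModType C) (f : V -> W) (L : {linear V -> W}) (x : V) :
  continuous L ->
  (forall e : R, 0 < e -> exists2 d, 0 < d & forall h, rn h < d ->
    rn (f (x + h) - f x - L h) <= e * rn h) ->
  differentiable f x /\ 'd f x = L :> (V -> W).
Proof.
move=> Lc H.
have fE : f \o shift x = cst (f x) + L +o_ (0 : V) id.
  apply/eqaddoP => _ /posC[e e0 ->]; have [d d0 dH] := H e e0.
  apply/nearP; exists d => // h; rewrite subr0 => hd.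
  by rewrite !fctE /= !rnE -rmorphM lecR opprD addrA [h + x]addrC dH.
have dE := diff_unique Lc fE; split => //.
by apply/diff_locallyP; rewrite dE.
Qed.

Definition cder (f : C -> C) (z d : C) := forall e : R, 0 < e ->
  exists2 r, 0 < r & forall h, rn h < r -> rn (f (z + h) - f z - h * d) <= e * rn h.

Lemma cderP (f : C -> C) z d : cder f z d <-> differentiable f z /\ derive1 f z = d.
Proof.
split=> [H|[df <-] e e0].
  pose g h : C := h * d.
  have lg : linear g by move=> a u v; rewrite /g mulrDl -mulrA.
  pose L : {linear C -> C} := HB.pack g (GRing.isLinear.Build C C C _ g lg).
  have Lc : continuous L.
    by move=> x; apply: continuousM; [exact: cvg_id|exact: cst_continuous].
  have [//|df dE] := @eps_diff _ _ f L z Lc; split=> //.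
  by rewrite derive1E' // dE; exact: mul1r.
have [r r0 H] := diff_eps df e0; exists r => // h /H.
by rewrite [X in _ - X](_ : _ = h * derive1 f z)// diff1E.
Qed.

End RealNorm.

(** * Integrals along real segments *)

Section Integral.
Variable R : realType.
Local Notation C := (cplx R).

Definition prim (L : R) (u : R -> R) (x : R) : R :=
  \int[lebesgue_measure]_(t in `[L, x]) u t.

Lemma prim_derive (L : R) (u : R -> R) (x : R) : continuous u -> L < x -> is_derive x 1 (prim L u) (u x).
Proof.
move=> uc Lx.
have xu : x < x + 1 by rewrite ltrDl.
have int : (@lebesgue_measure R).-integrable `[L, (x + 1)] (EFin \o u).
  apply: continuous_compact_integrable; first exact: segment_compact.
  exact: continuous_subspaceT.
have [dF FE] := continuous_FTC1_closed xu int Lx (uc x).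
have := derivableP dF; rewrite -derive1E => dd.
by apply: is_derive_eq dd FE.
Qed.

Lemma prim_bound (U V u v : R -> R) (a b e : R) : a <= b ->
  (forall t, a <= t <= b -> is_derive t 1 U (u t)) ->
  (forall t, a <= t <= b -> is_derive t 1 V (v t)) ->
  (forall t, a <= t <= b -> `|u t - v t| <= e) ->
  `|(U b - U a) - (V b - V a)| <= e * (b - a).
Proof.
move=> ab dU dV uv.
have dW t : a <= t <= b -> is_derive t 1 (U - V) (u t - v t).
  by move=> tab; have := dU t tab; have := dV t tab => ? ?; exact: is_deriveB.
have [||c cab] := @MVT_segment _ (U - V) (fun t => u t - v t) a b ab.
- move=> t; rewrite in_itv/= => /andP[/ltW h1 /ltW h2]; apply: dW.
  by rewrite h1 h2.
- apply: derivable_within_continuous => t; rewrite in_itv/= => tab.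
  by have [] := dW t tab.
rewrite !fctE => E; rewrite (_ : _ - _ = (u c - v c) * (b - a)); last first.
  by rewrite -E; ring.
rewrite normrM (ger0_norm (_ : 0 <= b - a)) ?subr_ge0// ler_wpM2r ?subr_ge0//.
by apply: uv; move: cab; rewrite in_itv.
Qed.

(** The integral of [w] over [a, b], as a difference of primitives from a base point [L], so that
    splitting the interval is an algebraic identity. The estimates assume [L < a], since [prim] is
    differentiated strictly to the right of [L]. *)
Definition cI L (w : R -> C) a b : C :=
  Complex (prim L (Re \o w) b - prim L (Re \o w) a)
    (prim L (Im \o w) b - prim L (Im \o w) a).

Lemma cI_split L w a m b : cI L w a m + cI L w m b = cI L w a b.
Proof. by apply/eqP; rewrite eq_complex /=; apply/andP; split; apply/eqP; ring. Qed.

Definition rcont (w : R -> C) := continuous (Re \o w) /\ continuous (Im \o w).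

Definition rder (V : R -> C) (t : R) (v : C) :=
  is_derive t 1 (Re \o V) (Re v) /\ is_derive t 1 (Im \o V) (Im v).

(** The mean value theorem is real, so real and imaginary parts are bounded separately; this is the
    source of the factor 2 here and in the contour estimates. *)
Lemma cI_bound L w (V v : R -> C) a b e : L < a -> a <= b -> rcont w ->
  (forall t, a <= t <= b -> rder V t (v t)) ->
  (forall t, a <= t <= b -> rn (w t - v t) <= e) ->
  rn (cI L w a b - (V b - V a)) <= 2 * e * (b - a).
Proof.
move=> La ab [wr wi] dV wv.
have dw (u : R -> R) : continuous u -> forall t, a <= t <= b -> is_derive t 1 (prim L u) (u t).
  by move=> uc t /andP[at_ _]; apply: prim_derive => //; exact: lt_le_trans La at_.
apply: le_trans (ReIm_le _) _.
have -> : 2 * e * (b - a) = e * (b - a) + e * (b - a) by ring.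
apply: lerD.
  have -> : Re (cI L w a b - (V b - V a)) =
    (prim L (Re \o w) b - prim L (Re \o w) a) - (Re (V b) - Re (V a)).
    by case: (V b) (V a) => ? ? [? ?].
  apply: prim_bound ab (dw _ wr) (fun t h => (dV t h).1) _ => t tab.
  apply: le_trans (wv t tab); apply: le_trans (Re_le _).
  by rewrite /=; case: (w t) (v t) => ? ? [? ?].
have -> : Im (cI L w a b - (V b - V a)) =
  (prim L (Im \o w) b - prim L (Im \o w) a) - (Im (V b) - Im (V a)).
  by case: (V b) (V a) => ? ? [? ?].
apply: prim_bound ab (dw _ wi) (fun t h => (dV t h).2) _ => t tab.
apply: le_trans (wv t tab); apply: le_trans (Im_le _).
by rewrite /=; case: (w t) (v t) => ? ? [? ?].
Qed.

Lemma rcontP (w : R -> C) :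
  (forall t e, 0 < e -> exists2 d, 0 < d & forall s, `|s - t| < d -> rn (w s - w t) < e) ->
  rcont w.
Proof.
move=> H; split=> t; apply/cvgrPdist_lt => e e0; have [d d0 dH] := H t e e0;
  (apply/nbhs_ballP; exists d => // s; rewrite /ball/= => ts);
  (apply: le_lt_trans (dH s _); last by rewrite distrC).
- rewrite distrC; apply: le_trans (Re_le _).
  by case: (w s) (w t) => ? ? [? ?].
- rewrite distrC; apply: le_trans (Im_le _).
  by case: (w s) (w t) => ? ? [? ?].
Qed.

Lemma cI_lin L (w : R -> C) (al be : C) a b e : L < a -> a <= b -> rcont w ->
  (forall t, a <= t <= b -> rn (w t - (al + be * t%:C%C)) <= e) ->
  rn (cI L w a b - (al * (b - a)%:C%C + be * ((b ^+ 2 - a ^+ 2) / 2)%:C%C)) <= 2 * e * (b - a).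
Proof.
move=> La ab wc wE.
pose V (t : R) : C := al * t%:C%C + be * (t ^+ 2 / 2)%:C%C.
have -> : al * (b - a)%:C%C + be * ((b ^+ 2 - a ^+ 2) / 2)%:C%C = V b - V a.
  rewrite /V; case: al {wE V}; case: be => ? ? ? ? /=; simpc.
  by congr Complex; ring.
apply: cI_bound wE => // t _; rewrite /V.
have q (x y : R) : is_derive t 1 (fun t => x * t + y * (t ^+ 2 / 2)) (x + y * t).
  have i2 : is_derive t 1 (fun t : R => t ^+ 2) (t *+ 2).
    have -> : (fun t : R => t ^+ 2) = id * id by apply/funext => s; rewrite !fctE expr2.
    by apply: is_derive_eq; rewrite /GRing.scale/= mulr1 mulr2n.
  have h1 : is_derive t 1 (x \*: (id : R -> R)) (x *: (1 : R)) by exact: is_deriveZ.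
  have h2 : is_derive t 1 ((y / 2) \*: (fun t : R => t ^+ 2)) ((y / 2) *: (t *+ 2)).
    exact: is_deriveZ.
  have h3 := is_deriveD h1 h2.
  have -> : (fun t => x * t + y * (t ^+ 2 / 2)) = x \*: id + (y / 2) \*: (fun t => t ^+ 2).
    by apply/funext => s; rewrite !fctE /=; move: (s ^+ 2) => q; rewrite /GRing.scale/=; field.
  apply: is_derive_eq h3 _; rewrite /GRing.scale/= mulr1 mulr2n mulrDr; congr (_ + _).
  by field.
split.
- apply: (is_derive_eq (f' := Re al + Re be * t)); last first.
    by case: al be {V} => ? ? [? ?] /=; ring.
  have -> : Re \o V = (fun t => Re al * t + Re be * (t ^+ 2 / 2)); last exact: q.
  by apply/funext => s; rewrite /V/=; case: al be {V} => ? ? [? ?] /=; ring.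
- apply: (is_derive_eq (f' := Im al + Im be * t)); last first.
    by case: al be {V} => ? ? [? ?] /=; ring.
  have -> : Im \o V = (fun t => Im al * t + Im be * (t ^+ 2 / 2)); last exact: q.
  by apply/funext => s; rewrite /V/=; case: al be {V} => ? ? [? ?] /=; ring.
Qed.

End Integral.

(** * Induction by bisection of rectangles *)

Section Bisection.
Variable R : realType.

Lemma pow_small (t e : R) : 0 <= t < 1 -> 0 < e -> exists n, t ^+ n < e.
Proof.
move=> /andP[t0 t1] e0.
have : (fun n => t ^+ n) @ \oo --> (0 : R) by apply: cvg_expr; rewrite ger0_norm.
move/cvgrPdist_lt => /(_ e e0) [n _ H]; exists n.
by have := H n (leqnn n); rewrite /= sub0r normrN ger0_norm// exprn_ge0.
Qed.

Let rect := (R * R * R * R)%type.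
Let quad (s : rect) (i j : bool) : rect :=
  let: (a, b, c, d) := s in
  let m := (a + b) / 2 in let n := (c + d) / 2 in
  ((if i then m else a), (if i then b else m), (if j then n else c), (if j then d else n)).

(** Otherwise one can choose a failing quarter again and again; the nested rectangles shrink to a
    point, around which [P] holds for small rectangles. The same induction serves Goursat's lemma,
    local constancy on a segment (with a degenerate second side) and primitives along a homotopy. *)
Lemma rect_bisect (P : R -> R -> R -> R -> Prop) (a b c d : R) :
  a <= b -> c <= d ->
  (forall a' b' c' d', a <= a' -> a' <= b' -> b' <= b -> c <= c' -> c' <= d' -> d' <= d ->
    let m := (a' + b') / 2 in let n := (c' + d') / 2 in
    P a' m c' n -> P m b' c' n -> P a' m n d' -> P m b' n d' -> P a' b' c' d') ->
  (forall x y, a <= x <= b -> c <= y <= d -> exists2 dl, 0 < dl &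
    forall a' b' c' d', a <= a' -> a' <= x -> x <= b' -> b' <= b ->
      c <= c' -> c' <= y -> y <= d' -> d' <= d ->
      b' - a' < dl -> d' - c' < dl -> P a' b' c' d') ->
  P a b c d.
Proof.
move=> ab cd HQ HL; apply: contrapT => nP.
pose Q (s : rect) := let: (a', b', c', d') := s in P a' b' c' d'.
(* The last two alternatives make the choice total; [inv] excludes them along the sequence. *)
have step_ex s : exists ij : bool * bool, ~ Q (quad s ij.1 ij.2) \/ Q s \/
   (let: (a', b', c', d') := s in
    ~ [/\ a <= a', a' <= b', b' <= b & [/\ c <= c', c' <= d' & d' <= d]]).
  case: s => -[[a' b'] c'] d'.
  apply: contrapT => H.
  have H1 ij : Q (quad (a', b', c', d') ij.1 ij.2).
    by apply: contrapT => nq; apply: H; exists ij; left.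
  apply: H; exists (true, true); right.
  have [[aa' ab' bb [cc' cd' dd]]|?] := pselect [/\ a <= a', a' <= b', b' <= b & [/\ c <= c', c' <= d' & d' <= d]]; last by right.
  left; apply: HQ => //.
  - exact: (H1 (false, false)).
  - exact: (H1 (true, false)).
  - exact: (H1 (false, true)).
  - exact: (H1 (true, true)).
pose step s := let ij := projT1 (cid (step_ex s)) in quad s ij.1 ij.2.
pose sq n := iter n step (a, b, c, d).
have inv n : ~ Q (sq n) /\ let: (a', b', c', d') := sq n in
    [/\ a <= a', a' <= b', b' <= b & [/\ c <= c', c' <= d' & d' <= d]] /\
    b' - a' = (b - a) / 2 ^+ n /\ d' - c' = (d - c) / 2 ^+ n.
  elim: n => [|n]; first by rewrite /= !expr0 !divr1.
  rewrite /sq iterS -/(sq n); case: (sq n) => -[[a' b'] c'] d' [nq [bd [wE hE]]].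
  rewrite /step; case: cid => ij /= [nq'|[//|//]]; split=> //.
  case: bd => h1 h2 h3 [h4 h5 h6].
  have wE' : (b' - a') / 2 = (b - a) / 2 ^+ n.+1 by rewrite wE exprS; field.
  have hE' : (d' - c') / 2 = (d - c) / 2 ^+ n.+1 by rewrite hE exprS; field.
  rewrite -wE' -hE'.
  clear -h1 h2 h3 h4 h5 h6.
  by case: (ij.1) (ij.2) => [] [] /=; (split; [split; [lra|lra|lra|split; lra]|split; lra]).
have nest n : let: (a', b', c', d') := sq n in let: (a1, b1, c1, d1) := sq n.+1 in
   [/\ a' <= a1, b1 <= b', c' <= c1 & d1 <= d'].
  have := inv n; rewrite /sq iterS -/(sq n); case: (sq n) => -[[a' b'] c'] d' [_ [[h1 h2 h3 [h4 h5 h6]] _]].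
  by rewrite /step; case: cid => ij _ /=; case: (ij.1) (ij.2) => [] [] /=; split; lra.
pose A n := (sq n).1.1.1; pose B n := (sq n).1.1.2; pose G n := (sq n).1.2; pose D n := (sq n).2.
have nd (X : nat -> R) : (forall n, X n <= X n.+1) -> forall n m, (n <= m)%N -> X n <= X m.
  by move=> XS n m /subnK <-; elim: (m - n)%N => [|k IH]; [by []|exact: le_trans IH (XS _)].
have An := nd A; have Gn := nd G.
have Bn := nd (fun n => - B n); have Dn := nd (fun n => - D n).
have {}An n m : (n <= m)%N -> A n <= A m.
  by apply: An => k; have := nest k; rewrite /A; case: (sq k) => -[[? ?] ?] ?; case: (sq k.+1) => -[[? ?] ?] ? [].
have {}Gn n m : (n <= m)%N -> G n <= G m.
  by apply: Gn => k; have := nest k; rewrite /G; case: (sq k) => -[[? ?] ?] ?; case: (sq k.+1) => -[[? ?] ?] ? [].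
have {}Bn n m : (n <= m)%N -> B m <= B n.
  move=> nm; rewrite -lerN2; apply: Bn nm => k; rewrite lerN2; have := nest k; rewrite /B; case: (sq k) => -[[? ?] ?] ?; case: (sq k.+1) => -[[? ?] ?] ? [] //.
have {}Dn n m : (n <= m)%N -> D m <= D n.
  move=> nm; rewrite -lerN2; apply: Dn nm => k; rewrite lerN2; have := nest k; rewrite /D; case: (sq k) => -[[? ?] ?] ?; case: (sq k.+1) => -[[? ?] ?] ? [] //.
have AB n : A n <= B n by have := inv n; rewrite /A /B; case: (sq n) => -[[? ?] ?] ? [_ [[]]].
have GD n : G n <= D n by have := inv n; rewrite /G /D; case: (sq n) => -[[? ?] ?] ? [_ [[? ? ? []]]].
have ABm n m : A n <= B m.
  apply: le_trans (An n (maxn n m) (leq_maxl _ _)) _.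
  exact: le_trans (AB _) (Bn _ _ (leq_maxr _ _)).
have GDm n m : G n <= D m.
  apply: le_trans (Gn n (maxn n m) (leq_maxl _ _)) _.
  exact: le_trans (GD _) (Dn _ _ (leq_maxr _ _)).
pose x := sup (range A); pose y := sup (range G).
have Ax n : A n <= x.
  by apply: ub_le_sup; [exists (B 0%N) => _ [k _ <-]|exists n].
have Gy n : G n <= y.
  by apply: ub_le_sup; [exists (D 0%N) => _ [k _ <-]|exists n].
have xB n : x <= B n by apply: ge_sup; [exists (A 0%N); exists 0%N|move=> _ [k _ <-]].
have yD n : y <= D n by apply: ge_sup; [exists (G 0%N); exists 0%N|move=> _ [k _ <-]].
have A0 := Ax 0%N; have B0 := xB 0%N; have G0 := Gy 0%N; have D0 := yD 0%N.
rewrite /A/B/G/D/= in A0 B0 G0 D0.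
have [||dl dl0 H] := HL x y; [by rewrite A0 B0|by rewrite G0 D0|].
have [n nE] : exists n, (2^-1) ^+ n < dl / (1 + (b - a) + (d - c)).
  apply: pow_small; first by apply/andP; split; lra.
  by apply: divr_gt0 => //; lra.
move: nE; rewrite ltr_pdivlMr; last by lra.
move=> nE.
have := inv n; move: (Ax n) (xB n) (Gy n) (yD n); rewrite /A/B/G/D.
case: (sq n) => -[[a' b'] c'] d' /= h1 h2 h3 h4 [nq [[k1 k2 k3 [k4 k5 k6]] [wE hE]]].
have p0 : (0 : R) < 2^-1 ^+ n by apply: exprn_gt0; lra.
apply: nq; apply: H => //.
- by rewrite wE -exprVn; nra.
- by rewrite hE -exprVn; nra.
Qed.

End Bisection.

(** * Goursat's lemma for rectangles *)

Section Goursat.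
Variable R : realType.
Local Notation C := (cplx R).

Definition gcont (w : C -> C) := forall z (e : R), 0 < e ->
  exists2 d : R, 0 < d & forall z', rn (z' - z) < d -> rn (w z' - w z) < e.

Definition hor (w : C -> C) (y t : R) : C := w (Complex t y).
Definition ver (w : C -> C) (x t : R) : C := w (Complex x t).

Lemma ii : 'i%C * 'i%C = -1 :> C.
Proof. by rewrite -expr2 sqr_i. Qed.

Lemma cplxE (x y : R) : Complex x y = x%:C%C + 'i%C * y%:C%C :> C.
Proof. exact: complexE. Qed.

Lemma hor_rcont w y : gcont w -> rcont (hor w y).
Proof.
move=> wc; apply: rcontP => t e e0; have [d d0 dH] := wc (Complex t y) e e0.
exists d => // s st; apply: dH; apply: le_lt_trans st.
by rewrite (_ : _ - _ = (s - t)%:C%C) ?rnR//; apply/eqP; rewrite eq_complex/= subrr !eqxx.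
Qed.

Lemma ver_rcont w x : gcont w -> rcont (ver w x).
Proof.
move=> wc; apply: rcontP => t e e0; have [d d0 dH] := wc (Complex x t) e e0.
exists d => // s st; apply: dH; apply: le_lt_trans st.
rewrite (_ : _ - _ = 'i%C * (s - t)%:C%C) ?rnM ?rn_i ?mul1r ?rnR//.
by rewrite (cplxE x s) (cplxE x t) (rmorphB (real_complex R)); ring.
Qed.

(** The counterclockwise integral of w dz over the boundary of [a, b] x [c, d]; dz is i dt on the
    vertical sides. *)
Definition RI L (w : C -> C) (a b c d : R) : C :=
  cI L (hor w c) a b + 'i%C * cI L (ver w b) c d
  - cI L (hor w d) a b - 'i%C * cI L (ver w a) c d.

Lemma RI_splitx L w a m b c d : RI L w a m c d + RI L w m b c d = RI L w a b c d.
Proof. by rewrite /RI -(cI_split L (hor w c) a m b) -(cI_split L (hor w d) a m b); ring. Qed.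

Lemma RI_splity L w a b c n d : RI L w a b c n + RI L w a b n d = RI L w a b c d.
Proof. by rewrite /RI -(cI_split L (ver w b) c n d) -(cI_split L (ver w a) c n d); ring. Qed.

(** The contour integral of al + be z. [A] and [B] stand for the integrals of the real parameter
    along the sides and cancel between opposite sides; the rest is be I (b - a) (d - c) taken with
    both signs. *)
Lemma rect_lin (K : comPzRingType) (al be I a b c d A B : K) :
  ((al + be * (I * c)) * (b - a) + be * A) + I * ((al + be * b) * (d - c) + (be * I) * B)
  - ((al + be * (I * d)) * (b - a) + be * A) - I * ((al + be * a) * (d - c) + (be * I) * B) = 0.
Proof. by ring. Qed.

Lemma RI_small L w (al be : C) (a b c d e : R) : L < a -> L < c -> a <= b -> c <= d ->
  (forall y, rcont (hor w y)) -> (forall x, rcont (ver w x)) ->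
  (forall x y, a <= x <= b -> c <= y <= d ->
     rn (w (Complex x y) - (al + be * Complex x y)) <= e) ->
  rn (RI L w a b c d) <= 4 * e * ((b - a) + (d - c)).
Proof.
move=> La Lc ab cd wh wv H.
have hE y : c <= y <= d -> rn (cI L (hor w y) a b -
    ((al + be * ('i%C * y%:C%C)) * (b - a)%:C%C + be * ((b ^+ 2 - a ^+ 2) / 2)%:C%C)) <= 2 * e * (b - a).
  move=> yc; apply: cI_lin => // t tab.
  by have := H t y tab yc; rewrite {2}cplxE mulrDr [be * t%:C%C + _]addrC addrA.
have vE x : a <= x <= b -> rn (cI L (ver w x) c d -
    ((al + be * x%:C%C) * (d - c)%:C%C + (be * 'i%C) * ((d ^+ 2 - c ^+ 2) / 2)%:C%C)) <= 2 * e * (d - c).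
  move=> yc; apply: cI_lin => // t tab.
  by have := H x t yc tab; rewrite {2}cplxE mulrDr addrA mulrA.
have h1 := hE c; have h2 := hE d; have h3 := vE a; have h4 := vE b.
rewrite lexx cd in h1; rewrite lexx cd in h2; rewrite lexx ab in h3; rewrite lexx ab in h4.
move: (h1 isT) (h2 isT) (h3 isT) (h4 isT) => {h1 h2 h3 h4}.
rewrite /RI.
move: (cI L (hor w c) a b) (cI L (hor w d) a b) (cI L (ver w a) c d) (cI L (ver w b) c d) => h1 h2 v1 v2.
set p1 := (X in rn (h1 - X)); set p2 := (X in rn (h2 - X)).
set q1 := (X in rn (v1 - X)); set q2 := (X in rn (v2 - X)) => r1 r2 r3 r4.
have -> : h1 + 'i%C * v2 - h2 - 'i%C * v1 =
    (h1 - p1) + 'i%C * (v2 - q2) - (h2 - p2) - 'i%C * (v1 - q1).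
  suff E : p1 + 'i%C * q2 - p2 - 'i%C * q1 = 0.
    by rewrite -[LHS]subr0 -E; ring.
  rewrite /p1 /p2 /q1 /q2 !(rmorphB (real_complex R) b a) !(rmorphB (real_complex R) d c).
  exact: rect_lin.
have t1 := rn_tri 0 (h1 - p1 + 'i%C * (v2 - q2) - (h2 - p2)) ('i%C * (v1 - q1)).
have t2 := rnB (h1 - p1 + 'i%C * (v2 - q2)) (h2 - p2).
have t3 := rnD (h1 - p1) ('i%C * (v2 - q2)).
have t4 : rn ('i%C * (v2 - q2) : C) = rn (v2 - q2) by rewrite rnM rn_i mul1r.
have t5 : rn ('i%C * (v1 - q1) : C) = rn (v1 - q1) by rewrite rnM rn_i mul1r.
by rewrite subr0 sub0r rnN in t1; lra.
Qed.

Lemma Goursat L w (a b c d : R) : L < a -> L < c -> a <= b -> c <= d -> gcont w ->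
  (forall x y, a <= x <= b -> c <= y <= d -> exists k : C, forall e : R, 0 < e ->
    exists2 r : R, 0 < r & forall x' y', a <= x' <= b -> c <= y' <= d ->
      let z := Complex x y : C in let z' := Complex x' y' : C in
      rn (z' - z) < r -> rn (w z' - w z - (z' - z) * k) <= e * rn (z' - z)) ->
  RI L w a b c d = 0.
Proof.
move=> La Lc ab cd wc H; apply/eqP; rewrite -rn_eq0; apply/eqP/le_anti; rewrite rn_ge0 andbT.
set S := (b - a) ^+ 2 + (d - c) ^+ 2.
have S0 : 0 <= S by rewrite addr_ge0// sqr_ge0.
suff main e : 0 < e -> rn (RI L w a b c d) <= e * S.
  apply/ler_addgt0Pr => e e0; rewrite add0r.
  apply: le_trans (main (e / (1 + S)) _) _; first by rewrite divr_gt0//; lra.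
  rewrite mulrAC ler_pdivrMr; last by lra.
  by rewrite ler_wpM2l//; lra.
move=> e0.
(* The squared sides of the four quarters add up exactly to those of the whole, so this bound is
   stable under bisection, while it is still quadratic on small rectangles. *)
pose P a' b' c' d' := rn (RI L w a' b' c' d') <= e * ((b' - a') ^+ 2 + (d' - c') ^+ 2).
apply: (@rect_bisect _ P) => //.
- move=> a' b' c' d' _ _ _ _ _ _ m n; rewrite /P => p1 p2 p3 p4.
  rewrite -(RI_splitx L w a' m b' c' d') -(RI_splity L w a' m c' n d') -(RI_splity L w m b' c' n d').
  have t1 := rnD (RI L w a' m c' n + RI L w a' m n d') (RI L w m b' c' n + RI L w m b' n d').
  have t2 := rnD (RI L w a' m c' n) (RI L w a' m n d').
  have t3 := rnD (RI L w m b' c' n) (RI L w m b' n d').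
  have -> : e * ((b' - a') ^+ 2 + (d' - c') ^+ 2) = e * ((m - a') ^+ 2 + (n - c') ^+ 2)
    + e * ((b' - m) ^+ 2 + (n - c') ^+ 2) + e * ((m - a') ^+ 2 + (d' - n) ^+ 2)
    + e * ((b' - m) ^+ 2 + (d' - n) ^+ 2) by rewrite /m /n; field.
  apply: le_trans t1 _; apply: le_trans (lerD t2 t3) _.
  by apply: le_trans (lerD (lerD p1 p3) (lerD p2 p4)) _; rewrite -!addrA lerD2l addrCA.
- move=> x y xab ycd; have [k Hk] := H x y xab ycd.
  (* With an affine approximation to within [e / 8 * s], [RI_small] gives [e * s ^+ 2 / 2], which is
     at most [e] times the sum of the squared sides. *)
  have [|r r0 rH] := Hk (e / 8); first by rewrite divr_gt0.
  exists (r / 2); first by rewrite divr_gt0.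
  move=> a' b' c' d' h1 h2 h3 h4 h5 h6 h7 h8 h9 h10; rewrite /P.
  set z : C := Complex x y; set s := (b' - a') + (d' - c').
  have B : rn (RI L w a' b' c' d') <= 4 * (e / 8 * s) * s.
    apply: (@RI_small _ _ (w z - z * k) k); [lra|lra|lra|lra|by move=> ?; exact: hor_rcont|by move=> ?; exact: ver_rcont|].
    move=> x' y' /andP[x1 x2] /andP[y1 y2]; set z' : C := Complex x' y'.
    have zs : rn (z' - z) <= s.
      apply: le_trans (ReIm_le _) _; rewrite /= /s lerD// ler_norml; apply/andP; split; lra.
    have := rH x' y'; rewrite -/z -/z' /= => /(_ _ _ _) R1.
    apply: le_trans (le_trans (R1 _ _ _) _).
    + by rewrite (_ : w z' - _ = w z' - w z - (z' - z) * k)//; ring.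
    + by apply/andP; split; lra.
    + by apply/andP; split; lra.
    + by apply: le_lt_trans zs _; rewrite /s; lra.
    + by rewrite ler_wpM2l//; lra.
  apply: le_trans B _; rewrite (_ : 4 * (e / 8 * s) * s = e * (s ^+ 2 / 2)); last by field.
  rewrite ler_wpM2l//; first exact: ltW.
  rewrite /s -subr_ge0 (_ : _ - _ = (b' - a' - (d' - c')) ^+ 2 / 2); last by field.
  by rewrite divr_ge0// sqr_ge0.
Qed.

End Goursat.

(** * The maximum modulus principle *)

Section MaximumModulus.
Variable R : realType.
Local Notation C := (cplx R).

Definition clamp (a b t : R) := Num.max a (Num.min t b).

Lemma clamp_in a b t : a <= b -> a <= clamp a b t <= b.
Proof.
by move=> ab; rewrite /clamp le_max lexx /= ge_max ab /= ge_min lexx orbT.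
Qed.

Lemma clamp_id a b t : a <= t <= b -> clamp a b t = t.
Proof.
by move=> /andP[at_ tb]; rewrite /clamp (min_idPl tb) (max_idPr at_).
Qed.

Lemma clamp_lip a b s t : `|clamp a b s - clamp a b t| <= `|s - t|.
Proof.
rewrite /clamp; have [h1|h1] := leP s b; have [h2|h2] := leP t b.
- have [h3|h3] := leP a s; have [h4|h4] := leP a t => //;
  rewrite ?subrr ?normr0// ler_norml; apply/andP;
  (have := ler_norm (s - t); have := ler_norm (t - s); rewrite (distrC t) => *; split; lra).
- have [h3|h3] := leP a s; have [h4|h4] := leP a b => //;
  rewrite ?subrr ?normr0// ler_norml; apply/andP;
  (have := ler_norm (s - t); have := ler_norm (t - s); rewrite (distrC t) => *; split; lra).
- have [h3|h3] := leP a b; have [h4|h4] := leP a t => //;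
  rewrite ?subrr ?normr0// ler_norml; apply/andP;
  (have := ler_norm (s - t); have := ler_norm (t - s); rewrite (distrC t) => *; split; lra).
- by rewrite subrr normr0.
Qed.

Definition inQ (a b c d : R) (z : C) := (a <= Re z <= b) && (c <= Im z <= d).

Definition onQ (a b c d : R) (z : C) :=
  [|| Re z == a, Re z == b, Im z == c | Im z == d].

(** A Lipschitz retraction onto the rectangle. Composed with it, a function that is continuous on
    the rectangle satisfies [gcont], which asks for continuity on the whole plane. *)
Definition clampC a b c d (z : C) : C := Complex (clamp a b (Re z)) (clamp c d (Im z)).

Lemma clampC_in a b c d z : a <= b -> c <= d -> inQ a b c d (clampC a b c d z).
Proof. by move=> ab cd; rewrite /inQ /= !clamp_in. Qed.

Lemma clampC_id a b c d z : inQ a b c d z -> clampC a b c d z = z.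
Proof. by case: z => x y /andP[/= h1 h2]; rewrite /clampC /= !clamp_id. Qed.

Lemma clampC_lip a b c d z z' : rn (clampC a b c d z - clampC a b c d z') <= 2 * rn (z - z').
Proof.
apply: le_trans (ReIm_le _) _; rewrite mulr2n mulrDl mul1r; apply: lerD.
- apply: le_trans (clamp_lip _ _ _ _) _; apply: le_trans (Re_le _).
  by case: z => ? ?; case: z'.
- apply: le_trans (clamp_lip _ _ _ _) _; apply: le_trans (Im_le _).
  by case: z => ? ?; case: z'.
Qed.

Lemma clamp_gcont a b c d f : a <= b -> c <= d ->
  (forall z, inQ a b c d z -> {for z, continuous (f : C -> C)}) ->
  gcont (f \o clampC a b c d).
Proof.
move=> ab cd fc z e e0.
have /contP/(_ e e0)[r r0 rH] := fc _ (clampC_in z ab cd).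
exists (r / 2); first by rewrite divr_gt0.
move=> z' zz'; apply: rH; apply: le_lt_trans (clampC_lip _ _ _ _ _ _) _.
by rewrite mulrC -ltr_pdivlMr.
Qed.

Lemma prim_MVT (L : R) (u : R -> R) (a b : R) : L < a -> a <= b -> continuous u ->
  exists2 t, a <= t <= b & prim L u b - prim L u a = u t * (b - a).
Proof.
move=> La ab uc.
have dU t : a <= t <= b -> is_derive t 1 (prim L u) (u t).
  by move=> /andP[at_ _]; apply: prim_derive => //; exact: lt_le_trans La at_.
have [||c cab E] := @MVT_segment _ (prim L u) u a b ab.
- by move=> t; rewrite in_itv/= => /andP[/ltW h1 /ltW h2]; apply: dU; rewrite h1 h2.
- apply: derivable_within_continuous => t; rewrite in_itv/= => tab.
  by have [] := dU t tab.
by exists c => //; move: cab; rewrite in_itv.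
Qed.

Lemma inv_rcont (g : R -> C) (m : R) : 0 < m -> (forall t, m <= rn (g t)) ->
  (forall s t, rn (g s - g t) <= `|s - t|) -> rcont (fun t => (g t)^-1).
Proof.
move=> m0 gm gl; apply: rcontP => t e e0.
exists (e * m ^+ 2); first by rewrite mulr_gt0 ?exprn_gt0.
move=> s st.
have g0 u : g u != 0 by rewrite -rn_gt0; exact: lt_le_trans m0 (gm u).
have -> : (g s)^-1 - (g t)^-1 = (g t - g s) * ((g s)^-1 * (g t)^-1).
  by field; rewrite !g0.
rewrite rnM rnM !rnV -invfM ltr_pdivrMr; last by rewrite mulr_gt0// rn_gt0.
rewrite rnBC; apply: le_lt_trans (gl s t) _; apply: lt_le_trans st _.
by apply: ler_wpM2l; [exact: ltW|rewrite expr2; apply: ler_pM => //; exact: ltW].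
Qed.

(* Only positivity of the imaginary part of the contour integral of 1/(z - p)
   is needed, not its value: the multiplicative constant it contributes is
   removed by applying the estimate to large powers of f. *)
Lemma RI_inv_pos (L a b c d : R) (p : C) : L < a -> L < c -> a < Re p < b -> c < Im p < d ->
  exists2 k, 0 < k & k <= Im (RI L (fun z => (z - p)^-1) a b c d).
Proof.
case: p => px py La Lc /= /andP[ap pb] /andP[cp pd].
set w := fun z : C => (z - Complex px py)^-1.
have ab : a <= b by lra. have cd : c <= d by lra.
have hc y : py != y -> rcont (hor w y).
  move=> yp; apply: (@inv_rcont _ `|y - py|).
  - by rewrite normr_gt0 subr_eq0 eq_sym.
  - by move=> t; apply: le_trans (Im_le _).
  - move=> s t; rewrite opprB addrA subrK; apply: le_trans (ReIm_le _) _.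
    by rewrite /= subrr normr0 addr0.
have vc x : px != x -> rcont (ver w x).
  move=> yp; apply: (@inv_rcont _ `|x - px|).
  - by rewrite normr_gt0 subr_eq0 eq_sym.
  - by move=> t; apply: le_trans (Re_le _).
  - move=> s t; rewrite opprB addrA subrK; apply: le_trans (ReIm_le _) _.
    by rewrite /= subrr normr0 add0r.
have hI x y : (Im \o hor w y) x = - ((y - py) / ((x - px) ^+ 2 + (y - py) ^+ 2)) by [].
have vR x y : (Re \o ver w x) y = (x - px) / ((x - px) ^+ 2 + (y - py) ^+ 2) by [].
have pos (s t : R) : 0 <= s ^+ 2 + t ^+ 2 by rewrite addr_ge0 ?sqr_ge0.
(* A lower bound for the imaginary part of 1 / (z - p) on the bottom side; the contributions of the
   other three sides have the same sign. *)
set k := (py - c) / ((b - a) ^+ 2 + (py - c) ^+ 2).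
have k0 : 0 < k by rewrite divr_gt0 ?subr_gt0// ltr_wpDl ?sqr_ge0// exprn_gt0// subr_gt0.
exists (k * (b - a)); first by rewrite mulr_gt0// subr_gt0; lra.
have h0 (q r : R) : 0 <= q -> 0 <= r -> 0 <= q * r by move=> *; exact: mulr_ge0.
have I1 : k * (b - a) <= Im (cI L (hor w c) a b).
  have [|t /andP[at_ tb] E] := prim_MVT La ab ((hc c _).2); first by rewrite gt_eqF.
  rewrite (_ : Im (cI L (hor w c) a b) = (Im \o hor w c) t * (b - a)); last exact: E.
  rewrite ler_wpM2r ?subr_ge0// hI -mulNr opprB.
  rewrite ler_pM2l ?subr_gt0// lef_pV2 ?posrE.
  - by rewrite -(sqrrN (c - py)) opprB lerD2r; nra.
  - by rewrite ltr_wpDl ?sqr_ge0//; nra.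
  - by rewrite ltr_wpDl ?sqr_ge0//; nra.
have I2 : Im (cI L (hor w d) a b) <= 0.
  have [|t /andP[at_ tb] E] := prim_MVT La ab ((hc d _).2); first by rewrite lt_eqF.
  rewrite (_ : Im (cI L (hor w d) a b) = (Im \o hor w d) t * (b - a)); last exact: E.
  by rewrite hI mulNr oppr_le0 h0 ?subr_ge0// divr_ge0// subr_ge0 ltW.
have I3 : 0 <= Re (cI L (ver w b) c d).
  have [|t /andP[at_ tb] E] := prim_MVT Lc cd ((vc b _).1); first by rewrite lt_eqF.
  rewrite (_ : Re (cI L (ver w b) c d) = (Re \o ver w b) t * (d - c)); last exact: E.
  by rewrite vR h0 ?subr_ge0// divr_ge0// subr_ge0 ltW.
have I4 : Re (cI L (ver w a) c d) <= 0.
  have [|t /andP[at_ tb] E] := prim_MVT Lc cd ((vc a _).1); first by rewrite gt_eqF.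
  rewrite (_ : Re (cI L (ver w a) c d) = (Re \o ver w a) t * (d - c)); last exact: E.
  by rewrite vR -[_ * _]opprK oppr_le0 -mulNr h0 ?subr_ge0// -mulNr opprB divr_ge0// subr_ge0 ltW.
have E (u v z t : C) : Im (u + 'i%C * v - z - 'i%C * t) = Im u + Re v - Im z - Re t.
  by case: u v z t => ? ? [? ?] [? ?] [? ?] /=; ring.
have K (q1 q2 q3 q4 q : R) : q <= q1 -> q2 <= 0 -> 0 <= q3 -> q4 <= 0 -> q <= q1 + q3 - q2 - q4.
  by clear; move=> *; lra.
by have := K _ _ _ _ _ I1 I2 I3 I4; rewrite -E.
Qed.

Lemma cI_near (L : R) (w v : R -> C) (a b e : R) : L < a -> a <= b -> rcont w -> rcont v ->
  (forall t, a <= t <= b -> rn (w t - v t) <= e) ->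
  rn (cI L w a b - cI L v a b) <= 2 * e * (b - a).
Proof.
move=> La ab wc vc.
pose V t : C := Complex (prim L (Re \o v) t) (prim L (Im \o v) t).
have -> : cI L v a b = V b - V a by rewrite /cI /V; simpc.
apply: cI_bound => // t /andP[at_ _].
by split; apply: prim_derive; [exact: vc.1|lra|exact: vc.2|lra].
Qed.

Lemma addrBK' (V : zmodType) (x y : V) : x + (y - x) = y.
Proof. by rewrite addrC subrK. Qed.

Lemma rn_le0 (z : C) : rn z <= 0 -> z = 0.
Proof.
move=> z0; apply/eqP; rewrite -rn_eq0; apply/eqP/le_anti.
by rewrite z0 rn_ge0.
Qed.

Lemma differentiable_expr (V : normedModType C) (f : V -> C) n x :
  differentiable f x -> differentiable (fun z => f z ^+ n : C) x.
Proof.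
move=> df; elim: n => [|n IH]; first exact: differentiable_cst.
have -> : (fun z => f z ^+ n.+1 : C) = (fun z => f z * f z ^+ n) by apply/funext => z; rewrite exprS.
exact: differentiableM.
Qed.

Lemma rn4 (x u v z t : C) : x = u + 'i%C * v - z - 'i%C * t -> rn x <= rn u + rn v + rn z + rn t.
Proof.
move=> ->; have E (w : C) : rn ('i%C * w : C) = rn w by rewrite rnM rn_i mul1r.
apply: le_trans (rnB _ _) _; rewrite E lerD2r.
apply: le_trans (rnB _ _) _; rewrite lerD2r.
by apply: le_trans (rnD _ _) _; rewrite E.
Qed.

Lemma RI_near (L : R) (w v : C -> C) (a b c d e : R) : L < a -> L < c -> a <= b -> c <= d -> gcont w ->
  rcont (hor v c) -> rcont (hor v d) -> rcont (ver v a) -> rcont (ver v b) ->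
  (forall z, inQ a b c d z -> onQ a b c d z -> rn (w z - v z) <= e) ->
  rn (RI L w a b c d - RI L v a b c d) <= 4 * e * ((b - a) + (d - c)).
Proof.
move=> La Lc ab cd wc hc hd va vb H.
have t1 : rn (cI L (hor w c) a b - cI L (hor v c) a b) <= 2 * e * (b - a).
  apply: cI_near => // [|t tab]; first exact: hor_rcont.
  by apply: H; rewrite /inQ /onQ /= ?tab ?lexx ?eqxx ?orbT.
have t2 : rn (cI L (hor w d) a b - cI L (hor v d) a b) <= 2 * e * (b - a).
  apply: cI_near => // [|t tab]; first exact: hor_rcont.
  by apply: H; rewrite /inQ /onQ /= ?tab ?lexx ?eqxx ?orbT ?cd.
have t3 : rn (cI L (ver w a) c d - cI L (ver v a) c d) <= 2 * e * (d - c).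
  apply: cI_near => // [|t tab]; first exact: ver_rcont.
  by apply: H; rewrite /inQ /onQ /= ?tab ?lexx ?eqxx ?orbT ?ab.
have t4 : rn (cI L (ver w b) c d - cI L (ver v b) c d) <= 2 * e * (d - c).
  apply: cI_near => // [|t tab]; first exact: ver_rcont.
  by apply: H; rewrite /inQ /onQ /= ?tab ?lexx ?eqxx ?orbT ?ab.
have := @rn4 (RI L w a b c d - RI L v a b c d) (cI L (hor w c) a b - cI L (hor v c) a b) (cI L (ver w b) c d - cI L (ver v b) c d)
  (cI L (hor w d) a b - cI L (hor v d) a b) (cI L (ver w a) c d - cI L (ver v a) c d).
move=> /(_ _)/wrap[|t]; first by rewrite /RI; ring.
apply: le_trans t _; apply: le_trans (lerD (lerD (lerD t1 t4) t2) t3) _.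
by rewrite -subr_ge0 (_ : _ - _ = 0)//; ring.
Qed.

Lemma Goursat_punctured (L : R) (w : C -> C) (a b c d : R) (p : C) : L < a -> L < c ->
  a < Re p < b -> c < Im p < d -> gcont w ->
  (forall z, inQ a b c d z -> z != p -> exists k : C, forall e : R, 0 < e ->
    exists2 r : R, 0 < r & forall z', inQ a b c d z' ->
      rn (z' - z) < r -> rn (w z' - w z - (z' - z) * k) <= e * rn (z' - z)) ->
  RI L w a b c d = 0.
Proof.
case: p => px py La Lc /= /andP[ap pb] /andP[cp pd] wc H.
have G a' b' c' d' : a <= a' -> a' <= b' -> b' <= b -> c <= c' -> c' <= d' -> d' <= d ->
    (forall x y, a' <= x <= b' -> c' <= y <= d' -> Complex x y != Complex px py :> C) ->
    RI L w a' b' c' d' = 0.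
  move=> h1 h2 h3 h4 h5 h6 np; apply: Goursat => //; [lra|lra|].
  move=> x y xb yb; have [||k kH] := H (Complex x y).
  - by rewrite /inQ /=; apply/andP; split; lra.
  - exact: np.
  exists k => e e0; have [r r0 rH] := kH e e0; exists r => // x' y' xb' yb'.
  by apply: rH; rewrite /inQ /=; apply/andP; split; lra.
have [r1 r10 wb] := wc (Complex px py) 1 ltr01.
set B := rn (w (Complex px py)) + 1.
have B0 : 0 <= B by rewrite addr_ge0// rn_ge0.
apply: rn_le0; apply/ler_addgt0Pr => e e0; rewrite add0r.
(* The four outer rectangles avoid [p]. The inner one is a square of side [2 * s] on which [w] is
   bounded by [B], and contributes at most [16 * B * s]. *)
have [s s0 [s1 s2 s3 s4 [s5 s6]]] : exists2 s, 0 < s & [/\ s <= px - a, s <= b - px, s <= py - c,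
    s <= d - py & s <= r1 / 4 /\ s <= e / (16 * (B + 1))].
  exists (Num.min (Num.min (px - a) (b - px)) (Num.min (Num.min (py - c) (d - py)) (Num.min (r1 / 4) (e / (16 * (B + 1)))))).
    rewrite !lt_min !subr_gt0 ap pb cp pd /=; apply/andP; split; first by rewrite divr_gt0.
    by rewrite divr_gt0// mulr_gt0// ltr_pwDr.
  by rewrite !ge_min !lexx ?orbT.
have e1 : a <= px - s by clear -s1; lra.
have e2 : px + s <= b by clear -s2; lra.
have e3 : c <= py - s by clear -s3; lra.
have e4 : py + s <= d by clear -s4; lra.
have e5 : px - s <= px + s by clear -s0; lra.
have e6 : py - s <= py + s by clear -s0; lra.
have e7 : px - s <= b by clear -e5 e2; lra.
have e8 : a <= px + s by clear -e5 e1; lra.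
have e9 : c <= d by clear -e3 e6 e4; lra.
have e10 : c <= py + s by exact: le_trans e3 e6.
have e11 : py - s <= d by exact: le_trans e6 e4.
have L1 : L < px - s by exact: lt_le_trans La e1.
have L2 : L < py - s by exact: lt_le_trans Lc e3.
have Cne (x y : R) : x != px \/ y != py -> Complex x y != Complex px py :> C.
  by move=> h; rewrite eq_complex /= negb_and; apply/orP.
rewrite -(RI_splitx L w a (px - s) b c d) -(RI_splitx L w (px - s) (px + s) b c d).
rewrite -(RI_splity L w (px - s) (px + s) c (py - s) d) -(RI_splity L w (px - s) (px + s) (py - s) (py + s) d).
rewrite (G a) ?(G (px + s)) ?(G (px - s) (px + s) c (py - s)) ?(G (px - s) (px + s) (py + s) d) //.
- rewrite !(add0r, addr0).
  apply: le_trans (@RI_small _ L w 0 0 _ _ _ _ B _ _ _ _ _ _ _) _ => //.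
  + by move=> y; exact: hor_rcont.
  + by move=> y; exact: ver_rcont.
  + move=> x y xs ys; rewrite mul0r addr0 subr0.
    have -> : w (Complex x y) = (w (Complex x y) - w (Complex px py)) + w (Complex px py) by rewrite subrK.
    apply: le_trans (rnD _ _) _; rewrite addrC lerD2l ltW// wb//.
    apply: le_lt_trans (ReIm_le _) _; rewrite /=.
    apply: (@le_lt_trans _ _ (s + s)); last by lra.
    by move: xs ys => /andP[? ?] /andP[? ?]; apply: lerD; rewrite ler_distl; apply/andP.
  + rewrite (_ : _ * _ = s * (16 * B)); last by ring.
    apply: le_trans (ler_wpM2r _ s6) _; first by rewrite mulr_ge0.
    rewrite mulrAC ler_pdivrMr ?mulr_gt0// ?ltr_pwDr//; clear -e0 B0; nra.
- by move=> x y ? /andP[k1 k2]; apply: Cne; right; apply/eqP => E; move: k1 k2 s0; rewrite E; clear; lra.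
- by move=> x y ? /andP[k1 k2]; apply: Cne; right; apply/eqP => E; move: k1 k2 s0; rewrite E; clear; lra.
- by move=> x y /andP[k1 k2] ?; apply: Cne; left; apply/eqP => E; move: k1 k2 s0; rewrite E; clear; lra.
- by move=> x y /andP[k1 k2] ?; apply: Cne; left; apply/eqP => E; move: k1 k2 s0; rewrite E; clear; lra.
Qed.

(** If the modulus at [p] exceeded [M], put F = (f / f p)^n. Then (1 - F) / (z - p) extends
    continuously over [p] and has contour integral zero, but on the boundary F is small, so that the
    integral is close to that of 1 / (z - p), which is bounded away from zero. *)
Lemma max_modulus_rect (f : C -> C) (a b c d M : R) :
  (forall z, inQ a b c d z -> differentiable f z) ->
  (forall z, inQ a b c d z -> onQ a b c d z -> rn (f z) <= M) ->
  forall p, inQ a b c d p -> rn (f p) <= M.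
Proof.
move=> df fM p pQ; have [pon|] := boolP (onQ a b c d p); first exact: fM.
rewrite /onQ !negb_or => /and4P[pa pb pc pd].
move: (pQ); rewrite /inQ => /andP[/andP[h1 h2] /andP[h3 h4]].
have {}pa : a < Re p by rewrite lt_def pa.
have {}pb : Re p < b by rewrite lt_def eq_sym pb.
have {}pc : c < Im p by rewrite lt_def pc.
have {}pd : Im p < d by rewrite lt_def eq_sym pd.
have ab : a <= b by lra. have cd : c <= d by lra.
rewrite leNgt; apply/negP => Mf.
have M0 : 0 <= M.
  apply: le_trans (rn_ge0 (f (Complex a c))) (fM _ _ _); rewrite /inQ /onQ /= ?lexx ?ab ?cd ?eqxx//.
have fp0 : f p != 0 by rewrite -rn_gt0; exact: le_lt_trans M0 Mf.
(* One base point to the left of both intervals of integration. *)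
pose L := Num.min a c - 1.
have La : L < a by rewrite /L ltrBlDr; apply: (@le_lt_trans _ _ a); rewrite ?ge_min ?lexx// ltrDl.
have Lc : L < c by rewrite /L ltrBlDr; apply: (@le_lt_trans _ _ c); rewrite ?ge_min ?lexx ?orbT// ltrDl.
have [k k0 kI] : exists2 k : R, 0 < k & k <= Im (RI L (fun z => (z - p)^-1) a b c d).
  by apply: RI_inv_pos => //; apply/andP.
pose m := Num.min (Num.min (Re p - a) (b - Re p)) (Num.min (Im p - c) (d - Im p)).
have m0 : 0 < m by rewrite /m !lt_min !subr_gt0 pa pb pc pd.
have : m <= m by []; rewrite {2}/m !le_min => /andP[/andP[m1 m2] /andP[m3 m4]].
have bd z : inQ a b c d z -> onQ a b c d z -> m <= rn (z - p).
  move=> _; case: z => x y; rewrite /onQ /= => /or4P[] /eqP E.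
  - by apply: le_trans (Re_le _); case: (p) m1 => ? ? /= ?; rewrite E distrC; apply: le_trans (ler_norm _).
  - by apply: le_trans (Re_le _); case: (p) m2 => ? ? /= ?; rewrite E; apply: le_trans (ler_norm _).
  - by apply: le_trans (Im_le _); case: (p) m3 => ? ? /= ?; rewrite E distrC; apply: le_trans (ler_norm _).
  - by apply: le_trans (Im_le _); case: (p) m4 => ? ? /= ?; rewrite E; apply: le_trans (ler_norm _).
set S := (b - a) + (d - c); have S0 : 0 < S by rewrite /S; lra.
(* On the boundary F is at most [eta], so the two contour integrals differ by at most
   [eta * (4 * S / m)], where [m] is a lower bound for the distance to [p]; this has to stay below
   [k]. *)
have [n nE] : exists n, (M / rn (f p)) ^+ n < (k / 2) / (4 * S / m).
  apply: pow_small; last by rewrite !divr_gt0 ?mulr_gt0.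
  by rewrite divr_ge0 ?rn_ge0//= ltr_pdivrMr ?mul1r// rn_gt0.
set eta := (M / rn (f p)) ^+ n in nE.
have eta0 : 0 <= eta by rewrite exprn_ge0// divr_ge0// rn_ge0.
pose F z := (f z / f p) ^+ n.
have Fp : F p = 1 by rewrite /F divff// expr1n.
have dF z : inQ a b c d z -> differentiable F z.
  move=> zQ; rewrite /F.
  apply: differentiable_expr; apply: differentiableM; [exact: df|exact: differentiable_cst].
have [dp Fdp] : exists dp, cder F p dp by exists (derive1 F p); apply/cderP; split=> //; exact: dF.
pose h z : C := if z == p then - dp else (1 - F z) / (z - p).
have hE z : z != p -> h z = (1 - F z) / (z - p) by rewrite /h => /negPf ->.
have dh z : inQ a b c d z -> z != p -> differentiable h z.
  move=> zQ zp; apply: (@near_differentiable _ _ _ (fun z => (1 - F z) / (z - p))).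
    apply/nearP; exists (rn (z - p)); first by rewrite rn_gt0 subr_eq0.
    move=> y yz; rewrite hE//; apply/eqP => E; move: yz; rewrite E rnBC ltxx//.
  apply: differentiableM.
    by apply: differentiableB; [exact: differentiable_cst|exact: dF].
  by apply: differentiableV; [apply: differentiableB => //; exact: differentiable_cst|rewrite subr_eq0].
have ch z : inQ a b c d z -> {for z, continuous h}.
  move=> zQ; have [->|zp] := eqVneq z p; last exact/differentiable_continuous/dh.
  apply/contP => e e0; have [|r r0 rH] := Fdp (e / 2); first by rewrite divr_gt0.
  exists r => // y yr; rewrite {2}/h eqxx.
  have [->|yp] := eqVneq y p; first by rewrite /h eqxx subrr rn0.
  have yp0 : y - p != 0 by rewrite subr_eq0.
  have := rH (y - p) yr; rewrite addrBK' Fp => B.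
  rewrite hE// (_ : _ - _ = - (F y - 1 - (y - p) * dp) / (y - p)); last by field; rewrite yp0.
  rewrite rnM rnN rnV ltr_pdivrMr ?rn_gt0//; apply: le_lt_trans B _.
  by rewrite ltr_pM2r ?rn_gt0//; lra.
pose w := h \o clampC a b c d.
have wc : gcont w by apply: clamp_gcont.
have wh z : inQ a b c d z -> w z = h z by move=> zQ; rewrite /w /= clampC_id.
have I0 : RI L w a b c d = 0.
  apply: (@Goursat_punctured _ _ _ _ _ _ p) => //; [exact/andP|exact/andP|].
  move=> z zQ zp; have /cderP : differentiable h z /\ derive1 h z = derive1 h z by split => //; exact: dh.
  move=> hd; exists (derive1 h z) => e e0; have [r r0 rH] := hd e e0; exists r => // z' z'Q z'r.
  by rewrite !wh//; have := rH _ z'r; rewrite addrBK'.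
have hc y : Im p != y -> rcont (hor (fun z => (z - p)^-1) y).
  case: (p) => px py /= yp; apply: (@inv_rcont _ `|y - py|).
  - by rewrite normr_gt0 subr_eq0 eq_sym.
  - by move=> t; apply: le_trans (Im_le _).
  - move=> s t; rewrite opprB addrA subrK; apply: le_trans (ReIm_le _) _.
    by rewrite /= subrr normr0 addr0.
have vc x : Re p != x -> rcont (ver (fun z => (z - p)^-1) x).
  case: (p) => px py /= yp; apply: (@inv_rcont _ `|x - px|).
  - by rewrite normr_gt0 subr_eq0 eq_sym.
  - by move=> t; apply: le_trans (Re_le _).
  - move=> s t; rewrite opprB addrA subrK; apply: le_trans (ReIm_le _) _.
    by rewrite /= subrr normr0 add0r.
have := @RI_near L w (fun z => (z - p)^-1) a b c d (eta / m) La Lc ab cd wc.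
rewrite I0 sub0r rnN => /(_ _ _ _ _ _) N.
have : rn (RI L (fun z : C => (z - p)^-1) a b c d) <= 4 * (eta / m) * S.
  apply: N; [by apply: hc; rewrite gt_eqF|by apply: hc; rewrite lt_eqF|by apply: vc; rewrite gt_eqF|by apply: vc; rewrite lt_eqF|].
  move=> z zQ zo; have zm := bd z zQ zo.
  have zp : z != p by rewrite -subr_eq0 -rn_gt0; exact: lt_le_trans m0 zm.
  rewrite wh// hE// (_ : _ - _ = - (F z / (z - p))); last by rewrite mulrBl div1r addrAC subrr add0r.
  rewrite rnN rnM rnV; apply: ler_pM; rewrite ?rn_ge0 ?invr_ge0 ?rn_ge0//.
    rewrite /F rnX rnM rnV lerXn2r ?nnegrE ?divr_ge0 ?rn_ge0// ler_pM2r ?invr_gt0 ?rn_gt0//.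
    exact: fM.
  by rewrite lef_pV2 ?posrE// ; exact: lt_le_trans m0 zm.
apply/negP; rewrite -ltNge; apply: (@lt_le_trans _ _ k); last first.
  by apply: le_trans kI _; apply: le_trans (Im_le _); exact: ler_norm.
move: nE; rewrite ltr_pdivlMr ?divr_gt0 ?mulr_gt0// => nE.
rewrite (_ : 4 * (eta / m) * S = eta * (4 * S / m)); last by ring.
by apply: lt_trans nE _; lra.
Qed.

End MaximumModulus.

(** * Schwarz's estimate and Taylor's formula *)

Section OneVariable.
Variable R : realType.
Local Notation C := (cplx R).

Lemma eqle (x y : R) : x = y -> x <= y.
Proof. by move=> ->. Qed.

Definition hb (V : normedModType C) (u : V -> C) (v : V) (r : R) :=
  forall w, rn (w - v) < r -> differentiable u w.

Lemma hbW (V : normedModType C) (u : V -> C) v r w s :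
  rn (w - v) + s <= r -> hb u v r -> hb u w s.
Proof.
move=> h H x xw; apply: H; apply: le_lt_trans (rn_tri w _ _) _.
by apply: lt_le_trans h; rewrite addrC ltrD2l.
Qed.

(** Applied to the square of half-side [s] around [p]: it contains the disc of radius [s], lies
    within [2 * s] of [p], and its boundary keeps at distance at least [s]. *)
Lemma max_modulus_ball (f : C -> C) (p : C) (r s M : R) : 0 < s -> 2 * s < r -> hb f p r ->
  (forall z, s <= rn (z - p) -> rn (z - p) < r -> rn (f z) <= M) ->
  forall z, rn (z - p) <= s -> rn (f z) <= M.
Proof.
move=> s0 sr df fM z zs.
have Q2 w : inQ (Re p - s) (Re p + s) (Im p - s) (Im p + s) w -> rn (w - p) < r.
  move=> /andP[h1 h2]; apply: le_lt_trans sr; apply: le_trans (ReIm_le _) _.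
  rewrite mulr2n mulrDl mul1r; apply: lerD.
    by rewrite (_ : Re (w - p) = Re w - Re p) ?ler_distl//; case: (w) (p) => ? ? [].
  by rewrite (_ : Im (w - p) = Im w - Im p) ?ler_distl//; case: (w) (p) => ? ? [].
apply: (@max_modulus_rect _ f (Re p - s) (Re p + s) (Im p - s) (Im p + s)).
- by move=> w wQ; apply: df; exact: Q2.
- move=> w wQ wo; apply: fM; last exact: Q2.
  have E1 : Re (w - p) = Re w - Re p by case: (w) (p) => ? ? [].
  have E2 : Im (w - p) = Im w - Im p by case: (w) (p) => ? ? [].
  move: wo; rewrite /onQ => /or4P[] /eqP E.
  + by apply: le_trans (Re_le _); rewrite E1 E addrAC subrr add0r normrN ler_norm.
  + by apply: le_trans (Re_le _); rewrite E1 E addrAC subrr add0r ler_norm.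
  + by apply: le_trans (Im_le _); rewrite E2 E addrAC subrr add0r normrN ler_norm.
  + by apply: le_trans (Im_le _); rewrite E2 E addrAC subrr add0r ler_norm.
- rewrite /inQ -!ler_distl; apply/andP; split.
    by apply: le_trans zs; apply: le_trans (Re_le _); case: (z) (p) => ? ? [].
  by apply: le_trans zs; apply: le_trans (Im_le _); case: (z) (p) => ? ? [].
Qed.

Lemma cder_mulX (k : C -> C) (p : C) : {for p, continuous k} ->
  cder (fun z => (z - p) * k z) p (k p).
Proof.
move=> /contP kc e e0; have [r r0 rH] := kc e e0; exists r => // h hr.
rewrite subrr mul0r subr0 (addrC p) addrK -mulrBr rnM mulrC ler_wpM2r ?rn_ge0// ltW//.
by apply: rH; rewrite addrK.
Qed.

Lemma pow_le_limit (x b c k : R) : 0 <= x -> 0 <= b -> 0 < c -> 0 < k ->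
  (forall n, c * x ^+ n <= k * b ^+ n) -> x <= b.
Proof.
move=> x0 b0 c0 k0 H; rewrite leNgt; apply/negP => bx.
have x1 : 0 < x by exact: le_lt_trans b0 bx.
have [n nE] : exists n, (b / x) ^+ n < c / k.
  apply: pow_small; last exact: divr_gt0.
  by rewrite divr_ge0//= ltr_pdivrMr// mul1r.
have := H n; apply/negP; rewrite -ltNge.
move: nE; rewrite ltr_pdivlMr// expr_div_n mulrAC ltr_pdivrMr ?exprn_gt0//.
by rewrite mulrC.
Qed.

Lemma continuous_expr (k : C -> C) (p : C) n :
  {for p, continuous k} -> {for p, continuous (fun z => k z ^+ n : C)}.
Proof.
move=> kc.
have h : {for k p, continuous (fun z : C => z ^+ n : C)}.
  by apply: differentiable_continuous; apply: differentiable_expr.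
exact: (continuous_comp kc h).
Qed.

(* (z - p) k(z)^n is differentiable at p as well, whence the bound on k by
   letting n go to infinity. *)
Lemma max_modulus_punctured (k : C -> C) (p : C) (r s B : R) : 0 < s -> 2 * s < r ->
  {for p, continuous k} ->
  (forall z, rn (z - p) < r -> z != p -> differentiable k z) ->
  (forall z, s <= rn (z - p) -> rn (z - p) < r -> rn (k z) <= B) ->
  forall z, rn (z - p) <= s -> z != p -> rn (k z) <= B.
Proof.
move=> s0 sr kc dk kB z zs zp.
have B0 : 0 <= B.
  have E : rn ((p + s%:C%C) - p) = s by rewrite (addrC p) addrK rnR gtr0_norm.
  by apply: le_trans (rn_ge0 _) (kB (p + s%:C%C) _ _); rewrite E// ; lra.
have zp0 : 0 < rn (z - p) by rewrite rn_gt0 subr_eq0.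
apply: (@pow_le_limit _ _ (rn (z - p)) r) => //; [exact: rn_ge0|lra|].
move=> n; rewrite -rnX -rnM.
pose g z : C := (z - p) * k z ^+ n.
have dg : hb g p r.
  move=> w wr; have [->|wp] := eqVneq w p.
    have kc' : {for p, continuous (fun z => k z ^+ n : C)}.
      exact: continuous_expr.
    by have /cderP[] := cder_mulX kc'.
  apply: differentiableM; last by apply: differentiable_expr; exact: dk.
  by apply: differentiableB => //; exact: differentiable_cst.
apply: (max_modulus_ball s0 sr dg _ zs) => w ws wr; rewrite /g rnM rnX.
apply: ler_pM; rewrite ?exprn_ge0 ?rn_ge0 ?(ltW wr)//.
by rewrite lerXn2r ?nnegrE ?rn_ge0//; exact: kB.
Qed.

(** The difference quotient at [p], completed by the derivative [d]. At first it is known to be no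
    more than continuous at [p], whence the punctured form of the maximum principle; [dq_hb]
    improves on this. *)
Definition dq (f : C -> C) (p d : C) (z : C) : C := if z == p then d else (f z - f p) / (z - p).

Lemma dqE f p d z : f z = f p + (z - p) * dq f p d z.
Proof.
rewrite /dq; have [->|zp] := eqVneq z p; first by rewrite subrr mul0r addr0.
by rewrite mulrC mulfVK ?subr_eq0// addrC subrK.
Qed.

Lemma dq_cont (f : C -> C) p d : cder f p d -> {for p, continuous (dq f p d)}.
Proof.
move=> fd; apply/contP => e e0; have [|r r0 rH] := fd (e / 2); first by rewrite divr_gt0.
exists r => // y yr; rewrite {2}/dq eqxx.
have [->|yp] := eqVneq y p; first by rewrite /dq eqxx subrr rn0.
have yp0 : y - p != 0 by rewrite subr_eq0.
have := rH (y - p) yr; rewrite addrBK' => B.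
rewrite /dq (negPf yp) (_ : _ - d = (f y - f p - (y - p) * d) / (y - p)); last by field; rewrite yp0.
rewrite rnM rnV ltr_pdivrMr ?rn_gt0//; apply: le_lt_trans B _.
by rewrite ltr_pM2r ?rn_gt0//; lra.
Qed.

Lemma dq_diff (f : C -> C) p d z : differentiable f z -> z != p -> differentiable (dq f p d) z.
Proof.
move=> df zp; apply: (@near_differentiable _ _ _ (fun z => (f z - f p) / (z - p))).
  apply/nearP; exists (rn (z - p)); first by rewrite rn_gt0 subr_eq0.
  move=> y yz; rewrite /dq; case: eqVneq => // E; move: yz; rewrite E rnBC ltxx//.
apply: differentiableM.
  by apply: differentiableB => //; exact: differentiable_cst.
by apply: differentiableV; [apply: differentiableB => //; exact: differentiable_cst|rewrite subr_eq0].
Qed.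

Lemma hb_cder (f : C -> C) p r : 0 < r -> hb f p r -> cder f p (derive1 f p).
Proof. by move=> r0 H; apply/cderP; split=> //; apply: H; rewrite subrr rn0. Qed.

(** The maximum principle for the difference quotient at [p], which beyond the distance [r / 3] is
    at most [2 * M / (r / 3)]. *)
Lemma schwarz (f : C -> C) p r M : 0 < r -> hb f p r ->
  (forall z, rn (z - p) < r -> rn (f z) <= M) ->
  forall z, rn (z - p) <= r / 3 -> rn (f z - f p) <= 6 * M / r * rn (z - p).
Proof.
move=> r0 df fM z zr; have [->|zp] := eqVneq z p; first by rewrite !subrr rn0 mulr0.
have dd := hb_cder r0 df; set d := derive1 f p in dd.
have M0 : 0 <= M by apply: le_trans (rn_ge0 _) (fM p _); rewrite subrr rn0.
have r3 : 0 < r / 3 by rewrite divr_gt0.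
rewrite (dqE f p d z) addrAC subrr add0r rnM mulrC ler_wpM2r ?rn_ge0//.
apply: (@max_modulus_punctured (dq f p d) p r (r / 3)) => //; first lra.
- exact: dq_cont.
- by move=> w wr wp; apply: dq_diff => //; exact: df.
- move=> w ws wr; have wp : w != p by rewrite -subr_eq0 -rn_gt0; exact: lt_le_trans ws.
  rewrite /dq (negPf wp) rnM rnV ler_pdivrMr; last exact: lt_le_trans ws.
  apply: (@le_trans _ _ (2 * M)).
    apply: le_trans (rnB _ _) _; rewrite mulr2n mulrDl mul1r lerD ?fM//.
    by rewrite subrr rn0.
  rewrite (_ : 2 * M = 6 * M / r * (r / 3)); last by field; rewrite gt_eqF.
  by rewrite ler_wpM2l// divr_ge0 ?mulr_ge0// ltW.
Qed.

(** Schwarz's estimate twice: it bounds the quotient [q] on the half disc, and is then applied to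
    [q] itself. *)
Lemma second_difference (f : C -> C) p r M : 0 < r -> hb f p r ->
  (forall z, rn (z - p) < r -> rn (f z) <= M) ->
  forall z h, rn (z - p) <= r / 6 -> rn h <= r / 6 ->
  rn (f (z + h) - f z - (f (p + h) - f p)) <= 144 * M / r ^+ 2 * rn (z - p) * rn h.
Proof.
move=> r0 df fM z h zr hr.
have M0 : 0 <= M by apply: le_trans (rn_ge0 _) (fM p _); rewrite subrr rn0.
have [->|h0] := eqVneq h 0; first by rewrite !addr0 !subrr rn0 mulr0.
have hp : 0 < rn h by rewrite rn_gt0.
pose q w := (f (w + h) - f w) / h.
have r2 : 0 < r / 2 by rewrite divr_gt0.
have wh w : rn (w - p) < r / 2 -> rn (w + h - p) < r.
  by move=> wr; rewrite addrAC; apply: le_lt_trans (rnD _ _) _; lra.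
have qM w : rn (w - p) < r / 2 -> rn (q w) <= 12 * M / r.
  move=> wr; rewrite /q rnM rnV ler_pdivrMr//.
  have := @schwarz f w (r / 2) M r2 _ _ (w + h).
  rewrite (addrC w) addrK (_ : 6 * M / (r / 2) = 12 * M / r); last by field; rewrite gt_eqF.
  apply; last by apply: le_trans hr _; lra.
  - by apply: hbW df; lra.
  - by move=> x xw; apply: fM; apply: le_lt_trans (rn_tri w _ _) _; lra.
have dq_ : hb q p (r / 2).
  move=> w wr; apply: differentiableM; last exact: differentiable_cst.
  apply: differentiableB; last by apply: df; lra.
  apply: (@differentiable_comp _ _ _ _ (fun w => w + h) f).
    by apply: differentiableD => //; exact: differentiable_cst.
  exact/df/wh.
have := @schwarz q p (r / 2) (12 * M / r) r2 dq_ qM z.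
rewrite (_ : r / 2 / 3 = r / 6); last by field.
move=> /(_ zr) S.
rewrite (_ : f (z + h) - f z - (f (p + h) - f p) = (q z - q p) * h); last first.
  by rewrite /q; field; rewrite h0.
rewrite rnM ler_wpM2r ?rn_ge0//; apply: le_trans S _.
by rewrite (_ : 6 * _ / _ = 144 * M / r ^+ 2)//; field; rewrite gt_eqF.
Qed.

(** The remainder satisfies E(k) = 2 E(k / 2) plus a second difference. On iterating, the second
    differences sum to a geometric series, and 2^n E(h / 2^n) tends to 0 by differentiability at
    [p]. *)
Lemma taylor2 (f : C -> C) p r M d : 0 < r -> hb f p r ->
  (forall z, rn (z - p) < r -> rn (f z) <= M) -> cder f p d ->
  forall h, rn h <= r / 6 -> rn (f (p + h) - f p - h * d) <= 144 * M / r ^+ 2 * rn h ^+ 2.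
Proof.
move=> r0 df fM fd h hr.
have M0 : 0 <= M by apply: le_trans (rn_ge0 _) (fM p _); rewrite subrr rn0.
set K := 144 * M / r ^+ 2.
have K0 : 0 <= K by rewrite /K divr_ge0 ?mulr_ge0 ?exprn_ge0 ?(ltW r0).
pose E h := f (p + h) - f p - h * d.
have c2 : rn (2^-1 : C) = 2^-1 by rewrite (_ : 2^-1 = (2^-1)%:C%C) ?rnR ?gtr0_norm ?invr_gt0// fmorphV rmorph_nat.
have half k : rn k <= r / 6 -> rn (E k) <= 2 * rn (E (k / 2)) + K * rn k ^+ 2 / 4.
  move=> kr; have k2r : rn (k / 2) <= r / 6 by rewrite rnM c2; have := rn_ge0 k; lra.
  have k2r' : rn (p + k / 2 - p) <= r / 6 by rewrite (addrC p) addrK.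
  have := @second_difference f p r M r0 df fM (p + k / 2) (k / 2) k2r' k2r.
  rewrite -/K (_ : p + k / 2 + k / 2 = p + k); last by field.
  rewrite (_ : p + k / 2 - p = k / 2) => [S|]; last by rewrite addrC addKr.
  have EE : E k = (f (p + k) - f (p + k / 2) - (f (p + k / 2) - f p)) + (E (k / 2) + E (k / 2)).
    by rewrite /E; field.
  rewrite EE; apply: le_trans (rnD _ _) _; rewrite addrC; apply: lerD.
    by apply: le_trans (rnD _ _) _; lra.
  by apply: le_trans S _; rewrite rnM c2 expr2; apply/eqle; field.
have iter n : rn (E h) <= 2 ^+ n * rn (E (h / 2 ^+ n)) + K * rn h ^+ 2 * (1 - 2^-1 ^+ n) / 2.
  elim: n => [|n IH]; first by rewrite !expr0 subrr mulr0 mul0r addr0 mul1r divr1.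
  apply: le_trans IH _.
  have rnh : rn (h / 2 ^+ n) = rn h * 2^-1 ^+ n by rewrite rnM -exprVn rnX c2.
  have p1 : 0 < (2^-1 : R) ^+ n by rewrite exprn_gt0 ?invr_gt0.
  have p2 : (2^-1 : R) ^+ n <= 1 by rewrite exprn_ile1 ?invr_ge0 ?invf_le1 ?ler1n.
  have := half (h / 2 ^+ n) _; rewrite rnh => /(_ _)/wrap[|H].
    by apply: le_trans hr; rewrite ler_piMr ?rn_ge0.
  have -> : h / 2 ^+ n.+1 = h / 2 ^+ n / 2 by rewrite exprS; field; rewrite expf_neq0.
  have P0 : 0 < (2 : R) ^+ n by rewrite exprn_gt0.
  apply: le_trans (lerD (ler_wpM2l (ltW P0) H) (lexx _)) _.
  apply/eqle; rewrite (exprS 2 n) (exprS 2^-1 n) exprVn; set y := (2 : R) ^+ n.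
  by field; rewrite gt_eqF.
apply/ler_addgt0Pr => e e0.
have [|s s0 sH] := fd (e / (1 + rn h)); first by rewrite divr_gt0// ltr_pwDl// rn_ge0.
have [n nE] : exists n, (2^-1 : R) ^+ n < s / (1 + rn h).
  by apply: pow_small; [rewrite invr_ge0 ler0n invf_lt1 ?ltr1n|rewrite divr_gt0// ltr_pwDl// rn_ge0].
have h1 : 0 < 1 + rn h by rewrite ltr_pwDl// rn_ge0.
have rnh : rn (h / 2 ^+ n) = rn h * 2^-1 ^+ n by rewrite rnM -exprVn rnX c2.
have p1 : 0 < (2^-1 : R) ^+ n by rewrite exprn_gt0 ?invr_gt0.
have p2 : (2^-1 : R) ^+ n <= 1 by rewrite exprn_ile1 ?invr_ge0 ?invf_le1 ?ler1n.
have := sH (h / 2 ^+ n) _; rewrite rnh => /(_ _)/wrap[|S].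
  move: nE; rewrite ltr_pdivlMr// => nE; apply: le_lt_trans nE.
  by rewrite mulrC ler_wpM2l ?(ltW p1)// lerDr.
apply: le_trans (iter n) _.
have P0 : 0 < (2 : R) ^+ n by rewrite exprn_gt0.
rewrite addrC; apply: lerD.
  rewrite -mulrA; apply: ler_piMr; first by rewrite mulr_ge0 ?exprn_ge0 ?rn_ge0.
  by clear -p1; move: (2^-1 ^+ n) p1 => y y0; lra.
apply: le_trans (ler_wpM2l (ltW P0) S) _.
rewrite (_ : _ * (_ * (_ * _)) = e * (rn h / (1 + rn h))); last first.
  by rewrite exprVn; field; rewrite !gt_eqF.
by rewrite ler_piMr ?(ltW e0)// ler_pdivrMr// mul1r lerDr.
Qed.

End OneVariable.

(** * Several complex variables *)

Section SeveralVariables.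
Variable R : realType.
Local Notation C := (cplx R).
Variable V : normedModType C.

Lemma line_diff (u : V -> C) (w h : V) (t : C) : differentiable u (w + t *: h) ->
  differentiable (fun s : C => u (w + s *: h) : C) t.
Proof.
move=> du; apply: (@differentiable_comp _ _ _ _ (fun s : C => w + s *: h) u); last by [].
apply: differentiableD; first exact: differentiable_cst.
exact: differentiableZl.
Qed.

Lemma line_cder (u : V -> C) (w h : V) : differentiable u w ->
  cder (fun s : C => u (w + s *: h)) 0 ('d u w h).
Proof.
move=> du e e0; have [|d d0 dH] := diff_eps du (e := e / (1 + rn h)).
  by rewrite divr_gt0// ltr_pwDl// rn_ge0.
have h1 : 0 < 1 + rn h by rewrite ltr_pwDl// rn_ge0.
exists (d / (1 + rn h)); first by rewrite divr_gt0.
move=> s; rewrite ltr_pdivlMr// => sd.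
have sh : rn (s *: h) < d.
  by rewrite rnZ; apply: le_lt_trans sd; rewrite ler_wpM2l ?rn_ge0// lerDr.
have := dH _ sh; rewrite add0r scale0r addr0 linearZ => H; apply: le_trans H _.
rewrite rnZ (_ : _ * _ = (e * rn s) * (rn h / (1 + rn h))); last by field; rewrite gt_eqF.
by apply: ler_piMr; rewrite ?mulr_ge0 ?rn_ge0 ?(ltW e0)// ler_pdivrMr// mul1r lerDr.
Qed.

Lemma line_hb (u : V -> C) (v w h : V) (r : R) : h != 0 -> hb u v r -> rn (w - v) <= r / 2 ->
  hb (fun s : C => u (w + s *: h)) 0 (r / (2 * rn h)).
Proof.
move=> h0 du wr s; rewrite subr0 ltr_pdivlMr ?mulr_gt0 ?rn_gt0// => sr.
apply: line_diff; apply: du; rewrite addrAC; apply: le_lt_trans (rnD _ _) _.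
by rewrite rnZ; lra.
Qed.

Lemma line_bound (u : V -> C) (v w h : V) (r M : R) : h != 0 ->
  (forall z, rn (z - v) < r -> rn (u z) <= M) -> rn (w - v) <= r / 2 ->
  forall s : C, rn (s - 0) < r / (2 * rn h) -> rn (u (w + s *: h)) <= M.
Proof.
move=> h0 uM wr s; rewrite subr0 ltr_pdivlMr ?mulr_gt0 ?rn_gt0// => sr.
apply: uM; rewrite addrAC; apply: le_lt_trans (rnD _ _) _.
by rewrite rnZ; lra.
Qed.

Lemma holo_lipschitz (u : V -> C) (v w h : V) (r M : R) : 0 < r -> hb u v r ->
  (forall z, rn (z - v) < r -> rn (u z) <= M) -> rn (w - v) <= r / 2 -> rn h <= r / 12 ->
  rn (u (w + h) - u w) <= 12 * M / r * rn h.
Proof.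
move=> r0 du uM wr hr; have [->|h0] := eqVneq h 0; first by rewrite addr0 subrr !rn0 mulr0.
have hp : 0 < rn h by rewrite rn_gt0.
have r' : 0 < r / (2 * rn h) by rewrite divr_gt0 ?mulr_gt0.
have := schwarz r' (line_hb h0 du wr) (line_bound h0 uM wr) (z := 1).
rewrite subr0 rn1 scale1r scale0r addr0 mulr1 => /(_ _)/wrap[|S].
  by rewrite ler_pdivlMr// ler_pdivlMr ?mulr_gt0//; lra.
by apply: le_trans S _; apply: eqle; field; rewrite !gt_eqF.
Qed.

Lemma taylor2V (u : V -> C) (v w h : V) (r M : R) : 0 < r -> hb u v r ->
  (forall z, rn (z - v) < r -> rn (u z) <= M) -> rn (w - v) <= r / 2 -> rn h <= r / 12 ->
  rn (u (w + h) - u w - 'd u w h) <= 576 * M / r ^+ 2 * rn h ^+ 2.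
Proof.
move=> r0 du uM wr hr; have [->|h0] := eqVneq h 0.
  by rewrite addr0 subrr linear0 subrr !rn0 expr0n mulr0.
have hp : 0 < rn h by rewrite rn_gt0.
have r' : 0 < r / (2 * rn h) by rewrite divr_gt0 ?mulr_gt0.
have dw : differentiable u w by apply: du; lra.
have := taylor2 r' (line_hb h0 du wr) (line_bound h0 uM wr) (line_cder h dw) (h := 1).
rewrite add0r rn1 scale1r scale0r addr0 mul1r expr1n mulr1 => /(_ _)/wrap[|S].
  by rewrite ler_pdivlMr// ler_pdivlMr ?mulr_gt0//; lra.
by apply: le_trans S _; apply: eqle; field; rewrite !gt_eqF.
Qed.

Lemma diff_bound (u : V -> C) (v w h : V) (r M : R) : 0 < r -> hb u v r ->
  (forall z, rn (z - v) < r -> rn (u z) <= M) -> rn (w - v) <= r / 2 ->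
  rn ('d u w h) <= 12 * M / r * rn h.
Proof.
move=> r0 du uM wr; have [->|h0] := eqVneq h 0; first by rewrite linear0 !rn0 mulr0.
have hp : 0 < rn h by rewrite rn_gt0.
have dw : differentiable u w by apply: du; lra.
apply/ler_addgt0Pr => e e0.
have [d d0 dH] := line_cder h dw e0.
pose t : R := Num.min (d / 2) (r / 12 / rn h).
have t0 : 0 < t by rewrite lt_min !divr_gt0.
have td : rn (t%:C%C : C) < d.
  by rewrite rnR gtr0_norm//; apply: (@le_lt_trans _ _ (d / 2)); [rewrite ge_min lexx|lra].
have := dH _ td; rewrite add0r scale0r addr0 => H.
have th : rn (t%:C%C *: h) <= r / 12.
  by rewrite rnZ rnR gtr0_norm// -ler_pdivlMr// ge_min lexx orbT.
have L := holo_lipschitz r0 du uM wr th.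
rewrite -(ler_pM2l t0) mulrDr -{1}(gtr0_norm t0) -{1}rnR -rnM.
have -> : t%:C%C * 'd u w h = (u (w + t%:C%C *: h) - u w) - (u (w + t%:C%C *: h) - u w - t%:C%C * 'd u w h) :> C.
  by rewrite opprB addrC subrK.
apply: le_trans (rnB _ _) _; apply: lerD.
  by apply: le_trans L _; rewrite rnZ rnR gtr0_norm//; apply: eqle; ring.
by apply: le_trans H _; rewrite rnR gtr0_norm// mulrC.
Qed.

Lemma locally_bounded (u : V -> C) (v : V) : differentiable u v ->
  exists M, exists2 r, 0 < r & forall z, rn (z - v) < r -> rn (u z) <= M.
Proof.
move=> /differentiable_continuous /contP/(_ 1 ltr01)[r r0 rH].
exists (rn (u v) + 1), r => // z /rH h.
rewrite -(subrK (u v) (u z)); apply: le_trans (rnD _ _) _.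
by rewrite addrC lerD2l ltW.
Qed.

Lemma near_hb (u : V -> C) (v : V) : (\forall w \near v, differentiable u w) <->
  exists2 r, 0 < r & hb u v r.
Proof. exact: nearP. Qed.

Lemma hb_data (u : V -> C) (v : V) : (\forall w \near v, differentiable u w) ->
  exists M, exists2 r, 0 < r & hb u v r /\ (forall z, rn (z - v) < r -> rn (u z) <= M).
Proof.
move=> /near_hb[r r0 rH].
have [|M [s s0 sH]] := @locally_bounded u v; first by apply: rH; rewrite subrr rn0.
exists M, (Num.min r s); first by rewrite lt_min r0.
by split=> z; rewrite lt_min => /andP[h1 h2]; [exact: rH|exact: sH].
Qed.

End SeveralVariables.

Section Completeness.
Variable R : realType.
Local Notation C := (cplx R).

Lemma complete_seq (a : nat -> C) (K : R) :
  (forall n m, rn (a n - a m) <= K * (2^-1 ^+ n + 2^-1 ^+ m)) ->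
  exists l, forall n, rn (a n - l) <= 2 * K * 2^-1 ^+ n.
Proof.
move=> H.
have real (x : nat -> R) : (forall n m, `|x n - x m| <= K * (2^-1 ^+ n + 2^-1 ^+ m)) ->
    exists l, forall n, `|x n - l| <= K * 2^-1 ^+ n.
  move=> xH.
  pose lo n := x n - K * 2^-1 ^+ n; pose hi n := x n + K * 2^-1 ^+ n.
  have lohi n m : lo n <= hi m.
    have := xH n m; rewrite mulrDr ler_distl => /andP[_ h2].
    by rewrite /lo /hi lerBlDr -addrA (addrC (K * _)).
  exists (sup (range lo)) => n; rewrite distrC ler_distl; apply/andP; split.
    by apply: ub_le_sup; [exists (hi 0%N) => _ [m _ <-]|exists n].
  apply: ge_sup; first by exists (lo 0%N); exists 0%N.
  by move=> _ [m _ <-]; exact: lohi.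
have [x xH] : exists l, forall n, `|Re (a n) - l| <= K * 2^-1 ^+ n.
  apply: real => n m; apply: le_trans (H n m); apply: le_trans (Re_le _).
  by case: (a n) (a m) => ? ? [].
have [y yH] : exists l, forall n, `|Im (a n) - l| <= K * 2^-1 ^+ n.
  apply: real => n m; apply: le_trans (H n m); apply: le_trans (Im_le _).
  by case: (a n) (a m) => ? ? [].
exists (Complex x y) => n; apply: le_trans (ReIm_le _) _.
rewrite -mulrA mulr2n mulrDl mul1r.
by apply: lerD; [have := xH n|have := yH n]; case: (a n).
Qed.

End Completeness.

Lemma small_le0 (R : realType) (x y : R) : 0 <= y -> (forall n, x <= y * 2^-1 ^+ n) -> x <= 0.
Proof.
move=> y0 H; apply/ler_addgt0Pr => e e0; rewrite add0r.
have y1 : 0 < 1 + y by rewrite ltr_pwDl.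
have p0 n : 0 <= (2^-1 : R) ^+ n by rewrite exprn_ge0 ?invr_ge0.
have h01 : 0 <= (2^-1 : R) < 1 by rewrite invr_ge0 ler0n invf_lt1 ?ltr1n.
have [n] := pow_small h01 (divr_gt0 e0 y1).
rewrite ltr_pdivlMr// => /ltW nE; apply: le_trans (H n) _.
by apply: le_trans nE; rewrite mulrC ler_wpM2l// lerDr.
Qed.

Lemma Kge0 (R : realType) (n m : nat) (M r : R) : 0 <= M -> 0 < r -> 0 <= n%:R * M / r ^+ m.
Proof. by move=> M0 r0; rewrite divr_ge0 ?exprn_ge0 ?(ltW r0)// mulr_ge0. Qed.

(** * Differentiability and symmetry of second derivatives *)

Section Derivatives.
Variable R : realType.
Local Notation C := (cplx R).
Variable V : normedModType C.

Lemma cder_uniq (f g : C -> C) (z a b : C) : cder f z a -> cder g z b -> f = g -> a = b.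
Proof. by move=> /cderP[_ <-] /cderP[_ <-] ->. Qed.

Lemma cderBM (f g : C -> C) (z a b c : C) : cder f z a -> cder g z b ->
  cder (fun w => (f w - g w) * c) z ((a - b) * c).
Proof.
move=> fa gb e e0.
have c1 : 0 < 1 + rn c by rewrite ltr_pwDl// rn_ge0.
have e1 : 0 < e / 2 / (1 + rn c) by rewrite !divr_gt0.
have [r r0 rH] := fa _ e1; have [s s0 sH] := gb _ e1.
exists (Num.min r s); first by rewrite lt_min r0.
move=> h; rewrite lt_min => /andP[/rH h1 /sH h2].
rewrite (_ : _ - _ = ((f (z + h) - f z - h * a) - (g (z + h) - g z - h * b)) * c); last by ring.
rewrite rnM; apply: le_trans (ler_wpM2r (rn_ge0 _) (rnB _ _)) _.
apply: le_trans (ler_wpM2r (rn_ge0 _) (lerD h1 h2)) _.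
rewrite (_ : (_ + _) * _ = e * rn h * (rn c / (1 + rn c))); last by field; rewrite gt_eqF.
by apply: ler_piMr; rewrite ?mulr_ge0 ?rn_ge0 ?(ltW e0)// ler_pdivrMr// mul1r lerDr.
Qed.

Lemma halfC n : rn (2^-1 ^+ n : C) = 2^-1 ^+ n.
Proof.
rewrite rnX (_ : 2^-1 = (2^-1)%:C%C) ?rnR ?gtr0_norm ?invr_gt0//.
by rewrite fmorphV rmorph_nat.
Qed.

Let qt (u : V -> C) (k : V) (s : C) (w : V) : C := (u (w + s *: k) - u w) / s.

(* The derivative of the difference quotient in the direction k converges as
   the step tends to 0, with explicit rate: its limit is the derivative of the
   directional derivative. *)
Lemma diff_differentiable_aux (u : V -> C) (v k : V) :
  (\forall w \near v, differentiable u w) ->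
  differentiable (fun w => 'd u w k : C) v /\
  exists (s0 : nat -> C) (c : R), [/\ 0 < c, forall n, rn (s0 n) = c * 2^-1 ^+ n &
    forall h, exists2 K, 0 <= K & forall n,
      rn (('d u (v + s0 n *: k) h - 'd u v h) / s0 n - 'd (fun w => 'd u w k : C) v h) <= K * 2^-1 ^+ n].
Proof.
move=> /hb_data[M [r r0 [du uM]]].
have M0 : 0 <= M by apply: le_trans (rn_ge0 _) (uM v _); rewrite subrr rn0.
pose c : R := r / (12 * (1 + rn k)).
have k1 : 0 < 1 + rn k by rewrite ltr_pwDl// rn_ge0.
have c0 : 0 < c by rewrite divr_gt0 ?mulr_gt0.
have sk (s : C) : rn s <= c -> rn (s *: k) <= r / 12.
  move=> sc; rewrite rnZ; apply: le_trans (ler_wpM2r (rn_ge0 _) sc) _.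
  rewrite (_ : c * rn k = r / 12 * (rn k / (1 + rn k))); last first.
    by rewrite /c; field; rewrite gt_eqF.
  by rewrite ler_piMr ?divr_ge0 ?(ltW r0)// ler_pdivrMr// mul1r lerDr.
pose K1 := 576 * M / r ^+ 2 * rn k ^+ 2.
have K10 : 0 <= K1 by rewrite /K1 mulr_ge0 ?exprn_ge0 ?rn_ge0 ?Kge0.
have qP (s : C) w : s != 0 -> rn s <= c -> rn (w - v) <= r / 2 ->
    rn (qt u k s w - 'd u w k) <= K1 * rn s.
  move=> s0 sc wr; have := taylor2V r0 du uM wr (sk s sc).
  rewrite linearZ => T.
  rewrite /qt (_ : _ - _ = (u (w + s *: k) - u w - s * 'd u w k) / s); last by field.
  rewrite rnM rnV ler_pdivrMr ?rn_gt0//; apply: le_trans T _.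
  by rewrite rnZ; apply: eqle; rewrite /K1; ring.
have qdiff (s : C) : s != 0 -> rn s <= c -> hb (qt u k s) v (r / 2).
  move=> s0 sc w wr; apply: differentiableM; last exact: differentiable_cst.
  apply: differentiableB; last by apply: du; lra.
  apply: (@differentiable_comp _ _ _ _ (fun w => w + s *: k) u).
    by apply: differentiableD => //; exact: differentiable_cst.
  apply: du; rewrite addrAC; apply: le_lt_trans (rnD _ _) _.
  by have := sk s sc; lra.
have r2 : 0 < r / 2 by rewrite divr_gt0.
have vv : rn (v - v) <= r / 2 / 2 by rewrite subrr rn0 !divr_ge0 ?(ltW r0).
pose s0 n : C := c%:C%C * 2^-1 ^+ n.
have s0n n : rn (s0 n) = c * 2^-1 ^+ n.
  by rewrite /s0 rnM rnR halfC gtr0_norm.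
have p0 n : 0 < (2^-1 : R) ^+ n by rewrite exprn_gt0 ?invr_gt0.
have s00 n : s0 n != 0 by rewrite -rn_gt0 s0n mulr_gt0.
have s0c n : rn (s0 n) <= c.
  by rewrite s0n ler_piMr ?(ltW c0)// exprn_ile1 ?invr_ge0 ?invf_le1 ?ler1n.
pose A n (h : V) : C := 'd (qt u k (s0 n)) v h.
have dA n : differentiable (qt u k (s0 n)) v.
  by apply: (qdiff _ (s00 n) (s0c n)); rewrite subrr rn0.
pose K2c := 24 / r * K1 * c.
have K2c0 : 0 <= K2c.
  rewrite /K2c; apply: mulr_ge0; last exact: ltW.
  by apply: mulr_ge0 K10; apply: divr_ge0; [exact: ler0n|exact: ltW].
pose K2 (h : V) := K2c * rn h.
(* [diff_bound] controls a differential by the size of the function nearby, and the quotients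
   approach ['d u z k] uniformly in [z], at the rate of their steps. *)
have Acauchy (h : V) n m : rn (A n h - A m h) <= K2 h * (2^-1 ^+ n + 2^-1 ^+ m).
  have dB : hb (qt u k (s0 n) - qt u k (s0 m)) v (r / 2).
    by move=> w wr; apply: differentiableB; apply: qdiff wr.
  have B : forall z, rn (z - v) < r / 2 -> rn ((qt u k (s0 n) - qt u k (s0 m)) z) <= K1 * c * (2^-1 ^+ n + 2^-1 ^+ m).
    move=> z zr; rewrite !fctE.
    apply: le_trans (rn_tri ('d u z k) _ _) _; rewrite mulrDr; apply: lerD.
      by rewrite -mulrA -s0n; apply: qP => //; exact: ltW.
    by rewrite -mulrA -s0n rnBC; apply: qP => //; exact: ltW.
  have := diff_bound h r2 dB B vv.
  rewrite diffB// => D; apply: le_trans (D) _.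
  by apply: eqle; rewrite /K2 /K2c; field; rewrite gt_eqF.
have lim_ex (h : V) : exists l, forall n, rn (A n h - l) <= 2 * K2 h * 2^-1 ^+ n.
  by apply: complete_seq => n m; exact: Acauchy.
pose L (h : V) : C := projT1 (cid (lim_ex h)).
have LP h n : rn (A n h - L h) <= 2 * K2 h * 2^-1 ^+ n.
  by rewrite /L; case: cid => l /= H; exact: H.
have small := @small_le0 R.
have K20 h : 0 <= K2 h by exact: mulr_ge0 K2c0 (rn_ge0 h).
have Llin : linear L.
  move=> a h1 h2; apply/eqP; rewrite -subr_eq0; apply/eqP/rn_le0.
  apply: (small _ (2 * K2 (a *: h1 + h2) + (rn a * (2 * K2 h1) + 2 * K2 h2))).
    have n2 : 0 <= 2 :> R by exact: ler0n.
    have H g : 0 <= 2 * K2 g by exact: mulr_ge0.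
    by apply: addr_ge0 (H _) _; apply: addr_ge0 (H _); apply: mulr_ge0 (rn_ge0 a) (H _).
  move=> n; have AE : A n (a *: h1 + h2) = a * A n h1 + A n h2 by exact: linearP.
  have LE : L (a *: h1 + h2) - (a *: L h1 + L h2) =
     (a * (A n h1 - L h1) + (A n h2 - L h2)) - (A n (a *: h1 + h2) - L (a *: h1 + h2)).
    by rewrite AE /GRing.scale/=; ring.
  rewrite LE; apply: le_trans (rnB _ _) _.
  have t1 := rnD (a * (A n h1 - L h1)) (A n h2 - L h2).
  have t2 := ler_wpM2l (rn_ge0 a) (LP h1 n); have t3 := LP h2 n; have t4 := LP (a *: h1 + h2) n.
  move: t1 t2 t3 t4; rewrite rnM; clear; lra.
pose LL : {linear V -> C} := HB.pack L (GRing.isLinear.Build C V C _ L Llin).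
pose M' := 12 * M / r * rn k.
have qM n w : rn (w - v) < r / 2 -> rn (qt u k (s0 n) w) <= M'.
  move=> wr; rewrite /qt rnM rnV ler_pdivrMr ?rn_gt0//.
  apply: le_trans (holo_lipschitz r0 du uM (ltW wr) (sk _ (s0c n))) _.
  by rewrite rnZ; apply: eqle; rewrite /M'; ring.
have M'0 : 0 <= M' by rewrite mulr_ge0 ?rn_ge0// divr_ge0 ?mulr_ge0 ?(ltW r0).
pose K3 := 12 * M' / (r / 2) + 2 * (24 / r * K1 * c).
have LLb (h : V) : rn (L h) <= K3 * rn h.
  rewrite -(subrK (A 0%N h) (L h)) addrC; apply: le_trans (rnD _ _) _.
  rewrite /K3 mulrDl; apply: lerD.
    exact: diff_bound r2 (qdiff _ (s00 _) (s0c _)) (qM 0%N) vv.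
  rewrite rnBC; apply: le_trans (LP h 0%N) _.
  by rewrite expr0 mulr1 /K2 /K2c; apply: eqle; ring.
have K30 : 0 <= K3.
  apply: addr_ge0; last by apply: mulr_ge0; [exact: ler0n|exact: K2c0].
  by apply: divr_ge0; [apply: mulr_ge0 => //; exact: ler0n|exact: ltW].
have LLc : continuous LL.
  move=> x; apply/contP => e e0; exists (e / (1 + K3)); first by rewrite divr_gt0// ltr_pwDl.
  move=> y; rewrite ltr_pdivlMr ?ltr_pwDl// => yx.
  rewrite -[LL y - LL x]/(L y - L x).
  have -> : L y - L x = L (y - x) by exact/esym/(linearB LL).
  apply: le_lt_trans (LLb _) _; apply: le_lt_trans yx.
  by rewrite mulrC ler_wpM2l ?rn_ge0// lerDr.
pose K4 := 576 * M' / (r / 2) ^+ 2.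
have K40 : 0 <= K4 by rewrite /K4 Kge0.
(* The second order remainders of the quotients are bounded independently of [n], so the estimate
   survives the limit. *)
have est (h : V) : rn h <= r / 24 -> rn ('d u (v + h) k - 'd u v k - L h) <= K4 * rn h ^+ 2.
  move=> hr; rewrite -subr_le0; apply: (small _ (2 * (K1 * c) + 2 * K2 h)).
    have n2 : 0 <= 2 :> R by exact: ler0n.
    by apply: addr_ge0 (mulr_ge0 n2 (K20 h)); apply: mulr_ge0 n2 _; exact: mulr_ge0 K10 (ltW c0).
  move=> n; rewrite lerBlDr.
  have vh : rn (v + h - v) <= r / 2 by rewrite addrC addKr; lra.
  have vv' : rn (v - v) <= r / 2 by rewrite subrr rn0 ltW.
  have h1' := qP _ _ (s00 n) (s0c n) vh.
  have h2' := qP _ _ (s00 n) (s0c n) vv'.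
  have h3' := taylor2V r2 (qdiff _ (s00 n) (s0c n)) (qM n) vv (_ : rn h <= r / 2 / 12).
  have h4' := LP h n.
  have -> : 'd u (v + h) k - 'd u v k - L h =
    (qt u k (s0 n) (v + h) - qt u k (s0 n) v - A n h) + (A n h - L h)
    + (qt u k (s0 n) v - 'd u v k) - (qt u k (s0 n) (v + h) - 'd u (v + h) k) :> C by ring.
  apply: le_trans (rnB _ _) _; apply: le_trans (lerD (rnD _ _) h1') _.
  apply: le_trans (lerD (lerD (rnD _ _) h2') (lexx _)) _.
  apply: le_trans (lerD (lerD (lerD (h3' _) h4') (lexx _)) (lexx _)) _; first by lra.
  by rewrite s0n -/K4; apply: eqle; ring.
have [|dP dPE] := @eps_diff _ _ _ (fun w => 'd u w k : C) LL v LLc; last first.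
  split=> //; exists s0, c; split=> // h; exists (2 * K2 h).
    by apply: mulr_ge0; [exact: ler0n|exact: K20].
  move=> n; have LE : 'd (fun w => 'd u w k : C) v h = L h by rewrite dPE.
  apply: le_trans (LP h n); apply: eqle; congr (rn (_ - _)); last exact: LE.
  apply: esym.
  have dus : differentiable u (v + s0 n *: k).
    by apply: du; rewrite addrC addKr; have := sk _ (s0c n); lra.
  have duv : differentiable u v by apply: du; rewrite subrr rn0.
  have c1 := line_cder h (dA n).
  have c2 := cderBM (s0 n)^-1 (line_cder h dus) (line_cder h duv).
  apply: (cder_uniq c1 c2); apply/funext => t; rewrite /qt; congr ((u _ - _) / _).
  by rewrite -!addrA (addrC (t *: h)).
move=> e e0; exists (Num.min (r / 24) (e / (1 + K4))); first by rewrite lt_min !divr_gt0// ltr_pwDl.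
move=> h; rewrite lt_min => /andP[/ltW h1 h2].
apply: le_trans (est h h1) _; rewrite expr2 mulrA ler_wpM2r ?rn_ge0//.
move: h2; rewrite ltr_pdivlMr ?ltr_pwDl// => /ltW h2; apply: le_trans h2.
by rewrite mulrC ler_wpM2l ?rn_ge0// lerDr.
Qed.

Lemma diff_differentiable (u : V -> C) (v k : V) :
  (\forall w \near v, differentiable u w) ->
  \forall w \near v, differentiable (fun w => 'd u w k : C) w.
Proof.
move=> /nearP[r r0 rH]; apply/nearP; exists r => // w wr.
apply: (diff_differentiable_aux _ _).1; apply/nearP; exists (r - rn (w - v)); first by rewrite subr_gt0.
move=> y yw; apply: rH; apply: le_lt_trans (rn_tri w _ _) _.
by rewrite -ltrBrDr.
Qed.

(** The quotients [('d u (v + s *: k) h - 'd u v h) / s] tend to both sides: to the left one by the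
    second part of [diff_differentiable_aux], to the right one by differentiability of ['d u w h] in
    [w] along [k]. *)
Lemma diff_sym (u : V -> C) (v h k : V) :
  (\forall w \near v, differentiable u w) ->
  'd (fun w => 'd u w k : C) v h = 'd (fun w => 'd u w h : C) v k.
Proof.
move=> nu; have [dk [s0 [c [c0 s0E H]]]] := diff_differentiable_aux k nu.
have [dh _] := diff_differentiable_aux h nu.
have [K K0 KH] := H h.
apply/eqP; rewrite -subr_eq0; apply/eqP/rn_le0/ler_addgt0Pr => e e0; rewrite add0r.
have [d d0 dE] := line_cder k dh (divr_gt0 e0 (ltr0n _ 2)).
have h01 : 0 <= (2^-1 : R) < 1 by rewrite invr_ge0 ler0n invf_lt1 ?ltr1n.
have [n nE] : exists n, (2^-1 : R) ^+ n < Num.min (d / c) (e / 2 / (1 + K)).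
  by apply: (pow_small h01); rewrite lt_min !divr_gt0// ltr_pwDl.
move: nE; rewrite lt_min ltr_pdivlMr// ltr_pdivlMr ?ltr_pwDl// => /andP[n1 n2].
have sd : rn (s0 n) < d by rewrite s0E mulrC.
have p0 : 0 < (2^-1 : R) ^+ n by rewrite exprn_gt0 ?invr_gt0.
have sn0 : s0 n != 0 by rewrite -rn_gt0 s0E mulr_gt0.
have := dE _ sd; rewrite add0r scale0r addr0 => D; have D2 := KH n.
rewrite rnBC; apply: le_trans (rn_tri (('d u (v + s0 n *: k) h - 'd u v h) / s0 n) _ _) _.
rewrite (splitr e); apply: lerD.
  rewrite rnBC (_ : _ - _ = ('d u (v + s0 n *: k) h - 'd u v h - s0 n * 'd (fun w => 'd u w h : C) v k) / s0 n); last by field.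
  by rewrite rnM rnV ler_pdivrMr ?rn_gt0.
apply: le_trans D2 _; apply: ltW; apply: le_lt_trans n2.
by rewrite mulrC ler_wpM2l ?(ltW p0)// lerDr.
Qed.

(** The segment is cut into [n.+1] pieces, on each of which Taylor's formula has an error of order
    [1 / n.+1 ^ 2]; the total error [K / n.+1] disappears in the limit. *)
Lemma mean_value (u : V -> C) (v h : V) (r M L : R) : 0 < r -> hb u v r ->
  (forall z, rn (z - v) < r -> rn (u z) <= M) -> rn h <= r / 12 ->
  (forall t : R, 0 <= t <= 1 -> rn ('d u (v + t%:C%C *: h) h) <= L) ->
  rn (u (v + h) - u v) <= L.
Proof.
move=> r0 du uM hr dL.
have M0 : 0 <= M by apply: le_trans (rn_ge0 _) (uM v _); rewrite subrr rn0.
pose K := 576 * M / r ^+ 2 * rn h ^+ 2.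
have K0 : 0 <= K by rewrite /K mulr_ge0 ?exprn_ge0 ?rn_ge0 ?Kge0.
have main n : rn (u (v + h) - u v) <= L + K / n.+1%:R.
  pose N : R := n.+1%:R; have N0 : 0 < N by rewrite ltr0n.
  pose x (i : nat) : V := v + (i%:R / N)%:C%C *: h.
  have step i : (i <= n)%N -> rn (u (x i.+1) - u (x i)) <= L / N + K / N ^+ 2.
    move=> ni.
    have i01 : 0 <= (i%:R / N : R) <= 1.
      by rewrite divr_ge0 ?ler0n ?(ltW N0)//= ler_pdivrMr// mul1r ler_nat ltnW.
    have xE : x i.+1 = x i + (N^-1)%:C%C *: h.
      by rewrite /x -addrA -scalerDl -rmorphD/= -natr1 mulrDl mul1r.
    have xr : rn (x i - v) <= r / 2.
      rewrite /x addrC addKr rnZ rnR ger0_norm; last by case/andP: i01.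
      apply: (@le_trans _ _ (rn h)); last by lra.
      by rewrite ler_piMl ?rn_ge0//; case/andP: i01.
    have N1 : N^-1 <= 1 by rewrite invf_le1// ler1n.
    have hr' : rn ((N^-1)%:C%C *: h) <= r / 12.
      rewrite rnZ rnR gtr0_norm ?invr_gt0//; apply: le_trans hr.
      by rewrite ler_piMl ?rn_ge0.
    have := taylor2V r0 du uM xr hr'; rewrite -xE linearZ rnZ rnR gtr0_norm ?invr_gt0// => T.
    rewrite -(subrK ((N^-1)%:C%C *: 'd u (x i) h) (u (x i.+1) - u (x i))) addrC.
    apply: le_trans (rnD _ _) _; apply: lerD.
      rewrite rnZ rnR gtr0_norm ?invr_gt0// mulrC ler_wpM2r ?invr_ge0 ?(ltW N0)//.
      exact: dL.
    apply: le_trans T _; apply: eqle; rewrite /K exprMn exprVn; ring.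
  have tel i : (i <= n.+1)%N -> rn (u (x i) - u (x 0%N)) <= i%:R * (L / N + K / N ^+ 2).
    elim: i => [|i IH] ni; first by rewrite subrr rn0 mul0r.
    apply: le_trans (rn_tri (u (x i)) _ _) _; rewrite -natr1 mulrDl mul1r addrC.
    by apply: lerD; [apply: IH; exact: ltnW|exact: step].
  have := tel n.+1 (leqnn _); rewrite -/N /x divff ?gt_eqF// scale1r mul0r scale0r addr0.
  by move=> T; apply: le_trans T _; apply: eqle; field; rewrite gt_eqF.
apply/ler_addgt0Pr => e e0.
have [n nE] : exists n, K / e < n.+1%:R.
  by exists (Num.truncn (K / e)); exact: truncnS_gt.
apply: le_trans (main n) _; rewrite lerD2l.
rewrite ler_pdivrMr ?ltr0n//; move: nE; rewrite ltr_pdivrMr// => /ltW.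
by rewrite mulrC.
Qed.

End Derivatives.

Section StrictDifferentiability.
Variable R : realType.
Local Notation C := (cplx R).
Variable V : normedModType C.

Lemma diff_lipschitz (u : V -> C) (v x h : V) (r M : R) : 0 < r -> hb u v r ->
  (forall z, rn (z - v) < r -> rn (u z) <= M) -> rn (x - v) <= r / 12 ->
  rn ('d u x h - 'd u v h) <= 288 * M / r ^+ 2 * rn (x - v) * rn h.
Proof.
move=> r0 du uM xr.
have r2 : 0 < r / 2 by rewrite divr_gt0.
pose D y := u (y + (x - v)) - u y.
have dx : hb (fun y => u (y + (x - v))) v (r / 2).
  move=> w wr; apply: (@differentiable_comp _ _ _ _ (fun w => w + (x - v)) u).
    by apply: differentiableD => //; exact: differentiable_cst.
  by apply: du; rewrite addrAC; apply: le_lt_trans (rnD _ _) _; lra.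
have duw : hb u v (r / 2) by move=> w wr; apply: du; lra.
have dD : hb D v (r / 2) by move=> w wr; apply: differentiableB; [exact: dx|exact: duw].
have DM z : rn (z - v) < r / 2 -> rn (D z) <= 12 * M / r * rn (x - v).
  by move=> zr; apply: holo_lipschitz r0 du uM (ltW zr) xr.
have vv : rn (v - v) <= r / 2 / 2 by rewrite subrr rn0 !divr_ge0 ?(ltW r0).
have vr : rn (v - v) < r / 2 by rewrite subrr rn0.
have xr' : differentiable u x by apply: du; apply: le_lt_trans xr _; lra.
have -> : 'd u x h - 'd u v h = 'd D v h.
  have E : (fun s : C => u (x + s *: h)) = (fun s : C => u (v + s *: h + (x - v))).
    by apply/funext => s; congr u; rewrite addrAC addrBK'.
  have c1 := line_cder h (dD v vr).
  have c2 := cderBM 1 (line_cder h xr') (line_cder h (duw v vr)).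
  rewrite -[LHS]mulr1; apply: (cder_uniq c2 c1); apply/funext => s.
  by rewrite mulr1 /D -(congr1 (fun f => f s) E).
apply: le_trans (diff_bound h r2 dD DM vv) _.
by apply: eqle; field; rewrite gt_eqF.
Qed.

Lemma lin_line (L : {linear V -> C}) (x h : V) : cder (fun s : C => L (x + s *: h)) 0 (L h).
Proof.
move=> e e0; exists 1 => // s _; rewrite add0r scale0r addr0 linearD linearZ /=.
by rewrite [X in X - _]addrAC subrr add0r subrr rn0 mulr_ge0 ?rn_ge0 ?(ltW e0).
Qed.

(** The mean value inequality for [u - 'd u v], whose differential is small near [v]. Uniformity in
    both points is what yields injectivity, in [local_inverse] and for the fixed points of a
    retraction. *)
Lemma strict_diff (u : V -> C) (v : V) (e : R) : 0 < e ->
  (\forall w \near v, differentiable u w) ->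
  exists2 r, 0 < r & forall z w, rn (z - v) < r -> rn (w - v) < r ->
    rn (u z - u w - 'd u v (z - w)) <= e * rn (z - w).
Proof.
move=> e0 /hb_data[M [r r0 [du uM]]].
have M0 : 0 <= M by apply: le_trans (rn_ge0 _) (uM v _); rewrite subrr rn0.
pose K := 288 * M / r ^+ 2.
have K0 : 0 <= K by rewrite /K Kge0.
pose s := Num.min (r / 48) (e / (1 + K)).
have s0 : 0 < s by rewrite lt_min !divr_gt0// ltr_pwDl.
have sr : s <= r / 48 by rewrite ge_min lexx.
have se : s * K <= e.
  have : s <= e / (1 + K) by rewrite ge_min lexx orbT.
  rewrite ler_pdivlMr ?ltr_pwDl// => h; apply: le_trans h.
  by rewrite ler_wpM2l ?(ltW s0)// lerDr.
exists s => // z w zs ws.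
have vr : rn (v - v) < r by rewrite subrr rn0.
have duv := du v vr.
pose G x := u x - 'd u v x.
have dG x : rn (x - v) < r -> differentiable G x.
  move=> xr; apply: differentiableB; first exact: du.
  by apply: linear_differentiable; exact: diff_continuous.
have wG : hb G w (r / 2) by apply: hbW (dG) => //; lra.
have zw : rn (z - w) <= r / 24 by apply: le_trans (rn_tri v _ _) _; rewrite (rnBC v); lra.
have GM x : rn (x - w) < r / 2 -> rn (G x) <= M + 12 * M / r * (rn v + r).
  move=> xr; have xv : rn (x - v) < r by apply: le_lt_trans (rn_tri w _ _) _; lra.
  apply: le_trans (rnB _ _) _; apply: lerD; first exact: uM.
  have vv : rn (v - v) <= r / 2 by rewrite subrr rn0 ltW// divr_gt0.
  apply: le_trans (diff_bound x r0 du uM vv) _.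
  apply: ler_wpM2l.
    by apply: divr_ge0; [apply: mulr_ge0 => //; exact: ler0n|exact: ltW].
  by rewrite -(subrK v x) addrC; apply: le_trans (rnD _ _) _; rewrite lerD2l ltW.
have r2 : 0 < r / 2 by rewrite divr_gt0.
have h12 : rn (z - w) <= r / 2 / 12 by lra.
have dGE x h : rn (x - v) < r -> 'd G x h = 'd u x h - 'd u v h.
  move=> xr; have c1 := line_cder h (dG x xr).
  have c2 := cderBM 1 (line_cder h (du x xr)) (lin_line ('d u v) x h).
  rewrite -[RHS]mulr1; apply: (cder_uniq c1 c2); apply/funext => t.
  by rewrite mulr1.
have := mean_value r2 wG GM h12 (L := e * rn (z - w)).
rewrite addrBK' => H.
have -> : u z - u w - 'd u v (z - w) = G z - G w by rewrite /G linearB; ring.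
apply: H => t /andP[t0 t1].
set x := w + _.
have xv : rn (x - v) <= s.
  have -> : x - v = (1 - t)%:C%C *: (w - v) + t%:C%C *: (z - v).
    rewrite /x rmorphB/= scalerBl scale1r -(addrA (w - v)) -scalerN -scalerDr.
    by rewrite addrAC opprB [in RHS](addrC (v - w)) addrA subrK.
  apply: le_trans (rnD _ _) _; rewrite !rnZ !rnR !ger0_norm ?subr_ge0//.
  have h1 : (1 - t) * rn (w - v) <= (1 - t) * s by rewrite ler_wpM2l ?subr_ge0// ltW.
  have h2 : t * rn (z - v) <= t * s by rewrite ler_wpM2l// ltW.
  by clear -h1 h2; lra.
rewrite dGE; last by apply: le_lt_trans xv _; lra.
apply: le_trans (diff_lipschitz (z - w) r0 du uM _) _; first by lra.
rewrite ler_wpM2r ?rn_ge0//; apply: le_trans se; rewrite -/K mulrC.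
by rewrite ler_wpM2r.
Qed.

Lemma zero_diff_const (u : V -> C) (v : V) (r : R) : 0 < r -> hb u v r ->
  (forall w h, rn (w - v) < r -> 'd u w h = 0) ->
  \forall w \near v, u w = u v.
Proof.
move=> r0 du d0.
have [|M [s s0 [ds sM]]] := @hb_data _ _ u v; first by apply/near_hb; exists r.
apply/nearP; exists (Num.min (s / 12) (r / 2)); first by rewrite lt_min !divr_gt0.
move=> w; rewrite lt_min => /andP[/ltW w1 w2].
have := mean_value s0 ds sM w1 (L := 0); rewrite addrBK' => H.
apply/eqP; rewrite -subr_eq0; apply/eqP/rn_le0/H => t /andP[t0 t1].
rewrite d0 ?rn0// addrC addKr rnZ rnR ger0_norm//.
apply: (@le_lt_trans _ _ (rn (w - v))); last by lra.
by rewrite ler_piMl ?rn_ge0.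
Qed.

End StrictDifferentiability.

(** * Zeros, open mapping and local inverses *)

Section Factorization.
Variable R : realType.
Local Notation C := (cplx R).

Lemma d1E (f : C -> C) (w h : C) : differentiable f w -> 'd f w h = h * derive1 f w.
Proof. by move=> df; rewrite diff1E. Qed.

Lemma diff_cder (f : C -> C) (z : C) : differentiable f z -> cder f z (derive1 f z).
Proof. by move=> df; apply/cderP; split. Qed.

Lemma cder_near (f g : C -> C) (z d : C) :
  (exists2 r : R, 0 < r & forall w, rn (w - z) < r -> f w = g w) ->
  cder f z d -> cder g z d.
Proof.
move=> [r r0 fg] fd e e0; have [s s0 sH] := fd e e0.
exists (Num.min r s); first by rewrite lt_min r0.
move=> h; rewrite lt_min => /andP[hr hs].
have E1 := fg z; have E2 := fg (z + h).
rewrite -E1 ?subrr ?rn0// -E2; first exact: sH.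
by rewrite addrC addKr.
Qed.

Lemma cder_quad (p w a b c : C) :
  cder (fun z => a + (z - p) * b + (z - p) ^+ 2 * c) w (b + (w - p) * c *+ 2).
Proof.
move=> e e0; have c1 : 0 < 1 + rn c by rewrite ltr_pwDl// rn_ge0.
exists (e / (1 + rn c)); first by rewrite divr_gt0.
move=> h; rewrite ltr_pdivlMr// => hr.
rewrite (_ : _ - _ - _ = h * (h * c)); last by ring.
rewrite rnM mulrC ler_wpM2r ?rn_ge0// rnM; apply: le_trans (ltW hr).
by rewrite ler_wpM2l ?rn_ge0// lerDr.
Qed.

(** At [p]: the function minus its second Taylor polynomial is [G], with G' = o(z - p), hence G =
    o((z - p)^2) by the mean value inequality. So the quotient has there the derivative [m / 2],
    half the second derivative. *)
Lemma dq_hb (f : C -> C) (p : C) (r : R) : 0 < r -> hb f p r -> hb (dq f p (derive1 f p)) p r.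
Proof.
move=> r0 df z zr; have [->|zp] := eqVneq z p; last by apply: dq_diff => //; exact: df.
have dp : cder f p (derive1 f p) := hb_cder r0 df; set d := derive1 f p in dp *.
have ndf : \forall w \near p, differentiable f w by apply/near_hb; exists r.
have [dP _] := diff_differentiable_aux (1 : C) ndf.
have [m mE] : exists m, cder (fun w => derive1 f w) p m.
  exists (derive1 (fun w => 'd f w 1) p).
  apply: (@cder_near (fun w => 'd f w 1 : C)); last exact: diff_cder dP.
  exists r => // w wr.
  have dw := df w wr.
  by have := d1E 1 dw; rewrite mul1r.
have two0 : (2 : C) != 0 by rewrite pnatr_eq0.
pose q z := f p + (z - p) * d + (z - p) ^+ 2 * (m / 2).
pose G z := (f z - q z) * 1.
have GE w : rn (w - p) < r -> cder G w ((derive1 f w - (d + (w - p) * m)) * 1).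
  move=> wr; apply: cderBM.
    exact: diff_cder (df _ wr).
  rewrite (_ : d + (w - p) * m = d + (w - p) * (m / 2) *+ 2); last by field.
  exact: cder_quad.
have hG : hb G p r by move=> w /GE /cderP[].
suff /cderP[] : cder (dq f p d) p (m / 2) by [].
move=> e e0; have [s s0 sH] := mE e e0.
have [|M [t t0 [Gt GM]]] := @hb_data _ _ G p; first by apply/near_hb; exists r.
exists (Num.min (Num.min r s) (t / 12)); first by rewrite !lt_min r0 s0 divr_gt0.
move=> h; rewrite !lt_min => /andP[/andP[h1 h2] h3].
have [->|h0] := eqVneq h 0; first by rewrite addr0 subrr mul0r subr0 rn0 mulr0.
rewrite /dq (_ : p + h == p = false) ?eqxx; last by rewrite -subr_eq0 addrC addKr (negPf h0).
rewrite (_ : _ - _ - _ = G (p + h) / h); last first.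
  by rewrite /G /q (addrC p h) addrK; field; rewrite ?h0 ?two0.
rewrite rnM rnV ler_pdivrMr ?rn_gt0//.
have Gp : G p = 0 by rewrite /G /q subrr expr0n /= !mul0r !addr0 subrr mul0r.
rewrite -(subr0 (G (p + h))) -Gp.
apply: (mean_value t0 Gt GM (ltW h3)) => x /andP[x0 x1].
have xh : rn (x%:C%C * h : C) <= rn h by rewrite rnM rnR ger0_norm// ler_piMl ?rn_ge0.
have xr : rn (p + x%:C%C *: h - p) < r by rewrite addrC addKr; apply: le_lt_trans xh h1.
have dG := (cderP _ _ _).1 (GE _ xr).
rewrite d1E; last exact: dG.1.
rewrite dG.2 mulr1 rnM mulrC.
have xs : rn (x%:C%C * h : C) < s by apply: le_lt_trans xh h2.
have := sH _ xs; rewrite -/d => B.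
have -> : p + x%:C%C *: h - p = x%:C%C * h :> C by rewrite addrC addKr.
rewrite opprD addrA ler_wpM2r ?rn_ge0//; apply: le_trans B _.
by rewrite ler_wpM2l ?(ltW e0).
Qed.

Lemma dqE0 (f : C -> C) (p z : C) (r : R) : 0 < r -> hb f p r -> f p = 0 ->
  exists2 g, hb g p r & forall z, f z = (z - p) * g z.
Proof.
move=> r0 df f0; exists (dq f p (derive1 f p)); first exact: dq_hb.
by move=> w; rewrite {1}(dqE f p (derive1 f p) w) f0 add0r.
Qed.

(** If every power of z - p divides [f], the maximum principle bounds the cofactors by [M / t ^+ n],
    so that [f] is at most [M / 2 ^+ n] within [t / 2] of [p] and vanishes there. Otherwise the
    largest power that divides leaves a nonzero value. *)
Lemma zero_order (f : C -> C) (p : C) (r : R) : 0 < r -> hb f p r ->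
  (\forall z \near p, f z = 0) \/
  exists n g, [/\ hb g p r, g p != 0 & forall z, f z = (z - p) ^+ n * g z].
Proof.
move=> r0 df.
pose Q n := exists2 g, hb g p r & forall z, f z = (z - p) ^+ n * g z.
have [allQ|] := pselect (forall n, Q n).
  left.
  have [|M [s s0 sM]] := @locally_bounded _ _ f p; first by apply: df; rewrite subrr rn0.
  pose t := Num.min r s / 3.
  have m0 : 0 < Num.min r s by rewrite lt_min r0.
  have t0 : 0 < t by rewrite divr_gt0.
  have M0 : 0 <= M by apply: le_trans (rn_ge0 _) (sM p _); rewrite subrr rn0.
  apply/nearP; exists (t / 2); first by rewrite divr_gt0.
  move=> z zt; apply: rn_le0; apply: (@small_le0 _ _ M) => // n.
  have [g dg fE] := allQ n.
  have gB : rn (g z) <= M / t ^+ n.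
    apply: (@max_modulus_ball _ g p (Num.min r s) t); [exact: t0|by clear -m0; rewrite /t; lra| | |].
    - by move=> w; rewrite lt_min => /andP[+ _]; exact: dg.
    - move=> w tw; rewrite lt_min => /andP[_ ws].
      have := sM w ws; rewrite fE rnM rnX ler_pdivlMr ?exprn_gt0// => h.
      apply: le_trans h; rewrite mulrC ler_wpM2r ?rn_ge0//.
      by rewrite lerXn2r ?nnegrE ?rn_ge0 ?(ltW t0).
    - by apply: ltW; apply: lt_le_trans zt _; lra.
  rewrite fE rnM rnX.
  have h1 : rn (z - p) ^+ n <= (t / 2) ^+ n.
    apply: lerXn2r (ltW zt); rewrite nnegrE; first exact: rn_ge0.
    by apply: divr_ge0; [exact: ltW|exact: ler0n].
  apply: le_trans (ler_pM _ _ h1 gB) _; rewrite ?exprn_ge0 ?rn_ge0//.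
  rewrite exprMn; apply: eqle; field; by rewrite expf_neq0// gt_eqF.
move=> /existsNP nQ; right.
have [n nQn nmin] : exists2 n, ~ Q n & forall m, (m < n)%N -> Q m.
  have [n0 n0Q] := nQ.
  have ex : exists n, `[< ~ Q n >] by exists n0; apply/asboolP.
  case: (ex_minnP ex) => n /asboolP nQn nmin; exists n => // m mn.
  by apply: contrapT => nQm; have := nmin m; rewrite leqNgt mn => /(_ (introT (asboolP _) nQm)).
case: n nQn nmin => [nQ0|n nQn nmin].
  by exfalso; apply: nQ0; exists f => // z; rewrite expr0 mul1r.
have [g dg fE] := nmin n (ltnSn n).
exists n, g; split=> //; apply/eqP => g0; apply: nQn.
have [h dh gE] := dqE0 p r0 dg g0.
by exists h => // z; rewrite fE gE exprSr mulrA.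
Qed.

Lemma near_lower (g : C -> C) (p : C) : {for p, continuous g} -> g p != 0 ->
  exists2 r, 0 < r & forall z, rn (z - p) < r -> rn (g p) / 2 <= rn (g z).
Proof.
move=> /contP gc g0; have g1 : 0 < rn (g p) / 2 by rewrite divr_gt0 ?rn_gt0.
have [r r0 rH] := gc _ g1; exists r => // z /rH h.
have := rnB (g z) (g z - g p); rewrite opprB addrC subrK => t.
by clear -t h; lra.
Qed.

Lemma zero_isolated (f : C -> C) (p : C) : (\forall z \near p, differentiable f z) ->
  (\forall z \near p, f z = 0) \/
  exists n (c r : R), [/\ 0 < c, 0 < r & forall z, rn (z - p) < r -> c * rn (z - p) ^+ n <= rn (f z)].
Proof.
move=> /near_hb[r r0 df]; have [?|[n [g [dg g0 fE]]]] := zero_order r0 df; first by left.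
have vr : rn (p - p) < r by rewrite subrr rn0.
right; have [s s0 sH] := near_lower (differentiable_continuous (dg p vr)) g0.
exists n, (rn (g p) / 2), s; split=> // [|z zs]; first by rewrite divr_gt0 ?rn_gt0.
by rewrite fE rnM rnX mulrC ler_wpM2l ?exprn_ge0 ?rn_ge0// sH.
Qed.

(** If [w] were omitted, 1 / (f - w) would break the maximum principle: f - w is at least
    [2 * eta / 3] on an annulus and less than [eta / 3] at [p]. *)
Lemma open_mapping (f : C -> C) (p : C) (rho : R) : (\forall z \near p, differentiable f z) ->
  ~ (\forall z \near p, f z = f p) -> 0 < rho ->
  exists2 d, 0 < d & forall w, rn (w - f p) < d -> exists2 z, rn (z - p) < rho & f z = w.
Proof.
move=> ndf nc rho0; have /near_hb[r r0 df] := ndf.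
have [||[n [c [s [c0 s0 sH]]]]] := @zero_isolated (fun z => f z - f p) p.
- by apply: filterS ndf => z dz; apply: differentiableB => //; exact: differentiable_cst.
- by move=> H; case: nc; apply: filterS H => z /eqP; rewrite subr_eq0 => /eqP.
pose m := Num.min (Num.min r s) rho; pose t := m / 3.
have m0 : 0 < m by rewrite !lt_min r0 s0.
have t0 : 0 < t by rewrite divr_gt0.
pose eta := c * t ^+ n; have eta0 : 0 < eta by rewrite mulr_gt0 ?exprn_gt0.
exists (eta / 3); first by rewrite divr_gt0.
move=> w wE; apply: contrapT => H.
have nz z : rn (z - p) < m -> f z - w != 0.
  move=> zm; apply/eqP => /eqP; rewrite subr_eq0 => /eqP E; apply: H; exists z => //.
  by apply: lt_le_trans zm _; rewrite ge_min lexx orbT.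
have : rn ((f p - w)^-1) <= (2 * eta / 3)^-1.
  apply: (@max_modulus_ball _ (fun z => (f z - w)^-1) p m t); [exact: t0|by clear -m0; rewrite /t; lra| | |].
  - move=> z zm; apply: differentiableV; last exact: nz.
    apply: differentiableB; last exact: differentiable_cst.
    by apply: df; apply: lt_le_trans zm _; rewrite !ge_min lexx.
  - move=> z tz zm; rewrite rnV lef_pV2 ?posrE; last first.
    + by clear -eta0; lra.
    + by rewrite rn_gt0 nz.
    have zs : rn (z - p) < s by apply: lt_le_trans zm _; rewrite !ge_min lexx orbT.
    have h1 := sH z zs.
    have h2 : eta <= c * rn (z - p) ^+ n.
      by rewrite /eta ler_wpM2l ?(ltW c0)// lerXn2r ?nnegrE ?rn_ge0 ?(ltW t0).
    have h3 := rn_tri w (f z) (f p).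
    by clear -h1 h2 h3 wE; lra.
  - by rewrite subrr rn0 ltW.
rewrite rnV lef_pV2 ?posrE; last first.
- by clear -eta0; lra.
- by rewrite rn_gt0 nz// subrr rn0.
by rewrite rnBC => h; clear -h wE eta0; lra.
Qed.

(** A nonconstant function would take nearby the value f(p) (1 + t), of larger modulus. *)
Lemma strong_maximum (f : C -> C) (p : C) : (\forall z \near p, differentiable f z) ->
  (\forall z \near p, rn (f z) <= rn (f p)) -> \forall z \near p, f z = f p.
Proof.
move=> ndf fM; apply: contrapT => nc; have /nearP[rho rho0 rH] := fM.
have [d d0 dH] := open_mapping ndf nc rho0.
have [f0|f0] := eqVneq (f p) 0.
  apply: nc; apply: filterS fM => z; rewrite f0 rn0.
  exact: rn_le0.
pose t : R := d / 2 / (1 + rn (f p)).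
have t0 : 0 < t by rewrite !divr_gt0// ltr_pwDl// rn_ge0.
have [|z zr fz] := dH (f p * (1 + t)%:C%C).
  rewrite rmorphD/= mulrDr mulr1 addrC addKr rnM rnR gtr0_norm// /t.
  rewrite mulrA ltr_pdivrMr ?ltr_pwDl ?rn_ge0//.
  have := rn_ge0 (f p); clear -d0; nra.
have := rH z zr; rewrite fz rnM rnR ger0_norm; last by rewrite addr_ge0// ltW.
by apply/negP; rewrite -ltNge ltr_pMr ?rn_gt0// ltrDl.
Qed.

(** Injectivity comes from strict differentiability, surjectivity onto a disc from the open mapping
    theorem. The lower bound [a] on the difference quotients makes [g] Lipschitz, so that the
    expansion of [f] at [g w] can be read as one of [g] at [w]. *)
Lemma local_inverse (f : C -> C) (p : C) : (\forall z \near p, differentiable f z) ->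
  derive1 f p != 0 ->
  exists (rho d : R) (g : C -> C), [/\ 0 < rho, 0 < d,
    forall w, rn (w - f p) < d -> [/\ rn (g w - p) < rho, f (g w) = w & differentiable g w] &
    forall z z', rn (z - p) < rho -> rn (z' - p) < rho -> f z = f z' -> z = z'].
Proof.
move=> ndf f'0.
have [r r0 df] := (near_hb _ _).1 ndf.
have e0 : 0 < rn (derive1 f p) / 2 by rewrite divr_gt0 ?rn_gt0.
have [s s0 sH] := strict_diff e0 ndf.
pose rho := Num.min r s; have rho0 : 0 < rho by rewrite lt_min r0.
have dp : differentiable f p by apply: df; rewrite subrr rn0.
have lower z w : rn (z - p) < rho -> rn (w - p) < rho ->
    rn (derive1 f p) / 2 * rn (z - w) <= rn (f z - f w).
  rewrite !lt_min => /andP[_ zs] /andP[_ ws].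
  have := sH z w zs ws; rewrite d1E// => B.
  have := rnB (f z - f w) (f z - f w - (z - w) * derive1 f p).
  rewrite opprB addrC subrK rnM => B'; clear -B B'; lra.
have inj z z' : rn (z - p) < rho -> rn (z' - p) < rho -> f z = f z' -> z = z'.
  move=> h1 h2 E; apply/eqP; rewrite -subr_eq0; apply/eqP/rn_le0.
  by have := lower z z' h1 h2; rewrite E subrr rn0 pmulr_rle0.
have nc : ~ (\forall z \near p, f z = f p).
  move=> /nearP[t t0 tH].
  have m0 : 0 < Num.min t rho by rewrite lt_min t0.
  have zE : rn (p + (Num.min t rho / 2)%:C%C - p) = Num.min t rho / 2.
    by rewrite (addrC p) addrK rnR gtr0_norm// divr_gt0.
  have z1 : rn (p + (Num.min t rho / 2)%:C%C - p) < Num.min t rho by rewrite zE; lra.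
  move: z1; rewrite lt_min => /andP[z1 z2].
  have := inj _ p z2 _ (tH _ z1); rewrite subrr rn0 => /(_ rho0) E.
  by move: zE; rewrite E subrr rn0; lra.
have [d d0 dH] := open_mapping ndf nc rho0.
have gex w : exists z, rn (w - f p) < d -> rn (z - p) < rho /\ f z = w.
  have [/dH[z z1 z2]|nw] := pselect (rn (w - f p) < d); first by exists z.
  by exists p.
pose g w := projT1 (cid (gex w)).
have gP w : rn (w - f p) < d -> rn (g w - p) < rho /\ f (g w) = w.
  by rewrite /g; case: cid.
exists rho, d, g; split; [exact: rho0|exact: d0| |exact: inj].
move=> w wd; have [g1 g2] := gP w wd; split; [exact: g1|exact: g2|].
have gr : rn (g w - p) < r by move: g1; rewrite lt_min => /andP[].
have dgw := df _ gr.
set a := rn (derive1 f p) / 2 in e0 lower.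
have cf : cder f (g w) (derive1 f (g w)) by exact: diff_cder dgw.
have lo : a <= rn (derive1 f (g w)).
  apply/ler_addgt0Pr => e ee; have [t t0 tH] := cf _ ee.
  pose m := Num.min t (rho - rn (g w - p)).
  have m0 : 0 < m by rewrite lt_min t0 subr_gt0.
  pose h : C := (m / 2)%:C%C.
  have rh : rn h = m / 2 by rewrite /h rnR gtr0_norm// divr_gt0.
  have rh0 : 0 < rn h by rewrite rh divr_gt0.
  have : rn h < m by rewrite rh; clear -m0; lra.
  rewrite lt_min => /andP[ht hr]; have h1 := tH h ht.
  have h2 : a * rn h <= rn (f (g w + h) - f (g w)).
    have := lower (g w + h) (g w); rewrite (_ : g w + h - g w = h); last by rewrite addrC addKr.
    apply=> //.
    by rewrite addrAC; apply: le_lt_trans (rnD _ _) _; rewrite -ltrBrDl.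
  rewrite -(ler_pM2r rh0) mulrDl; apply: le_trans h2 _.
  rewrite -[X in rn X](subrK (h * derive1 f (g w))); apply: le_trans (rnD _ _) _.
  by rewrite addrC rnM (mulrC (rn h)) lerD2l.
have f'g : derive1 f (g w) != 0 by rewrite -rn_gt0; apply: lt_le_trans e0 lo.
have f'g0 : 0 < rn (derive1 f (g w)) by rewrite rn_gt0.
suff /cderP[] : cder g w (derive1 f (g w))^-1 by [].
move=> e ee; have e1 : 0 < e * a * rn (derive1 f (g w)) by exact: mulr_gt0 (mulr_gt0 ee e0) f'g0.
have [t t0 tH] := cf _ e1.
exists (Num.min (a * t) (d - rn (w - f p))); first by rewrite lt_min subr_gt0 wd andbT; exact: mulr_gt0 e0 t0.
move=> h; rewrite lt_min => /andP[h1 h2].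
have whd : rn (w + h - f p) < d.
  by rewrite addrAC; apply: le_lt_trans (rnD _ _) _; rewrite -ltrBrDl.
have [k1 k2] := gP _ whd.
pose eta := g (w + h) - g w.
have etaE : g w + eta = g (w + h) by rewrite addrBK'.
have etah : a * rn eta <= rn h.
  have := lower (g (w + h)) (g w) k1 g1; rewrite k2 g2.
  by rewrite (_ : w + h - w = h)// addrC addKr.
have etat : rn eta < t by rewrite -(ltr_pM2l e0); apply: le_lt_trans etah h1.
have := tH _ etat; rewrite etaE k2 g2 (_ : w + h - w = h); last by rewrite addrC addKr.
move=> B.
rewrite -/eta (_ : eta - h / derive1 f (g w) = - (h - eta * derive1 f (g w)) / derive1 f (g w)); last by field.
rewrite rnM rnN rnV ler_pdivrMr//; apply: le_trans B _.
rewrite (_ : _ * rn eta = e * rn (derive1 f (g w)) * (a * rn eta)); last by ring.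
rewrite mulrAC ler_wpM2r//; first exact: ltW.
by rewrite ler_wpM2l// ltW.
Qed.

End Factorization.

(** * Holomorphic maps and 1-forms on manifolds *)

Section LocalConstancy.
Variable R : realType.

Lemma segment_lconst (T : Type) (h : R -> T) (a b : R) : a <= b ->
  (forall t, a <= t <= b -> exists2 d, 0 < d & forall s, a <= s <= b -> `|s - t| < d -> h s = h t) ->
  h a = h b.
Proof.
move=> ab H.
apply: (@rect_bisect _ (fun a b _ _ => h a = h b) a b 0 0) => //.
- by move=> a' b' c' d' _ _ _ _ _ _ /= -> ->.
- move=> x y xab _; have [d d0 dH] := H x xab; exists d => // a' b' c' d' h1 h2 h3 h4 _ _ _ _ h5 _.
  have xx := xab; case/andP: xx => x1 x2.
  rewrite (dH a') ?(dH b')//.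
  + by rewrite h4 andbT; apply: le_trans h1 _; exact: le_trans h2 h3.
  + by rewrite ger0_norm ?subr_ge0//; apply: le_lt_trans h5; rewrite lerD2l lerN2.
  + by rewrite h1 /=; apply: le_trans h2 x2.
  + by rewrite ler0_norm ?subr_le0// opprB; apply: le_lt_trans h5; rewrite lerD2r.
Qed.

(** Connectedness, in a form that passes at once to products and to continuous images with a
    section. Values in any type are allowed, in particular propositions. *)
Definition lcc (M : topologicalType) := forall (T : Type) (h : M -> T),
  (forall x, \forall y \near x, h y = h x) -> forall x y, h x = h y.

Lemma lcc_prod (M N : topologicalType) : lcc M -> lcc N -> lcc (M * N)%type.
Proof.
move=> cM cN T h hl [x y] [x' y'].
transitivity (h (x', y)).
  apply: (cM _ (fun x => h (x, y))) => z.
  have [[A B] [/= nA nB] AB] := hl (z, y).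
  apply: filterS nA => w Aw; apply: (AB (w, y)); split=> //=; exact: nbhs_singleton nB.
apply: (cN _ (fun y => h (x', y))) => z.
have [[A B] [/= nA nB] AB] := hl (x', z).
by apply: filterS nB => w Bw; apply: (AB (x', w)); split=> //=; exact: nbhs_singleton nA.
Qed.

Lemma lcc_image (M N : topologicalType) (f : M -> N) (g : N -> M) :
  continuous f -> (forall y, f (g y) = y) -> lcc M -> lcc N.
Proof.
move=> fc fg cM T h hl x y.
rewrite -(fg x) -(fg y); apply: (cM _ (h \o f)) => z.
exact: fc (hl (f z)).
Qed.

Lemma within_continuous_near (S T : topologicalType) (A : set S) (g : S -> T) (t : S) (B : set T) :
  {within A, continuous g} -> A t -> nbhs (g t) B -> \forall s \near t, A s -> B (g s).
Proof.
by move=> /subspace_continuousP/(_ t)gc At nB; exact: gc At B nB.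
Qed.

Lemma simply_connected_lcc (M : topologicalType) : simply_connected R M -> lcc M.
Proof.
move=> [_ pc _] T h hl x y; have [g [gc <- <-]] := pc x y.
apply: (@segment_lconst _ (h \o g)) => // t t01.
have t01' : (`[0, 1]%classic : set R) t by [].
have gt : nbhs (g t) [set z | h z = h (g t)] by exact: hl.
have /nbhs_ballP[d /= d0 H] := within_continuous_near gc t01' gt.
exists d => // s s01 st; apply: H; last by [].
by rewrite /ball /= distrC.
Qed.

End LocalConstancy.

(** * Holomorphic functions on manifolds and the maximum principle *)

Section Charts.
Variable R : realType.
Local Notation C := (cplx R).

Section OneManifold.
Variables (m : nat) (M : cmanifold R m).

Lemma chart_ex (x : M) : exists phi, atlas phi /\ chart_dom phi x.
Proof. by have [phi a d] := atlas_cover x; exists phi. Qed.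

Definition ch (x : M) : chart R m M := projT1 (cid (chart_ex x)).

Lemma ch_atlas x : atlas (ch x).
Proof. by rewrite /ch; case: cid => ? []. Qed.

Lemma ch_dom x : chart_dom (ch x) x.
Proof. by rewrite /ch; case: cid => ? []. Qed.

Lemma chart_near (phi : chart R m M) x : chart_dom phi x ->
  \forall v \near phi x, chart_dom phi (chart_inv phi v) /\ phi (chart_inv phi v) = v.
Proof.
move=> dx.
have : nbhs (phi x) (chart_map phi @` chart_dom phi).
  by apply: open_nbhs_nbhs; split; [exact: chart_img_open|exists x].
by apply: filterS => _ [y dy <-]; rewrite chart_mapK.
Qed.

Lemma near_chart (phi : chart R m M) x (P : M -> Prop) : chart_dom phi x ->
  (\forall y \near x, P y) <-> (\forall v \near phi x, P (chart_inv phi v)).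
Proof.
move=> dx; split=> [|H]; first exact: chart_inv_cvg.
have c : nbhs x (fun y => P (chart_inv phi (phi y))) := chart_map_continuous dx H.
have d := chart_dom_nbhs dx.
by apply: filterS2 c d => y /= + dy; rewrite chart_mapK.
Qed.

Lemma chart_change (V : normedModType C) (h : M -> V) (phi psi : chart R m M) x :
  atlas phi -> atlas psi -> chart_dom phi x -> chart_dom psi x ->
  differentiable (h \o chart_inv phi) (phi x) -> differentiable (h \o chart_inv psi) (psi x).
Proof.
move=> ap aq dp dq dh.
apply: (@near_differentiable _ _ _ ((h \o chart_inv phi) \o (phi \o chart_inv psi))).
  have : \forall y \near x, chart_dom phi y by exact: chart_dom_nbhs.
  move=> /(near_chart _ dq); apply: filterS => v dv /=.
  by rewrite chart_mapK.
apply: differentiable_comp; first exact: atlas_compatible.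
by rewrite /= chart_mapK.
Qed.

Definition hfun_at (h : M -> C) (x : M) :=
  differentiable (h \o chart_inv (ch x)) (ch x x).

Definition hfun (h : M -> C) := forall x, hfun_at h x.

Lemma hfun_chart (h : M -> C) phi x : atlas phi -> chart_dom phi x ->
  hfun_at h x <-> differentiable (h \o chart_inv phi) (phi x).
Proof.
by move=> ap dp; split; apply: chart_change => //; (exact: ch_atlas || exact: ch_dom).
Qed.

Lemma hfun_at_continuous (h : M -> C) x : hfun_at h x -> {for x, continuous h}.
Proof.
move=> /differentiable_continuous hc.
apply: (@near_continuous _ _ ((h \o chart_inv (ch x)) \o ch x)).
  by apply: filterS (chart_dom_nbhs (ch_dom x)) => y dy /=; rewrite chart_mapK.
apply: continuous_comp => //; apply: chart_map_continuous; exact: ch_dom.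
Qed.

Lemma hfun_near_chart (h : M -> C) phi x : atlas phi -> chart_dom phi x ->
  (\forall y \near x, hfun_at h y) ->
  \forall v \near phi x, differentiable (h \o chart_inv phi) v.
Proof.
move=> ap dp; move/(near_chart _ dp) => H.
apply: filterS2 H (chart_near dp) => v hv [dv vE].
by have /(hfun_chart h ap dv) := hv; rewrite vE.
Qed.

End OneManifold.

Lemma strong_maximumV (V : normedModType C) (u : V -> C) (v : V) :
  (\forall w \near v, differentiable u w) ->
  (\forall w \near v, rn (u w) <= rn (u v)) -> \forall w \near v, u w = u v.
Proof.
move=> /nearP[r r0 du] /nearP[s s0 uM].
pose m := Num.min r s; have m0 : 0 < m by rewrite lt_min r0.
apply/nearP; exists (m / 2); first by rewrite divr_gt0.
move=> w wm.
pose k t : C := u (v + t *: (w - v)).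
have wv : rn (w - v) < m by clear -wm m0; lra.
have in_ball (t : C) : rn t < 2 -> rn (v + t *: (w - v) - v) < m.
  move=> t2; rewrite addrC addKr rnZ; apply: le_lt_trans (ler_wpM2r (rn_ge0 _) (ltW t2)) _.
  by clear -wm; lra.
have dk t : rn t < 2 -> differentiable k t.
  move=> t2; apply: line_diff; apply: du; have := in_ball t t2.
  by rewrite lt_min => /andP[].
have kM t : rn t < 2 -> rn (k t) <= rn (u v).
  by move=> t2; apply: uM; have := in_ball t t2; rewrite lt_min => /andP[].
have k0 : k 0 = u v by rewrite /k scale0r addr0.
have k1 : k 1 = u w by rewrite /k scale1r addrBK'.
suff : (k 0 = u v) = (k 1 = u v) by rewrite k0 k1 => <-.
(* The proposition [k t = u v] is locally constant in [t]: where it holds by the one-variable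
   principle, as [u v] is still of maximal modulus, and where it fails by continuity. *)
have := @segment_lconst R Prop (fun t : R => k t%:C%C = u v) 0 1 ler01.
rewrite rmorph0 rmorph1; apply => t /andP[t0 t1].
have t2 : rn (t%:C%C : C) < 2 by rewrite rnR ger0_norm//; lra.
have [E|nE] := pselect (k t%:C%C = u v).
  have [||d d0 dE] := (nearP _ _).1 (@strong_maximum R k t%:C%C _ _).
  - apply/nearP; exists (2 - rn (t%:C%C : C)); first by rewrite subr_gt0.
    move=> z zt; apply: dk; rewrite -(subrK (t%:C%C) z); apply: le_lt_trans (rnD _ _) _.
    by rewrite -ltrBrDr.
  - apply/nearP; exists (2 - rn (t%:C%C : C)); first by rewrite subr_gt0.
    move=> z zt; rewrite E; apply: kM; rewrite -(subrK (t%:C%C) z); apply: le_lt_trans (rnD _ _) _.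
    by rewrite -ltrBrDr.
  exists d => // s' _ sd; apply/propext; rewrite E; split=> // _.
  by rewrite dE// -rmorphB/= rnR.
have kc := differentiable_continuous (dk _ t2).
have e0 : 0 < rn (k t%:C%C - u v) by rewrite rn_gt0 subr_eq0; apply/eqP.
have /contP/(_ _ e0)[d d0 dH] := kc.
exists d => // s' _ sd; apply/propext; split=> // E'; exfalso.
by have := dH s'%:C%C; rewrite -rmorphB/= rnR E' => /(_ sd); rewrite rnBC ltxx.
Qed.

(** At a point [c] of maximal modulus; the proposition [h x = h c] is locally constant, by the
    strong principle in a chart where it holds and by continuity elsewhere. *)
Lemma maximum_principle m (M : cmanifold R m) (h : M -> C) :
  compact [set: M] -> lcc M -> hfun h -> forall x y, h x = h y.
Proof.
move=> cM lM hh x0 y0.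
have hc : continuous h by move=> x; exact/hfun_at_continuous.
have nc : continuous (fun x => rn (h x)).
  move=> x; apply/cvgrPdist_lt => e e0.
  have H : \forall w \near h x, rn (w - h x) < e by apply/nearP; exists e.
  have H' : \forall y \near x, rn (h y - h x) < e := hc x _ H.
  apply: filterS H' => y; apply: le_lt_trans.
  rewrite ler_norml; have h1 := rnD (h y - h x) (h x); have h2 := rnB (h y) (h y - h x).
  by rewrite subrK in h1; rewrite opprB addrC subrK in h2; apply/andP; split; lra.
have [||c _ cmax] := @compact_EVT_max _ _ (fun x => rn (h x)) [set: M] _ cM _.
- by exists x0.
- exact: continuous_subspaceT.
suff H x : h x = h c by rewrite !H.
suff -> : (h x = h c) = (h c = h c) by [].
apply: (lM _ (fun x => h x = h c)) => y.
have [E|nE] := pselect (h y = h c).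
  have dy : \forall v \near ch y y, differentiable (h \o chart_inv (ch y)) v.
    apply: hfun_near_chart; [exact: ch_atlas|exact: ch_dom|].
    by apply: nearW => z; exact: hh.
  have P : \forall v \near ch y y, rn ((h \o chart_inv (ch y)) v) <= rn ((h \o chart_inv (ch y)) (ch y y)).
    apply/nearP; exists 1; [exact: ltr01|move=> v _].
    by rewrite /= [in leRHS]chart_mapK ?E; [apply: cmax; rewrite in_setT|exact: ch_dom].
  apply/(near_chart _ (ch_dom y)); apply: filterS (strong_maximumV dy P) => v.
  rewrite /= chart_mapK; last exact: ch_dom.
  by move=> vE; apply/propext; rewrite vE.
have e0 : 0 < rn (h y - h c) by rewrite rn_gt0 subr_eq0; apply/eqP.
have H : \forall w \near h y, rn (w - h y) < rn (h y - h c) by apply/nearP; exists (rn (h y - h c)).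
have H' : \forall z \near y, rn (h z - h y) < rn (h y - h c) := hc y _ H.
apply: filterS H' => z zE; apply/propext; split=> // E'; exfalso.
by move: zE; rewrite E' rnBC ltxx.
Qed.

End Charts.

(** * Jacobian matrices in charts *)

Section Jacobians.
Variable R : realType.
Local Notation C := (cplx R).

Lemma diff_coord n (w h : 'rV[C]_n) (j : 'I_n) : 'd (fun v : 'rV[C]_n => v 0 j : C) w h = h 0 j.
Proof.
have dc : differentiable (fun v : 'rV[C]_n => v 0 j : C) w by exact: differentiable_coord.
have c1 := line_cder h dc.
apply: (cder_uniq c1 (b := h 0 j) (g := fun s : C => (w + s *: h) 0 j)) => //.
move=> e e0; exists 1 => // s _; rewrite !mxE add0r !mul0r addr0.
by rewrite [X in X - _]addrAC subrr add0r subrr rn0 mulr_ge0 ?rn_ge0 ?(ltW e0).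
Qed.

Lemma differentiable_entry m n (u : 'rV[C]_m -> 'rV[C]_n) v (j : 'I_n) :
  differentiable u v -> differentiable (fun w => u w 0 j : C) v.
Proof.
move=> du; exact: (@differentiable_comp _ _ _ _ u (fun w : 'rV[C]_n => w 0 j : C) v du
  (differentiable_coord _ _ _)).
Qed.

Lemma diff_entry m n (u : 'rV[C]_m -> 'rV[C]_n) v h (j : 'I_n) :
  differentiable u v -> 'd (fun w => u w 0 j : C) v h = ('d u v h) 0 j.
Proof.
move=> du.
have E := @diff_comp C _ _ _ u (fun w : 'rV[C]_n => w 0 j : C) v du (differentiable_coord _ _ _).
have E' := congr1 (fun f : 'rV[C]_m -> C => f h) E.
apply: etrans E' _; exact: diff_coord.
Qed.

Lemma jac_entry m n (u : 'rV[C]_m -> 'rV[C]_n) v i j :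
  differentiable u v -> jacobian u v i j = 'd (fun w => u w 0 j : C) v (delta_mx 0 i).
Proof. by move=> du; rewrite diff_entry// /jacobian /lin1_mx mxE. Qed.

Lemma jac_mul m n (u : 'rV[C]_m -> 'rV[C]_n) v h : h *m jacobian u v = 'd u v h.
Proof. by rewrite /jacobian mul_rV_lin1. Qed.

(** Vectors are rows and jacobians act from the right, so the factors come in the order in which the
    maps are applied; all matrix products below follow this convention. *)
Lemma jac_chain m n p (u : 'rV[C]_m -> 'rV[C]_n) (w : 'rV[C]_n -> 'rV[C]_p) v :
  differentiable u v -> differentiable w (u v) ->
  jacobian (w \o u) v = jacobian u v *m jacobian w (u v).
Proof.
move=> du dw; apply/row_matrixP => i; rewrite !rowE mulmxA !jac_mul.
have E := @diff_comp C _ _ _ u w v du dw.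
exact: (congr1 (fun f : 'rV[C]_m -> 'rV[C]_p => f (delta_mx 0 i)) E).
Qed.

Lemma near_jac m n (u w : 'rV[C]_m -> 'rV[C]_n) v : (\forall x \near v, u x = w x) ->
  differentiable u v -> jacobian u v = jacobian w v.
Proof.
move=> uw du; have dw := near_differentiable uw du.
apply/matrixP => i j; apply: etrans (jac_entry _ _ du) _; apply: etrans (esym (jac_entry _ _ dw)).
have c1 := line_cder (delta_mx 0 i) (differentiable_entry j du).
have c2 := line_cder (delta_mx 0 i) (differentiable_entry j dw).
have [r r0 rH] := (nearP _ _).1 uw.
have {}c1 : cder (fun s : C => w (v + s *: delta_mx 0 i) 0 j) 0 ('d (fun w => u w 0 j : C) v (delta_mx 0 i)).
  apply: (cder_near _ c1); exists (r / (1 + rn (delta_mx 0 i : 'rV[C]_m))).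
    by rewrite divr_gt0// ltr_pwDl// rn_ge0.
  move=> s; rewrite subr0 ltr_pdivlMr ?ltr_pwDl ?rn_ge0// => sr.
  rewrite rH// addrC addKr rnZ; apply: le_lt_trans sr.
  by rewrite ler_wpM2l ?rn_ge0// lerDr.
exact: cder_uniq c1 c2 erefl.
Qed.

Lemma jac_id m (v : 'rV[C]_m) : jacobian id v = 1%:M.
Proof.
apply/matrixP => i j; rewrite jac_entry; last by [].
by rewrite (diff_coord v) !mxE eqxx eq_sym.
Qed.

Lemma jac_differentiable m n (u : 'rV[C]_m -> 'rV[C]_n) v i j :
  (\forall w \near v, differentiable u w) ->
  differentiable (fun w => jacobian u w i j : C) v.
Proof.
move=> du.
have due : \forall w \near v, differentiable (fun w => u w 0 j : C) w.
  by apply: filterS du => w; exact: differentiable_entry.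
have [dd _] := diff_differentiable_aux (delta_mx 0 i) due.
apply: near_differentiable dd; apply: filterS du => w dw.
by rewrite jac_entry.
Qed.

Lemma near_near (V : topologicalType) (v : V) (P : V -> Prop) :
  (\forall w \near v, P w) -> \forall w \near v, \forall x \near w, P x.
Proof. by move=> H; exact: nbhs_interior H. Qed.

End Jacobians.

Section ChartJacobians.
Variable R : realType.
Local Notation C := (cplx R).

Definition Jc m n (M : cmanifold R m) (N : cmanifold R n) (phi : chart R m M) (psi : chart R n N)
  (f : M -> N) (x : M) := jacobian (psi \o f \o chart_inv phi) (phi x).

Section Basic.
Variables (m n : nat) (M : cmanifold R m) (N : cmanifold R n).
Implicit Types (phi : chart R m M) (psi : chart R n N) (f : M -> N).

Lemma Jc_chain p (P : cmanifold R p) phi psi (th : chart R p P) f (g : N -> P) x :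
  holomorphic f -> holomorphic g -> atlas phi -> atlas psi -> atlas th ->
  chart_dom phi x -> chart_dom psi (f x) -> chart_dom th (g (f x)) ->
  Jc phi th (g \o f) x = Jc phi psi f x *m Jc psi th g (f x).
Proof.
move=> [fc fd] [gc gd] ap aq at_ dp dq dt.
have d1 := fd _ _ _ ap aq dp dq.
have d2 := gd _ _ _ aq at_ dq dt.
have E1 : (psi \o f \o chart_inv phi) (phi x) = psi (f x) by rewrite /= chart_mapK.
have E2 : Jc psi th g (f x) = jacobian (th \o g \o chart_inv psi) ((psi \o f \o chart_inv phi) (phi x)) by rewrite E1.
have d2' : differentiable (th \o g \o chart_inv psi) ((psi \o f \o chart_inv phi) (phi x)) by rewrite E1.
rewrite E2; apply: etrans (jac_chain d1 d2').
apply: esym; apply: near_jac; last exact: differentiable_comp d1 d2'.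
have dq' : \forall y \near x, chart_dom psi (f y) by exact: fc (chart_dom_nbhs dq).
by move/(near_chart _ dp) : dq'; apply: filterS => v dv /=; rewrite chart_mapK.
Qed.

Lemma Jc_id phi x : atlas phi -> chart_dom phi x -> Jc phi phi (@idfun M) x = 1%:M.
Proof.
move=> ap dp; rewrite -(jac_id (phi x)); apply: esym; apply: near_jac => //.
by apply: filterS (chart_near dp) => v [_ vE] /=; rewrite vE.
Qed.

Lemma holo_near_chart phi psi f x : holomorphic f -> atlas phi -> atlas psi ->
  chart_dom phi x -> chart_dom psi (f x) ->
  \forall v \near phi x, differentiable (psi \o f \o chart_inv phi) v.
Proof.
move=> [fc fd] ap aq dp dq.
have dq' : \forall y \near x, chart_dom psi (f y) by exact: fc (chart_dom_nbhs dq).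
move/(near_chart _ dp) : dq' => dq'.
apply: filterS2 dq' (chart_near dp) => v dv [dv' vE].
by have := fd _ _ _ ap aq dv' dv; rewrite vE.
Qed.

Lemma Jc_differentiable phi psi f x i j : holomorphic f -> atlas phi -> atlas psi ->
  chart_dom phi x -> chart_dom psi (f x) ->
  differentiable (fun v => Jc phi psi f (chart_inv phi v) i j : C) (phi x).
Proof.
move=> hf ap aq dp dq.
apply: (@near_differentiable _ _ _ (fun v => jacobian (psi \o f \o chart_inv phi) v i j : C)).
  by apply: filterS (chart_near dp) => v [_ vE]; rewrite /Jc vE.
by apply: jac_differentiable; exact: holo_near_chart.
Qed.

(** One pair of charts at each point is enough, because the changes of charts are holomorphic;
    continuity is inherited from the local expression. *)
Lemma holomorphic_of_chart f :
  (forall x, exists phi psi, [/\ atlas phi, atlas psi, chart_dom phi x, chart_dom psi (f x) &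
     nbhs x (fun y => chart_dom psi (f y)) /\
     differentiable (psi \o f \o chart_inv phi) (phi x)]) -> holomorphic f.
Proof.
move=> H.
have fc : continuous f.
  move=> x; have [phi [psi [ap aq dp dq [nq df]]]] := H x.
  apply: (@near_continuous _ _ (chart_inv psi \o (psi \o f \o chart_inv phi) \o phi)).
    apply: filterS2 nq (chart_dom_nbhs dp) => y dy dy' /=.
    by rewrite !chart_mapK.
  apply: continuous_comp; first exact: chart_map_continuous.
  apply: continuous_comp; first exact: differentiable_continuous.
  rewrite /= chart_mapK//; apply: chart_inv_continuous; by exists (f x).
split=> // phi' psi' x ap' aq' dp' dq'.
have [phi [psi [ap aq dp dq [nq df]]]] := H x.
apply: (@near_differentiable _ _ _ ((psi' \o chart_inv psi) \o
    (psi \o f \o chart_inv phi) \o (phi \o chart_inv phi'))).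
  move: nq => /(near_chart _ dp') nq.
  have := chart_dom_nbhs dp; move/(near_chart _ dp') => np.
  by apply: filterS2 nq np => v dv dv' /=; rewrite !chart_mapK.
apply: differentiable_comp; first exact: atlas_compatible.
rewrite /= chart_mapK//; apply: differentiable_comp => //.
by rewrite /= chart_mapK//; exact: atlas_compatible.
Qed.

Lemma Jc0_const f : holomorphic f -> lcc M ->
  (forall phi psi x, atlas phi -> atlas psi -> chart_dom phi x -> chart_dom psi (f x) ->
    Jc phi psi f x = 0) -> forall x y, f x = f y.
Proof.
move=> hf lM J0 x y; apply: (lM _ f) => {x y} x.
have ap := ch_atlas x; have dp := ch_dom x; have aq := ch_atlas (f x); have dq := ch_dom (f x).
set phi := ch x in ap dp; set psi := ch (f x) in aq dq.
have nd := holo_near_chart hf ap aq dp dq.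
have dq' : \forall y \near x, chart_dom psi (f y) by exact: hf.1 (chart_dom_nbhs dq).
have nq := dq'; move/(near_chart _ dp) : nq => nq.
have j0 : \forall v \near phi x, jacobian (psi \o f \o chart_inv phi) v = 0.
  apply: filterS2 nq (chart_near dp) => v dv [dv' vE].
  by rewrite -[in LHS]vE; apply: J0.
have cst j : \forall v \near phi x, (psi \o f \o chart_inv phi) v 0 j = psi (f x) 0 j :> C.
  have nde : \forall v \near phi x, differentiable (fun w => (psi \o f \o chart_inv phi) w 0 j : C) v.
    by apply: filterS nd => v; exact: differentiable_entry.
  have /near_hb[r r0 hr] := nde.
  have [s s0 sH] := (nearP _ _).1 j0; have [t t0 tH] := (nearP _ _).1 nd.
  have xE : psi (f x) = psi (f (chart_inv phi (phi x))) by rewrite chart_mapK.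
  rewrite xE.
  apply: (@zero_diff_const _ _ (fun v => (psi \o f \o chart_inv phi) v 0 j) (phi x) (Num.min r (Num.min s t))).
  - by rewrite !lt_min r0 s0.
  - by move=> w; rewrite lt_min => /andP[wr _]; exact: hr.
  - move=> w h; rewrite !lt_min => /and3P[_ ws wt].
    rewrite (@diff_entry _ _ _ (psi \o f \o chart_inv phi))//; last exact: tH.
    by rewrite -jac_mul sH// mulmx0 mxE.
have {}cst : \forall v \near phi x, forall j, (psi \o f \o chart_inv phi) v 0 j = psi (f x) 0 j :> C.
  exact: filter_forall cst.
apply/(near_chart _ dp); apply: filterS2 cst nq => v vE dv.
rewrite -(chart_mapK dq) -(chart_mapK dv); congr chart_inv.
by apply/rowP => j; exact: vE.
Qed.

End Basic.

(** Holomorphic 1-forms: [w phi x] is the column of coefficients on the differentials of the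
    coordinates of [phi], and the second clause is the transformation rule of covectors. *)
Definition oneform m (M : cmanifold R m) (w : chart R m M -> M -> 'cV[C]_m) :=
  (forall phi x i, atlas phi -> chart_dom phi x ->
     differentiable (fun v => w phi (chart_inv phi v) i 0 : C) (phi x)) /\
  (forall phi psi x, atlas phi -> atlas psi -> chart_dom phi x -> chart_dom psi x ->
     w phi x = Jc phi psi (@idfun M) x *m w psi x).

Definition noforms m (M : cmanifold R m) := forall w, @oneform m M w ->
  forall phi x, atlas phi -> chart_dom phi x -> w phi x = 0 :> 'cV[C]_m.

End ChartJacobians.

(** * Del Pezzo surfaces have no holomorphic 1-forms *)

Section RealDerivatives.
Variable R : realType.
Local Notation C := (cplx R).

Lemma is_derive_eps (F : R -> R) (t f : R) :
  (forall e : R, 0 < e -> exists2 d : R, 0 < d & forall h : R, `|h| < d ->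
    `|F (t + h) - F t - h * f| <= e * `|h|) -> is_derive t (1 : R) F f.
Proof.
move=> H.
have c : (fun h : R => h^-1 *: (F (h *: (1 : R) + t) - F t)) h @[h --> 0^'] --> f.
  apply/cvgrPdist_le => e e0; have [d d0 dH] := H e e0.
  apply/nbhs_ballP; exists d => // h; rewrite /ball /= sub0r normrN => hd h0.
  have h1 : 0 < `|h| by rewrite normr_gt0.
  rewrite -(ler_pM2r h1) -normrM; apply: le_trans (dH h hd).
  rewrite -normrN; apply: eqle; congr (Num.norm _).
  rewrite /GRing.scale /= mulr1 (addrC h) mulrBl opprB; congr (_ - _); last by rewrite mulrC.
  by rewrite mulrAC mulVf// mul1r.
by split; [apply/cvg_ex; exists f|exact: cvg_lim c].
Qed.

Lemma rder_eps (V : R -> C) (t : R) (v : C) :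
  (forall e : R, 0 < e -> exists2 d : R, 0 < d & forall h : R, `|h| < d ->
    rn (V (t + h) - V t - h%:C%C * v) <= e * `|h|) -> rder V t v.
Proof.
move=> H; split; apply: is_derive_eps => e e0; have [d d0 dH] := H e e0; exists d => // h hd;
  apply: le_trans (dH h hd).
- apply: le_trans (Re_le _).
  by apply: eqle; congr (Num.norm _); rewrite /=; case: (V (t + h)) (V t) v {H dH} => a b [c g] [p q] /=; rewrite mul0r subr0.
- apply: le_trans (Im_le _).
  by apply: eqle; congr (Num.norm _); rewrite /=; case: (V (t + h)) (V t) v {H dH} => a b [c g] [p q] /=; rewrite mul0r addr0.
Qed.

Lemma rder_cI (L a t : R) (w : R -> C) (c : C) (V : R -> C) (v : C) : rcont w -> L < t ->
  rder V t v -> rder (fun x => cI L w a x + V x) t (w t + v).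
Proof.
move=> [wr wi] Lt [Vr Vi].
have h (u p : R -> R) (q k : R) : continuous u -> is_derive t (1 : R) p q ->
    is_derive t (1 : R) (fun x => prim L u x - k + p x) (u t + q).
  move=> uc pq; have h1 := @prim_derive _ L u t uc Lt.
  have h3 : is_derive t (1 : R) (cst k : R -> R) 0 by exact: is_derive_cst.
  by have := is_deriveD (is_deriveB h1 h3) pq; rewrite subr0.
split.
- have -> : Re \o (fun x => cI L w a x + V x) =
    (fun x => prim L (Re \o w) x - prim L (Re \o w) a + (Re \o V) x).
    by apply/funext => x /=; case: (V x).
  have -> : Re (w t + v) = (Re \o w) t + Re v by rewrite /=; case: (w t) v {Vr Vi} => ? ? [? ?].
  exact: h.
- have -> : Im \o (fun x => cI L w a x + V x) =
    (fun x => prim L (Im \o w) x - prim L (Im \o w) a + (Im \o V) x).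
    by apply/funext => x /=; case: (V x).
  have -> : Im (w t + v) = (Im \o w) t + Im v by rewrite /=; case: (w t) v {Vr Vi} => ? ? [? ?].
  exact: h.
Qed.

Lemma cI_bound2 (L : R) (w1 w2 : R -> C) (V v : R -> C) a b e : L < a -> a <= b ->
  rcont w1 -> rcont w2 -> (forall t, a <= t <= b -> rder V t (v t)) ->
  (forall t, a <= t <= b -> rn (w1 t - w2 t - v t) <= e) ->
  rn (cI L w1 a b - cI L w2 a b - (V b - V a)) <= 2 * e * (b - a).
Proof.
move=> La ab c1 c2 dV H.
have := @cI_bound _ L w1 (fun x => cI L w2 a x + V x) (fun x => w2 x + v x) a b e La ab c1.
have -> : cI L w1 a b - (cI L w2 a b + V b - (cI L w2 a a + V a)) =
  cI L w1 a b - cI L w2 a b - (V b - V a).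
  have -> : cI L w2 a a = 0 by rewrite /cI !subrr.
  by rewrite add0r; ring.
apply.
- move=> t tab; apply: rder_cI => //; last exact: dV.
  by case/andP: tab => at_ _; exact: lt_le_trans at_.
- by move=> t tab; rewrite opprD addrA; exact: H.
Qed.

Lemma rn_coord m n (h : 'M[C]_(m, n)) i j : rn (h i j : C) <= rn h.
Proof.
suff : `|h i j : C| <= `|h| by rewrite !rnE lecR.
rewrite [leRHS]/Num.norm /= mx_normE.
change (`|h i j|%:nng%:num <= (\big[Num.max/0%:nng]_ij `|h ij.1 ij.2|%:nng)%:num).
by rewrite num_le; exact: (le_bigmax _ (fun ij : 'I_m * 'I_n => `|h ij.1 ij.2|%:nng) (i, j)).
Qed.

End RealDerivatives.

Lemma lt_quarter (R : realType) (r a : R) : 0 < r -> a < r / 4 -> [/\ a <= r / 2, a < r & a <= r].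
Proof. by move=> r0 ar; split; lra. Qed.

Lemma om_alg (F : comRingType) (d0 d1 h0 h1 A A' B B' p q P Q t k0 k1 : F) : k0 = t * p -> k1 = t * q ->
  d0 * p + d1 * q = h0 * P + h1 * Q ->
  (d0 + h0) * A + (d1 + h1) * B - (d0 * A' + d1 * B') - (h0 * A' + h1 * B' + t * (h0 * P + h1 * Q)) =
  (d0 * (A - A' - k0) + h0 * (A - A')) + (d1 * (B - B' - k1) + h1 * (B - B')).
Proof. by move=> -> -> <-; ring. Qed.

Lemma lt_quarter2 (R : realType) (r a b : R) : 0 < r -> a < r / 4 -> b < r / 12 -> a + b < r.
Proof. by move=> r0 ar br; lra. Qed.

Lemma quad_le (R : realType) (K n e : R) : 0 <= K -> 0 <= n -> n * (2 * K + 1) < e ->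
  2 * (K * n ^+ 2) * (1 - 0) <= e * n * (1 - 0).
Proof.
move=> K0 n0 he; rewrite subr0 !mulr1 expr2 !mulrA; apply: ler_wpM2r => //.
by apply: le_trans (ltW he); rewrite mulrDr mulr1 mulrC mulrA lerDl.
Qed.

Lemma cder_eq (R : realType) (f : cplx R -> cplx R) (z a b : cplx R) : cder f z a -> a = b -> cder f z b.
Proof. by move=> h <-. Qed.

Lemma line_shift (R : realType) (V : normedModType (cplx R)) (u : V -> cplx R) (v d : V) (t D : cplx R) :
  cder (fun s => u (v + t *: d + s *: d)) 0 D -> cder (fun s => u (v + s *: d)) t D.
Proof.
move=> H e e0; have [r r0 rH] := H e e0; exists r => // s sr.
have -> : v + (t + s) *: d = v + t *: d + s *: d by rewrite scalerDl addrA.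
by have := rH s sr; rewrite add0r scale0r addr0.
Qed.

(** * Primitives of closed forms on a ball of C^2 *)

Section Poincare.
Variable R : realType.
Local Notation C := (cplx R).
Local Notation V2 := ('rV[C]_2).

Lemma diff_scale (W : V2 -> C) (x h : V2) (t : C) : 'd W x (t *: h) = t * 'd W x h.
Proof. exact: linearZ. Qed.

Lemma rder_cder (f : C -> C) (t : R) (D : C) : cder f t%:C%C D -> rder (fun x : R => f x%:C%C) t D.
Proof.
move=> H; apply: rder_eps => e e0; have [d d0 dH] := H e e0; exists d => // h hd.
by have := dH h%:C%C; rewrite rnR -rmorphD /=; exact.
Qed.

Lemma cder_mulid (F : C -> C) (z D : C) : cder F z D -> cder (fun s => s * F s) z (F z + z * D).
Proof.
move=> H e e0; have z1 : 0 < 3 * (1 + rn z) by rewrite mulr_gt0 ?ltr0n// ltr_pwDl// rn_ge0.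
have D1 : 0 < 3 * (1 + rn D) by rewrite mulr_gt0 ?ltr0n// ltr_pwDl// rn_ge0.
have [d d0 dH] := H _ (divr_gt0 e0 z1); have [s s0 sH] := H _ (ltr01).
exists (Num.min (Num.min d s) (e / (3 * (1 + rn D)))).
  by rewrite !lt_min d0 s0 divr_gt0.
move=> h; rewrite !lt_min ltr_pdivlMr// => /andP[/andP[hd hs] hD].
have h1 := dH h hd; have h2 := sH h hs.
have -> : (z + h) * F (z + h) - z * F z - h * (F z + z * D) =
  z * (F (z + h) - F z - h * D) + h * ((F (z + h) - F z - h * D) + h * D) by ring.
apply: le_trans (rnD _ _) _; rewrite !rnM.
have h3 : rn (F (z + h) - F z - h * D + h * D) <= rn h * (1 + rn D).
  by apply: le_trans (rnD _ _) _; rewrite rnM mulrDr mulr1 lerD// -[leRHS]mul1r.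
have h4 : rn h * rn (F (z + h) - F z - h * D + h * D) <= (e / 3) * rn h.
  rewrite mulrC; apply: ler_wpM2r; first exact: rn_ge0.
  by apply: le_trans h3 _; clear -hD; lra.
have h5 : rn z * rn (F (z + h) - F z - h * D) <= (e / 3) * rn h.
  apply: le_trans (ler_wpM2l (rn_ge0 _) h1) _.
  rewrite mulrA; apply: ler_wpM2r; first exact: rn_ge0.
  rewrite invfM !mulrA mulrC !mulrA ler_pdivrMr ?ltr_pwDl ?rn_ge0//.
  rewrite divfK ?pnatr_eq0// mulrC ger_pMr// mulrC ler_pdivrMr ?ltr_pwDl ?rn_ge0//.
  by rewrite mul1r lerDr.
apply: le_trans (lerD h5 h4) _; rewrite -mulrDl; apply: ler_wpM2r; first exact: rn_ge0.
by clear -e0; lra.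
Qed.

Variables (W0 W1 : V2 -> C).

Definition om (v h : V2) : C := h 0 0 * W0 v + h 0 1 * W1 v.

Lemma diff_om (v h k : V2) : differentiable W0 v -> differentiable W1 v ->
  differentiable (om^~ h) v /\ 'd (om^~ h) v k = h 0 0 * 'd W0 v k + h 0 1 * 'd W1 v k.
Proof.
move=> d0 d1.
have e0 : differentiable (h 0 0 *: W0) v by exact: differentiableZ.
have e1 : differentiable (h 0 1 *: W1) v by exact: differentiableZ.
have E : om^~ h = h 0 0 *: W0 + h 0 1 *: W1 by [].
split; first by rewrite E; exact: differentiableD.
rewrite E; apply: etrans (congr1 (fun f : V2 -> C => f k) (diffD e0 e1)) _.
rewrite /=; congr (_ + _).
  exact: (congr1 (fun f : V2 -> C => f k) (diffZ (h 0 0) d0)).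
exact: (congr1 (fun f : V2 -> C => f k) (diffZ (h 0 1) d1)).
Qed.

Lemma om_lin_diff (v h : V2) (x : V2) : differentiable (om v) x /\ 'd (om v) x h = om v h.
Proof.
have c j : differentiable (fun h : V2 => h 0 j : C) x by exact: differentiable_coord.
have E : om v = W0 v *: (fun h : V2 => h 0 0 : C) + W1 v *: (fun h : V2 => h 0 1 : C).
  by apply/funext => y; rewrite /om mulrC [X in _ + X]mulrC.
have e0 : differentiable (W0 v *: (fun h : V2 => h 0 0 : C)) x by exact: differentiableZ.
have e1 : differentiable (W1 v *: (fun h : V2 => h 0 1 : C)) x by exact: differentiableZ.
split; first by rewrite E; exact: differentiableD.
rewrite E; apply: etrans (congr1 (fun f : V2 -> C => f h) (diffD e0 e1)) _.
rewrite /=; congr (_ + _).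
  apply: etrans (congr1 (fun f : V2 -> C => f h) (diffZ (W0 v) (c 0))) _.
  exact: (congr1 (fun y : C => W0 v * y) (diff_coord x h 0)).
apply: etrans (congr1 (fun f : V2 -> C => f h) (diffZ (W1 v) (c 1))) _.
exact: (congr1 (fun y : C => W1 v * y) (diff_coord x h 1)).
Qed.

Variables (v0 : V2) (r M : R).
Hypothesis r0 : 0 < r.
Hypotheses (h0 : hb W0 v0 r) (h1 : hb W1 v0 r).
Hypotheses (b0 : forall z : V2, rn (z - v0) < r -> rn (W0 z) <= M)
           (b1 : forall z : V2, rn (z - v0) < r -> rn (W1 z) <= M).
Hypothesis closed_om : forall v h k : V2, rn (v - v0) < r ->
  h 0 0 * 'd W0 v k + h 0 1 * 'd W1 v k = k 0 0 * 'd W0 v h + k 0 1 * 'd W1 v h.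

Let gam (v : V2) (t : R) : V2 := v0 + t%:C%C *: (v - v0).

Let g (v : V2) (t : R) : C := om (gam v (clamp 0 1 t)) (v - v0).

(** The integral of the form along the ray from [v0] to [v]. The base point -1 lies to the left of
    the parameter interval, and the clamp in [g] makes the integrand continuous on the line. *)
Definition om_prim (v : V2) : C := cI (- 1) (g v) 0 1.

Let quarter (a : R) : a < r / 4 -> [/\ a <= r / 2, a < r & a <= r] := lt_quarter r0.

Let gam_in (v : V2) (t s : R) : rn (v - v0) < s -> 0 <= t <= 1 -> rn (gam v t - v0) < s.
Proof.
move=> vs /andP[t0 t1]; rewrite /gam addrC addKr rnZ rnR ger0_norm//.
by apply: le_lt_trans vs; rewrite ler_piMl ?rn_ge0.
Qed.

Let g_rcont (v : V2) : rn (v - v0) < r -> rcont (g v).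
Proof.
move=> vr; apply: rcontP => t e e0.
have c01 := @clamp_in _ 0 1 t ler01.
have /contP/(_ e e0)[d d0 dH] : {for gam v (clamp 0 1 t), continuous (om^~ (v - v0))}.
  apply: differentiable_continuous.
  by have [] := @diff_om (gam v (clamp 0 1 t)) (v - v0) 0 (h0 (gam_in vr c01)) (h1 (gam_in vr c01)).
exists (d / (1 + rn (v - v0))); first by rewrite divr_gt0// ltr_pwDl// rn_ge0.
move=> s; rewrite ltr_pdivlMr ?ltr_pwDl ?rn_ge0// => st; apply: dH.
rewrite /gam opprD addrACA subrr add0r -scalerBl -rmorphB rnZ rnR; apply: le_lt_trans st.
by apply: ler_pM; rewrite ?rn_ge0 ?normr_ge0 ?clamp_lip ?lerDr.
Qed.

Let K := 2 * (r * (576 * M / r ^+ 2) + 12 * M / r).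

Let M0 : 0 <= M.
Proof. by apply: le_trans (rn_ge0 _) (b0 (z := v0) _); rewrite subrr rn0. Qed.

(** By closedness the first variation of the integrand in the direction [h] is the derivative in [t]
    of [t * om (gam v t) h]; its integral over [0, 1] is [om v h], the differential sought. *)
Let om_taylor (v h : V2) (t : R) : rn (v - v0) < r / 4 -> rn h <= r / 12 -> 0 <= t <= 1 ->
  rn (om (gam (v + h) t) (v + h - v0) - om (gam v t) (v - v0) -
    (om (gam v t) h + t%:C%C * (h 0 0 * 'd W0 (gam v t) (v - v0) + h 0 1 * 'd W1 (gam v t) (v - v0))))
  <= K * rn h ^+ 2.
Proof.
move=> vr hr t01; set x := gam v t; set d := v - v0; set k := t%:C%C *: h.
have t1 : rn k <= rn h.
  by rewrite rnZ rnR; case/andP: t01 => ta tb; rewrite ger0_norm// ler_piMl ?rn_ge0.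
have xE : gam (v + h) t = x + k by rewrite /x /k /gam addrAC scalerDr addrA.
have dE : v + h - v0 = d + h by rewrite addrAC.
have xr : rn (x - v0) < r / 4 by exact: gam_in.
have xr2 : rn (x - v0) <= r / 2 by have [] := quarter xr.
have xr1 : rn (x - v0) < r by have [] := quarter xr.
have kr : rn k <= r / 12 by exact: le_trans t1 hr.
have dr : rn d <= r by have [] := quarter vr.
have T0 := taylor2V r0 h0 b0 xr2 kr; have T1 := taylor2V r0 h1 b1 xr2 kr.
have L0 := holo_lipschitz r0 h0 b0 xr2 kr; have L1 := holo_lipschitz r0 h1 b1 xr2 kr.
have S := closed_om d h xr1.
have k0 : 'd W0 x k = t%:C%C * 'd W0 x h by exact: diff_scale.
have k1 : 'd W1 x k = t%:C%C * 'd W1 x h by exact: diff_scale.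
rewrite xE dE.
have -> : om (x + k) (d + h) - om x d - (om x h + t%:C%C * (h 0 0 * 'd W0 x d + h 0 1 * 'd W1 x d)) =
  (d 0 0 * (W0 (x + k) - W0 x - 'd W0 x k) + h 0 0 * (W0 (x + k) - W0 x)) +
  (d 0 1 * (W1 (x + k) - W1 x - 'd W1 x k) + h 0 1 * (W1 (x + k) - W1 x)).
  have o1 : om (x + k) (d + h) = (d 0 0 + h 0 0) * W0 (x + k) + (d 0 1 + h 0 1) * W1 (x + k).
    by rewrite /om; congr (_ * _ + _ * _); rewrite mxE.
  rewrite o1; exact: om_alg k0 k1 S.
have A0 : 0 <= 576 * M / r ^+ 2 by exact: Kge0.
have B0 : 0 <= 12 * M / r by have := @Kge0 R 12 1 M r M0 r0; rewrite expr1.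
have kh : rn k ^+ 2 <= rn h ^+ 2 by rewrite ler_pXn2r// nnegrE rn_ge0.
have est (D E : C) j : rn D <= 576 * M / r ^+ 2 * rn k ^+ 2 -> rn E <= 12 * M / r * rn k ->
    rn (d 0 j * D + h 0 j * E) <= (r * (576 * M / r ^+ 2) + 12 * M / r) * rn h ^+ 2.
  move=> hD hE; apply: le_trans (rnD _ _) _; rewrite !rnM mulrDl; apply: lerD.
    rewrite -mulrA; apply: ler_pM; rewrite ?rn_ge0//.
      exact: le_trans (rn_coord _ _ _) dr.
    by apply: le_trans hD _; apply: ler_wpM2l.
  rewrite expr2 mulrA mulrC; apply: ler_pM; rewrite ?rn_ge0 ?rn_coord//.
  by apply: le_trans hE _; apply: ler_wpM2l.
apply: le_trans (rnD _ _) _; rewrite /K mulr2n mulrDl mul1r mulrDl.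
have E0 := est _ _ 0 T0 L0; have E1 := est _ _ 1 T1 L1; exact: lerD E0 E1.
Qed.

Lemma om_prim_diff (v : V2) : rn (v - v0) < r / 4 ->
  differentiable om_prim v /\ 'd om_prim v = om v :> (V2 -> C).
Proof.
move=> vr.
have [dL _] := om_lin_diff v 0 0.
have LE : 'd (om v) 0 = om v :> (V2 -> C) by apply/funext => h; have [] := om_lin_diff v h 0.
have K0 : 0 <= K.
  rewrite /K; have A0 := @Kge0 R 576 2 M r M0 r0; have B0 := @Kge0 R 12 1 M r M0 r0.
  rewrite expr1 in B0; apply: mulr_ge0; first exact: ler0n.
  exact: addr_ge0 (mulr_ge0 (ltW r0) A0) B0.
suff [d dE] : differentiable om_prim v /\ 'd om_prim v = 'd (om v) 0 :> (V2 -> C).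
  split; [exact: d|exact: etrans dE LE].
apply: eps_diff; first exact: diff_continuous.
move=> e e0.
have K1 : 0 < 2 * K + 1 by rewrite ltr_pwDr// mulr_ge0 ?ler0n.
exists (Num.min (r / 12) (e / (2 * K + 1))).
  by rewrite lt_min; apply/andP; split; apply: divr_gt0 => //; exact: ltr0n.
move=> h; rewrite lt_min => /andP[hr]; rewrite ltr_pdivlMr// => he.
have {}LE := congr1 (fun f : V2 -> C => f h) LE; rewrite [X in _ - X]LE {LE}.
pose V (t : R) : C := t%:C%C * om (gam v t) h.
have VE : V 1 - V 0 = om v h.
  by rewrite /V /gam rmorph1 rmorph0 mul0r subr0 mul1r scale1r addrBK'.
rewrite -VE.
have vr1 : rn (v - v0) < r by have [] := quarter vr.
have vhr : rn (v + h - v0) < r.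
  rewrite addrAC; apply: le_lt_trans (rnD _ _) _; exact: lt_quarter2 r0 vr hr.
have -> : e * rn h = e * rn h * (1 - 0) by rewrite subr0 mulr1.
apply: le_trans (quad_le K0 (rn_ge0 h) he).
apply: (@cI_bound2 _ _ _ _ _ (fun t => om (gam v t) h + t%:C%C *
   (h 0 0 * 'd W0 (gam v t) (v - v0) + h 0 1 * 'd W1 (gam v t) (v - v0)))).
- by rewrite ltrN10.
- exact: ler01.
- exact: g_rcont.
- exact: g_rcont.
- move=> t t01; have gr := gam_in vr1 t01.
  have [du dE] := @diff_om (gam v t) h (v - v0) (h0 gr) (h1 gr).
  have cd := cder_eq (line_cder (v - v0) du) dE.
  have c2 := @line_shift _ _ (om^~ h) v0 (v - v0) t%:C%C _ cd.
  exact: (@rder_cder (fun s => s * om (v0 + s *: (v - v0)) h) _ _ (cder_mulid c2)).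
- move=> t t01; rewrite /g !clamp_id//; exact: om_taylor (ltW hr) t01.
Qed.

End Poincare.

Lemma within_comp (X Y Z : topologicalType) (A : set Y) (B : set X) (phi : X -> Y) (H : Y -> Z) :
  continuous phi -> (forall x, B x -> A (phi x)) -> {within A, continuous H} ->
  {within B, continuous (H \o phi)}.
Proof.
move=> pc BA c; apply/subspace_continuousP => x Bx U HU.
have H1 : nbhs x (phi @^-1` (fun s => A s -> U (H s))) := pc x _ (within_continuous_near c (BA x Bx) HU).
have H2 : nbhs x (fun s => B s -> U (H (phi s))).
  by apply: filterS H1 => s /= h Bs; exact: h (BA s Bs).
exact: H2.
Qed.

Section RealLemmas.
Variable R : realType.
Implicit Types a b s dl : R.

Lemma mid_ge a b : a <= b -> a <= (a + b) / 2. Proof. lra. Qed.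
Lemma mid_le a b : a <= b -> (a + b) / 2 <= b. Proof. lra. Qed.

Lemma dbl_in1 s : 0 <= s <= 1 -> s <= 2^-1 -> 0 <= 2 * s <= 1.
Proof. by move=> /andP[? ?] ?; apply/andP; split; lra. Qed.

Lemma dbl_in2 s : 0 <= s <= 1 -> 2^-1 <= s -> 0 <= 2 * s - 1 <= 1.
Proof. by move=> /andP[? ?] ?; apply/andP; split; lra. Qed.

Lemma half_in s : 0 <= s <= 1 -> 0 <= s / 2 <= 1.
Proof. by move=> /andP[? ?]; apply/andP; split; lra. Qed.

Lemma half_le s : 0 <= s <= 1 -> s / 2 <= 2^-1.
Proof. by move=> /andP[? ?]; lra. Qed.

Lemma half1_in s : 0 <= s <= 1 -> 0 <= (s + 1) / 2 <= 1.
Proof. by move=> /andP[? ?]; apply/andP; split; lra. Qed.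

Lemma half1_le s : 0 <= s <= 1 -> (s + 1) / 2 <= 2^-1 -> s = 0.
Proof. by move=> /andP[? ?] ?; lra. Qed.

Lemma near_interval a b (x : R) s dl : a <= x -> x <= b -> b - a < dl -> a <= s -> s <= b -> `|x - s| < dl.
Proof. by move=> *; rewrite ltr_norml; apply/andP; split; lra. Qed.

End RealLemmas.

(** * Monodromy of primitives *)

Section Monodromy.
Variable R : realType.
Local Notation C := (cplx R).
Variable T : topologicalType.
(* [Pr p y] reads: [p] is a primitive of a fixed closed form near [y]. *)
Variable Pr : (T -> C) -> T -> Prop.
Hypothesis Pr_ex : forall y, exists p, Pr p y.
Hypothesis Pr_near : forall p y, Pr p y -> \forall z \near y, Pr p z.
Hypothesis Pr_uniq : forall p q y, Pr p y -> Pr q y ->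
  \forall z \near y, p z - p y = q z - q y.

(** Continuation of a primitive along the map [g]: [q] is its value as a function of the parameter,
    which need not be a function of the point of [T]. *)
Definition pa (X : topologicalType) (A : set X) (g : X -> T) (q : X -> C) :=
  forall t, A t -> exists2 p, Pr p (g t) &
    \forall s \near t, A s -> q s - q t = p (g s) - p (g t).

Lemma pa_any (X : topologicalType) (A : set X) (g : X -> T) (q : X -> C) t p :
  {within A, continuous g} -> pa A g q -> A t -> Pr p (g t) ->
  \forall s \near t, A s -> q s - q t = p (g s) - p (g t).
Proof.
move=> gc qa At Pp; have [p' Pp' H] := qa t At.
have U := within_continuous_near gc At (Pr_uniq Pp' Pp).
by apply: filterS2 H U => s H U As; rewrite H// U.
Qed.

Lemma pa_comp (X Y : topologicalType) (A : set Y) (B : set X) (phi : X -> Y) (g : Y -> T) (g' : X -> T) q :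
  continuous phi -> (forall x, B x -> A (phi x)) -> (forall x, B x -> g' x = g (phi x)) ->
  pa A g q -> pa B g' (q \o phi).
Proof.
move=> pc BA E qa t Bt; have [p Pp H] := qa (phi t) (BA _ Bt).
exists p; first by rewrite E.
have H' := pc t _ H; rewrite nbhs_simpl /= in H'.
by apply: filterS H' => s /= H' Bs; rewrite !E// H'//; exact: BA.
Qed.

Lemma pa_glue (X : topologicalType) (A A1 A2 : set X) (g : X -> T) q1 q2 (k : C) :
  {within A, continuous g} -> (forall s, A s <-> A1 s \/ A2 s) ->
  (forall t, ~ A1 t -> \forall s \near t, ~ A1 s) ->
  (forall t, ~ A2 t -> \forall s \near t, ~ A2 s) ->
  (forall t, A1 t -> A2 t -> q1 t = q2 t + k) ->
  pa A1 g q1 -> pa A2 g q2 -> exists q, pa A g q.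
Proof.
move=> gc AE c1 c2 qk p1 p2.
pose q (s : X) := if pselect (A1 s) then q1 s else q2 s + k.
have qE1 s : A1 s -> q s = q1 s by rewrite /q; case: pselect.
have qE2 s : A2 s -> q s = q2 s + k by move=> As; rewrite /q; case: pselect => // As1; exact: qk.
have gc1 : {within A1, continuous g} by apply: continuous_subspaceW gc => s As; apply/AE; left.
have gc2 : {within A2, continuous g} by apply: continuous_subspaceW gc => s As; apply/AE; right.
exists q => t At; have [p Pp] := Pr_ex (g t); exists p => //.
have E1 : \forall s \near t, A1 s -> q s - q t = p (g s) - p (g t).
  have [At1|nA] := pselect (A1 t); last by apply: filterS (c1 _ nA).
  by apply: filterS (pa_any gc1 p1 At1 Pp) => s + As; rewrite !qE1//; exact.
have E2 : \forall s \near t, A2 s -> q s - q t = p (g s) - p (g t).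
  have [At2|nA] := pselect (A2 t); last by apply: filterS (c2 _ nA).
  by apply: filterS (pa_any gc2 p2 At2 Pp) => s + As; rewrite !qE2// opprD addrACA subrr addr0; exact.
by apply: filterS2 E1 E2 => s e1 e2 /AE[].
Qed.

Lemma pa_lconst (X : topologicalType) (A : set X) (g g' : X -> T) q q' :
  {within A, continuous g} -> (forall t, A t -> g t = g' t) -> pa A g q -> pa A g' q' ->
  forall t, A t -> \forall s \near t, A s -> q s - q' s = q t - q' t.
Proof.
move=> gc E qa qa' t At; have [p Pp H'] := qa' t At.
rewrite -E// in Pp; have H := pa_any gc qa At Pp.
apply: filterS2 H H' => s H H' As.
have e : q s - q t = q' s - q' t by rewrite H// H'// !E.
have -> : q s = q' s - q' t + q t by rewrite -e subrK.
by ring.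
Qed.

Lemma segment_within (A : set R) (k : R -> C) (a b : R) : a <= b ->
  (forall t, a <= t <= b -> A t) ->
  (forall t, A t -> \forall s \near t, A s -> k s = k t) -> k a = k b.
Proof.
move=> ab sA H; apply: (@segment_lconst _ _ k) => // t tab.
have /nbhs_ballP[d /= d0 dH] := H t (sA t tab).
exists d => // s sab st; apply: dH; last exact: sA.
by rewrite /ball /= distrC.
Qed.

Let rect (a b c d : R) : set (R * R) := [set z | a <= z.1 <= b /\ c <= z.2 <= d].

Let near_lt1 (t : R * R) m : t.1 < m -> \forall s \near t, s.1 < m.
Proof.
move=> tm; have : nbhs t.1 [set x | x < m] by apply: open_nbhs_nbhs; split => //; exact: open_lt.
exact: (@cvg_fst _ _ (nbhs t.1) (nbhs t.2) _ [set x : R | x < m]).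
Qed.

Let near_gt1 (t : R * R) m : m < t.1 -> \forall s \near t, m < s.1.
Proof.
move=> tm; have : nbhs t.1 [set x | m < x] by apply: open_nbhs_nbhs; split => //; exact: open_gt.
exact: (@cvg_fst _ _ (nbhs t.1) (nbhs t.2) _ [set x : R | m < x]).
Qed.

Let near_lt2 (t : R * R) m : t.2 < m -> \forall s \near t, s.2 < m.
Proof.
move=> tm; have : nbhs t.2 [set x | x < m] by apply: open_nbhs_nbhs; split => //; exact: open_lt.
exact: (@cvg_snd _ _ (nbhs t.1) (nbhs t.2) _ [set x : R | x < m]).
Qed.

Let near_gt2 (t : R * R) m : m < t.2 -> \forall s \near t, m < s.2.
Proof.
move=> tm; have : nbhs t.2 [set x | m < x] by apply: open_nbhs_nbhs; split => //; exact: open_gt.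
exact: (@cvg_snd _ _ (nbhs t.1) (nbhs t.2) _ [set x : R | m < x]).
Qed.

Let rect_closed a b c d (t : R * R) : ~ rect a b c d t -> \forall s \near t, ~ rect a b c d s.
Proof.
move=> nt.
have [h|h1] := ltP t.1 a.
  by apply: filterS (near_lt1 h) => s sa [/andP[]]; rewrite leNgt sa.
have [h|h2] := ltP b t.1.
  by apply: filterS (near_gt1 h) => s sa [/andP[_]]; rewrite leNgt sa.
have [h|h3] := ltP t.2 c.
  by apply: filterS (near_lt2 h) => s sa [_ /andP[]]; rewrite leNgt sa.
have [h|h4] := ltP d t.2.
  by apply: filterS (near_gt2 h) => s sa [_ /andP[_]]; rewrite leNgt sa.
by exfalso; apply: nt; split; apply/andP.
Qed.

Let cont1 (y : R) : continuous (fun x : R => (x, y)).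
Proof. by move=> x; exact: cvg_pair cvg_id (cvg_cst y). Qed.

Let cont2 (x : R) : continuous (fun y : R => (x, y)).
Proof. by move=> y; exact: cvg_pair (cvg_cst x) cvg_id. Qed.

(** Bisection: primitives along two adjacent pieces differ by a constant on the common side, which
    is a segment, and therefore glue after a shift. A small rectangle is mapped to where one local
    primitive [p] works. *)
Lemma rect_prim (H : R * R -> T) a b c d : a <= b -> c <= d ->
  {within rect a b c d, continuous H} -> exists q, pa (rect a b c d) H q.
Proof.
move=> ab cd Hc.
apply: (@rect_bisect _ (fun a b c d => exists q, pa (rect a b c d) H q)) => //.
- move=> a' b' c' d' aa a'b' bb cc c'd' dd m n.
  have am : a' <= m by exact: mid_ge.
  have mb : m <= b' by exact: mid_le.
  have cn : c' <= n by exact: mid_ge.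
  have nd : n <= d' by exact: mid_le.
  have sub a1 b1 c1 d1 : a' <= a1 -> b1 <= b' -> c' <= c1 -> d1 <= d' ->
      {within rect a1 b1 c1 d1, continuous H}.
    move=> h1 h2 h3 h4; apply: continuous_subspaceW Hc => -[x y] [/= /andP[x1 x2] /andP[y1 y2]].
    split=> /=; apply/andP; split.
    + exact: le_trans aa (le_trans h1 x1).
    + exact: le_trans x2 (le_trans h2 bb).
    + exact: le_trans cc (le_trans h3 y1).
    + exact: le_trans y2 (le_trans h4 dd).
  have glueV c1 d1 : c' <= c1 -> c1 <= d1 -> d1 <= d' ->
     (exists q, pa (rect a' m c1 d1) H q) -> (exists q, pa (rect m b' c1 d1) H q) ->
     exists q, pa (rect a' b' c1 d1) H q.
    move=> h1 h2 h3 [q1 p1] [q2 p2].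
    have E y : c1 <= y <= d1 -> q1 (m, y) - q2 (m, y) = q1 (m, c1) - q2 (m, c1).
      move=> /andP[y1 y2]; apply: esym.
      apply: (@segment_within [set y | c1 <= y <= d1] (fun y => q1 (m, y) - q2 (m, y))) => //=.
        by move=> t /andP[t1 t2]; rewrite t1 (le_trans t2).
      apply: (@pa_lconst _ _ (fun y => H (m, y)) (fun y => H (m, y))
         (q1 \o (fun y => (m, y))) (q2 \o (fun y => (m, y)))) => //.
      + apply: (within_comp (A := rect a' b' c1 d1) (phi := fun y => (m, y)) (H := H)) => //; [|exact: sub].
        by move=> y' /= h; split=> //=; rewrite am mb.
      + apply: pa_comp p1 => // y' /= h; split=> //=; by rewrite am lexx.
      + apply: pa_comp p2 => // y' /= h; split=> //=; by rewrite mb lexx.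
    apply: (@pa_glue _ _ (rect a' m c1 d1) (rect m b' c1 d1) H q1 q2 (q1 (m, c1) - q2 (m, c1))) => //.
    + exact: sub.
    + move=> [x y]; split=> [[/= /andP[x1 x2] yy]|[] [/= /andP[x1 x2] yy]].
      * by have [h|/ltW h] := leP x m; [left|right]; split=> //=; apply/andP.
      * by split=> //=; rewrite x1 (le_trans x2).
      * by split=> //=; rewrite x2 (le_trans _ x1).
    + by move=> t; exact: rect_closed.
    + by move=> t; exact: rect_closed.
    + move=> [x y] [/= /andP[_ x1] yy] [/= /andP[x2 _] _].
      have -> : x = m by apply/eqP; rewrite eq_le x1.
      by rewrite -(E y)// addrC subrK.
  move=> q1 q2 q3 q4.
  have [q5 p5] := glueV _ _ (lexx _) cn nd q1 q2.
  have [q6 p6] := glueV _ _ cn nd (lexx _) q3 q4.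
  have E x : a' <= x <= b' -> q5 (x, n) - q6 (x, n) = q5 (a', n) - q6 (a', n).
    move=> /andP[x1 x2]; apply: esym.
    apply: (@segment_within [set x | a' <= x <= b'] (fun x => q5 (x, n) - q6 (x, n))) => //=.
      by move=> t /andP[t1 t2]; rewrite t1 (le_trans t2).
    apply: (@pa_lconst _ _ (fun x => H (x, n)) (fun x => H (x, n))
       (q5 \o (fun x => (x, n))) (q6 \o (fun x => (x, n)))) => //.
    + apply: (within_comp (A := rect a' b' c' d') (phi := fun x => (x, n)) (H := H)) => //; [|exact: sub].
      by move=> y' /= h; split=> //=; rewrite cn nd.
    + apply: pa_comp p5 => // y' /= h; split=> //=; by rewrite cn lexx.
    + apply: pa_comp p6 => // y' /= h; split=> //=; by rewrite nd lexx.
  apply: (@pa_glue _ _ (rect a' b' c' n) (rect a' b' n d') H q5 q6 (q5 (a', n) - q6 (a', n))) => //.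
  + exact: sub.
  + move=> [x y]; split=> [[/= xx /andP[y1 y2]]|[] [/= xx /andP[y1 y2]]].
    * by have [h|/ltW h] := leP y n; [left|right]; split=> //=; apply/andP.
    * by split=> //=; rewrite y1 (le_trans y2).
    * by split=> //=; rewrite y2 (le_trans _ y1).
  + by move=> t; exact: rect_closed.
  + by move=> t; exact: rect_closed.
  + move=> [x y] [/= xx /andP[_ y1]] [/= _ /andP[y2 _]].
    have -> : y = n by apply/eqP; rewrite eq_le y1.
    by rewrite -(E x)// addrC subrK.
- move=> x y xab ycd; have [p Pp] := Pr_ex (H (x, y)).
  have Axy : rect a b c d (x, y) by split.
  have /nbhs_ballP[dl /= dl0 dH] := within_continuous_near Hc Axy (Pr_near Pp).
  exists dl => // a' b' c' d' aa a'x xb' bb cc c'y yd' dd bd cd'.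
  exists (p \o H) => -[s t] [/= /andP[s1 s2] /andP[t1 t2]]; exists p; last exact: (@filterE _ (nbhs ((s, t) : R * R)) _).
  apply: dH; last first.
    split=> /=; apply/andP; split.
    + exact: le_trans aa s1.
    + exact: le_trans s2 bb.
    + exact: le_trans cc t1.
    + exact: le_trans t2 dd.
  by split; rewrite /ball /=; [apply: near_interval a'x xb' bd s1 s2|apply: near_interval c'y yd' cd' t1 t2].
Qed.

Local Notation I01 := (`[0, 1]%classic : set R).

Let I01P (t : R) : I01 t <-> 0 <= t <= 1. Proof. by rewrite /= in_itv. Qed.

Lemma path_prim (g : R -> T) : {within I01, continuous g} -> exists q, pa I01 g q.
Proof.
move=> gc.
have [|||q qa] := @rect_prim (g \o fst) 0 1 0 0.
- exact: ler01.
- exact: lexx.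
- apply: within_comp gc; first by move=> x; exact: cvg_fst.
  by move=> [x y] [/= ? _]; exact/I01P.
exists (q \o (fun x => (x, 0))); apply: pa_comp qa => //.
by move=> x /I01P x01; split=> //=; rewrite lexx.
Qed.

Lemma pa_uniq (g g' : R -> T) q q' : {within I01, continuous g} -> (forall t, I01 t -> g t = g' t) ->
  pa I01 g q -> pa I01 g' q' -> q 1 - q 0 = q' 1 - q' 0.
Proof.
move=> gc E qa qa'.
have := @segment_within I01 (fun s => q s - q' s) 0 1 ler01 _ (pa_lconst gc E qa qa').
have H t : 0 <= t <= 1 -> I01 t by move/I01P.
move=> /(_ H) e; have -> : q 0 = q 0 - q' 0 + q' 0 by rewrite subrK.
by rewrite e; ring.
Qed.

Lemma pa_cst (g : R -> T) q y : {within I01, continuous g} -> (forall t, I01 t -> g t = y) ->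
  pa I01 g q -> q 0 = q 1.
Proof.
move=> gc E qa; have := @pa_uniq g (fun=> y) q (fun=> 0) gc E qa.
rewrite subrr => /(_ _)/eqP; rewrite subr_eq0 => H; apply: esym; apply/eqP; apply: H.
by move=> t _; have [p Pp] := Pr_ex y; exists p => //; apply: (@filterE _ (nbhs (t : R)) _) => s _; rewrite !subrr.
Qed.

Definition pcat (g1 g2 : R -> T) (t : R) : T := if t <= 2^-1 then g1 (2 * t) else g2 (2 * t - 1).

Let dbl_cont : continuous (fun t : R => 2 * t).
Proof. by move=> t; apply: cvgM; [exact: cvg_cst|exact: cvg_id]. Qed.

Let dbl1_cont : continuous (fun t : R => 2 * t - 1).
Proof. by move=> t; apply: cvgB; [exact: dbl_cont|exact: cvg_cst]. Qed.

Lemma pcat_cont g1 g2 : {within I01, continuous g1} -> {within I01, continuous g2} -> g1 1 = g2 0 ->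
  {within I01, continuous (pcat g1 g2)}.
Proof.
move=> c1 c2 g12; apply/subspace_continuousP => t /I01P t01 U HU'.
have HU : nbhs (pcat g1 g2 t) U := HU'.
have E1 : \forall s \near t, I01 s -> s <= 2^-1 -> U (pcat g1 g2 s).
  have [h|h] := leP t 2^-1.
    have t1 : I01 (2 * t) by apply/I01P; exact: dbl_in1 t01 h.
    rewrite /pcat h in HU; have H := dbl_cont (within_continuous_near c1 t1 HU).
    rewrite nbhs_simpl /= in H.
    apply: filterS H => s /= H /I01P s01 s2; rewrite /pcat s2; apply: H.
    by apply/I01P; exact: dbl_in1 s01 s2.
  have : nbhs t [set x | 2^-1 < x] by apply: open_nbhs_nbhs; split => //; exact: open_gt.
  by apply: filterS => s /= sh _; rewrite leNgt sh.
have E2 : \forall s \near t, I01 s -> 2^-1 < s -> U (pcat g1 g2 s).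
  have [h|h] := leP 2^-1 t.
    have t1 : I01 (2 * t - 1) by apply/I01P; exact: dbl_in2 t01 h.
    have HU2 : nbhs (g2 (2 * t - 1)) U.
      move: HU; rewrite /pcat; case: leP => // h'.
      have -> : t = 2^-1 by apply/eqP; rewrite eq_le h h'.
      by rewrite divff ?pnatr_eq0// subrr g12.
    have H := dbl1_cont (within_continuous_near c2 t1 HU2).
    rewrite nbhs_simpl /= in H.
    apply: filterS H => s /= H /I01P s01 s2; rewrite /pcat leNgt s2 /=; apply: H.
    by apply/I01P; exact: dbl_in2 s01 (ltW s2).
  have : nbhs t [set x | x < 2^-1] by apply: open_nbhs_nbhs; split => //; exact: open_lt.
  by apply: filterS => s /= sh _; rewrite ltNge (ltW sh).
by apply: filterS2 E1 E2 => s e1 e2 s01; have [h|h] := leP s 2^-1; [exact: e1|exact: e2].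
Qed.

Let half_cont : continuous (fun t : R => t / 2).
Proof. by move=> t; apply: cvgM; [exact: cvg_id|exact: cvg_cst]. Qed.

Let half1_cont : continuous (fun t : R => (t + 1) / 2).
Proof. by move=> t; apply: cvgM; [apply: cvgD; [exact: cvg_id|exact: cvg_cst]|exact: cvg_cst]. Qed.

Lemma pa_cat1 g1 g2 q : pa I01 (pcat g1 g2) q -> pa I01 g1 (q \o (fun t => t / 2)).
Proof.
apply: pa_comp; first exact: half_cont.
  by move=> t /I01P t01; apply/I01P; exact: half_in t01.
move=> t /I01P /half_le h; rewrite /pcat h mulrC divfK ?pnatr_eq0//.
Qed.

Lemma pa_cat2 g1 g2 q : g1 1 = g2 0 -> pa I01 (pcat g1 g2) q -> pa I01 g2 (q \o (fun t => (t + 1) / 2)).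
Proof.
move=> g12; apply: pa_comp; first exact: half1_cont.
  by move=> t /I01P t01; apply/I01P; exact: half1_in t01.
move=> t /I01P t01; have e : 2 * ((t + 1) / 2) = t + 1 by rewrite mulrC divfK ?pnatr_eq0.
rewrite /pcat e addrK; case: leP => // h.
have -> : t = 0 by exact: half1_le t01 h.
by rewrite add0r g12.
Qed.

Let rev_cont : continuous (fun t : R => 1 - t).
Proof. by move=> t; apply: cvgB; [exact: cvg_cst|exact: cvg_id]. Qed.

Let rev_in (t : R) : I01 t -> I01 (1 - t).
Proof. by move=> /I01P /andP[t0 t1]; apply/I01P; rewrite subr_ge0 t1 lerBlDr lerDl. Qed.

Hypothesis Tsc : simply_connected R T.

(** Along a null homotopy a primitive exists. It is constant on the three sides of the square where
    the homotopy is constant, hence takes equal values at the ends of the fourth side, which is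
    [g]. *)
Lemma pa_loop (g : R -> T) q : {within I01, continuous g} -> g 0 = g 1 -> pa I01 g q -> q 0 = q 1.
Proof.
move=> gc g01 qa; have [_ _ hl] := Tsc; have [H [Hc H01 H2]] := hl g gc g01.
have RE : I01 `*` I01 = rect 0 1 0 1.
  by apply/seteqP; split=> -[x y] [/= h1 h2]; split; exact/I01P.
rewrite RE in Hc.
have [q' qa'] := rect_prim ler01 ler01 Hc.
have c1 := continuous_subspaceW.
have z0 : 0 <= (0 : R) <= 1 by rewrite lexx ler01.
have o0 : 0 <= (1 : R) <= 1 by rewrite lexx ler01.
have i1 y : 0 <= y <= 1 -> forall x, I01 x -> rect 0 1 0 1 (x, y) by move=> y01 x /I01P.
have i2 x : 0 <= x <= 1 -> forall y, I01 y -> rect 0 1 0 1 (x, y) by move=> x01 y /I01P.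
have e1 : q' (0, 0) = q' (1, 0).
  apply: (@pa_cst (H \o (fun x => (x, 0))) (q' \o (fun x => (x, 0))) (g 0)).
  - exact: within_comp (@cont1 0) (i1 0 z0) Hc.
  - by move=> t /H2[].
  - exact: pa_comp (@cont1 0) (i1 0 z0) _ qa'.
have e2 : q' (0, 1) = q' (1, 1).
  apply: (@pa_cst (H \o (fun x => (x, 1))) (q' \o (fun x => (x, 1))) (g 0)).
  - exact: within_comp (@cont1 1) (i1 1 o0) Hc.
  - by move=> t /H2[].
  - exact: pa_comp (@cont1 1) (i1 1 o0) _ qa'.
have e3 : q' (1, 0) = q' (1, 1).
  apply: (@pa_cst (H \o (fun y => (1, y))) (q' \o (fun y => (1, y))) (g 0)).
  - exact: within_comp (@cont2 1) (i2 1 o0) Hc.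
  - by move=> t /H01[].
  - exact: pa_comp (@cont2 1) (i2 1 o0) _ qa'.
have e4 : q 1 - q 0 = q' (0, 1) - q' (0, 0).
  apply: (@pa_uniq g (H \o (fun y => (0, y))) q (q' \o (fun y => (0, y)))) => //.
  - by move=> t /H01[].
  - exact: pa_comp (@cont2 0) (i2 0 z0) _ qa'.
by apply: esym; apply/eqP; rewrite -subr_eq0 e4 e1 e2 e3 subrr.
Qed.

Hypothesis Tlpc : forall y (U : set T), nbhs y U -> \forall z \near y, exists g : R -> T,
  [/\ {within I01, continuous g}, g 0 = y, g 1 = z & forall t, I01 t -> U (g t)].

Theorem monodromy : exists h : T -> C, forall y p, Pr p y -> \forall z \near y, h z - h y = p z - p y.
Proof.
have [[x0 _] pc _] := Tsc.
pose gam y := projT1 (cid (pc x0 y)).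
have gamc y : {within I01, continuous (gam y)} by rewrite /gam; case: cid => g [].
have gam0 y : gam y 0 = x0 by rewrite /gam; case: cid => g [].
have gam1 y : gam y 1 = y by rewrite /gam; case: cid => g [].
pose Q y := projT1 (cid (path_prim (gamc y))).
have Qpa y : pa I01 (gam y) (Q y) by rewrite /Q; case: cid.
exists (fun y => Q y 1 - Q y 0) => y p Pp.
apply: filterS (Tlpc (Pr_near Pp)) => z [s [sc s0 s1 sU]].
(* The loop: the chosen path to [y], a short path [s] on which [p] is a primitive, and the chosen
   path to [z] backwards. Its total increment is zero, which compares the values of the primitive at
   [y] and [z]. *)
have c1 : {within I01, continuous (pcat (gam y) s)} by apply: pcat_cont => //; rewrite gam1 s0.
have rc : {within I01, continuous (gam z \o (fun t => 1 - t))} by exact: within_comp rev_cont rev_in (gamc z).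
have j : pcat (gam y) s 1 = (gam z \o (fun t => 1 - t)) 0.
  by rewrite /= subr0 gam1 /pcat leNgt invf_lt1 ?ltr0n// ltr1n /= mulr1 -[X in X - 1]natr1 addrK s1.
have c2 := pcat_cont c1 rc j.
have [q qa] := path_prim c2.
have lp : q 0 = q 1.
  apply: pa_loop c2 _ qa.
  rewrite /pcat invr_ge0 ler0n mulr0 /= invr_ge0 ler0n mulr0 gam0.
  by rewrite leNgt invf_lt1 ?ltr0n// ltr1n /= mulr1 -[X in X - 1]natr1 addrK subrr gam0.
have a1 := pa_cat1 qa; have a2 := pa_cat2 j qa.
have a11 := pa_cat1 a1.
have js : gam y 1 = s 0 by rewrite gam1 s0.
have a12 := pa_cat2 js a1.
have a22 : pa I01 (gam z) ((q \o (fun t => (t + 1) / 2)) \o (fun t => 1 - t)).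
  apply: pa_comp a2 => //; move=> t _ /=; by rewrite opprB addrC subrK.
have e1 := pa_uniq (gamc y) (fun _ _ => erefl) (Qpa y) a11.
have e2 := pa_uniq (gamc z) (fun _ _ => erefl) (Qpa z) a22.
have ps : pa I01 s (p \o s).
  by move=> t t01; exists p; [exact: sU|exact: (@filterE _ (nbhs (t : R)) _)].
have e3 := pa_uniq sc (fun _ _ => erefl) ps a12.
rewrite /= s0 s1 in e3; rewrite e1 e2 e3 /= !mul0r.
have h0 : (0 + 1) / 2 / 2 = 1 / 2 / 2 :> R by rewrite add0r.
have h1 : ((1 + 1) / 2) = 1 :> R by rewrite -mulr2n -[1 *+ 2]/(2%:R) divff ?pnatr_eq0.
rewrite subrr subr0 h0 h1 add0r lp; ring.
Qed.

End Monodromy.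

(** * The exterior derivative of a 1-form on a surface *)

Section Curl.
Variable R : realType.
Local Notation C := (cplx R).

Lemma det2 (F : comRingType) (A : 'M[F]_2) : \det A = A 0 0 * A 1 1 - A 0 1 * A 1 0.
Proof.
rewrite (expand_det_row A 0) big_ord_recr big_ord1 /= /cofactor !det_mx11 !mxE /=.
rewrite [lift 0 0](_ : _ = 1); last exact/val_inj.
have -> : widen_ord (leqnSn 1) ord0 = 0 :> 'I_2 by apply/val_inj.
have -> : ord_max = 1 :> 'I_2 by apply/val_inj.
have -> : lift (1 : 'I_2) 0 = 0 by apply/val_inj.
have -> : lift (0 : 'I_2) 0 = 1 by apply/val_inj.
by rewrite /= expr0 expr1 mul1r mulN1r mulrN.
Qed.

Lemma sum2 (V : nmodType) (F : 'I_2 -> V) : \sum_i F i = F 0 + F 1.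
Proof. by rewrite big_ord_recr big_ord1; congr (F _ + F _); apply/val_inj. Qed.

Lemma near_d (V : normedModType C) (u w : V -> C) (v h : V) : (\forall x \near v, u x = w x) ->
  differentiable u v -> 'd u v h = 'd w v h.
Proof.
move=> uw du; have dw := near_differentiable uw du.
have c1 := line_cder h du; have c2 := line_cder h dw.
have [r r0 rH] := (nearP _ _).1 uw.
have {}c1 : cder (fun s : C => w (v + s *: h)) 0 ('d u v h).
  apply: (cder_near _ c1); exists (r / (1 + rn h)).
    by rewrite divr_gt0// ltr_pwDl// rn_ge0.
  move=> s; rewrite subr0 ltr_pdivlMr ?ltr_pwDl ?rn_ge0// => sr.
  apply: rH; rewrite addrC addKr rnZ; apply: le_lt_trans sr.
  by rewrite ler_wpM2l ?rn_ge0// lerDr.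
exact: cder_uniq c1 c2 erefl.
Qed.

Lemma diff_prod2 (V : normedModType C) (a0 b0 a1 b1 : V -> C) (v h : V) :
  differentiable a0 v -> differentiable b0 v -> differentiable a1 v -> differentiable b1 v ->
  differentiable (fun x => a0 x * b0 x + a1 x * b1 x) v /\
  'd (fun x => a0 x * b0 x + a1 x * b1 x : C) v h =
  a0 v * 'd b0 v h + b0 v * 'd a0 v h + (a1 v * 'd b1 v h + b1 v * 'd a1 v h).
Proof.
move=> da0 db0 da1 db1.
have e0 : differentiable (a0 * b0) v by exact: differentiableM.
have e1 : differentiable (a1 * b1) v by exact: differentiableM.
have E : (fun x => a0 x * b0 x + a1 x * b1 x) = a0 * b0 + a1 * b1 by [].
split; first by rewrite E; exact: differentiableD.
rewrite E; apply: etrans (congr1 (fun f : V -> C => f h) (diffD e0 e1)) _.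
rewrite /=; congr (_ + _).
  exact: (congr1 (fun f : V -> C => f h) (diffM da0 db0)).
exact: (congr1 (fun f : V -> C => f h) (diffM da1 db1)).
Qed.

Lemma diff_delta (V : normedModType C) m (g : 'rV[C]_m -> V) (w h : 'rV[C]_m) :
  'd g w h = \sum_i h 0 i *: 'd g w (delta_mx 0 i).
Proof.
rewrite {1}(row_sum_delta h) linear_sum; apply: eq_bigr => i _; exact: linearZ.
Qed.

Lemma diff_comp_entries (V : normedModType C) m (tau : V -> 'rV[C]_m) (g : 'rV[C]_m -> C) (v h : V) :
  differentiable tau v -> differentiable g (tau v) ->
  'd (g \o tau) v h = \sum_i ('d tau v h) 0 i * 'd g (tau v) (delta_mx 0 i).
Proof.
move=> dt dg; apply: etrans (congr1 (fun f : V -> C => f h) (diff_comp dt dg)) _.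
exact: diff_delta.
Qed.

Local Notation V2 := ('rV[C]_2).
Local Notation e i := (delta_mx 0 i : V2).

Definition curl (W : 'I_2 -> V2 -> C) (v : V2) : C := 'd (W 1) v (e 0) - 'd (W 0) v (e 1).

Lemma curl_alg (F : comRingType) (j00 j01 j10 j11 q0 q1 s0 s1 t0 t1 d00 d01 d10 d11 a b x00 x10 x01 x11 : F) :
  s0 = t0 -> s1 = t1 ->
  a = j10 * x00 + q0 * s0 + (j11 * x10 + q1 * s1) -> b = j00 * x01 + q0 * t0 + (j01 * x11 + q1 * t1) ->
  x00 = j00 * d00 + j01 * d10 -> x10 = j00 * d01 + j01 * d11 ->
  x01 = j10 * d00 + j11 * d10 -> x11 = j10 * d01 + j11 * d11 ->
  a - b = (j00 * j11 - j01 * j10) * (d01 - d10).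
Proof. by move=> -> -> -> -> -> -> -> ->; ring. Qed.

(** Exterior derivative commutes with pullback: the second derivatives of [tau] cancel by
    [diff_sym], and the first ones assemble into the determinant. *)
Lemma curl_change (Wp Wq : 'I_2 -> V2 -> C) (tau : V2 -> V2) (v : V2) :
  (\forall x \near v, differentiable tau x) -> (forall l, differentiable (Wq l) (tau v)) ->
  (forall k, differentiable (Wp k) v) ->
  (forall k, \forall x \near v, Wp k x =
     'd (fun y => tau y 0 0 : C) x (e k) * Wq 0 (tau x) + 'd (fun y => tau y 0 1 : C) x (e k) * Wq 1 (tau x)) ->
  curl Wp v = \det (jacobian tau v) * curl Wq (tau v).
Proof.
move=> ndt dq dp H.
have dt : differentiable tau v by exact: nbhs_singleton ndt.
have ndte l : \forall x \near v, differentiable (fun y => tau y 0 l : C) x.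
  by apply: filterS ndt => x; exact: differentiable_entry.
pose J k l : V2 -> C := fun x => 'd (fun y => tau y 0 l : C) x (e k).
have dJ k l : differentiable (J k l) v by have [] := diff_differentiable_aux (e k) (ndte l).
have dqt l : differentiable (Wq l \o tau) v by exact: (differentiable_comp dt (dq l)).
have E k i : 'd (Wp k) v (e i) =
   J k 0 v * 'd (Wq 0 \o tau) v (e i) + (Wq 0 \o tau) v * 'd (J k 0) v (e i) +
   (J k 1 v * 'd (Wq 1 \o tau) v (e i) + (Wq 1 \o tau) v * 'd (J k 1) v (e i)).
  have [_ <-] := diff_prod2 (e i) (dJ k 0) (dqt 0) (dJ k 1) (dqt 1).
  exact: (near_d (e i) (H k) (dp k)).
have S l : 'd (J 1 l) v (e 0) = 'd (J 0 l) v (e 1) by exact: diff_sym.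
have Q l i : 'd (Wq l \o tau) v (e i) = J i 0 v * 'd (Wq l) (tau v) (e 0) + J i 1 v * 'd (Wq l) (tau v) (e 1).
  apply: etrans (diff_comp_entries (e i) dt (dq l)) _.
  apply: etrans (sum2 _) _.
  have en l' : ('d tau v (e i)) 0 l' = J i l' v by apply: esym; exact: diff_entry.
  by rewrite (en 0) (en 1).
have D : \det (jacobian tau v) = J 0 0 v * J 1 1 v - J 0 1 v * J 1 0 v.
  by rewrite det2; congr (_ * _ - _ * _); exact: jac_entry.
rewrite D; exact: (curl_alg (S 0) (S 1) (E 1 0) (E 0 1) (Q 0 0) (Q 1 0) (Q 0 1) (Q 1 1)).
Qed.

End Curl.

Section Forms.
Variable R : realType.
Local Notation C := (cplx R).

Section AnyDim.
Variables (m : nat) (M : cmanifold R m).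
Local Notation I01 := (`[0, 1]%classic : set R).

Lemma manifold_lpc (y : M) (U : set M) : nbhs y U -> \forall z \near y, exists g : R -> M,
  [/\ {within I01, continuous g}, g 0 = y, g 1 = z & forall t, I01 t -> U (g t)].
Proof.
move=> nU; have dp := ch_dom y; set phi := ch y in dp.
have nU' : \forall z \near y, U z by exact: nU.
have n1 := (near_chart U dp).1 nU'.
have [r r0 rH] := (nearP _ _).1 n1; have [s s0 sH] := (nearP _ _).1 (chart_near dp).
have nz : \forall z \near y, rn (phi z - phi y) < Num.min r s.
  have H : \forall v \near phi y, rn (v - phi y) < Num.min r s.
    by apply/nearP; exists (Num.min r s) => //; rewrite lt_min r0.
  exact: chart_map_continuous dp _ H.
apply: filterS2 nz (chart_dom_nbhs dp) => z zr dz.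
pose v (t : R) := phi y + t%:C%C *: (phi z - phi y).
have vr t : I01 t -> rn (v t - phi y) < r /\ rn (v t - phi y) < s.
  rewrite /= in_itv /= => /andP[t0 t1].
  have : rn (v t - phi y) < Num.min r s.
    rewrite /v addrC addKr rnZ rnR ger0_norm//; apply: le_lt_trans zr.
    by rewrite ler_piMl ?rn_ge0.
  by rewrite lt_min => /andP[].
exists (chart_inv phi \o v); split.
- apply/subspace_continuousP => t /vr[_ ts] B HB.
  have [dv vE] := sH _ ts.
  have c : {for v t, continuous (chart_inv phi)}.
    by apply: chart_inv_continuous; exists (chart_inv phi (v t)).
  have H : \forall w \near v t, B (chart_inv phi w) by exact: c _ HB.
  have [d d0 dH] := (nearP _ _).1 H.
  have k0 : 0 < 1 + rn (phi z - phi y) by rewrite ltr_pwDl// rn_ge0.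
  have H2 : nbhs t (fun s' => I01 s' -> B (chart_inv phi (v s'))).
    apply/nbhs_ballP; exists (d / (1 + rn (phi z - phi y))); first by rewrite /= divr_gt0.
    move=> s'; rewrite /ball /= ltr_pdivlMr// => st _; apply: dH.
    rewrite /v opprD addrACA subrr add0r -scalerBl -rmorphB rnZ rnR distrC; apply: le_lt_trans st.
    by rewrite ler_wpM2l ?normr_ge0// lerDr.
  exact: H2.
- by rewrite /= /v rmorph0 scale0r addr0 chart_mapK.
- by rewrite /= /v rmorph1 scale1r addrBK' chart_mapK.
- by move=> t /vr[tr _]; exact: rH.
Qed.

Variable w : chart R m M -> M -> 'cV[C]_m.
Hypothesis wO : oneform w.

Definition Wc (phi : chart R m M) (i : 'I_m) (v : 'rV[C]_m) : C := w phi (chart_inv phi v) i 0.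

Lemma Wc_near phi x i : atlas phi -> chart_dom phi x -> \forall v \near phi x, differentiable (Wc phi i) v.
Proof.
move=> ap dp; apply: filterS (chart_near dp) => v [dv vE].
by have := wO.1 phi (chart_inv phi v) i ap dv; rewrite vE.
Qed.

Definition Pr (p : M -> C) (y : M) := exists phi, [/\ atlas phi, chart_dom phi y &
  \forall v \near phi y, differentiable (p \o chart_inv phi) v /\
    forall h, 'd (p \o chart_inv phi) v h = (h *m w phi (chart_inv phi v)) 0 0].

Lemma Pr_near p y : Pr p y -> \forall z \near y, Pr p z.
Proof.
move=> [phi [ap dp H]].
have H1 := chart_map_continuous dp (near_near H).
have H2 : \forall z \near y, \forall v \near phi z, differentiable (p \o chart_inv phi) v /\
    forall h, 'd (p \o chart_inv phi) v h = (h *m w phi (chart_inv phi v)) 0 0 by exact: H1.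
apply: filterS2 H2 (chart_dom_nbhs dp) => z Hz dz.
by exists phi.
Qed.

Lemma Pr_chart p phi y : atlas phi -> chart_dom phi y -> Pr p y ->
  differentiable (p \o chart_inv phi) (phi y) /\
  forall h, 'd (p \o chart_inv phi) (phi y) h = (h *m w phi y) 0 0.
Proof.
move=> ap dp [psi [aq dq H]].
have [dpp dE] := nbhs_singleton H.
have dtau : differentiable (psi \o chart_inv phi) (phi y) by exact: atlas_compatible.
have tE : (psi \o chart_inv phi) (phi y) = psi y by rewrite /= chart_mapK.
have dpp' : differentiable (p \o chart_inv psi) ((psi \o chart_inv phi) (phi y)).
  by rewrite tE; exact: dpp.
have N : \forall v \near phi y, ((p \o chart_inv psi) \o (psi \o chart_inv phi)) v = (p \o chart_inv phi) v.
  have : \forall z \near y, chart_dom psi z by exact: chart_dom_nbhs.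
  by move/(near_chart _ dp); apply: filterS => v dv /=; rewrite chart_mapK.
have dcomp := differentiable_comp dtau dpp'.
split; first exact: near_differentiable N dcomp.
move=> h; apply: etrans (esym (near_d h N dcomp)) _.
apply: etrans (congr1 (fun f : 'rV[C]_m -> C => f h) (diff_comp dtau dpp')) _.
have dE' := dE ('d (psi \o chart_inv phi) (phi y) h); rewrite chart_mapK// in dE'.
rewrite -tE in dE'; apply: etrans dE' _; rewrite (wO.2 phi psi y ap aq dp dq) mulmxA.
congr ((_ *m _) 0 0); exact: (esym (jac_mul (psi \o chart_inv phi) (phi y) h)).
Qed.

Lemma Pr_uniq p q y : Pr p y -> Pr q y -> \forall z \near y, p z - p y = q z - q y.
Proof.
move=> Pp Pq; have ap := ch_atlas y; have dp := ch_dom y; set phi := ch y in ap dp.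
have nP : \forall z \near y, Pr p z /\ Pr q z by apply: filterI; exact: Pr_near.
move/(near_chart _ dp) : nP => nP.
have H : \forall v \near phi y, differentiable ((p \o chart_inv phi) - (q \o chart_inv phi)) v /\
    forall h, 'd ((p \o chart_inv phi) - (q \o chart_inv phi)) v h = 0.
  apply: filterS2 nP (chart_near dp) => v [Pp' Pq'] [dv vE].
  have [d1 e1] := Pr_chart ap dv Pp'; have [d2 e2] := Pr_chart ap dv Pq'.
  rewrite vE in d1 e1 d2 e2; split; first exact: differentiableB.
  move=> h; apply: etrans (congr1 (fun f : 'rV[C]_m -> C => f h) (diffB d1 d2)) _.
  by apply/eqP; rewrite subr_eq0; apply/eqP; exact: etrans (e1 h) (esym (e2 h)).
have [r r0 rH] := (nearP _ _).1 H.
have Z := @zero_diff_const _ _ ((p \o chart_inv phi) - (q \o chart_inv phi)) (phi y) r r0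
  (fun v hv => (rH v hv).1) (fun v h hv => (rH v hv).2 h).
apply/(near_chart _ dp); apply: filterS Z => v.
rewrite !fctE /= (chart_mapK dp) => e.
have -> : p (chart_inv phi v) = p (chart_inv phi v) - q (chart_inv phi v) + q (chart_inv phi v) by rewrite subrK.
by rewrite e; ring.
Qed.

Lemma Pr_exact : compact [set: M] -> simply_connected R M -> (forall y, exists p, Pr p y) ->
  forall phi x, atlas phi -> chart_dom phi x -> w phi x = 0.
Proof.
move=> cM sM ex phi x ap dp.
have [h hH] := monodromy ex Pr_near Pr_uniq sM manifold_lpc.
have hh : hfun h.
  move=> y; have [p Pp] := ex y.
  have [dd _] := Pr_chart (ch_atlas y) (ch_dom y) Pp.
  have N : \forall v \near ch y y, ((p \o chart_inv (ch y)) - cst (p y - h y)) v = (h \o chart_inv (ch y)) v.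
    have := hH y p Pp; move/(near_chart _ (ch_dom y)); apply: filterS => v e.
    rewrite !fctE /= opprB addrA addrC addrA addrC; have := e; move/eqP; rewrite subr_eq => /eqP ->.
    by ring.
  by apply: near_differentiable N _; apply: differentiableB => //; exact: differentiable_cst.
have [p Pp] := ex x; have [dd dE] := Pr_chart ap dp Pp.
have N : \forall v \near phi x, (p \o chart_inv phi) v = cst (p x) v.
  have := hH x p Pp; move/(near_chart _ dp); apply: filterS => v.
  rewrite (maximum_principle cM (simply_connected_lcc sM) hh (chart_inv phi v) x) subrr /= => /esym/eqP.
  by rewrite subr_eq0 => /eqP.
apply/matrixP => i j; rewrite (ord1 j) [RHS]mxE.
have := dE (delta_mx 0 i); rewrite -rowE mxE => <-.
apply: etrans (near_d _ N dd) _.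
exact: (congr1 (fun f : 'rV[C]_m -> C => f _) (diff_cst _ _)).
Qed.

End AnyDim.
End Forms.

Lemma symm_alg (F : comRingType) (h0 h1 k0 k1 a b c d p q x y : F) :
  p = h0 * a + h1 * b -> q = k0 * a + k1 * b -> x = h0 * c + h1 * d -> y = k0 * c + k1 * d ->
  c = b -> h0 * q + h1 * y = k0 * p + k1 * x.
Proof. by move=> -> -> -> -> ->; ring. Qed.

Lemma expM_eq0 (F : idomainType) (a b c d : F) k : (0 < k)%N -> a ^+ k * b = c * d -> b != 0 -> d = 0 -> a = 0.
Proof. move=> k0 E b0 d0; move: E; rewrite d0 mulr0 => /eqP.
by rewrite mulf_eq0 expf_eq0 k0 (negbTE b0) orbF => /eqP. Qed.

Lemma diff_lin2 (R : realType) (g : 'rV[cplx R]_2 -> cplx R) (v l : 'rV[cplx R]_2) :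
  'd g v l = l 0 0 * 'd g v (delta_mx 0 0) + l 0 1 * 'd g v (delta_mx 0 1).
Proof.
have E : 'd g v l = \sum_i l 0 i *: 'd g v (delta_mx 0 i) by exact: diff_delta.
by rewrite E; exact: sum2.
Qed.

Section Separation.
Variable R : realType.
Local Notation C := (cplx R).

(** The forms x_i - (b_i / b_j) x_j all vanish at [b]; if they vanished at [a] as well, [a] would be
    proportional to [b]. *)
Lemma separating_form N (a b : 'rV[C]_N.+1) : a != 0 -> b != 0 -> line a <> line b ->
  exists u : 'cV[C]_N.+1, (a *m u) 0 0 != 0 /\ (b *m u) 0 0 = 0.
Proof.
move=> a0 b0 ab; have /rV0Pn[j bj] := b0.
have mE (x : 'rV[C]_N.+1) (i k : 'I_N.+1) (c : C) :
    (x *m (delta_mx i 0 - c *: delta_mx k 0) : 'M[C]_1) 0 0 = x 0 i - c * x 0 k.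
  by rewrite mulmxBr -scalemxAr -!colE !mxE.
apply: contrapT => H; apply: ab.
have E i : a 0 i = b 0 i / b 0 j * a 0 j.
  apply/eqP; rewrite -subr_eq0; apply/negPn/negP => n0; apply: H.
  exists (delta_mx i 0 - (b 0 i / b 0 j) *: delta_mx j 0); rewrite !mE; split=> //.
  by rewrite divfK// subrr.
have aE : a = (a 0 j / b 0 j) *: b by apply/rowP => i; rewrite mxE E mulrC mulrA mulrAC.
have c0 : a 0 j / b 0 j != 0.
  by apply: contra_neq a0 => c0; rewrite aE c0 scale0r.
by rewrite aE lineZ.
Qed.

Lemma other_point m (M : cmanifold R m.+1) (x : M) : exists y, y <> x.
Proof.
have dp := ch_dom x; set phi := ch x in dp.
have [r r0 rH] := (nearP _ _).1 (chart_near dp).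
pose e : 'rV[C]_m.+1 := delta_mx 0 0.
have e0 : e != 0 by apply/eqP => /matrixP/(_ 0 0)/eqP; rewrite !mxE !eqxx /= oner_eq0.
have k0 : 0 < 1 + rn e by rewrite ltr_pwDl// rn_ge0.
pose c := (r / (1 + rn e))%:C%C : C.
have c0 : c != 0 by rewrite -rn_gt0 rnR normr_gt0 gt_eqF// divr_gt0.
have vr : rn (phi x + c *: e - phi x) < r.
  rewrite addrC addKr rnZ rnR gtr0_norm ?divr_gt0// mulrAC ltr_pdivrMr//.
  by rewrite ltr_pM2l// ltrDr.
have [dv vE] := rH _ vr.
exists (chart_inv phi (phi x + c *: e)) => E.
move: vE; rewrite E => /esym/eqP; rewrite -subr_eq0 addrC addKr scaler_eq0.
by rewrite (negbTE c0) (negbTE e0).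
Qed.

End Separation.

Section Surface.
Variable R : realType.
Local Notation C := (cplx R).
Variable S : cmanifold R 2.
Variable w : chart R 2 S -> S -> 'cV[C]_2.
Hypothesis wO : oneform w.

Lemma curl_chart phi psi x : atlas phi -> atlas psi -> chart_dom phi x -> chart_dom psi x ->
  curl (Wc w phi) (phi x) = \det (jacobian (psi \o chart_inv phi) (phi x)) * curl (Wc w psi) (psi x).
Proof.
move=> ap aq dp dq.
have tE : (psi \o chart_inv phi) (phi x) = psi x by rewrite /= chart_mapK.
have nd := holo_near_chart (holomorphic_id S) ap aq dp dq.
rewrite -[in RHS]tE.
apply: curl_change.
- exact: nd.
- by move=> l; rewrite tE; exact: nbhs_singleton (Wc_near wO l aq dq).
- by move=> k; exact: nbhs_singleton (Wc_near wO k ap dp).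
- move=> k.
  have nq : \forall y \near x, chart_dom psi y by exact: chart_dom_nbhs.
  move/(near_chart _ dp) : nq => nq.
  apply: filterS3 nd nq (chart_near dp) => v dv qv [pv vE].
  have e := wO.2 phi psi (chart_inv phi v) ap aq pv qv.
  have je l : Jc phi psi (@idfun S) (chart_inv phi v) k l =
     'd (fun y => (psi \o chart_inv phi) y 0 l : C) v (delta_mx 0 k).
    rewrite /Jc vE; exact: jac_entry dv.
  have we l : w psi (chart_inv phi v) l 0 = Wc w psi l ((psi \o chart_inv phi) v).
    by rewrite /Wc /= chart_mapK.
  have e' := congr1 (fun A : 'cV[C]_2 => A k 0) e; rewrite [in X in _ = X]mxE in e'.
  apply: etrans e' _; apply: etrans (sum2 _) _.
  exact: (f_equal2 +%R (f_equal2 *%R (je 0) (we 0)) (f_equal2 *%R (je 1) (we 1))).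
Qed.

Lemma curl_differentiable phi x : atlas phi -> chart_dom phi x -> differentiable (curl (Wc w phi)) (phi x).
Proof.
move=> ap dp.
have [d1 _] := diff_differentiable_aux (delta_mx 0 0) (Wc_near wO 1 ap dp).
have [d0 _] := diff_differentiable_aux (delta_mx 0 1) (Wc_near wO 0 ap dp).
exact: differentiableB d1 d0.
Qed.

Hypothesis cS : compact [set: S].
Hypothesis lS : lcc S.
Hypothesis aS : anticanonical_ample S.

(* [curl w], a section of [K], multiplied [k] times by itself and by a section of [-kK] is a function. *)
Lemma curl_eq0 phi x : atlas phi -> chart_dom phi x -> curl (Wc w phi) (phi x) = 0.
Proof.
move=> ap dp; have [k k0 [N [s [f [sec fE [_ finj _]]]]]] := aS.
have [q qx] := other_point x.
pose row psi y : 'rV[C]_N.+1 := \row_i s i psi y.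
have [a0 fx] := fE _ _ ap dp; have [b0 fq] := fE _ _ (ch_atlas q) (ch_dom q).
(* This combination of the sections vanishes at [q] and not at [x]. The constant function [F] is
   then zero, as is the curl at [x]. *)
have [|u [ua ub]] := separating_form a0 b0.
  by rewrite -fx -fq => /finj/esym.
pose su psi y : C := (row psi y *m u) 0 0.
have suE psi y : su psi y = \sum_i s i psi y * u i 0.
  by rewrite /su mxE; apply: eq_bigr => i _; rewrite mxE.
pose F y := curl (Wc w (ch y)) (ch y y) ^+ k * su (ch y) y.
have FE psi y : atlas psi -> chart_dom psi y -> F y = curl (Wc w psi) (psi y) ^+ k * su psi y.
  move=> aq dq; have c := curl_chart (ch_atlas y) aq (ch_dom y) dq.
  rewrite /F c exprMn mulrAC mulrC; congr (_ * _).
  rewrite !suE mulr_sumr; apply: eq_bigr => i _.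
  by rewrite ((sec i).2 (ch y) psi y (ch_atlas y) aq (ch_dom y) dq) mulrA.
have hF : hfun F.
  move=> y; have at_ := ch_atlas y; have dt := ch_dom y; set th := ch y in at_ dt.
  apply/(hfun_chart F at_ dt).
  have N1 : \forall v \near th y, curl (Wc w th) v ^+ k * su th (chart_inv th v) = (F \o chart_inv th) v.
    apply: filterS (chart_near dt) => v [dv vE].
    by rewrite /= (FE th _ at_ dv) vE.
  apply: near_differentiable N1 _; apply: differentiableM.
    by apply: differentiable_expr; exact: curl_differentiable.
  have -> : (fun v => su th (chart_inv th v)) = \sum_i (fun v => (s i th \o chart_inv th) v * u i 0 : C).
    by apply/funext => v; rewrite fct_sumE suE.
  apply: differentiable_sum => i; apply: differentiableM; last exact: differentiable_cst.
  exact: (sec i).1.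
have E := maximum_principle cS lS hF x q.
have {}E := etrans (esym (FE phi x ap dp)) (etrans E (FE (ch q) q (ch_atlas q) (ch_dom q))).
exact: (expM_eq0 k0 E ua ub).
Qed.

Lemma Pr_ex y : exists p, Pr w p y.
Proof.
have ap := ch_atlas y; have dp := ch_dom y; set phi := ch y in ap dp.
have [M0 [r0 r00 [h0 b0]]] := hb_data (Wc_near wO 0 ap dp).
have [M1 [r1 r10 [h1 b1]]] := hb_data (Wc_near wO 1 ap dp).
have [r2 r20 h2] := (nearP _ _).1 (chart_near dp).
pose r := Num.min r0 (Num.min r1 r2).
have rp : 0 < r by rewrite !lt_min r00 r10.
have rP v : rn (v - phi y) < r -> [/\ rn (v - phi y) < r0, rn (v - phi y) < r1 & rn (v - phi y) < r2].
  by rewrite !lt_min => /and3P[].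
have H0 : hb (Wc w phi 0) (phi y) r by move=> v /rP[? _ _]; exact: h0.
have H1 : hb (Wc w phi 1) (phi y) r by move=> v /rP[_ ? _]; exact: h1.
have B0 z : rn (z - phi y) < r -> rn (Wc w phi 0 z) <= Num.max M0 M1.
  by move=> /rP[h _ _]; rewrite le_max b0.
have B1 z : rn (z - phi y) < r -> rn (Wc w phi 1 z) <= Num.max M0 M1.
  by move=> /rP[_ h _]; rewrite le_max b1 ?orbT.
have cl (v h k : 'rV[C]_2) : rn (v - phi y) < r ->
  h 0 0 * 'd (Wc w phi 0) v k + h 0 1 * 'd (Wc w phi 1) v k =
  k 0 0 * 'd (Wc w phi 0) v h + k 0 1 * 'd (Wc w phi 1) v h.
  move=> /rP[_ _ v2]; have [dv vE] := h2 v v2.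
  have c := curl_eq0 ap dv; rewrite vE in c.
  have e : 'd (Wc w phi 1) v (delta_mx 0 0) = 'd (Wc w phi 0) v (delta_mx 0 1).
    by apply/eqP; rewrite -subr_eq0; apply/eqP.
  have E j l : 'd (Wc w phi j) v l = l 0 0 * 'd (Wc w phi j) v (delta_mx 0 0) + l 0 1 * 'd (Wc w phi j) v (delta_mx 0 1).
    exact: diff_lin2.
  exact: (symm_alg (E 0 h) (E 0 k) (E 1 h) (E 1 k) e).
pose P := om_prim (Wc w phi 0) (Wc w phi 1) (phi y).
have PD v : rn (v - phi y) < r / 4 -> differentiable P v /\ 'd P v = om (Wc w phi 0) (Wc w phi 1) v :> (_ -> _).
  by apply: om_prim_diff rp H0 H1 B0 B1 cl v.
exists (P \o phi); exists phi; split=> //.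
have E : \forall v \near phi y, P v = ((P \o phi) \o chart_inv phi) v.
  by apply: filterS (chart_near dp) => v [_ vE]; rewrite /= vE.
have Q : \forall v \near phi y, differentiable P v /\ 'd P v = om (Wc w phi 0) (Wc w phi 1) v :> (_ -> _).
  by apply/nearP; exists (r / 4) => //; rewrite divr_gt0 ?ltr0n.
apply: filterS2 (near_near E) Q => v Ev [dP dE]; split; first exact: near_differentiable Ev dP.
move=> h; apply: etrans (esym (near_d h Ev dP)) _.
apply: etrans (congr1 (fun f : 'rV[C]_2 -> C => f h) dE) _.
by rewrite mxE; apply: esym; exact: sum2.
Qed.

End Surface.

Lemma del_pezzo_noforms (R : realType) (S : cmanifold R 2) : del_pezzo S -> noforms S.
Proof.
move=> [[cS _] sS aS] w wO phi x ap dp.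
exact: (Pr_exact wO cS sS (Pr_ex wO cS (simply_connected_lcc sS) aS)).
Qed.

(** * Isomorphisms between products *)

Section ProductJacobians.
Variable R : realType.
Local Notation C := (cplx R).

Lemma holomorphic_cst m n (M : cmanifold R m) (N : cmanifold R n) (c : N) : holomorphic (fun _ : M => c).
Proof.
split; first exact: cst_continuous.
move=> phi psi x _ _ _ _; exact: differentiable_cst.
Qed.

Lemma hfun_comp m n (M : cmanifold R m) (N : cmanifold R n) (f : M -> N) (h : N -> C) x :
  holomorphic f -> hfun_at h (f x) -> hfun_at (h \o f) x.
Proof.
move=> hf hh; have ap := ch_atlas x; have dp := ch_dom x.
have aq := ch_atlas (f x); have dq := ch_dom (f x); set psi := ch (f x) in aq dq.
have dc : differentiable ((h \o chart_inv psi) \o (psi \o f \o chart_inv (ch x))) (ch x x).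
  apply: differentiable_comp; first exact: hf.2.
  by rewrite /= chart_mapK//; exact: hh.
apply: near_differentiable dc.
have : \forall y \near x, chart_dom psi (f y) by exact: hf.1 (chart_dom_nbhs dq).
by move/(near_chart _ dp); apply: filterS => v dv /=; rewrite chart_mapK.
Qed.

Lemma near_hfun m (M : cmanifold R m) (h k : M -> C) x : (\forall y \near x, h y = k y) ->
  hfun_at h x -> hfun_at k x.
Proof.
by move=> /(near_chart _ (ch_dom x)) e; exact: near_differentiable.
Qed.

Lemma hfun_sum m (M : cmanifold R m) l (h : 'I_l -> M -> C) x :
  (forall i, hfun_at (h i) x) -> hfun_at (fun y => \sum_i h i y) x.
Proof.
move=> H; rewrite /hfun_at.
have -> : (fun y => \sum_i h i y) \o chart_inv (ch x) = \sum_i (h i \o chart_inv (ch x)).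
  by apply/funext => v; rewrite fct_sumE.
by apply: differentiable_sum => i; exact: H.
Qed.

Lemma hfun_mul m (M : cmanifold R m) (h k : M -> C) x :
  hfun_at h x -> hfun_at k x -> hfun_at (fun y => h y * k y) x.
Proof. exact: differentiableM. Qed.

Section Basic.
Variables (m n : nat) (M : cmanifold R m) (N : cmanifold R n).

Lemma Jc_hfun (phi : chart R m M) (psi : chart R n N) f x i j : holomorphic f -> atlas phi -> atlas psi ->
  chart_dom phi x -> chart_dom psi (f x) -> hfun_at (fun z => Jc phi psi f z i j) x.
Proof.
move=> hf ap aq dp dq; apply/(hfun_chart _ ap dp).
exact: Jc_differentiable.
Qed.

Lemma Jc_cst (phi : chart R m M) (psi : chart R n N) (c : N) x : Jc phi psi (fun _ => c) x = 0.
Proof.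
apply/matrixP => i j; apply: etrans (jac_entry _ _ (differentiable_cst (psi c) (phi x))) _.
rewrite [RHS]mxE.
exact: (congr1 (fun f : 'rV[C]_m -> C => f _) (diff_cst (psi c 0 j : C) (phi x))).
Qed.

Lemma Jc_trans (phi psi : chart R m M) x : atlas phi -> atlas psi -> chart_dom phi x -> chart_dom psi x ->
  Jc phi psi (@idfun M) x *m Jc psi phi (@idfun M) x = 1%:M.
Proof.
move=> ap aq dp dq.
have := Jc_chain (holomorphic_id M) (holomorphic_id M) ap aq ap dp dq dp.
by move=> <-; exact: Jc_id.
Qed.

Lemma Jc_pair l (L : cmanifold R l) (th : chart R l L) (phi : chart R m M) (psi : chart R n N)
    (u : L -> M) (v : L -> N) z :
  holomorphic u -> holomorphic v -> atlas th -> atlas phi -> atlas psi ->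
  chart_dom th z -> chart_dom phi (u z) -> chart_dom psi (v z) ->
  Jc (N := prod_manifold M N) th (prod_chart phi psi) (fun z => (u z, v z)) z =
  row_mx (Jc th phi u z) (Jc th psi v z).
Proof.
move=> hu hv at_ ap aq dt dp dq.
have hp := holomorphic_pair hu hv.
have ac : @atlas _ _ (prod_manifold M N) (prod_chart phi psi) by exists phi => //; exists psi.
have dF := hp.2 th (prod_chart phi psi) z at_ ac dt (conj dp dq).
have du := hu.2 _ _ _ at_ ap dt dp; have dv := hv.2 _ _ _ at_ aq dt dq.
apply/matrixP => i j; apply: etrans (jac_entry _ _ dF) _.
rewrite -(splitK j); case: (fintype.split j) => k /=.
- rewrite row_mxEl; apply: etrans (esym (jac_entry i k du)).
  have E : (fun w => (prod_chart phi psi \o (fun z => (u z, v z)) \o chart_inv th) w 0 (lshift n k) : C) =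
      (fun w => (phi \o u \o chart_inv th) w 0 k : C) by apply/funext => w; exact: row_mxEl.
  exact: (congr1 (fun g : _ -> C => 'd g (th z) (delta_mx 0 i)) E).
- rewrite row_mxEr; apply: etrans (esym (jac_entry i k dv)).
  have E : (fun w => (prod_chart phi psi \o (fun z => (u z, v z)) \o chart_inv th) w 0 (rshift m k) : C) =
      (fun w => (psi \o v \o chart_inv th) w 0 k : C) by apply/funext => w; exact: row_mxEr.
  exact: (congr1 (fun g : _ -> C => 'd g (th z) (delta_mx 0 i)) E).
Qed.

End Basic.

Section Product.
Variables (m n : nat) (M : cmanifold R m) (N : cmanifold R n).
Local Notation MN := (prod_manifold M N).

Definition inl_at (y : N) (x : M) : MN := (x, y).
Definition inr_at (x : M) (y : N) : MN := (x, y).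

Lemma holomorphic_inl y : holomorphic (inl_at y).
Proof. exact: holomorphic_pair (holomorphic_id M) (holomorphic_cst M y). Qed.

Lemma holomorphic_inr x : holomorphic (inr_at x).
Proof. exact: holomorphic_pair (holomorphic_cst N x) (holomorphic_id N). Qed.

Variables (p : nat) (P : cmanifold R p) (k : MN -> P).
Hypothesis hk : holomorphic k.

Lemma Jc_prod (phi : chart R m M) (psi : chart R n N) (th : chart R p P) x y :
  atlas phi -> atlas psi -> atlas th -> chart_dom phi x -> chart_dom psi y -> chart_dom th (k (x, y)) ->
  Jc (M := MN) (prod_chart phi psi) th k (x, y) =
  col_mx (Jc phi th (k \o inl_at y) x) (Jc psi th (k \o inr_at x) y).
Proof.
move=> ap aq at_ dp dq dt.
have ac : @atlas _ _ MN (prod_chart phi psi) by exists phi => //; exists psi.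
have dc : chart_dom (prod_chart phi psi) ((x, y) : MN) by split.
have e1 := Jc_chain (holomorphic_inl y) hk ap ac at_ dp dc dt.
have e2 := Jc_chain (holomorphic_inr x) hk aq ac at_ dq dc dt.
have p1 := Jc_pair (holomorphic_id M) (holomorphic_cst M y) ap ap aq dp dp dq.
have p2 := Jc_pair (holomorphic_cst N x) (holomorphic_id N) aq ap aq dq dp dq.
rewrite (Jc_id ap dp) (Jc_cst phi psi y x) in p1; rewrite (Jc_id aq dq) (Jc_cst psi phi x y) in p2.
rewrite e1 e2 [Jc phi _ (inl_at y) x]p1 [Jc psi _ (inr_at x) y]p2.
move: (Jc _ th k _) => J; rewrite -[in LHS](vsubmxK J) -[in RHS](vsubmxK J) !mul_row_col.
by rewrite !mul1mx !mul0mx addr0 add0r.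
Qed.

Lemma Jc_chain2 l (L : cmanifold R l) (u : L -> M) (v : L -> N) z
  (ze : chart R l L) (phi : chart R m M) (psi : chart R n N) (th : chart R p P) :
  holomorphic u -> holomorphic v -> atlas ze -> atlas phi -> atlas psi -> atlas th ->
  chart_dom ze z -> chart_dom phi (u z) -> chart_dom psi (v z) -> chart_dom th (k (u z, v z)) ->
  Jc ze th (fun z => k (u z, v z)) z =
  Jc ze phi u z *m Jc phi th (k \o inl_at (v z)) (u z) + Jc ze psi v z *m Jc psi th (k \o inr_at (u z)) (v z).
Proof.
move=> hu hv az ap aq at_ dz dp dq dt.
have ac : @atlas _ _ MN (prod_chart phi psi) by exists phi => //; exists psi.
have dc : chart_dom (prod_chart phi psi) ((u z, v z) : MN) by split.
apply: etrans (Jc_chain (holomorphic_pair hu hv) hk az ac at_ dz dc dt) _.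
by rewrite (Jc_pair hu hv az ap aq dz dp dq) (Jc_prod ap aq at_ dp dq dt) mul_row_col.
Qed.

Lemma Jc_inl_hfun (phi : chart R m M) (th : chart R p P) q i j : atlas phi -> atlas th ->
  chart_dom phi q.1 -> chart_dom th (k q) ->
  hfun_at (M := MN) (fun q => Jc phi th (k \o inl_at q.2) q.1 i j) q.
Proof.
move=> ap at_ dp dt; have aq := ch_atlas q.2; have dq := ch_dom q.2; set psi := ch q.2 in aq dq.
have ac : @atlas _ _ MN (prod_chart phi psi) by exists phi => //; exists psi.
have dc : chart_dom (prod_chart phi psi) (q : MN) by split.
have := Jc_hfun (lshift n i) j hk ac at_ dc dt; apply: near_hfun.
have n1 : \forall z \near q, chart_dom th (k z) by exact: hk.1 (chart_dom_nbhs dt).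
apply: filterS2 n1 (chart_dom_nbhs dc) => -[x y] dt' [dp' dq'].
by rewrite (Jc_prod ap aq at_ dp' dq' dt') col_mxEu.
Qed.

End Product.

(** [b] is a holomorphic section over [M] of the cotangent bundle of [N] pulled back by [f]; the
    jacobian of [f] turns it into a 1-form on [M]. *)
Lemma oneform_along m n (M : cmanifold R m) (N : cmanifold R n) (f : M -> N)
    (b : chart R n N -> M -> 'cV[C]_n) : holomorphic f ->
  (forall psi x i, atlas psi -> chart_dom psi (f x) -> hfun_at (fun z => b psi z i 0) x) ->
  (forall psi th x, atlas psi -> atlas th -> chart_dom psi (f x) -> chart_dom th (f x) ->
     b psi x = Jc psi th (@idfun N) (f x) *m b th x) ->
  oneform (fun phi x => Jc phi (ch (f x)) f x *m b (ch (f x)) x) /\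
  forall phi psi x, atlas phi -> atlas psi -> chart_dom phi x -> chart_dom psi (f x) ->
    Jc phi (ch (f x)) f x *m b (ch (f x)) x = Jc phi psi f x *m b psi x.
Proof.
move=> hf hb bt.
have WE phi psi x : atlas phi -> atlas psi -> chart_dom phi x -> chart_dom psi (f x) ->
    Jc phi (ch (f x)) f x *m b (ch (f x)) x = Jc phi psi f x *m b psi x.
  move=> ap aq dp dq; have ac := ch_atlas (f x); have dc := ch_dom (f x).
  have e := bt (ch (f x)) psi x ac aq dc dq.
  have e' : Jc phi psi f x = Jc phi (ch (f x)) f x *m Jc (ch (f x)) psi (@idfun N) (f x).
    exact: (Jc_chain hf (holomorphic_id N) ap ac aq dp dc dq).
  by rewrite e e' mulmxA.
split=> //; split=> [phi x i ap dp|phi th x ap at_ dp dt]; last first.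
  have e' : Jc phi (ch (f x)) f x = Jc phi th (@idfun M) x *m Jc th (ch (f x)) f x.
    exact: (Jc_chain (holomorphic_id M) hf ap at_ (ch_atlas _) dp dt (ch_dom _)).
  by rewrite e' mulmxA.
have ac := ch_atlas (f x); have dc := ch_dom (f x); set ps := ch (f x) in ac dc.
pose h z : C := (Jc phi (ch (f z)) f z *m b (ch (f z)) z) i 0.
suff hh : hfun_at h x by exact: ((hfun_chart h ap dp).1 hh).
apply: (@near_hfun _ _ (fun z => \sum_l Jc phi ps f z i l * b ps z l 0)).
  have nd : \forall z \near x, chart_dom ps (f z) by exact: hf.1 (chart_dom_nbhs dc).
  by apply: filterS2 nd (chart_dom_nbhs dp) => z dz dz'; rewrite /h (WE phi ps)// mxE.
by apply: hfun_sum => l; apply: hfun_mul; [exact: Jc_hfun|exact: hb].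
Qed.

Lemma noforms_along m n (M : cmanifold R m) (N : cmanifold R n) (f : M -> N)
    (b : chart R n N -> M -> 'cV[C]_n) : noforms M -> holomorphic f ->
  (forall psi x i, atlas psi -> chart_dom psi (f x) -> hfun_at (fun z => b psi z i 0) x) ->
  (forall psi th x, atlas psi -> atlas th -> chart_dom psi (f x) -> chart_dom th (f x) ->
     b psi x = Jc psi th (@idfun N) (f x) *m b th x) ->
  forall phi psi x, atlas phi -> atlas psi -> chart_dom phi x -> chart_dom psi (f x) ->
    Jc phi psi f x *m b psi x = 0.
Proof.
move=> nM hf hb bt phi psi x ap aq dp dq; have [wO wE] := oneform_along hf hb bt.
by rewrite -(wE phi psi x ap aq dp dq); exact: nM wO phi x ap dp.
Qed.

Lemma pullback_form0 m n (M : cmanifold R m) (N : cmanifold R n) (f : M -> N) w : noforms M ->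
  holomorphic f -> oneform (M := N) w ->
  forall phi psi x, atlas phi -> atlas psi -> chart_dom phi x -> chart_dom psi (f x) ->
    Jc phi psi f x *m w psi (f x) = 0.
Proof.
move=> nM hf [wd wt]; apply: (noforms_along nM hf (b := fun psi x => w psi (f x))).
  move=> psi x i aq dq; apply: (hfun_comp (h := fun z => w psi z i 0) hf).
  exact: ((hfun_chart (fun z => w psi z i 0) aq dq).2 (wd psi (f x) i aq dq)).
by move=> psi th x aq at_ dq dt; exact: wt.
Qed.

(** The identity of [N] factors through [M], so a form on [N] is the pullback by [i] of its pullback
    by [r], which vanishes. *)
Lemma noforms_retract m n (M : cmanifold R m) (N : cmanifold R n) (i : N -> M) (r : M -> N) :
  holomorphic i -> holomorphic r -> cancel i r -> noforms M -> noforms N.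
Proof.
move=> hi hr ir nM w wO phi x ap dp.
have ai := ch_atlas (i x); have di := ch_dom (i x); set th := ch (i x) in ai di.
have dp' : chart_dom phi (r (i x)) by rewrite ir.
have E := pullback_form0 nM hr wO ai ap di dp'; rewrite ir in E.
have E1 := Jc_chain hi hr ap ai ap dp di dp'.
have ri : r \o i = idfun by apply/funext => z /=; rewrite ir.
by rewrite ri (Jc_id ap dp) in E1; rewrite -[LHS]mul1mx E1 -mulmxA E mulmx0.
Qed.

Lemma noforms_prod m n (M : cmanifold R m) (N : cmanifold R n) : noforms M -> noforms N ->
  noforms (prod_manifold M N).
Proof.
move=> nM nN w wO _ [x y] [phi ap [psi aq ->]] [/= dp dq].
have ac : @atlas _ _ (prod_manifold M N) (prod_chart phi psi) by exists phi => //; exists psi.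
have e1 := pullback_form0 nM (holomorphic_inl M y) wO ap ac dp (conj dp dq).
have e2 := pullback_form0 nN (holomorphic_inr N x) wO aq ac dq (conj dp dq).
rewrite (Jc_pair (holomorphic_id M) (holomorphic_cst M y) ap ap aq dp dp dq) in e1.
rewrite (Jc_pair (holomorphic_cst N x) (holomorphic_id N) aq ap aq dq dp dq) in e2.
rewrite (Jc_id ap dp) (Jc_cst phi psi y x) -(vsubmxK (w _ _)) mul_row_col mul1mx mul0mx addr0 in e1.
rewrite (Jc_id aq dq) (Jc_cst psi phi x y) -(vsubmxK (w _ _)) mul_row_col mul1mx mul0mx add0r in e2.
by rewrite -[LHS]vsubmxK e1 e2 col_mx0.
Qed.

End ProductJacobians.

(** * Idempotent matrices *)

Section Idempotents.
Variable R : realType.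
Local Notation C := (cplx R).

Lemma idem_factor n r (A : 'M[C]_(n, r)) (B : 'M[C]_(r, n)) X Y : B *m X = 1%:M -> Y *m A = 1%:M ->
  (A *m B) *m (A *m B) = A *m B -> B *m A = 1%:M.
Proof.
move=> BX YA E; have := congr1 (fun Z => Y *m Z *m X) E.
have -> : Y *m (A *m B *m (A *m B)) *m X = (Y *m A) *m (B *m A) *m (B *m X) by rewrite !mulmxA.
have -> : Y *m (A *m B) *m X = (Y *m A) *m (B *m X) by rewrite !mulmxA.
by rewrite BX YA !mul1mx mulmx1.
Qed.

(** In the rank factorization the two factors, multiplied in the other order, give the identity
    matrix of size the rank. *)
Lemma idem_trace n (E : 'M[C]_n) : E *m E = E -> \tr E = (\rank E)%:R.
Proof.
move=> EE; have [X XE] := row_freeP (row_base_free E); have [Y YE] := row_fullP (col_base_full E).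
have H : row_base E *m col_base E = 1%:M.
  by apply: idem_factor XE YE _; rewrite mulmx_base.
by rewrite -{1}(mulmx_base E) mxtrace_mulC H mxtrace1.
Qed.

Lemma idem_full n (E : 'M[C]_n) : E *m E = E -> \tr E = n%:R -> E = 1%:M.
Proof.
move=> EE; rewrite (idem_trace EE) => /eqP; rewrite eqr_nat => rE.
have uE : E \in unitmx by rewrite -row_free_unit.
by rewrite -[LHS]mulmx1 -(mulmxV uE) mulmxA EE.
Qed.

Lemma idem_zero n (E : 'M[C]_n) : E *m E = E -> \tr E = 0 -> E = 0.
Proof.
by move=> EE; rewrite (idem_trace EE) => /eqP; rewrite pnatr_eq0 mxrank_eq0 => /eqP.
Qed.

Lemma mulmx1C_cast m n (A : 'M[C]_(m, n)) (B : 'M[C]_(n, m)) : m = n -> A *m B = 1%:M -> B *m A = 1%:M.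
Proof. by move=> mn; move: A B; case: _ / mn => A B; exact: mulmx1C. Qed.

Lemma mx_killl m k l (X : 'M[C]_(m, k)) Y (Z : 'M[C]_(m, l)) : X *m Y = 1%:M -> Y *m Z = 0 -> Z = 0.
Proof. by move=> XY YZ; rewrite -[LHS]mul1mx -XY -mulmxA YZ mulmx0. Qed.

Lemma mx_killr m k l (X : 'M[C]_(m, k)) Y (Z : 'M[C]_(l, m)) : X *m Y = 1%:M -> Z *m X = 0 -> Z = 0.
Proof. by move=> XY ZX; rewrite -[LHS]mulmx1 -XY mulmxA ZX mul0mx. Qed.

(** Turns the continuity of a trace into the local constancy of a rank. *)
Lemma natr_dist1 (a b : nat) : rn (a%:R - b%:R : C) < 1 -> a = b.
Proof.
wlog ab : a b / (a <= b)%N.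
  move=> H h; have [ab|/ltnW ab] := leqP a b; first exact: H.
  by apply: esym; apply: H; rewrite // rnBC.
rewrite rnBC -natrB// -[X in rn X](rmorph_nat (real_complex R)) rnR normr_nat ltrn1 => ba.
by apply/eqP; rewrite eqn_leq ab /= -subn_eq0 -leqn0 -ltnS.
Qed.

End Idempotents.

(** * Jacobian blocks of an isomorphism of products *)

Section Isomorphism.
Variable R : realType.
Local Notation C := (cplx R).

Record pairiso m n m' n' (M : cmanifold R m) (N : cmanifold R n) (M' : cmanifold R m') (N' : cmanifold R n')
  (F : prod_manifold M N -> prod_manifold M' N') (G : prod_manifold M' N' -> prod_manifold M N) := PairIso {
  iso_F : holomorphic F; iso_G : holomorphic G; iso_FK : cancel F G; iso_GK : cancel G F }.

Section Relations.
Variables (m n m' n' : nat) (M : cmanifold R m) (N : cmanifold R n) (M' : cmanifold R m') (N' : cmanifold R n').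
Variables (F : prod_manifold M N -> prod_manifold M' N') (G : prod_manifold M' N' -> prod_manifold M N).
Hypothesis FG : pairiso F G.

Let hF := iso_F FG. Let hG := iso_G FG.
Let f (p : prod_manifold M N) : M' := (F p).1.
Let g (p : prod_manifold M N) : N' := (F p).2.
Let h (p : prod_manifold M' N') : M := (G p).1.
Let k (p : prod_manifold M' N') : N := (G p).2.

Let hf : holomorphic f. Proof. exact: holomorphic_comp hF (@holomorphic_fst _ _ _ _ _). Qed.
Let hg : holomorphic g. Proof. exact: holomorphic_comp hF (@holomorphic_snd _ _ _ _ _). Qed.
Let hh : holomorphic h. Proof. exact: holomorphic_comp hG (@holomorphic_fst _ _ _ _ _). Qed.
Let hk : holomorphic k. Proof. exact: holomorphic_comp hG (@holomorphic_snd _ _ _ _ _). Qed.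

Variables (phi : chart R m M) (psi : chart R n N) (phi' : chart R m' M') (psi' : chart R n' N').
Variable p : prod_manifold M N.
Hypotheses (ap : atlas phi) (aq : atlas psi) (ap' : atlas phi') (aq' : atlas psi').
Hypotheses (dp : chart_dom phi p.1) (dq : chart_dom psi p.2)
  (dp' : chart_dom phi' (F p).1) (dq' : chart_dom psi' (F p).2).

Local Notation A := (Jc phi phi' (fun x => (F (x, p.2)).1) p.1).
Local Notation B := (Jc phi psi' (fun x => (F (x, p.2)).2) p.1).
Local Notation A' := (Jc phi' phi (fun x => (G (x, (F p).2)).1) (F p).1).
Local Notation B' := (Jc phi' psi (fun x => (G (x, (F p).2)).2) (F p).1).
Local Notation C' := (Jc psi' phi (fun y => (G ((F p).1, y)).1) (F p).2).
Local Notation D' := (Jc psi' psi (fun y => (G ((F p).1, y)).2) (F p).2).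

Lemma iso_id : A *m A' + B *m C' = 1%:M.
Proof.
have dh : chart_dom phi (h (f p, g p)) by rewrite /h /f /g -surjective_pairing (iso_FK FG).
have := Jc_chain2 hh (u := fun x => f (x, p.2)) (v := fun x => g (x, p.2))
   (holomorphic_comp (holomorphic_inl M p.2) hf) (holomorphic_comp (holomorphic_inl M p.2) hg) (z := p.1)
   ap ap' aq' ap.
rewrite /= -(surjective_pairing p) => /(_ dp dp' dq' dh) <-.
rewrite -(Jc_id ap dp); congr (Jc _ _ _ _).
by apply/funext => x; rewrite /h /f /g -surjective_pairing (iso_FK FG).
Qed.

Lemma iso_cst : A *m B' + B *m D' = 0.
Proof.
have dh : chart_dom psi (k (f p, g p)) by rewrite /k /f /g -surjective_pairing (iso_FK FG).
have := Jc_chain2 hk (u := fun x => f (x, p.2)) (v := fun x => g (x, p.2))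
   (holomorphic_comp (holomorphic_inl M p.2) hf) (holomorphic_comp (holomorphic_inl M p.2) hg) (z := p.1)
   ap ap' aq' aq.
rewrite /= -(surjective_pairing p) => /(_ dp dp' dq' dh) <-.
rewrite -(Jc_cst phi psi p.2 p.1); congr (Jc _ _ _ _).
by apply/funext => x; rewrite /k /f /g -surjective_pairing (iso_FK FG).
Qed.

(** When [x] varies and [p.2] is fixed, the point [k (F (x, p.2))] stays at [p.2]. So B' takes
    values in a single tangent space of [N], one chart [psi] serves throughout, and each column of A
    B' is a holomorphic 1-form on [M]. *)
Lemma iso_AB : noforms M -> A *m B' = 0.
Proof.
move=> nM; apply/matrixP => i j.
have dk x : chart_dom psi (k (F (x, p.2))) by rewrite /k (iso_FK FG).
have dk2 : chart_dom psi (k (F p)) by rewrite /k (iso_FK FG).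
have hy := holomorphic_comp (holomorphic_inl M p.2) hF.
have pE : F (p.1, p.2) = F p by rewrite -surjective_pairing.
have dpp : chart_dom phi' (f (p.1, p.2)) by rewrite /f pE.
pose J th x := Jc th psi (k \o inl_at (F (x, p.2)).2) (F (x, p.2)).1.
pose b th x : 'cV[C]_m' := J th x *m delta_mx j 0.
have b1 th x l : atlas th -> chart_dom th (f (x, p.2)) -> hfun_at (fun z => b th z l 0) x.
  move=> at_ dt; have H4 := Jc_inl_hfun hk l j at_ aq (q := F (x, p.2)) dt (dk x).
  have H5 := @hfun_comp R _ _ M (prod_manifold M' N') (F \o inl_at p.2) (fun q => Jc th psi (k \o inl_at q.2) q.1 l j) x hy H4.
  have bE : (fun z => b th z l 0) = (fun z => J th z l j).
    by apply/funext => z; rewrite /b -colE [LHS]mxE.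
  by rewrite bE; exact: H5.
have b2 th ze x : atlas th -> atlas ze -> chart_dom th (f (x, p.2)) -> chart_dom ze (f (x, p.2)) ->
    b th x = Jc th ze (@idfun M') (f (x, p.2)) *m b ze x.
  move=> at_ az dt dz.
  have hki := holomorphic_comp (holomorphic_inl M' (F (x, p.2)).2) hk.
  have dki : chart_dom psi ((k \o inl_at (F (x, p.2)).2) (F (x, p.2)).1).
    by rewrite /= /inl_at -surjective_pairing.
  have JE : J th x = Jc th ze (@idfun M') (f (x, p.2)) *m J ze x.
    exact: (Jc_chain (holomorphic_id M') hki at_ az aq dt dz dki).
  by rewrite /b JE mulmxA.
have H := noforms_along nM (holomorphic_comp (holomorphic_inl M p.2) hf) b1 b2 ap ap' dp dpp.
have JE : J phi' p.1 = B' by rewrite /J pE.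
rewrite /b JE in H.
have := congr1 (fun X : 'cV[C]_m => X i 0) H.
by rewrite mulmxA -colE !mxE.
Qed.

Lemma iso_half : noforms M -> [/\ A *m A' + B *m C' = 1%:M, A *m B' = 0 & B *m D' = 0].
Proof.
move=> nM; have e := iso_AB nM; split=> //; first exact: iso_id.
by have := iso_cst; rewrite e add0r.
Qed.

End Relations.

Lemma swap_holo m n (M : cmanifold R m) (N : cmanifold R n) :
  holomorphic (fun p : prod_manifold M N => (p.2, p.1) : prod_manifold N M).
Proof. exact: holomorphic_pair (@holomorphic_snd _ _ _ M N) (@holomorphic_fst _ _ _ M N). Qed.

Section Swap.
Variables (m n m' n' : nat) (M : cmanifold R m) (N : cmanifold R n) (M' : cmanifold R m') (N' : cmanifold R n').
Variables (F : prod_manifold M N -> prod_manifold M' N') (G : prod_manifold M' N' -> prod_manifold M N).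
Hypothesis FG : pairiso F G.

Definition swapped (a b a' b' : Type) (H : a * b -> a' * b') (p : b * a) : b' * a' :=
  ((H (p.2, p.1)).2, (H (p.2, p.1)).1).

Lemma pairiso_swap : pairiso (M := N) (N := M) (M' := N') (N' := M') (swapped F) (swapped G).
Proof.
split.
- exact: holomorphic_comp (holomorphic_comp (swap_holo N M) (iso_F FG)) (swap_holo M' N').
- exact: holomorphic_comp (holomorphic_comp (swap_holo N' M') (iso_G FG)) (swap_holo M N).
- by move=> [y x]; rewrite /swapped /= -surjective_pairing (iso_FK FG).
- by move=> [y x]; rewrite /swapped /= -surjective_pairing (iso_GK FG).
Qed.

Lemma pairiso_inv : pairiso G F.
Proof. by split; [exact: iso_G FG|exact: iso_F FG|exact: iso_GK FG|exact: iso_FK FG]. Qed.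
End Swap.

(* The blocks A B C D and A' B' C' D' of the jacobians of F at p and of G at F p. *)
Definition blocks a b c d (A : 'M[C]_(a, c)) (B : 'M[C]_(a, d)) (Cc : 'M[C]_(b, c)) (D : 'M[C]_(b, d))
   (A' : 'M[C]_(c, a)) (B' : 'M[C]_(c, b)) (C' : 'M[C]_(d, a)) (D' : 'M[C]_(d, b)) :=
  [/\ [/\ A *m A' + B *m C' = 1%:M, A *m B' = 0 & B *m D' = 0],
      [/\ D *m D' + Cc *m B' = 1%:M, D *m C' = 0 & Cc *m A' = 0],
      [/\ A' *m A + B' *m Cc = 1%:M, A' *m B = 0 & B' *m D = 0] &
      [/\ D' *m D + C' *m B = 1%:M, D' *m Cc = 0 & C' *m A = 0]].

Section Rank.
Variables (m n m' n' : nat) (M : cmanifold R m) (N : cmanifold R n) (M' : cmanifold R m') (N' : cmanifold R n').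
Variables (F : prod_manifold M N -> prod_manifold M' N') (G : prod_manifold M' N' -> prod_manifold M N).
Hypothesis FG : pairiso F G.
Hypotheses (nM : noforms M) (nN : noforms N) (nM' : noforms M') (nN' : noforms N').

Definition dA phi phi' (p : prod_manifold M N) := Jc phi phi' (fun x => (F (x, p.2)).1) p.1.
Definition dB phi psi' (p : prod_manifold M N) := Jc phi psi' (fun x => (F (x, p.2)).2) p.1.
Definition dC psi phi' (p : prod_manifold M N) := Jc psi phi' (fun y => (F (p.1, y)).1) p.2.
Definition dD psi psi' (p : prod_manifold M N) := Jc psi psi' (fun y => (F (p.1, y)).2) p.2.
Definition dA' phi' phi (p : prod_manifold M N) := Jc phi' phi (fun x => (G (x, (F p).2)).1) (F p).1.
Definition dB' phi' psi (p : prod_manifold M N) := Jc phi' psi (fun x => (G (x, (F p).2)).2) (F p).1.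
Definition dC' psi' phi (p : prod_manifold M N) := Jc psi' phi (fun y => (G ((F p).1, y)).1) (F p).2.
Definition dD' psi' psi (p : prod_manifold M N) := Jc psi' psi (fun y => (G ((F p).1, y)).2) (F p).2.

Lemma iso_blocks phi psi phi' psi' (p : prod_manifold M N) : atlas phi -> atlas psi -> atlas phi' -> atlas psi' ->
  chart_dom phi p.1 -> chart_dom psi p.2 -> chart_dom phi' (F p).1 -> chart_dom psi' (F p).2 ->
  blocks (dA phi phi' p) (dB phi psi' p) (dC psi phi' p) (dD psi psi' p)
    (dA' phi' phi p) (dB' phi' psi p) (dC' psi' phi p) (dD' psi' psi p).
Proof.
move=> ap aq ap' aq' dp dq dp' dq'.
have pE : (p.1, p.2) = p by rewrite -surjective_pairing.
have FE : ((F p).1, (F p).2) = F p by rewrite -surjective_pairing.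
have GE : G (F p) = p by exact: (iso_FK FG p).
have GE1 : chart_dom phi (G (F p)).1 by rewrite GE.
have GE2 : chart_dom psi (G (F p)).2 by rewrite GE.
split.
- have H := iso_half FG ap aq ap' aq' dp dq dp' dq' nM.
  exact H.
- have := iso_half (pairiso_swap FG) (p := (p.2, p.1)) aq ap aq' ap' dq dp.
  by rewrite /swapped /= pE => /(_ dq' dp' nN).
- have := iso_half (pairiso_inv FG) (p := F p) ap' aq' ap aq dp' dq' GE1 GE2 nM'.
  by rewrite GE.
- have := iso_half (pairiso_swap (pairiso_inv FG)) (p := ((F p).2, (F p).1)) aq' ap' aq ap dq' dp'.
  by rewrite /swapped /= FE => /(_ GE2 GE1 nN'); rewrite GE.
Qed.

Definition dAA phi phi' p := dA phi phi' p *m dA' phi' phi p.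

(** A (A' A) A' = A (1 - B' C) A', and A B' = 0. *)
Lemma dAA_idem phi phi' (p : prod_manifold M N) : atlas phi -> atlas phi' ->
  chart_dom phi p.1 -> chart_dom phi' (F p).1 -> dAA phi phi' p *m dAA phi phi' p = dAA phi phi' p.
Proof.
move=> ap ap' dp dp'.
have [[_ AB _] _ [AA _ _] _] := iso_blocks ap (ch_atlas p.2) ap' (ch_atlas (F p).2) dp (ch_dom _) dp' (ch_dom _).
have E : dA' phi' phi p *m dA phi phi' p = 1%:M - dB' phi' (ch p.2) p *m dC (ch p.2) phi' p.
  by rewrite -AA addrK.
by rewrite /dAA -mulmxA (mulmxA _ (dA _ _ _)) E mulmxBl mul1mx mulmxBr !mulmxA AB !mul0mx subr0.
Qed.

Lemma dAA_trace phi phi' th th' (p : prod_manifold M N) : atlas phi -> atlas phi' -> atlas th -> atlas th' ->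
  chart_dom phi p.1 -> chart_dom phi' (F p).1 -> chart_dom th p.1 -> chart_dom th' (F p).1 ->
  \tr (dAA phi phi' p) = \tr (dAA th th' p).
Proof.
move=> ap ap' at_ at' dp dp' dt dt'.
have pE : (p.1, p.2) = p by rewrite -surjective_pairing.
have FE : ((F p).1, (F p).2) = F p by rewrite -surjective_pairing.
have GE : G (F p) = p by exact: (iso_FK FG p).
have h1 : holomorphic (fun x : M => (F (x, p.2)).1).
  exact: holomorphic_comp (holomorphic_comp (holomorphic_inl M p.2) (iso_F FG)) (@holomorphic_fst _ _ _ _ _).
have h2 : holomorphic (fun x : M' => (G (x, (F p).2)).1).
  exact: holomorphic_comp (holomorphic_comp (holomorphic_inl M' (F p).2) (iso_G FG)) (@holomorphic_fst _ _ _ _ _).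
have d1 : chart_dom phi' (F (p.1, p.2)).1 by rewrite pE.
have d1' : chart_dom th' (F (p.1, p.2)).1 by rewrite pE.
have d2 : chart_dom phi (G ((F p).1, (F p).2)).1 by rewrite FE GE.
have d2' : chart_dom th (G ((F p).1, (F p).2)).1 by rewrite FE GE.
have e1 : dA phi phi' p = Jc phi th (@idfun M) p.1 *m dA th phi' p.
  exact: (Jc_chain (holomorphic_id M) h1 ap at_ ap' dp dt d1).
have e2 : dA th phi' p = dA th th' p *m Jc th' phi' (@idfun M') (F p).1.
  by have := Jc_chain h1 (holomorphic_id M') at_ at' ap' dt d1' d1; rewrite pE.
have e3 : dA' phi' phi p = Jc phi' th' (@idfun M') (F p).1 *m dA' th' phi p.
  exact: (Jc_chain (holomorphic_id M') h2 ap' at' ap dp' dt' d2).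
have e4 : dA' th' phi p = dA' th' th p *m Jc th phi (@idfun M) p.1.
  by have := Jc_chain h2 (holomorphic_id M) at' at_ ap dt' d2' d2; rewrite FE GE.
have t1 := Jc_trans at' ap' dt' dp'; have t2 := Jc_trans at_ ap dt dp.
rewrite /dAA e1 e2 e3 e4 !mulmxA mxtrace_mulC !mulmxA t2 mul1mx.
by rewrite -(mulmxA (dA th th' p)) t1 mulmx1.
Qed.

Definition rk (p : prod_manifold M N) := \rank (dAA (ch p.1) (ch (F p).1) p).

Lemma rkE phi phi' (p : prod_manifold M N) : atlas phi -> atlas phi' ->
  chart_dom phi p.1 -> chart_dom phi' (F p).1 -> \tr (dAA phi phi' p) = (rk p)%:R.
Proof.
move=> ap ap' dp dp'; have ac := ch_atlas p.1; have ac' := ch_atlas (F p).1.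
rewrite (dAA_trace ap ap' ac ac' dp dp' (ch_dom _) (ch_dom _)); apply: idem_trace.
by apply: dAA_idem => //; exact: ch_dom.
Qed.

(** The trace of the idempotent is holomorphic in charts that are kept fixed near [p], and equal to
    the rank; a continuous function with integer values is locally constant. *)
Lemma rk_const : lcc M -> lcc N -> forall p q, rk p = rk q.
Proof.
move=> lM lN; apply: (lcc_prod lM lN) => p.
have ap := ch_atlas p.1; have ap' := ch_atlas (F p).1; have dp := ch_dom p.1; have dp' := ch_dom (F p).1.
set phi := ch p.1 in ap dp; set phi' := ch (F p).1 in ap' dp'.
have GE : G (F p) = p by exact: (iso_FK FG p).
have hf : holomorphic (fun q : prod_manifold M N => (F q).1).
  exact: holomorphic_comp (iso_F FG) (@holomorphic_fst _ _ _ _ _).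
have hh : holomorphic (fun q : prod_manifold M' N' => (G q).1).
  exact: holomorphic_comp (iso_G FG) (@holomorphic_fst _ _ _ _ _).
have hT : hfun_at (M := prod_manifold M N) (fun q => \tr (dAA phi phi' q)) p.
  have -> : (fun q => \tr (dAA phi phi' q)) =
      (fun q => \sum_i \sum_j dA phi phi' q i j * dA' phi' phi q j i).
    by apply/funext => q; apply: eq_bigr => i _; rewrite mxE.
  apply: hfun_sum => i; apply: hfun_sum => j; apply: hfun_mul.
    exact: (Jc_inl_hfun hf i j ap ap' (q := p) dp dp').
  have H : hfun_at (M := prod_manifold M' N') (fun q => Jc phi' phi (fun x => (G (x, q.2)).1) q.1 j i) (F p).
    by apply: (Jc_inl_hfun hh j i ap' ap (q := F p) dp'); rewrite /= GE.
  exact: (hfun_comp (iso_F FG) H).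
have /hfun_at_continuous hc := hT.
have H : \forall w \near (\tr (dAA phi phi' p) : C), rn (w - \tr (dAA phi phi' p)) < 1.
  by apply/nearP; exists 1 => //; exact: ltr01.
have H' : \forall q \near p, rn (\tr (dAA phi phi' q) - \tr (dAA phi phi' p)) < 1 := hc _ H.
have n1 : \forall q \near p, chart_dom phi q.1.
  exact: (@holomorphic_fst _ _ _ M N).1 (chart_dom_nbhs dp).
have n2 : \forall q \near p, chart_dom phi' (F q).1 by exact: hf.1 (chart_dom_nbhs dp').
apply: filterS3 H' n1 n2 => q Hq d1 d2; apply: natr_dist1.
have e1 := rkE ap ap' d1 d2; have e2 := rkE ap ap' dp dp'.
exact: (eq_ind _ (fun z : C => rn z < 1) Hq _ (f_equal2 (fun a b : C => a - b) e1 e2)).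
Qed.

End Rank.

Section Cases.
Variables (m n n' : nat) (M : cmanifold R m) (N : cmanifold R n) (M' : cmanifold R m) (N' : cmanifold R n').
Variables (F : prod_manifold M N -> prod_manifold M' N') (G : prod_manifold M' N' -> prod_manifold M N).
Hypothesis FG : pairiso F G.
Hypotheses (nM : noforms M) (nN : noforms N) (nM' : noforms M') (nN' : noforms N').
Hypotheses (lM : lcc M) (lN : lcc N).

Let h1 (y : N) : holomorphic (fun x : M => (F (x, y)).1).
Proof. exact: holomorphic_comp (holomorphic_comp (holomorphic_inl M y) (iso_F FG)) (@holomorphic_fst _ _ _ _ _). Qed.
Let h2 (y : N) : holomorphic (fun x : M => (F (x, y)).2).
Proof. exact: holomorphic_comp (holomorphic_comp (holomorphic_inl M y) (iso_F FG)) (@holomorphic_snd _ _ _ _ _). Qed.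
Let h3 (x : M) : holomorphic (fun y : N => (F (x, y)).1).
Proof. exact: holomorphic_comp (holomorphic_comp (holomorphic_inr N x) (iso_F FG)) (@holomorphic_fst _ _ _ _ _). Qed.
Let h4 (x : M) : holomorphic (fun y : N => (F (x, y)).2).
Proof. exact: holomorphic_comp (holomorphic_comp (holomorphic_inr N x) (iso_F FG)) (@holomorphic_snd _ _ _ _ _). Qed.

(** From A A' = 1 and A' B = 0 follows B = 0. Since [M] and [M'] have the same dimension, also A' A
    = 1, and C A' = 0 gives C = 0. *)
Lemma iso_full : (forall p, rk F G p = m) ->
  (forall x x' y, (F (x, y)).2 = (F (x', y)).2) /\ (forall x y y', (F (x, y)).1 = (F (x, y')).1).
Proof.
move=> rm.
have AA1 phi phi' (p : prod_manifold M N) : atlas phi -> atlas phi' ->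
    chart_dom phi p.1 -> chart_dom phi' (F p).1 -> dAA F G phi phi' p = 1%:M.
  move=> ap ap' dp dp'; apply: idem_full; first exact: (dAA_idem FG nM nN nM' nN').
  by rewrite (rkE FG nM nN nM' nN' ap ap' dp dp') rm.
split=> [x x' y|x y y'].
- move: x x'; apply: (Jc0_const (h2 y) lM) => phi psi' x ap aq' dp dq'.
  have aq := ch_atlas y; have dq := ch_dom y.
  have ap' := ch_atlas (F (x, y)).1; have dp' := ch_dom (F (x, y)).1.
  have [_ _ [_ AB _] _] := iso_blocks FG nM nN nM' nN' (p := (x, y)) ap aq ap' aq' dp dq dp' dq'.
  have := AA1 _ _ (x, y) ap ap' dp dp'; rewrite /dAA => AA.
  exact: mx_killl AA AB.
- move: y y'; apply: (Jc0_const (h3 x) lN) => psi phi' y aq ap' dq dp'.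
  have ap := ch_atlas x; have dp := ch_dom x.
  have aq' := ch_atlas (F (x, y)).2; have dq' := ch_dom (F (x, y)).2.
  have [_ [_ _ CA] _ _] := iso_blocks FG nM nN nM' nN' (p := (x, y)) ap aq ap' aq' dp dq dp' dq'.
  have := AA1 _ _ (x, y) ap ap' dp dp'; rewrite /dAA => /mulmx1C AA.
  exact: mx_killr AA CA.
Qed.

(** If A A' = 0 then B C' = 1, and C' A = 0 gives A = 0. When B is square, also C' B = 1, and D C' =
    0 gives D = 0. *)
Lemma iso_zero : (forall p, rk F G p = 0%N) ->
  (forall x x' y, (F (x, y)).1 = (F (x', y)).1) /\ (n' = m -> forall x y y', (F (x, y)).2 = (F (x, y')).2).
Proof.
move=> rm.
have AA0 phi phi' (p : prod_manifold M N) : atlas phi -> atlas phi' ->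
    chart_dom phi p.1 -> chart_dom phi' (F p).1 -> dAA F G phi phi' p = 0.
  move=> ap ap' dp dp'; apply: idem_zero; first exact: (dAA_idem FG nM nN nM' nN').
  by rewrite (rkE FG nM nN nM' nN' ap ap' dp dp') rm.
split=> [x x' y|nm x y y'].
- move: x x'; apply: (Jc0_const (h1 y) lM) => phi phi' x ap ap' dp dp'.
  have aq := ch_atlas y; have dq := ch_dom y.
  have aq' := ch_atlas (F (x, y)).2; have dq' := ch_dom (F (x, y)).2.
  have [[AB _ _] _ _ [_ _ CA]] := iso_blocks FG nM nN nM' nN' (p := (x, y)) ap aq ap' aq' dp dq dp' dq'.
  have := AA0 _ _ (x, y) ap ap' dp dp'; rewrite /dAA => AA.
  rewrite AA add0r in AB.
  exact: mx_killl AB CA.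
- move: y y'; apply: (Jc0_const (h4 x) lN) => psi psi' y aq aq' dq dq'.
  have ap := ch_atlas x; have dp := ch_dom x.
  have ap' := ch_atlas (F (x, y)).1; have dp' := ch_dom (F (x, y)).1.
  have [[AB _ _] [_ DC _] _ _] := iso_blocks FG nM nN nM' nN' (p := (x, y)) ap aq ap' aq' dp dq dp' dq'.
  have := AA0 _ _ (x, y) ap ap' dp dp'; rewrite /dAA => AA.
  rewrite AA add0r in AB.
  have BC := mulmx1C_cast (esym nm) AB.
  exact: mx_killr BC DC.
Qed.

End Cases.
End Isomorphism.

(** * Compact curves without holomorphic 1-forms *)

Section OneDim.
Variable R : realType.
Local Notation C := (cplx R).
Variable B : cmanifold R 1.

Definition up (z : C) : 'rV[C]_1 := const_mx z.
Definition cv (phi : chart R 1 B) (z : C) : B := chart_inv phi (up z).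
Definition cz (phi : chart R 1 B) (Q : B) : C := phi Q 0 0.

Lemma up_lo (v : 'rV[C]_1) : up (v 0 0) = v.
Proof. by apply/rowP => i; rewrite mxE (ord1 i). Qed.

Lemma rn_up z : rn (up z) = rn z.
Proof.
apply/eqP; rewrite eq_le; apply/andP; split; last by have := rn_coord (up z) 0 0; rewrite mxE.
have -> : up z = z *: up 1 by apply/rowP => i; rewrite !mxE mulr1.
rewrite rnZ; apply: (@le_trans _ _ (rn z * 1)); last by rewrite mulr1.
rewrite ler_wpM2l ?rn_ge0//.
suff : `|up 1| <= (1 : C) by rewrite rnE lecR.
rewrite [leLHS]/Num.norm /= mx_normE.
have -> : (1 : C) = (1%:nng : {nonneg C})%:num by [].
rewrite num_le; apply/bigmax_leP; split=> [|i _]; first by rewrite -num_le /=.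
by rewrite -num_le /= mxE normr1.
Qed.

Lemma upB z w : up z - up w = up (z - w).
Proof. by apply/rowP => i; rewrite !mxE. Qed.

Lemma near_up (P : 'rV[C]_1 -> Prop) z : (\forall v \near up z, P v) <-> (\forall w \near z, P (up w)).
Proof.
split=> [/nearP[d d0 dH]|/nearP[d d0 dH]]; apply/nearP; exists d => //.
  by move=> w wz; apply: dH; rewrite upB rn_up.
by move=> v; rewrite -(up_lo v) upB rn_up; exact: dH.
Qed.

Lemma cv_cz phi Q : chart_dom phi Q -> cv phi (cz phi Q) = Q.
Proof. by move=> dQ; rewrite /cv /cz up_lo chart_mapK. Qed.

Lemma near_cv phi Q (P : B -> Prop) : chart_dom phi Q ->
  (\forall q \near Q, P q) <-> (\forall z \near cz phi Q, P (cv phi z)).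
Proof.
move=> dQ; apply: iff_trans (near_chart P dQ) _.
have {1}-> : phi Q = up (cz phi Q) by rewrite /cz up_lo.
exact: near_up.
Qed.

Lemma cv_near phi Q : chart_dom phi Q ->
  \forall z \near cz phi Q, chart_dom phi (cv phi z) /\ cz phi (cv phi z) = z.
Proof.
move=> dQ; have := chart_near dQ.
have {1}-> : phi Q = up (cz phi Q) by rewrite /cz up_lo.
move=> /near_up; apply: filterS => z [d e]; split=> //.
by rewrite /cz /cv e mxE.
Qed.

Lemma up_differentiable (z : C) : differentiable up z.
Proof. by apply: differentiable_row => j; rewrite (_ : (fun _ => _) = id) //; apply/funext => w; rewrite mxE. Qed.

Lemma hfun_cv h phi Q : atlas phi -> chart_dom phi Q ->
  hfun_at h Q <-> differentiable (h \o cv phi) (cz phi Q).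
Proof.
move=> ap dQ; apply: iff_trans (hfun_chart h ap dQ) _.
have E : phi Q = up (cz phi Q) by rewrite /cz up_lo.
split=> H.
  apply: (@differentiable_comp _ _ _ _ up (h \o chart_inv phi)); first exact: up_differentiable.
  by rewrite -E.
have -> : h \o chart_inv phi = (h \o cv phi) \o (fun v : 'rV[C]_1 => v 0 0 : C).
  by apply/funext => v; rewrite /cv /= up_lo.
by apply: differentiable_comp; [exact: differentiable_coord|exact: H].
Qed.

Definition nh (h : B -> C) (Q : B) := \forall q \near Q, hfun_at h q.

Lemma nh_cv h phi Q : atlas phi -> chart_dom phi Q ->
  nh h Q <-> \forall z \near cz phi Q, differentiable (h \o cv phi) z.
Proof.
move=> ap dQ; apply: iff_trans (near_cv _ dQ) _.
split=> H; apply: filterS2 H (cv_near dQ) => z H [dz ez].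
  by have := (hfun_cv h ap dz).1 H; rewrite ez.
by apply/(hfun_cv h ap dz); rewrite ez.
Qed.

Lemma nh_at h Q : nh h Q -> hfun_at h Q.
Proof. exact: nbhs_singleton. Qed.

Lemma nh_near h Q : nh h Q -> \forall q \near Q, nh h q.
Proof. exact: near_near. Qed.

Lemma nh_eq h k Q : (\forall q \near Q, h q = k q) -> nh h Q -> nh k Q.
Proof.
by move=> e H; apply: filterS2 (near_near e) H => q; exact: near_hfun.
Qed.

Lemma nh_cst (c : C) Q : nh (fun=> c) Q.
Proof.
apply/(near_cv _ (ch_dom Q)); apply: (@filterE _ (nbhs (cz (ch Q) Q)) _) => z.
exact: differentiable_cst.
Qed.

Lemma nh_mul h k Q : nh h Q -> nh k Q -> nh (fun q => h q * k q) Q.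
Proof. by move=> H K; apply: filterS2 H K => q; exact: hfun_mul. Qed.

Lemma hfun_add h k (Q : B) : hfun_at h Q -> hfun_at k Q -> hfun_at (fun q => h q + k q) Q.
Proof. exact: differentiableD. Qed.

Lemma hfun_sub h k (Q : B) : hfun_at h Q -> hfun_at k Q -> hfun_at (fun q => h q - k q) Q.
Proof. exact: differentiableB. Qed.

Lemma nh_add h k Q : nh h Q -> nh k Q -> nh (fun q => h q + k q) Q.
Proof. by move=> H K; apply: filterS2 H K => q; exact: differentiableD. Qed.

Lemma nh_sub h k Q : nh h Q -> nh k Q -> nh (fun q => h q - k q) Q.
Proof. by move=> H K; apply: filterS2 H K => q; exact: differentiableB. Qed.

Lemma nh_sum l (h : 'I_l -> B -> C) Q : (forall i, nh (h i) Q) -> nh (fun q => \sum_i h i q) Q.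
Proof.
move=> H; have {}H : \forall q \near Q, forall i, hfun_at (h i) q by exact: filter_forall.
by apply: filterS H => q; exact: hfun_sum.
Qed.

Lemma nh_exp h n Q : nh h Q -> nh (fun q => h q ^+ n) Q.
Proof. by move=> H; apply: filterS H => q; exact: differentiable_expr. Qed.

Lemma nh_cont h Q : nh h Q -> {for Q, continuous h}.
Proof. by move=> /nh_at; exact: hfun_at_continuous. Qed.

Lemma nh_close h Q (e : R) : nh h Q -> 0 < e -> \forall q \near Q, rn (h q - h Q) < e.
Proof.
move=> /nh_cont hc e0.
have H : \forall w \near h Q, rn (w - h Q) < e by apply/nearP; exists e.
exact: hc _ H.
Qed.

Lemma nh_neq0 h Q : nh h Q -> h Q != 0 -> \forall q \near Q, h q != 0.
Proof.
move=> H h0; have e0 : 0 < rn (h Q) by rewrite rn_gt0.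
apply: filterS (nh_close H e0) => q; apply: contraTneq => ->.
by rewrite sub0r rnN ltxx.
Qed.

Lemma nh_inv h Q : nh h Q -> h Q != 0 -> nh (fun q => (h q)^-1) Q.
Proof.
move=> H h0; apply: filterS2 H (nh_neq0 H h0) => q H1 H2.
apply: differentiableV; first exact: H1.
by rewrite /= chart_mapK//; exact: ch_dom.
Qed.

Lemma nh_data h phi Q : atlas phi -> chart_dom phi Q -> nh h Q ->
  exists2 r, 0 < r & hb (h \o cv phi) (cz phi Q) r.
Proof. by move=> ap dQ /(nh_cv h ap dQ) /near_hb. Qed.

Lemma nh_of_hb (g : C -> C) phi Q r : atlas phi -> chart_dom phi Q -> 0 < r ->
  hb g (cz phi Q) r -> nh (g \o cz phi) Q.
Proof.
move=> ap dQ r0 hg; apply/(nh_cv _ ap dQ).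
have N : \forall z \near cz phi Q, g z = ((g \o cz phi) \o cv phi) z.
  by apply: filterS (cv_near dQ) => z [_ e]; rewrite /= e.
have D : \forall z \near cz phi Q, differentiable g z by apply/near_hb; exists r.
by apply: filterS2 (near_near N) D => z; exact: near_differentiable.
Qed.

(** A curve has no isolated points; this turns a property of punctured neighbourhoods into a
    witness, or into a contradiction. *)
Lemma near_neq (Q : B) (P : B -> Prop) : (\forall q \near Q, q <> Q -> P q) ->
  (forall U, nbhs Q U -> exists q, [/\ U q, q <> Q & P q]).
Proof.
move=> H U nU; have dQ := ch_dom Q; set phi := ch Q in dQ.
have nU' : \forall q \near Q, U q by exact: nU.
have /(near_cv _ dQ)/nearP[r r0 rH] : \forall q \near Q, U q /\ (q <> Q -> P q) by exact: filterI.
have [s s0 sH] := (nearP _ _).1 (cv_near dQ).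
pose e := Num.min r s / 2; have e0 : 0 < e by rewrite divr_gt0// lt_min r0.
have er : e < Num.min r s by rewrite ltr_pdivrMr// ltr_pMr ?lt_min ?r0// ltr1n.
move: er; rewrite lt_min => /andP[er es].
pose z := cz phi Q + e%:C%C.
have zr : rn (z - cz phi Q) = e by rewrite /z addrC addKr rnR gtr0_norm.
have [dz ez] := sH z (ltac:(by rewrite zr)); have [Uz Pz] := rH z (ltac:(by rewrite zr)).
have zQ : cv phi z <> Q.
  move=> E; have := zr; rewrite -ez E subrr rn0 => e1.
  by move: e0; rewrite -e1 ltxx.
by exists (cv phi z); split=> //; exact: Pz.
Qed.

Lemma nh_limit h k Q : nh h Q -> nh k Q -> (\forall q \near Q, q <> Q -> h q = k q) -> h Q = k Q.
Proof.
move=> H K E; apply/eqP; rewrite -subr_eq0; apply/negPn/negP => n0.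
have N := nh_neq0 (nh_sub H K) n0.
have [q [/= + _ hk]] := near_neq E N.
by rewrite hk subrr eqxx.
Qed.

Lemma nh_zero h Q : nh h Q -> (\forall q \near Q, h q = 0) \/ (\forall q \near Q, q <> Q -> h q != 0).
Proof.
move=> H; have ap := ch_atlas Q; have dQ := ch_dom Q; set phi := ch Q in ap dQ.
have [|[n [c [r [c0 r0 rH]]]]] := zero_isolated ((nh_cv h ap dQ).1 H).
  by move=> E; left; apply/(near_cv _ dQ).
right; apply/(near_cv _ dQ).
have N : \forall z \near cz phi Q, rn (z - cz phi Q) < r by apply/nearP; exists r.
apply: filterS2 N (cv_near dQ) => z zr [dz ez] zQ.
have z0 : z != cz phi Q by apply: contra_notN zQ => /eqP ->; rewrite cv_cz.
rewrite -rn_gt0; apply: lt_le_trans (rH z zr).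
by rewrite mulr_gt0// exprn_gt0// rn_gt0 subr_eq0.
Qed.

Definition dz (phi : chart R 1 B) (h : B -> C) (Q : B) : C := derive1 (h \o cv phi) (cz phi Q).

Lemma dz_uniq phi h Q d : cder (h \o cv phi) (cz phi Q) d -> dz phi h Q = d.
Proof. by move=> /cderP[_ <-]. Qed.

Lemma dz_near phi h k Q : chart_dom phi Q -> (\forall q \near Q, h q = k q) -> dz phi h Q = dz phi k Q.
Proof.
move=> dQ /(near_cv _ dQ) E; rewrite /dz.
rewrite !derive1E; apply: near_eq_derive; exact: E.
Qed.

Lemma nh_dz phi h Q : atlas phi -> chart_dom phi Q -> nh h Q -> nh (dz phi h) Q.
Proof.
move=> ap dQ H; apply/(nh_cv _ ap dQ).
have D : \forall z \near cz phi Q, differentiable (h \o cv phi) z by exact/(nh_cv h ap dQ).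
have D1 := diff_differentiable (1 : C) D.
have E : \forall z \near cz phi Q, 'd (h \o cv phi) z (1 : C) = (dz phi h \o cv phi) z.
  by apply: filterS2 D (cv_near dQ) => z Dz [_ ez]; rewrite /dz /= ez d1E// mul1r.
by apply: filterS2 (near_near E) D1 => z; exact: near_differentiable.
Qed.

Lemma d1M (f g : C -> C) z : differentiable f z -> differentiable g z ->
  derive1 (fun w => f w * g w) z = f z * derive1 g z + g z * derive1 f z.
Proof.
move=> df dg; have dfg : differentiable (f * g) z by exact: differentiableM.
have e1 := d1E (1 : C) dfg; rewrite mul1r in e1; rewrite -[LHS]e1.
have e2 := d1E (1 : C) df; have e3 := d1E (1 : C) dg; rewrite mul1r in e2; rewrite mul1r in e3.
rewrite -e2 -e3; exact: (congr1 (fun F : C -> C => F 1) (diffM df dg)).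
Qed.

Lemma d1B (f g : C -> C) z : differentiable f z -> differentiable g z ->
  derive1 (fun w => f w - g w) z = derive1 f z - derive1 g z.
Proof.
move=> df dg; have dfg : differentiable (f - g) z by exact: differentiableB.
have e1 := d1E (1 : C) dfg; rewrite mul1r in e1; rewrite -[LHS]e1.
have e2 := d1E (1 : C) df; have e3 := d1E (1 : C) dg; rewrite mul1r in e2; rewrite mul1r in e3.
rewrite -e2 -e3; exact: (congr1 (fun F : C -> C => F 1) (diffB df dg)).
Qed.

Lemma d1D (f g : C -> C) z : differentiable f z -> differentiable g z ->
  derive1 (fun w => f w + g w) z = derive1 f z + derive1 g z.
Proof.
move=> df dg; have dfg : differentiable (f + g) z by exact: differentiableD.
have e1 := d1E (1 : C) dfg; rewrite mul1r in e1; rewrite -[LHS]e1.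
have e2 := d1E (1 : C) df; have e3 := d1E (1 : C) dg; rewrite mul1r in e2; rewrite mul1r in e3.
rewrite -e2 -e3; exact: (congr1 (fun F : C -> C => F 1) (diffD df dg)).
Qed.

Section DzRules.
Variables (phi : chart R 1 B) (Q : B).
Hypotheses (ap : atlas phi) (dQ : chart_dom phi Q).

Lemma dz_mul h k : hfun_at h Q -> hfun_at k Q -> dz phi (fun q => h q * k q) Q = h Q * dz phi k Q + k Q * dz phi h Q.
Proof.
move=> /(hfun_cv h ap dQ) H /(hfun_cv k ap dQ) K.
by apply: etrans (d1M H K) _; rewrite /= cv_cz.
Qed.

Lemma dz_sub h k : hfun_at h Q -> hfun_at k Q -> dz phi (fun q => h q - k q) Q = dz phi h Q - dz phi k Q.
Proof. by move=> /(hfun_cv h ap dQ) H /(hfun_cv k ap dQ) K; exact: d1B H K. Qed.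

Lemma dz_add h k : hfun_at h Q -> hfun_at k Q -> dz phi (fun q => h q + k q) Q = dz phi h Q + dz phi k Q.
Proof. by move=> /(hfun_cv h ap dQ) H /(hfun_cv k ap dQ) K; exact: d1D H K. Qed.

Lemma dz_cst (c : C) : dz phi (fun=> c) Q = 0.
Proof. by rewrite /dz derive1E derive_cst. Qed.

Lemma dz_sum l (h : 'I_l -> B -> C) : (forall i, hfun_at (h i) Q) ->
  dz phi (fun q => \sum_i h i q) Q = \sum_i dz phi (h i) Q.
Proof.
elim: l h => [|l IH] h H.
  have -> : (fun q => \sum_(i < 0) h i q) = fun=> 0 by apply/funext => q; exact: big_ord0.
  by rewrite dz_cst big_ord0.
have -> : (fun q => \sum_i h i q) = (fun q => \sum_(i < l) h (widen_ord (leqnSn l) i) q + h ord_max q).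
  by apply/funext => q; rewrite big_ord_recr.
have H' i : hfun_at (h (widen_ord (leqnSn l) i)) Q by exact: H.
rewrite (dz_add (hfun_sum H') (H ord_max)) (IH _ H') big_ord_recr.
by [].
Qed.

Lemma dz_poly (p : {poly C}) x : hfun_at x Q ->
  hfun_at (fun q => p.[x q]) Q /\ dz phi (fun q => p.[x q]) Q = p^`().[x Q] * dz phi x Q.
Proof.
move=> hx; elim/poly_ind: p => [|p c [IH1 IH2]].
  have E : (fun q => (0 : {poly C}).[x q]) = fun=> 0 by apply/funext => q; rewrite horner0.
  rewrite E; split; first exact: nh_at (nh_cst 0 Q).
  by rewrite dz_cst deriv0 horner0 mul0r.
have E : (fun q => (p * 'X + c%:P).[x q]) = (fun q => p.[x q] * x q + c).
  by apply/funext => q; rewrite hornerMXaddC.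
have hc : hfun_at (fun _ : B => c) Q by exact: nh_at (nh_cst c Q).
have hpx : hfun_at (fun q => p.[x q] * x q) Q by exact: hfun_mul IH1 hx.
have hs : hfun_at (fun q => p.[x q] * x q + c) Q by exact: hfun_add hpx hc.
rewrite E; split; first exact: hs.
rewrite (dz_add hpx hc) (dz_mul IH1 hx) IH2 dz_cst addr0.
rewrite derivD derivM derivX derivC addr0 mulr1 hornerD hornerM hornerX.
by ring.
Qed.

End DzRules.

Lemma nh_poly (p : {poly C}) x Q : nh x Q -> nh (fun q => p.[x q]) Q.
Proof. by apply: filterS => q hx; have [] := dz_poly (ch_atlas q) (ch_dom q) p hx. Qed.

(** Both functions have the coordinate as a factor, and the cofactor of [s] does not vanish because
    the zero is simple. *)
Lemma nh_div phi f s Q : atlas phi -> chart_dom phi Q -> nh f Q -> nh s Q -> f Q = 0 -> s Q = 0 -> dz phi s Q != 0 ->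
  exists2 rho, nh rho Q & \forall q \near Q, f q = s q * rho q.
Proof.
move=> ap dQ hf hs f0 s0 ds.
have [r1 r10 h1] := nh_data ap dQ hf; have [r2 r20 h2] := nh_data ap dQ hs.
have f0' : (f \o cv phi) (cz phi Q) = 0 by rewrite /= cv_cz.
have s0' : (s \o cv phi) (cz phi Q) = 0 by rewrite /= cv_cz.
have [g1 hg1 e1] := dqE0 (cz phi Q) r10 h1 f0'.
have [g2 hg2 e2] := dqE0 (cz phi Q) r20 h2 s0'.
have n1 := nh_of_hb ap dQ r10 hg1; have n2 := nh_of_hb ap dQ r20 hg2.
have fE : \forall q \near Q, f q = (cz phi q - cz phi Q) * (g1 \o cz phi) q.
  by apply: filterS (chart_dom_nbhs dQ) => q dq; rewrite -e1 /= cv_cz.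
have sE : \forall q \near Q, s q = (cz phi q - cz phi Q) * (g2 \o cz phi) q.
  by apply: filterS (chart_dom_nbhs dQ) => q dq; rewrite -e2 /= cv_cz.
have g20 : (g2 \o cz phi) Q != 0.
  have zid : hfun_at (cz phi) Q.
    apply/(hfun_cv _ ap dQ); apply: (@near_differentiable _ _ _ (id : C -> C)); last by [].
    by apply: filterS (cv_near dQ) => z [_ e]; rewrite /= e.
  have zd : hfun_at (fun q => cz phi q - cz phi Q) Q by apply: differentiableB zid _; exact: nh_at (nh_cst _ Q).
  have e := dz_mul ap dQ zd (nh_at n2); rewrite subrr mul0r add0r in e.
  move: ds; rewrite (dz_near dQ sE) e mulf_eq0 negb_or => /andP[h _]; exact: h.
exists (fun q => (g1 \o cz phi) q * ((g2 \o cz phi) q)^-1); first by apply: nh_mul n1 _; exact: nh_inv.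
apply: filterS3 fE sE (nh_neq0 n2 g20) => q -> -> gq.
by rewrite -[RHS]mulrA; congr (_ * _); rewrite mulrCA divff ?mulr1.
Qed.

End OneDim.

(** * Functions with poles at given points *)

Section Poles.
Variable R : realType.
Local Notation C := (cplx R).
Variable B : cmanifold R 1.
Hypotheses (cB : compact [set: B]) (lB : lcc B).
Variables (d : nat) (P : 'I_d -> B) (x : B -> C).

Definition fin (Q : B) := forall j, Q <> P j.

(* [x] has simple poles at the [P j] and no others; [x^-1] is a coordinate at [P j], since 0^-1 = 0. *)
Hypothesis d0 : (0 < d)%N.
Hypothesis x_fin : forall Q, fin Q -> nh x Q.
Hypothesis xP : forall j, x (P j) = 0.
Let t (q : B) := (x q)^-1.
Hypothesis t_nh : forall j, nh t (P j).
Hypothesis t_dz : forall j, dz (ch (P j)) t (P j) != 0.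

Let tP j : t (P j) = 0. Proof. by rewrite /t xP invr0. Qed.

Lemma near_ne (Q Q' : B) : Q <> Q' -> \forall q \near Q, q <> Q'.
Proof.
move=> QQ'; have : closed [set Q'].
  exact/accessible_closed_set1/hausdorff_accessible/(@manifold_hausdorff _ _ B).
by move=> /closed_openC o; apply: open_nbhs_nbhs; split.
Qed.

Lemma fin_near Q : fin Q -> \forall q \near Q, fin q.
Proof. by move=> fQ; apply: filter_forall => j; apply: near_ne; exact: fQ. Qed.

Lemma pole_near j : \forall q \near P j, q <> P j -> fin q.
Proof.
have H : \forall q \near P j, forall i, P i <> P j -> q <> P i.
  apply: filter_forall => i; have [->|n] := pselect (P i = P j); first by apply: nearW.
  by apply: filterS (near_ne (fun e => n (esym e))) => q.
apply: filterS H => q H qj i E; have [e|n] := pselect (P i = P j); first by apply: qj; rewrite E e.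
exact: H n E.
Qed.

Lemma t_neq0 j : \forall q \near P j, q <> P j -> t q != 0.
Proof.
have [E|//] := nh_zero (t_nh j); exfalso.
move: (t_dz j); rewrite (dz_near (ch_dom _) (k := fun=> 0) E) dz_cst eqxx.
by [].
Qed.

Lemma x_neq0 j : \forall q \near P j, q <> P j -> x q != 0.
Proof. by apply: filterS (t_neq0 j) => q h /h; rewrite invr_eq0. Qed.

(* [a] is holomorphic off the [P j], and [a / x^n] takes the values [v] at the [P j]. *)
Definition lcr (n : nat) (a : B -> C) (v : 'rV[C]_d) := (forall Q, fin Q -> nh a Q) /\
  forall j, exists g, [/\ nh g (P j), g (P j) = v 0 j & \forall q \near P j, q <> P j -> a q = g q * x q ^+ n].

Lemma lcr_uniq n a v w : lcr n a v -> lcr n a w -> v = w.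
Proof.
move=> [_ Hv] [_ Hw]; apply/rowP => j; have [g [hg <- gE]] := Hv j; have [h [hh <- hE]] := Hw j.
apply: nh_limit hg hh _; apply: filterS3 gE hE (x_neq0 j) => q e1 e2 e3 qj.
by apply: (mulIf (expf_neq0 n (e3 qj))); rewrite -e1 ?e2.
Qed.

Lemma lcr0 n : lcr n (fun=> 0) 0.
Proof.
split=> [Q _|j]; first exact: nh_cst.
exists (fun=> 0); split; [exact: nh_cst|by rewrite mxE|].
by apply: nearW => q _; rewrite mul0r.
Qed.

Lemma lcr_add n a b v w : lcr n a v -> lcr n b w -> lcr n (fun q => a q + b q) (v + w).
Proof.
move=> [ha Ha] [hb Hb]; split=> [Q fQ|j]; first exact: nh_add (ha Q fQ) (hb Q fQ).
have [g [hg gv gE]] := Ha j; have [h [hh hv hE]] := Hb j.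
exists (fun q => g q + h q); split; [exact: nh_add|by rewrite mxE gv hv|].
by apply: filterS2 gE hE => q e1 e2 qj; rewrite e1// e2// mulrDl.
Qed.

Lemma lcr_scale n (c : C) a v : lcr n a v -> lcr n (fun q => c * a q) (c *: v).
Proof.
move=> [ha Ha]; split=> [Q fQ|j]; first exact: nh_mul (nh_cst c Q) (ha Q fQ).
have [g [hg gv gE]] := Ha j.
exists (fun q => c * g q); split; [exact: nh_mul (nh_cst c _) hg|by rewrite mxE gv|].
by apply: filterS gE => q e1 qj; rewrite e1// mulrA.
Qed.

Lemma lcr_sum n l (a : 'I_l -> B -> C) v : (forall i, lcr n (a i) (v i)) ->
  lcr n (fun q => \sum_i a i q) (\sum_i v i).
Proof.
elim: l a v => [|l IH] a v H.
  rewrite big_ord0; have -> : (fun q => \sum_(i < 0) a i q) = fun=> 0 by apply/funext => q; exact: big_ord0.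
  exact: lcr0.
rewrite big_ord_recr /=.
have -> : (fun q => \sum_i a i q) = (fun q => \sum_(i < l) a (widen_ord (leqnSn l) i) q + a ord_max q).
  by apply/funext => q; rewrite big_ord_recr.
by apply: lcr_add; [apply: IH => i; exact: H|exact: H].
Qed.

Lemma lcr_mul n m a b v w : lcr n a v -> lcr m b w ->
  lcr (n + m) (fun q => a q * b q) (\row_j (v 0 j * w 0 j)).
Proof.
move=> [ha Ha] [hb Hb]; split=> [Q fQ|j]; first exact: nh_mul (ha Q fQ) (hb Q fQ).
have [g [hg gv gE]] := Ha j; have [h [hh hv hE]] := Hb j.
exists (fun q => g q * h q); split; [exact: nh_mul|by rewrite mxE gv hv|].
by apply: filterS2 gE hE => q e1 e2 qj; rewrite e1// e2// exprD mulrACA.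
Qed.

Lemma lcr_poly k (p : {poly C}) : (size p <= k.+1)%N -> lcr k (fun q => p.[x q]) (const_mx p`_k).
Proof.
move=> sp; split=> [Q fQ|j]; first exact: nh_poly (x_fin fQ).
exists (fun q => \sum_(i < k.+1) p`_i * t q ^+ (k - i)); split.
- by apply: nh_sum => i; apply: nh_mul; [exact: nh_cst|apply: nh_exp; exact: t_nh].
- rewrite mxE tP big_ord_recr /= subnn expr0 mulr1 big1 ?add0r// => i _.
  by rewrite expr0n subn_eq0 leqNgt ltn_ord mulr0.
- apply: filterS (x_neq0 j) => q h /h xq; rewrite (horner_coef_wide _ sp) mulr_suml.
  apply: eq_bigr => i _; rewrite -mulrA; congr (_ * _).
  by rewrite /t exprVn mulrC -expfB_cond// ?(negbTE xq) ?leq_subr// subKn// -ltnS.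
Qed.

Lemma lcr_x1 : lcr 1 x (const_mx 1).
Proof.
have := @lcr_poly 1 'X; rewrite size_polyX coefX => /(_ isT).
by have -> : (fun q => 'X.[x q]) = x by apply/funext => q; rewrite hornerX.
Qed.

Lemma lcr_shift n m a v : (n <= m)%N -> lcr n a v -> lcr m (fun q => x q ^+ (m - n) * a q) v.
Proof.
move=> nm H; have h : (size ('X^(m - n) : {poly C}) <= (m - n).+1)%N by rewrite size_polyXn.
have := lcr_mul (lcr_poly h) H; rewrite subnK// coefXn eqxx.
have -> : \row_j ((const_mx 1 : 'rV[C]_d) 0 j * v 0 j) = v by apply/rowP => j; rewrite !mxE mul1r.
by have -> : (fun q => ('X^(m - n)).[x q] * a q) = (fun q => x q ^+ (m - n) * a q)
  by apply/funext => q; rewrite hornerXn.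
Qed.

(** A cofactor that vanishes at [P j] is divisible there by the coordinate 1 / x, which lowers the
    power of [x] by one. *)
Lemma lcr_drop n a : lcr n.+1 a 0 -> exists v, lcr n a v.
Proof.
move=> [ha Ha].
have H j : exists g, nh g (P j) /\ \forall q \near P j, q <> P j -> a q = g q * x q ^+ n.
  have [g [hg gv gE]] := Ha j; rewrite mxE in gv.
  have [rho hr rE] := nh_div (ch_atlas _) (ch_dom _) hg (t_nh j) gv (tP j) (t_dz j).
  exists rho; split=> //; apply: filterS3 gE rE (x_neq0 j) => q e1 e2 e3 qj.
  by rewrite e1// e2 exprS mulrACA [t q * _]mulVf ?mul1r ?e3.
pose g j := projT1 (cid (H j)).
have gH j : nh (g j) (P j) /\ \forall q \near P j, q <> P j -> a q = g j q * x q ^+ n.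
  by rewrite /g; case: cid.
exists (\row_j g j (P j)); split=> // j; exists (g j); have [h1 h2] := gH j; split=> //.
by rewrite mxE.
Qed.

Lemma lcr_cst a v : lcr 0 a v -> exists c, (forall Q, fin Q -> a Q = c) /\ forall j, v 0 j = c.
Proof.
move=> [ha Ha].
have ex q : ~ fin q -> exists j, q = P j by move=> /existsNP[j /contrapT]; exists j.
pose J q (n : ~ fin q) := projT1 (cid (ex q n)).
have JP q n : P (J q n) = q by rewrite /J; case: cid.
(* [a] with its values at the [P j] replaced by the limits [v]; this makes it holomorphic
   everywhere, hence constant. *)
pose h q := match pselect (fin q) with left _ => a q | right n => v 0 (J q n) end.
have hF q : fin q -> h q = a q by rewrite /h; case: pselect.
have hP q (n : ~ fin q) : exists2 j, q = P j & h q = v 0 j.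
  by rewrite /h; case: pselect => // n'; exists (J q n').
have hh : hfun h.
  move=> q; have [fq|nq] := pselect (fin q).
    apply: nh_at; apply: nh_eq (ha q fq); apply: filterS (fin_near fq) => r fr; exact: esym (hF r fr).
  have [j qj hq] := hP q nq; have [g [hg gv gE]] := Ha j.
  apply: nh_at; rewrite qj; apply: nh_eq hg.
  apply: filterS2 gE (pole_near j) => r e f.
  have [->|rj] := pselect (r = P j); first by rewrite gv -hq qj.
  by rewrite (hF r (f rj)) (e rj) expr0 mulr1.
have c0 := maximum_principle cB lB hh; pose j0 := Ordinal d0.
exists (h (P j0)); split=> [Q fQ|j]; first by rewrite -hF.
have [g [hg <- gE]] := Ha j; apply: (nh_limit hg (nh_cst _ _)).
apply: filterS2 gE (pole_near j) => r e f rj.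
by rewrite (c0 _ r) hF ?e ?expr0 ?mulr1//; exact: f.
Qed.

Lemma lcr00 a : lcr 0 a 0 -> forall Q, fin Q -> a Q = 0.
Proof.
by move=> /lcr_cst[c [ac vc]] Q fQ; rewrite ac// -(vc (Ordinal d0)) mxE.
Qed.

(** The row [i] of [E] holds the leading coefficients of [eta i] at the poles; invertibility of [E]
    prevents the leading terms of a combination over C[x] from cancelling. *)
Definition pole_basis (eta : 'I_d -> B -> C) (a : 'I_d -> nat) (E : 'M[C]_d) :=
  (forall i, lcr (a i) (eta i) (row i E)) /\ E \in unitmx.

Hypothesis P_full : forall j, exists n a, lcr n a (delta_mx 0 j).

Lemma min_family : exists eta a E, pole_basis eta a E /\
  forall eta' a' E', pole_basis eta' a' E' -> (\sum_i a i <= \sum_i a' i)%N.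
Proof.
pose S n := `[< exists eta a E, pole_basis eta a E /\ (\sum_i a i = n)%N >].
have exS : exists n, S n.
  have [n nH] := choice P_full; have [b H] := choice nH.
  exists (\sum_i n i)%N; apply/asboolP; exists b, n, 1%:M; split=> //; split=> [i|]; last exact: unitmx1.
  by rewrite rowE mulmx1.
case: (ex_minnP exS) => m /asboolP[eta [a [E [f e]]]] min.
exists eta, a, E; split=> // eta' a' E' f'; rewrite e; apply: min.
by apply/asboolP; exists eta', a', E'.
Qed.

Variables (eta : 'I_d -> B -> C) (a : 'I_d -> nat) (E : 'M[C]_d).
Hypothesis fam : pole_basis eta a E.
Hypothesis mini : forall eta' a' E', pole_basis eta' a' E' -> (\sum_i a i <= \sum_i a' i)%N.

(* Otherwise [b] could replace [eta i] in the pole_basis. *)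
Lemma exchange n b (c : 'rV[C]_d) i : lcr n b (c *m E) -> c 0 i != 0 -> (a i <= n)%N.
Proof.
move=> Hb ci; rewrite leqNgt; apply/negP => na.
pose eta' k := if k == i then b else eta k.
pose a' k := if k == i then n else a k.
pose E' := \matrix_k (if k == i then c *m E else row k E).
have f' : pole_basis eta' a' E'.
  split=> [k|].
    by rewrite rowK /a' /eta'; case: (k == i) => //; exact: fam.1.
  pose T : 'M[C]_d := \matrix_(k, l) (if k == i then c 0 l else (k == l)%:R).
  have -> : E' = T *m E.
    apply/row_matrixP => k; rewrite row_mul !rowK; case: (eqVneq k i) => ki.
      by congr (_ *m _); apply/rowP => l; rewrite !mxE ki eqxx.
    have -> : row k T = delta_mx 0 k by apply/rowP => l; rewrite !mxE (negPf ki) eqxx eq_sym.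
    exact: rowE.
  rewrite unitmx_mul fam.2 andbT -row_free_unit; apply/inj_row_free => w W0.
  have W l : w 0 i * c 0 l + (if l == i then 0 else w 0 l) = 0.
    have := congr1 (fun r : 'rV[C]_d => r 0 l) W0; rewrite [in X in _ = X -> _]mxE mxE.
    apply: etrans; rewrite [RHS](bigD1 i)//=; congr (_ + _); first by rewrite mxE eqxx.
    case: eqVneq => [->|li].
      by rewrite [RHS]big1// => k ki; rewrite mxE (negPf ki) mulr0.
    rewrite (bigD1 l)//= mxE (negPf li) eqxx mulr1 big1 ?addr0// => k /andP[ki kl].
    by rewrite mxE (negPf ki) (negPf kl) mulr0.
  have wi : w 0 i = 0.
    by have := W i; rewrite eqxx addr0 => /eqP; rewrite mulf_eq0 (negPf ci) orbF => /eqP.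
  apply/rowP => k; rewrite mxE; have := W k; rewrite wi mul0r add0r.
  by case: (eqVneq k i) => [->|].
have := mini f'; rewrite (bigD1 i)//= [X in (_ <= X)%N](bigD1 i)//= {1}/a' eqxx.
rewrite [X in (_ <= _ + X)%N](eq_bigr a) => [|k ki]; last by rewrite /a' (negPf ki).
by rewrite leq_add2r leqNgt na.
Qed.

Definition comb (p : 'I_d -> {poly C}) (Q : B) := \sum_i (p i).[x Q] * eta i Q.

Lemma combD p p' Q : comb (fun i => p i + p' i) Q = comb p Q + comb p' Q.
Proof. by rewrite /comb -big_split; apply: eq_bigr => i _; rewrite hornerD mulrDl. Qed.

(** The leading vector [v] is written in the rows of [E]. By [exchange] each [eta i] that occurs has
    order at most [n], and a power of [x] raises it to order [n]; where the subtraction [n - a i] is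
    truncated, the coefficient is zero. *)
Lemma comb_step n b v : lcr n b v -> exists p, lcr n (fun q => b q - comb p q) 0.
Proof.
move=> Hb; pose c := v *m invmx E; have cE : c *m E = v by rewrite /c mulmxKV ?fam.2.
pose p i : {poly C} := c 0 i *: 'X^(n - a i).
have Hp i : lcr n (fun q => (p i).[x q] * eta i q) (c 0 i *: row i E).
  have [c0|ci] := eqVneq (c 0 i) 0.
    have -> : (fun q => (p i).[x q] * eta i q) = fun=> 0.
      by apply/funext => q; rewrite /p c0 scale0r horner0 mul0r.
    by rewrite c0 scale0r; exact: lcr0.
  have -> : (fun q => (p i).[x q] * eta i q) = (fun q => c 0 i * (x q ^+ (n - a i) * eta i q)).
    by apply/funext => q; rewrite /p hornerZ hornerXn mulrA.
  apply: lcr_scale; apply: lcr_shift; last exact: fam.1.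
  by apply: exchange ci; rewrite cE; exact: Hb.
exists p; have := lcr_add Hb (lcr_scale (-1) (lcr_sum Hp)).
have -> : \sum_i c 0 i *: row i E = v by rewrite -mulmx_sum_row.
rewrite scaleN1r subrr.
by have -> : (fun q => b q + -1 * \sum_i (p i).[x q] * eta i q) = (fun q => b q - comb p q)
  by apply/funext => q; rewrite mulN1r.
Qed.

Lemma comb_span n b v : lcr n b v -> exists p, forall Q, fin Q -> b Q = comb p Q.
Proof.
elim: n b v => [|n IH] b v /comb_step[p Hp].
  by exists p => Q fQ; apply/eqP; rewrite -subr_eq0; apply/eqP; exact: lcr00 Hp Q fQ.
have [w /IH[p' Hp']] := lcr_drop Hp.
exists (fun i => p' i + p i) => Q fQ; rewrite combD -Hp'//.
by rewrite subrK.
Qed.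

Lemma comb_eq0 p : (forall Q, fin Q -> comb p Q = 0) -> forall i, p i = 0.
Proof.
move=> H.
have main n : (forall i, p i != 0 -> (size (p i) + a i <= n)%N) -> forall i, p i = 0.
  elim: n => [|n IH] Hn i.
    apply/eqP/negPn/negP => pi; have := Hn i pi.
    by rewrite leqn0 addn_eq0 size_poly_eq0 (negPf pi).
  (* The coefficients of the terms of order exactly [n]: the combination has leading vector [c *m E]
     at order [n], so [c] vanishes and the bound on the orders decreases. *)
  pose c : 'rV[C]_d := \row_i (if (a i <= n)%N then (p i)`_(n - a i) else 0).
  have Hp k : lcr n (fun q => (p k).[x q] * eta k q) (c 0 k *: row k E).
    have [p0|pk] := eqVneq (p k) 0.
      rewrite mxE p0 coef0 if_same scale0r.
      have -> : (fun q => (0 : {poly C}).[x q] * eta k q) = fun=> 0 by apply/funext => q; rewrite horner0 mul0r.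
      exact: lcr0.
    have sk := Hn k pk.
    have ak : (a k <= n)%N by rewrite -ltnS; apply: leq_trans sk; rewrite -add1n leq_add2r size_poly_gt0.
    have s : (size (p k) <= (n - a k).+1)%N by rewrite -subSn// leq_subRL ?(leq_trans ak)// addnC.
    have := lcr_mul (lcr_poly s) (fam.1 k); rewrite subnK//.
    by congr (lcr _ _ _); apply/rowP => j; rewrite !mxE ak.
  have Hs := lcr_sum Hp.
  have H0 : lcr n (fun q => \sum_i (p i).[x q] * eta i q) 0.
    split=> [Q fQ|j]; first by apply: nh_eq (nh_cst 0 Q); apply: filterS (fin_near fQ) => q fq; rewrite -[RHS]/(comb p q) H.
    exists (fun=> 0); split; [exact: nh_cst|by rewrite mxE|].
    by apply: filterS (pole_near j) => q h /h fq; rewrite mul0r; exact: H.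
  have c0 : c = 0.
    have := lcr_uniq Hs H0; rewrite -mulmx_sum_row => e.
    by rewrite -[c](mulmxK fam.2) e mul0mx.
  apply: IH => k pk; rewrite leqNgt; apply/negP => nk.
  have e : (size (p k) + a k)%N = n.+1 by apply/eqP; rewrite eqn_leq Hn.
  have := c0 => /rowP/(_ k); rewrite !mxE.
  have ak : (a k <= n)%N by rewrite -ltnS -e -[X in (X < _)%N]add0n ltn_add2r size_poly_gt0.
  rewrite ak; have -> : (n - a k)%N = (size (p k)).-1.
    by rewrite -subn1 -(addnK (a k) (size (p k))) e subnAC subn1.
  by rewrite -[_`_ _]/(lead_coef (p k)) => /eqP; rewrite lead_coef_eq0 (negPf pk).
apply: (main (\sum_i (size (p i) + a i))%N) => i.
by rewrite (bigD1 i)//= leq_addr.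
Qed.

End Poles.

Section MatrixFunctions.
Variable R : realType.
Local Notation C := (cplx R).
Variable B : cmanifold R 1.

Lemma nh_bigsum (I : Type) (r : seq I) (S : pred I) (h : I -> B -> C) Q : (forall i, nh (h i) Q) ->
  nh (fun q => \sum_(i <- r | S i) h i q) Q.
Proof.
move=> H; elim: r => [|i r IH].
  have -> : (fun q => \sum_(i <- [::] | S i) h i q) = fun=> 0 by apply/funext => q; rewrite big_nil.
  exact: nh_cst.
case: (boolP (S i)) => Si.
  have -> : (fun q => \sum_(j <- i :: r | S j) h j q) = (fun q => h i q + \sum_(j <- r | S j) h j q).
    by apply/funext => q; rewrite big_cons Si.
  exact: nh_add (H i) IH.
have -> : (fun q => \sum_(j <- i :: r | S j) h j q) = (fun q => \sum_(j <- r | S j) h j q).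
  by apply/funext => q; rewrite big_cons (negPf Si).
exact: IH.
Qed.

Lemma nh_bigprod (I : Type) (r : seq I) (S : pred I) (h : I -> B -> C) Q : (forall i, nh (h i) Q) ->
  nh (fun q => \prod_(i <- r | S i) h i q) Q.
Proof.
move=> H; elim: r => [|i r IH].
  have -> : (fun q => \prod_(i <- [::] | S i) h i q) = fun=> 1 by apply/funext => q; rewrite big_nil.
  exact: nh_cst.
case: (boolP (S i)) => Si.
  have -> : (fun q => \prod_(j <- i :: r | S j) h j q) = (fun q => h i q * \prod_(j <- r | S j) h j q).
    by apply/funext => q; rewrite big_cons Si.
  exact: nh_mul (H i) IH.
have -> : (fun q => \prod_(j <- i :: r | S j) h j q) = (fun q => \prod_(j <- r | S j) h j q).
  by apply/funext => q; rewrite big_cons (negPf Si).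
exact: IH.
Qed.

Lemma nh_det n (A : B -> 'M[C]_n) Q : (forall i j, nh (fun q => A q i j) Q) -> nh (fun q => \det (A q)) Q.
Proof.
move=> H; apply: nh_bigsum => s; apply: nh_mul; first exact: nh_cst.
by apply: nh_bigprod => i; exact: H.
Qed.

Lemma nh_adj n (A : B -> 'M[C]_n) Q i j : (forall i j, nh (fun q => A q i j) Q) -> nh (fun q => (\adj (A q)) i j) Q.
Proof.
move=> H; have -> : (fun q => (\adj (A q)) i j) = fun q => cofactor (A q) j i by apply/funext => q; rewrite mxE.
apply: nh_mul; first exact: nh_cst.
apply: nh_det => k l; have -> : (fun q => (row' j (col' i (A q))) k l) = fun q => A q (lift j k) (lift i l).
  by apply/funext => q; rewrite !mxE.
exact: H.
Qed.

Lemma nh_mulmx m n p (A : B -> 'M[C]_(m, n)) (D : B -> 'M[C]_(n, p)) Q :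
  (forall i j, nh (fun q => A q i j) Q) -> (forall i j, nh (fun q => D q i j) Q) ->
  forall i j, nh (fun q => (A q *m D q) i j) Q.
Proof.
move=> HA HD i j; have -> : (fun q => (A q *m D q) i j) = fun q => \sum_k A q i k * D q k j.
  by apply/funext => q; rewrite mxE.
by apply: nh_sum => k; exact: nh_mul.
Qed.

Lemma ex_notin (l : seq C) : exists c : C, c \notin l.
Proof.
apply: contrapT => H; have {}H c : c \in l by apply/negPn/negP => n; apply: H; exists c.
have u : uniq [seq (n%:R : C) | n <- iota 0 (size l).+1].
  by rewrite map_inj_uniq ?iota_uniq// => n m /eqP; rewrite eqr_nat => /eqP.
by have := uniq_leq_size u (fun c _ => H c); rewrite size_map size_iota ltnn.
Qed.

End MatrixFunctions.

(** * Square matrices with one-dimensional kernel *)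

Section LinearAlgebra.
Variable F : fieldType.

(** The left and right kernels of a square matrix have the same dimension. *)
Lemma right_kernel_sub d (M : 'M[F]_d) (e : 'cV[F]_d) : M *m e = 0 -> e != 0 ->
  (forall r r' : 'rV[F]_d, r != 0 -> r *m M = 0 -> r' *m M = 0 -> exists k, r' = k *: r) ->
  (kermx M^T <= e^T)%MS.
Proof.
move=> Me e0 ker.
have rk : (\rank (kermx M) <= 1)%N.
  have [/eqP|k0] := eqVneq (kermx M) 0; first by rewrite -mxrank_eq0 => /eqP ->.
  have [i ri] : exists i, row i (kermx M) != 0.
    apply: contrapT => H; case/eqP: k0; apply/row_matrixP => i; rewrite row0.
    by apply/eqP/negPn/negP => n; apply: H; exists i.
  have kM j : row j (kermx M) *m M = 0 by rewrite -row_mul mulmx_ker row0.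
  apply: leq_trans (mxrankS (_ : (_ <= row i (kermx M))%MS)) (rank_leq_row _).
  apply/row_subP => j; have [k ->] := ker _ _ ri (kM i) (kM j).
  exact: scalemx_sub.
have rM : (d <= (\rank M).+1)%N by move: rk; rewrite mxrank_ker leq_subLR addn1.
have se : (e^T <= kermx M^T)%MS by apply/sub_kermxP; rewrite -trmx_mul Me trmx0.
rewrite -(geq_leqif (mxrank_leqif_sup se)) mxrank_ker mxrank_tr.
have : \rank e^T != 0%N by rewrite mxrank_eq0 -(inj_eq trmx_inj) trmxK trmx0.
by rewrite -lt0n; apply: leq_trans; rewrite leq_subLR addn1.
Qed.

Lemma right_kernel1 d (M : 'M[F]_d) (e : 'cV[F]_d) : M *m e = 0 -> e != 0 ->
  (forall r r' : 'rV[F]_d, r != 0 -> r *m M = 0 -> r' *m M = 0 -> exists k, r' = k *: r) ->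
  forall k : 'cV[F]_d, M *m k = 0 -> exists c, k = c *: e.
Proof.
move=> Me e0 ker k Mk; have kt := right_kernel_sub Me e0 ker.
have sk : (k^T <= e^T)%MS.
  by apply: submx_trans kt; apply/sub_kermxP; rewrite -trmx_mul Mk trmx0.
have [w kw] := submxP sk; exists (w 0 0).
by apply: trmx_inj; rewrite kw linearZ /= {1}[w]mx11_scalar mul_scalar_mx.
Qed.

Lemma left_inverse_row d (r : 'rV[F]_d) : r != 0 -> exists w : 'cV[F]_d, r *m w = 1%:M.
Proof.
move=> /rV0Pn[k rk]; exists ((r 0 k)^-1 *: delta_mx k 0); rewrite -scalemxAr -colE.
by apply/matrixP => i j; rewrite !ord1 !mxE eqxx mulVf.
Qed.

Lemma right_inverse_col d (e : 'cV[F]_d) : e != 0 -> exists v : 'rV[F]_d, v *m e = 1%:M.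
Proof.
move=> e0; have : e^T != 0 by apply: contra_neq e0 => e0; rewrite -[e]trmxK e0 trmx0.
move=> /left_inverse_row[w ew]; exists w^T; apply: trmx_inj.
by rewrite trmx_mul trmxK ew trmx1.
Qed.

(** A rank-one matrix transverse to the kernels makes [M] invertible. In a family this remains so
    nearby, and the adjugate then yields a left kernel vector depending holomorphically on the
    parameter, as [bordered_kernel] and [bordered_line] show. *)
Lemma bordered_unit d (M : 'M[F]_d) (e w : 'cV[F]_d) (r v : 'rV[F]_d) : r *m M = 0 -> r *m w = 1%:M -> v *m e = 1%:M ->
  (forall k : 'cV[F]_d, M *m k = 0 -> exists c, k = c *: e) -> M + w *m v \in unitmx.
Proof.
move=> rM rw ve ker; rewrite -unitmx_tr -row_free_unit; apply/inj_row_free => k.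
move=> /(congr1 trmx); rewrite trmx_mul trmxK trmx0 mulmxDl -mulmxA => E.
have vk : v *m k^T = 0.
  have := congr1 (mulmx r) E; rewrite mulmxDr !mulmxA rM mul0mx add0r rw mul1mx mulmx0.
  by [].
rewrite vk mulmx0 addr0 in E; have [c kc] := ker _ E.
move: vk; rewrite kc -scalemxAr ve => /(congr1 (fun X : 'M[F]_1 => X 0 0)).
rewrite !mxE eqxx mulr1 => c0; apply: trmx_inj; rewrite kc c0 scale0r trmx0.
by [].
Qed.

Lemma bordered_kernel d (M : 'M[F]_d) (e w : 'cV[F]_d) (v : 'rV[F]_d) :
  M *m e = 0 -> (v *m e) 0 0 != 0 ->
  v *m \adj (M + w *m v) *m M = 0 /\ (v *m \adj (M + w *m v) *m w) = (\det (M + w *m v))%:M.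
Proof.
move=> Me ve; set N := M + _; set D := \det N.
have Ne : N *m e = w *m (v *m e) by rewrite mulmxDl Me add0r mulmxA.
have k : v *m \adj N *m w = D%:M.
  have : v *m (\adj N *m N) *m e = v *m \adj N *m w *m (v *m e).
    by rewrite -!mulmxA Ne.
  rewrite mul_adj_mx mul_mx_scalar -scalemxAl [v *m e]mx11_scalar mul_mx_scalar.
  rewrite -/D scale_scalar_mx mulrC -scale_scalar_mx => /(scalerI ve) <-.
  by [].
split=> //; have -> : M = N - w *m v by rewrite /N addrK.
by rewrite mulmxBr -(mulmxA v) mul_adj_mx mul_mx_scalar mulmxA k mul_scalar_mx subrr.
Qed.

Lemma bordered_line d (M : 'M[F]_d) (w : 'cV[F]_d) (r v : 'rV[F]_d) : r *m M = 0 ->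
  (\det (M + w *m v)) *: r = (r *m w) 0 0 *: (v *m \adj (M + w *m v)).
Proof.
move=> rM; have : r *m (M + w *m v) *m \adj (M + w *m v) = (r *m w) *m v *m \adj (M + w *m v).
  by rewrite mulmxDr rM add0r mulmxA.
rewrite -[in LHS]mulmxA mul_mx_adj mul_mx_scalar => ->.
by rewrite {1}[r *m w]mx11_scalar mul_scalar_mx -scalemxAl.
Qed.

End LinearAlgebra.

Lemma scale_entry (F : comRingType) (a b c : F) (u v : 'M[F]_1) : a *: u = b *: u + c *: v ->
  (a - b) * u 0 0 = c * v 0 0.
Proof.
move=> /(congr1 (fun X : 'M[F]_1 => X 0 0)); rewrite !mxE => e.
by rewrite mulrBl e addrAC subrr add0r.
Qed.

Lemma entry_lin (F : comRingType) d (r' r : 'rV[F]_d) (k : F) (D : 'M[F]_d) (e : 'cV[F]_d) :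
  ((r' - k *: r) *m D *m e) 0 0 = (r' *m D *m e) 0 0 - k * (r *m D *m e) 0 0.
Proof.
rewrite !mulmxBl -!scalemxAl; move: (r' *m D *m e) (r *m D *m e) => u v.
by rewrite !mxE.
Qed.

Lemma ker_entry (F : comRingType) d (al : 'rV[F]_d) (y : F) (Y : 'M[F]_d) :
  al *m (y%:M - Y) = 0 <-> forall j, y * al 0 j = \sum_i al 0 i * Y i j.
Proof.
rewrite mulmxBr mul_mx_scalar; split=> [/eqP|H]; last first.
  by apply/eqP; rewrite subr_eq0; apply/eqP/rowP => j; rewrite mxE H mxE.
by rewrite subr_eq0 => /eqP/rowP H j; have := H j; rewrite mxE => ->; rewrite mxE.
Qed.

Lemma deriv_algebra (F : comRingType) d (al eta de : 'I_d -> F) (Yv Yd : 'I_d -> 'I_d -> F) (y dy dx : F) :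
  (forall i, y * de i + eta i * dy = \sum_j (Yv i j * de j + eta j * (Yd i j * dx))) ->
  (forall j, y * al j = \sum_i al i * Yv i j) ->
  (\sum_i al i * eta i) * dy = dx * \sum_j (\sum_i al i * Yd i j) * eta j.
Proof.
move=> key aM.
have E : \sum_i al i * (y * de i + eta i * dy) =
    \sum_i al i * (\sum_j Yv i j * de j) + \sum_i al i * \sum_j eta j * (Yd i j * dx).
  by rewrite -big_split; apply: eq_bigr => i _; rewrite key big_split mulrDr.
have E1 : \sum_i al i * (\sum_j Yv i j * de j) = \sum_i al i * (y * de i).
  rewrite (eq_bigr (fun i => \sum_j al i * (Yv i j * de j))); last by move=> i _; rewrite mulr_sumr.
  rewrite exchange_big; apply: eq_bigr => j _.
  have -> : al j * (y * de j) = (y * al j) * de j by rewrite mulrCA mulrA.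
  by rewrite aM mulr_suml; apply: eq_bigr => i _; rewrite mulrA.
have E2 : \sum_i al i * (\sum_j eta j * (Yd i j * dx)) = dx * \sum_j (\sum_i al i * Yd i j) * eta j.
  rewrite (eq_bigr (fun i => \sum_j al i * (eta j * (Yd i j * dx)))); last by move=> i _; rewrite mulr_sumr.
  rewrite exchange_big mulr_sumr; apply: eq_bigr => j _.
  by rewrite mulr_suml mulr_sumr; apply: eq_bigr => i _; ring.
have E0 : \sum_i al i * (y * de i + eta i * dy) = \sum_i al i * (y * de i) + (\sum_i al i * eta i) * dy.
  by rewrite mulr_suml -big_split /=; apply: eq_bigr => i _; rewrite mulrDr [X in _ + X]mulrA.
by move: E; rewrite E0 E1 E2 => /addrI.
Qed.

Lemma form_algebra (F : fieldType) (k ae dy dx h a : F) : k * ae = 1 -> ae * dy = dx * h -> h != 0 ->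
  a * dy * h^-1 = k * a * dx.
Proof.
move=> k1 e h0; apply: (mulIf h0); rewrite mulfVK//.
have -> : k * a * dx * h = k * a * (dx * h) by rewrite mulrA.
by rewrite -e mulrACA k1 mul1r.
Qed.

Lemma hornerE_sum (F : comRingType) l (p : 'I_l -> {poly F}) (z : F) : (\sum_i p i).[z] = \sum_i (p i).[z].
Proof. by rewrite -[LHS]/(horner_eval z _) linear_sum. Qed.

(** * The dual basis for the trace, at finite points *)

Section DualForm.
Variable R : realType.
Local Notation C := (cplx R).
Variable B : cmanifold R 1.
Variables (fin : B -> Prop) (x : B -> C) (A : (B -> C) -> Prop) (d : nat) (eta : 'I_d -> B -> C).
Hypothesis fin_near : forall Q, fin Q -> \forall q \near Q, fin q.
Hypothesis A_nh : forall b Q, A b -> fin Q -> nh b Q.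
Hypothesis A_eta : forall i, A (eta i).
Hypothesis A_cst : forall c : C, A (fun=> c).
Hypothesis A_x : A x.
Hypothesis A_add : forall a b, A a -> A b -> A (fun q => a q + b q).
Hypothesis A_mul : forall a b, A a -> A b -> A (fun q => a q * b q).

Definition divat (c : C) (a : B -> C) (Q : B) := exists2 g, nh g Q & \forall q \near Q, a q = (x q - c) * g q.

Hypothesis A_div : forall a c, A a -> (forall Q, fin Q -> x Q = c -> divat c a Q) ->
  exists2 b, A b & forall Q, fin Q -> a Q = (x Q - c) * b Q.

Definition combo (p : 'I_d -> {poly C}) (Q : B) := \sum_i (p i).[x Q] * eta i Q.

Hypothesis A_span : forall b, A b -> exists p, forall Q, fin Q -> b Q = combo p Q.
Hypothesis A_free : forall p, (forall Q, fin Q -> combo p Q = 0) -> forall i, p i = 0.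

Lemma A_sum l (a : 'I_l -> B -> C) : (forall i, A (a i)) -> A (fun q => \sum_i a i q).
Proof.
elim: l a => [|l IH] a H.
  have -> : (fun q => \sum_(i < 0) a i q) = fun=> 0 by apply/funext => q; exact: big_ord0.
  exact: A_cst.
have -> : (fun q => \sum_i a i q) = (fun q => \sum_(i < l) a (widen_ord (leqnSn l) i) q + a ord_max q).
  by apply/funext => q; rewrite big_ord_recr.
by apply: A_add => //; apply: IH => i; exact: H.
Qed.

Lemma A_poly (p : {poly C}) : A (fun q => p.[x q]).
Proof.
elim/poly_ind: p => [|p c IH].
  have -> : (fun q => (0 : {poly C}).[x q]) = fun=> 0 by apply/funext => q; rewrite horner0.
  exact: A_cst.
have -> : (fun q => (p * 'X + c%:P).[x q]) = (fun q => p.[x q] * x q + c).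
  by apply/funext => q; rewrite hornerMXaddC.
by apply: A_add => //; exact: A_mul.
Qed.

Lemma A_combo p : A (combo p).
Proof. by apply: A_sum => i; apply: A_mul; [exact: A_poly|exact: A_eta]. Qed.

(** The [eta i] remain independent modulo x - c: the quotient by x - c is again a combination, by
    [A_div] and [A_span], and coefficients are unique. *)
Lemma combo_div p c : (forall Q, fin Q -> x Q = c -> divat c (combo p) Q) -> forall i, (p i).[c] = 0.
Proof.
move=> H; have [b Ab bE] := A_div (A_combo p) H; have [p' p'E] := A_span Ab.
have Z := A_free (p := fun i => p i - ('X - c%:P) * p' i).
have {}Z i : p i - ('X - c%:P) * p' i = 0.
  apply: Z => Q fQ; apply/eqP; have := bE Q fQ; rewrite p'E// => e.
  rewrite /combo (eq_bigr (fun i => (p i).[x Q] * eta i Q - (x Q - c) * ((p' i).[x Q] * eta i Q))); last first.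
    by move=> j _; rewrite hornerD hornerN hornerM hornerXsubC mulrBl mulrA.
  by rewrite sumrB -mulr_sumr subr_eq0 -[X in X == _]/(combo p Q) e.
move=> i; have := congr1 (fun P => P.[c]) (Z i).
by rewrite hornerD hornerN hornerM hornerXsubC subrr mul0r subr0 horner0.
Qed.

Definition ev (Q : B) : 'cV[C]_d := \col_i eta i Q.

Definition el (r : 'rV[C]_d) (Q : B) : C := (r *m ev Q) 0 0.

Lemma elE r Q : el r Q = combo (fun i => (r 0 i)%:P) Q.
Proof. by rewrite /el mxE; apply: eq_bigr => i _; rewrite hornerC mxE. Qed.

Lemma el_nh r Q : fin Q -> nh (el r) Q.
Proof.
move=> fQ; have -> : el r = combo (fun i => (r 0 i)%:P) by apply/funext => q; exact: elE.
by apply: A_nh fQ; exact: A_combo.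
Qed.

Lemma el_div r c : (forall Q, fin Q -> x Q = c -> divat c (el r) Q) -> r = 0.
Proof.
move=> H; apply/rowP => i; rewrite mxE.
have E : el r = combo (fun i => (r 0 i)%:P) by apply/funext => q; exact: elE.
rewrite E in H; by have := combo_div H i; rewrite hornerC.
Qed.

Lemma ev_neq0 Q : fin Q -> ev Q != 0.
Proof.
move=> fQ; have [p pE] := A_span (A_cst 1).
apply/eqP => e0; have := pE Q fQ; rewrite /combo big1 => [/eqP|i _]; first by rewrite oner_eq0.
by have := congr1 (fun X : 'cV[C]_d => X i 0) e0; rewrite !mxE => ->; rewrite mulr0.
Qed.

Lemma divat_mul c a k Q : divat c a Q -> nh k Q -> divat c (fun q => k q * a q) Q.
Proof.
move=> [g hg gE] hk; exists (fun q => k q * g q); first exact: nh_mul.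
by apply: filterS gE => q ->; rewrite mulrCA.
Qed.

Lemma divat_unit c a s g Q : nh s Q -> s Q != 0 -> nh g Q -> (\forall q \near Q, s q * a q = (x q - c) * g q) ->
  divat c a Q.
Proof.
move=> hs s0 hg E; exists (fun q => g q / s q); first by apply: nh_mul hg _; exact: nh_inv.
apply: filterS2 E (nh_neq0 hs s0) => q e sq.
by rewrite mulrA -e mulrC mulKf.
Qed.

Lemma xc_nh c Q : fin Q -> nh (fun q => x q - c) Q.
Proof. by move=> fQ; apply: nh_sub; [exact: A_nh A_x fQ|exact: nh_cst]. Qed.

(** The polynomial (p(X) - p(c)) / (X - c), whose value at [c] is the derivative. *)
Definition dqp (p : {poly C}) (c : C) := (p - (p.[c])%:P) %/ ('X - c%:P).

Lemma dqpE p c z : p.[z] = p.[c] + (z - c) * (dqp p c).[z].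
Proof.
have r : root (p - (p.[c])%:P) c by rewrite /root hornerD hornerN hornerC subrr.
have := divpK (_ : ('X - c%:P) %| p - (p.[c])%:P); rewrite dvdp_XsubCl => /(_ r) e.
have := congr1 (fun q => q.[z]) e; rewrite hornerM hornerXsubC hornerD hornerN hornerC => e'.
by rewrite mulrC /dqp e' addrC subrK.
Qed.

Lemma dqp_deriv p c : (dqp p c).[c] = p^`().[c].
Proof.
have r : root (p - (p.[c])%:P) c by rewrite /root hornerD hornerN hornerC subrr.
have := divpK (_ : ('X - c%:P) %| p - (p.[c])%:P); rewrite dvdp_XsubCl => /(_ r) e.
have := congr1 (fun q => q^`().[c]) e; rewrite derivM derivD derivN derivXsubC derivC subr0.
by rewrite hornerD !hornerM hornerXsubC subrr mulr0 add0r hornerC mulr1.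
Qed.

Lemma el_lin k r r' Q : el (k *: r + r') Q = k * el r Q + el r' Q.
Proof. by rewrite /el mulmxDl -scalemxAl !mxE. Qed.

Lemma near_cancel (s a b : B -> C) (Q : B) : nh s Q -> nh a Q -> nh b Q -> (\forall q \near Q, q <> Q -> s q != 0) ->
  (\forall q \near Q, s q * a q = s q * b q) -> \forall q \near Q, a q = b q.
Proof.
move=> hs ha hb s0 E.
have E' : \forall q \near Q, q <> Q -> a q = b q.
  by apply: filterS2 s0 E => q sq e qQ; apply: (mulfI (sq qQ)).
have e := nh_limit ha hb E'.
by apply: filterS E' => q Hq; have [->|n] := pselect (q = Q); [exact: e|exact: Hq n].
Qed.

Lemma dz_zero_const phi (h : B -> C) (Q : B) : atlas phi -> chart_dom phi Q -> nh h Q ->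
  (\forall q \near Q, dz phi h q = 0) -> \forall q \near Q, h q = h Q.
Proof.
move=> ap dQ hh D; have [r r0 hr] := nh_data ap dQ hh.
have D' : \forall z \near cz phi Q, derive1 (h \o cv phi) z = 0.
  move/(near_cv _ dQ): D => D; apply: filterS2 D (cv_near dQ) => z e [_ ez].
  by rewrite -e /dz ez.
have [s s0 sH] := (nearP _ _).1 D'.
have cQ : h Q = (h \o cv phi) (cz phi Q) by rewrite /= cv_cz.
rewrite cQ; apply/(near_cv _ dQ).
apply: (@zero_diff_const _ _ (h \o cv phi) (cz phi Q) (Num.min r s)); first by rewrite lt_min r0.
  by move=> w; rewrite lt_min => /andP[wr _]; exact: hr.
move=> w k; rewrite lt_min => /andP[wr ws].
have e := d1E k (hr w wr); rewrite (sH w ws) mulr0 in e.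
exact: e.
Qed.

Section Local.
Variables (phi : chart R 1 B) (Q0 : B) (y : B -> C) (Y : 'M[{poly C}]_d).
Hypotheses (ap : atlas phi) (dp : chart_dom phi Q0).
Hypotheses (fQ0 : fin Q0) (Ay : A y).
Hypothesis dy0 : dz phi y Q0 != 0.
Hypothesis ysep : forall Q, fin Q -> x Q = x Q0 -> Q <> Q0 -> y Q != y Q0.
Let Yx (z : C) : 'M[C]_d := \matrix_(i, j) (Y i j).[z].
Hypothesis YE : forall Q, fin Q -> y Q *: ev Q = Yx (x Q) *m ev Q.

(** [Y] is the matrix of multiplication by [y] in the basis [eta]. Thus [ev Q] lies in the right
    kernel of [Mx Q]; the dual basis at [Q] will be found in its left kernel. *)
Let Mx (Q : B) : 'M[C]_d := (y Q)%:M - Yx (x Q).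
Let c0 := x Q0.
Let Dx (z : C) : 'M[C]_d := \matrix_(i, j) (dqp (Y i j) c0).[z].
Let g (r : 'rV[C]_d) (Q : B) : C := (r *m Dx (x Q) *m ev Q) 0 0.
Let s (Q : B) : C := y Q - y Q0.

Lemma loc_ev Q : fin Q -> Mx Q *m ev Q = 0.
Proof. by move=> fQ; rewrite mulmxBl mul_scalar_mx YE// subrr. Qed.

Lemma loc_nhY Q i j : fin Q -> nh (fun q => Yx (x q) i j) Q.
Proof.
move=> fQ; have -> : (fun q => Yx (x q) i j) = fun q => (Y i j).[x q] by apply/funext => q; rewrite mxE.
by apply: nh_poly; exact: A_nh A_x fQ.
Qed.

Lemma ev_nh Q i j : fin Q -> nh (fun q => ev q i j) Q.
Proof.
move=> fQ; have -> : (fun q => ev q i j) = eta i by apply/funext => q; rewrite mxE.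
exact: A_nh (A_eta i) fQ.
Qed.

Lemma loc_nhg r Q : fin Q -> nh (g r) Q.
Proof.
move=> fQ; apply: nh_mulmx => i j; last exact: ev_nh.
apply: nh_mulmx => k l; first exact: nh_cst.
have -> : (fun q => Dx (x q) k l) = fun q => (dqp (Y k l) c0).[x q] by apply/funext => q; rewrite mxE.
by apply: nh_poly; exact: A_nh A_x fQ.
Qed.

(** [r] is a left eigenvector of the matrix of [y] over the fibre of [Q0], so only the difference of
    this matrix at [x Q] and at [c0] remains, and it has the factor [x Q - c0]. *)
Lemma loc_g (r : 'rV[C]_d) Q : fin Q -> r *m Mx Q0 = 0 -> s Q * el r Q = (x Q - c0) * g r Q.
Proof.
move=> fQ; rewrite mulmxBr mul_mx_scalar => /eqP; rewrite subr_eq0 => /eqP rM.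
have YD : Yx (x Q) = Yx c0 + (x Q - c0) *: Dx (x Q).
  by apply/matrixP => i j; rewrite !mxE; exact: dqpE.
apply: (@scale_entry _ (y Q) (y Q0) (x Q - c0)).
by rewrite scalemxAr YE// YD mulmxDl mulmxDr mulmxA -rM -!scalemxAl -scalemxAr mulmxA.
Qed.

Lemma loc_s : [/\ nh s Q0, s Q0 = 0 & dz phi s Q0 != 0].
Proof.
have h : nh y Q0 := A_nh Ay fQ0.
split; [exact: nh_sub h (nh_cst _ _)|by rewrite /s subrr|].
have := dz_sub ap dp (nh_at h) (nh_at (nh_cst (y Q0) Q0)).
by rewrite dz_cst subr0 => e; move: dy0; rewrite -e.
Qed.

Lemma loc_rho : exists2 rho, nh rho Q0 & \forall q \near Q0, x q - c0 = s q * rho q.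
Proof.
have [h1 h2 h3] := loc_s.
apply: (nh_div ap dp (xc_nh c0 fQ0) h1 _ h2 h3).
by rewrite subrr.
Qed.

Lemma loc_s0 : \forall q \near Q0, q <> Q0 -> s q != 0.
Proof.
have [h1 h2 h3] := loc_s; have [E|//] := nh_zero h1; exfalso.
by move: h3; rewrite (dz_near dp (k := fun=> 0) E) dz_cst eqxx.
Qed.

Lemma loc_other (r : 'rV[C]_d) Q : r *m Mx Q0 = 0 -> fin Q -> x Q = c0 -> Q <> Q0 -> divat c0 (el r) Q.
Proof.
move=> rM fQ xQ QQ0; apply: (@divat_unit c0 (el r) s (g r)).
- exact: nh_sub (A_nh Ay fQ) (nh_cst _ _).
- by rewrite subr_eq0; exact: ysep.
- exact: loc_nhg.
- by apply: filterS (fin_near fQ) => q fq; exact: loc_g.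
Qed.

Lemma loc_el (r : 'rV[C]_d) rho : r *m Mx Q0 = 0 -> nh rho Q0 -> (\forall q \near Q0, x q - c0 = s q * rho q) ->
  \forall q \near Q0, el r q = rho q * g r q.
Proof.
move=> rM hr rE; have [h1 _ _] := loc_s.
apply: (near_cancel h1 (el_nh r fQ0) (nh_mul hr (loc_nhg r fQ0)) loc_s0).
by apply: filterS2 rE (fin_near fQ0) => q e fq; rewrite (loc_g fq rM) e mulrA.
Qed.

(** Otherwise [el r] would be divisible by x - c0 at every point of the fibre: at [Q0] because [g r]
    cancels the zero of [s], elsewhere by [loc_other]. Then [r = 0]. *)
Lemma loc_g0 (r : 'rV[C]_d) : r *m Mx Q0 = 0 -> r != 0 -> g r Q0 != 0.
Proof.
move=> rM; apply: contra_neq => g0; apply: (@el_div r c0) => Q fQ xQ.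
have [->|QQ0] := pselect (Q = Q0); last exact: loc_other.
have [rho hr rE] := loc_rho; have [h1 h2 h3] := loc_s.
have [k hk kE] := nh_div ap dp (loc_nhg r fQ0) h1 g0 h2 h3.
exists k => //; apply: filterS3 (loc_el rM hr rE) rE kE => q -> -> ->.
by rewrite mulrCA mulrA.
Qed.

Lemma loc_line (r r' : 'rV[C]_d) : r != 0 -> r *m Mx Q0 = 0 -> r' *m Mx Q0 = 0 -> exists k, r' = k *: r.
Proof.
move=> r0 rM rM'; have gr := loc_g0 rM r0.
pose k := g r' Q0 / g r Q0; exists k.
apply/eqP; rewrite -subr_eq0; apply/negPn/negP => n0.
have rM'' : (r' - k *: r) *m Mx Q0 = 0 by rewrite mulmxBl rM' -scalemxAl rM scaler0 subr0.
have := loc_g0 rM'' n0; have -> : g (r' - k *: r) Q0 = g r' Q0 - k * g r Q0 by rewrite /g; exact: entry_lin.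
by rewrite /k divfK// subrr eqxx.
Qed.

Lemma loc_left : exists2 r : 'rV[C]_d, r != 0 & r *m Mx Q0 = 0.
Proof.
apply/det0P; rewrite -det_tr; apply/det0P; exists (ev Q0)^T.
  by rewrite -(inj_eq trmx_inj) trmxK trmx0; exact: ev_neq0.
by rewrite -trmx_mul loc_ev// trmx0.
Qed.

(** [gam] is the value at [Q0] of the basis dual to [eta] for the trace: paired with [eta] it gives
    1 at [Q0] and 0 at the other points of the fibre. It is a normalized left kernel vector. *)
Lemma loc_unram : dz phi x Q0 != 0 ->
  exists gam : 'rV[C]_d, el gam Q0 = 1 /\ forall Q, fin Q -> x Q = x Q0 -> Q <> Q0 -> divat (x Q0) (el gam) Q.
Proof.
move=> dx0; have [r r0 rM] := loc_left; have [rho hr rE] := loc_rho; have [h1 h2 h3] := loc_s.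
have hx := nh_at (A_nh A_x fQ0).
have rho0 : rho Q0 != 0.
  have e := dz_sub ap dp hx (nh_at (nh_cst c0 Q0)); rewrite dz_cst subr0 in e.
  have e2 := dz_mul ap dp (nh_at h1) (nh_at hr); rewrite h2 mul0r add0r in e2.
  have e3 := dz_near dp rE.
  by move: dx0; rewrite -e e3 e2 mulf_eq0 negb_or => /andP[].
have e0 : el r Q0 != 0.
  have -> := nbhs_singleton (loc_el rM hr rE).
  by rewrite mulf_neq0//; exact: loc_g0.
exists ((el r Q0)^-1 *: r + 0).
split; first by rewrite el_lin mulVf// /el mul0mx mxE addr0.
move=> Q fQ xQ QQ0; have := divat_mul (loc_other rM fQ xQ QQ0) (nh_cst (el r Q0)^-1 Q).
suff -> : el ((el r Q0)^-1 *: r + 0) = (fun q => (el r Q0)^-1 * el r q) by [].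
by apply/funext => q; rewrite el_lin /el mul0mx [X in _ + X]mxE addr0.
Qed.

(** Conversely, (y - y(Q)) times [el gam] is divisible by x - x(Q) on the whole fibre, at [Q]
    because x - x(Q) has a simple zero there. Its coefficients in the basis therefore vanish at
    [x Q], which is the eigenvector equation. *)
Lemma gam_kernel Q gam : fin Q -> chart_dom phi Q -> dz phi x Q != 0 ->
  (forall Q', fin Q' -> x Q' = x Q -> Q' <> Q -> divat (x Q) (el gam) Q') -> gam *m Mx Q = 0.
Proof.
move=> fQ dQ dx H.
pose p j := \sum_i (gam 0 i)%:P * Y i j - (y Q * gam 0 j)%:P.
have pE : forall q, fin q -> (y q - y Q) * el gam q = combo p q.
  move=> q fq; have E : y q * el gam q = (gam *m (Yx (x q) *m ev q)) 0 0 by rewrite -YE// -scalemxAr [RHS]mxE.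
  rewrite mulrBl E mulmxA mxE /combo elE /combo mulr_sumr -sumrB; apply: eq_bigr => j _.
  rewrite /p hornerD hornerN !hornerC hornerE_sum mulrBl mulrA; congr (_ - _).
  by rewrite !mxE; congr (_ * _); apply: eq_bigr => i _; rewrite hornerM hornerC mxE.
have Z : forall j, (p j).[x Q] = 0.
  apply: combo_div => Q' fQ' xQ'.
  have [g1 hg1 g1E] : divat (x Q) (fun q => (y q - y Q) * el gam q) Q'.
    have hs : nh (fun q => y q - y Q) Q' by apply: nh_sub (A_nh Ay fQ') (nh_cst _ _).
    have [E|n] := pselect (Q' = Q); last exact: divat_mul (H Q' fQ' xQ' n) hs.
    rewrite E in hs *.
    have hx := xc_nh (x Q) fQ; have hm := nh_mul hs (el_nh gam fQ).
    have dx' : dz phi (fun q => x q - x Q) Q != 0.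
      have := dz_sub ap dQ (nh_at (A_nh A_x fQ)) (nh_at (nh_cst (x Q) Q)).
      by rewrite dz_cst subr0 => ->.
    have [||g1 h1 h2] := nh_div ap dQ hm hx _ _ dx'; try by rewrite subrr ?mul0r.
    by exists g1.
  by exists g1 => //; apply: filterS2 g1E (fin_near fQ') => q e fq; rewrite -pE.
apply/ker_entry => j; have := Z j.
rewrite /p hornerD hornerN hornerC hornerE_sum => /eqP; rewrite subr_eq0 => /eqP e.
by rewrite -e; apply: eq_bigr => i _; rewrite hornerM hornerC mxE.
Qed.

Lemma loc_const : ~ (\forall q \near Q0, x q = x Q0).
Proof.
move=> xc; have [r r0 rM] := loc_left; apply/negP: r0; rewrite negbK; apply/eqP.
apply: (@el_div r c0) => Q fQ xQ; have [->|QQ0] := pselect (Q = Q0); last exact: loc_other.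
exists (fun=> 0); first exact: nh_cst.
have xc' : \forall q \near Q0, x q - c0 = s q * 0.
  by apply: filterS xc => q ->; rewrite subrr mulr0.
have := loc_el rM (nh_cst 0 Q0) xc'; apply: filterS => q ->.
by rewrite mul0r mulr0.
Qed.

Lemma loc_dx : \forall q \near Q0, q <> Q0 -> dz phi x q != 0.
Proof.
have [E|//] := nh_zero (nh_dz ap dp (A_nh A_x fQ0)); exfalso.
exact: loc_const (dz_zero_const ap dp (A_nh A_x fQ0) E).
Qed.

Let Yd (z : C) : 'M[C]_d := \matrix_(i, j) ((Y i j)^`()).[z].

(** The relation between [y], [Y] and [ev] is differentiated and paired with [al]; the left kernel
    equation removes the derivatives of [eta]. *)
Lemma loc_deriv (al : 'rV[C]_d) q : fin q -> chart_dom phi q -> al *m Mx q = 0 ->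
  (al *m ev q) 0 0 * dz phi y q = dz phi x q * (al *m Yd (x q) *m ev q) 0 0.
Proof.
move=> fq dq alM.
have hx := nh_at (A_nh A_x fq); have hy := nh_at (A_nh Ay fq).
have he i := nh_at (A_nh (A_eta i) fq).
have key i : y q * dz phi (eta i) q + eta i q * dz phi y q =
    \sum_j ((Y i j).[x q] * dz phi (eta j) q + eta j q * (((Y i j)^`()).[x q] * dz phi x q)).
  apply: etrans (esym (dz_mul ap dq hy (he i))) _.
  have E : \forall p \near q, y p * eta i p = \sum_j (Y i j).[x p] * eta j p.
    apply: filterS (fin_near fq) => p fp; have := congr1 (fun X : 'cV[C]_d => X i 0) (YE fp).
    rewrite mxE [ev p i 0]mxE => ->; rewrite mxE; apply: eq_bigr => j _.
    by rewrite !mxE.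
  apply: etrans (dz_near dq E) _.
  have hp j := dz_poly ap dq (Y i j) hx.
  apply: etrans (dz_sum ap dq (h := fun j p => (Y i j).[x p] * eta j p) _) _; first by move=> j; exact: hfun_mul (hp j).1 (he j).
  apply: eq_bigr => j _; apply: etrans (dz_mul ap dq (hp j).1 (he j)) _.
  by congr (_ + _ * _); exact: (hp j).2.
have aM j : y q * al 0 j = \sum_i al 0 i * (Y i j).[x q].
  rewrite ((ker_entry _ _ _).1 alM j); apply: eq_bigr => i _; by rewrite mxE.
have -> : (al *m ev q) 0 0 = \sum_i al 0 i * eta i q by rewrite mxE; apply: eq_bigr => i _; rewrite mxE.
have -> : (al *m Yd (x q) *m ev q) 0 0 = \sum_j (\sum_i al 0 i * ((Y i j)^`()).[x q]) * eta j q.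
  rewrite mxE; apply: eq_bigr => j _; rewrite [ev q j 0]mxE mxE.
  by congr (_ * _); apply: eq_bigr => i _; rewrite mxE.
exact: deriv_algebra key aM.
Qed.

(** [Q0] may be a ramification point, where the dual basis has poles. Nearby, gam = k al with [al]
    the holomorphic kernel vector of the bordered matrix and k (al ev) = 1. By [loc_deriv], k dx =
    dy / h1 with [h1] nonzero at [Q0], so gam_i dx = al_i dy / h1 has no pole. *)
Lemma loc_form i : exists W, nh W Q0 /\ \forall q \near Q0, q <> Q0 -> forall gam : 'rV[C]_d, el gam q = 1 ->
  (forall Q', fin Q' -> x Q' = x q -> Q' <> q -> divat (x q) (el gam) Q') -> W q = gam 0 i * dz phi x q.
Proof.
have [r r0 rM] := loc_left.
have [w rw] := left_inverse_row r0; have [v ve1] := right_inverse_col (ev_neq0 fQ0).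
have v1 : (v *m ev Q0) 0 0 != 0 by rewrite ve1 mxE eqxx mulr1n oner_neq0.
pose N q := Mx q + w *m v; pose al q := v *m \adj (N q).
have hN q k l : fin q -> nh (fun p => N p k l) q.
  move=> fq.
  have -> : (fun p => N p k l) = (fun p => y p * (k == l)%:R - Yx (x p) k l + (w *m v) k l).
    by apply/funext => p; rewrite /N /Mx [LHS]mxE [X in X + _]mxE [X in X + _ + _]mxE [X in _ + X + _]mxE mulr_natr.
  apply: nh_add (nh_cst _ _); apply: nh_sub (loc_nhY _ _ fq).
  by apply: nh_mul (A_nh Ay fq) (nh_cst _ _).
have hal q k l : fin q -> nh (fun p => al p k l) q.
  by move=> fq; apply: nh_mulmx => a b; [exact: nh_cst|apply: nh_adj => a' b'; exact: hN].
have hdet q : fin q -> nh (fun p => \det (N p)) q by move=> fq; apply: nh_det => a b; exact: hN.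
have D0 : \det (N Q0) != 0.
  rewrite -unitfE -unitmxE; apply: (bordered_unit rM rw ve1).
  exact: (right_kernel1 (loc_ev fQ0) (ev_neq0 fQ0) loc_line).
have hve : nh (fun q => (v *m ev q) 0 0) Q0 by apply: nh_mulmx => a b; [exact: nh_cst|exact: ev_nh].
have alM : \forall q \near Q0, al q *m Mx q = 0.
  apply: filterS2 (nh_neq0 hve v1) (fin_near fQ0) => q ve fq.
  exact: (bordered_kernel w (loc_ev fq) ve).1.
have al0 : al Q0 != 0.
  have := (bordered_kernel w (loc_ev fQ0) v1).2; rewrite -/(N Q0) -/(al Q0) => e.
  apply/eqP => z0; move: e; rewrite z0 mul0mx => /(congr1 (fun X : 'M[C]_1 => X 0 0)).
  by rewrite mxE mxE eqxx mulr1n => /esym/eqP; rewrite (negPf D0).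
pose h1 q := (al q *m Yd (x q) *m ev q) 0 0.
have hYd q k l : fin q -> nh (fun p => Yd (x p) k l) q.
  move=> fq; have -> : (fun p => Yd (x p) k l) = fun p => ((Y k l)^`()).[x p] by apply/funext => p; rewrite mxE.
  by apply: nh_poly; exact: A_nh A_x fq.
have hh1 : nh h1 Q0.
  apply: nh_mulmx => a b; last exact: ev_nh.
  by apply: nh_mulmx => a' b'; [exact: hal|exact: hYd].
have h10 : h1 Q0 != 0.
  (* At [c0] the difference quotients of the entries of [Y] are their derivatives, so [loc_g0]
     applies. *)
  have -> : h1 Q0 = g (al Q0) Q0.
    rewrite /h1 /g; congr ((_ *m _ *m _) 0 0); apply/matrixP => k l.
    by rewrite !mxE dqp_deriv.
  by apply: loc_g0 => //; exact: (nbhs_singleton alM).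
exists (fun q => al q 0 i * dz phi y q * (h1 q)^-1); split.
  apply: nh_mul (nh_inv hh1 h10); apply: nh_mul; first exact: hal.
  by apply: nh_dz => //; exact: A_nh Ay fQ0.
have G1 := @filterI _ _ (nbhs_filter Q0) _ _ alM loc_dx.
have G2 := @filterI _ _ (nbhs_filter Q0) _ _ (nh_neq0 hh1 h10) (nh_neq0 (hdet Q0 fQ0) D0).
have G3 := @filterI _ _ (nbhs_filter Q0) _ _ (fin_near fQ0) (chart_dom_nbhs dp).
apply: filterS3 G1 G2 G3 => q [aM dx] [h1q Dq] [fq dq] qQ gam g1 gd.
have gM := gam_kernel fq dq (dx qQ) gd.
have L := bordered_line w v gM.
have dE := loc_deriv fq dq aM.
pose k := (\det (N q))^-1 * (gam *m w) 0 0.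
have gE : gam = k *: al q by rewrite /k -scalerA -L scalerA mulVf// scale1r.
have kal : k * (al q *m ev q) 0 0 = 1 by rewrite -g1 gE /el -scalemxAl [RHS]mxE.
have gi : gam 0 i = k * al q 0 i by rewrite [in LHS]gE [LHS]mxE.
rewrite gi; exact: (form_algebra (al q 0 i) kal dE h1q).
Qed.

End Local.

End DualForm.

(** * A form given up to removable singularities *)

Section Gluing.
Variable R : realType.
Local Notation C := (cplx R).
Variable B : cmanifold R 1.

Lemma dzE (phi : chart R 1 B) (h : B -> C) (Q : B) : atlas phi -> chart_dom phi Q -> hfun_at h Q ->
  dz phi h Q = 'd (h \o chart_inv phi) (phi Q) (up 1).
Proof.
move=> ap dQ /(hfun_chart h ap dQ) hh; apply: dz_uniq.
have E (s : C) : phi Q + s *: up 1 = up (cz phi Q + s).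
  by apply/rowP => j; rewrite !mxE mulr1 (ord1 j).
have c1 := line_cder (up 1) hh.
move=> e e0; have [r r0 rH] := c1 e e0; exists r => // k kr.
have := rH k kr; rewrite add0r !E addr0.
by [].
Qed.

Lemma dz_change (phi psi : chart R 1 B) (h : B -> C) (Q : B) : atlas phi -> atlas psi -> chart_dom phi Q -> chart_dom psi Q ->
  hfun_at h Q -> dz phi h Q = Jc phi psi (@idfun B) Q 0 0 * dz psi h Q.
Proof.
move=> ap aq dp dq hh; rewrite (dzE ap dp hh) (dzE aq dq hh).
have hk := (hfun_chart h aq dq).1 hh.
have du : differentiable (psi \o idfun \o chart_inv phi) (phi Q) by exact: atlas_compatible.
have uQ : (psi \o idfun \o chart_inv phi) (phi Q) = psi Q by rewrite /= chart_mapK.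
have hk' : differentiable (h \o chart_inv psi) ((psi \o idfun \o chart_inv phi) (phi Q)) by rewrite uQ.
have E : \forall v \near phi Q, ((h \o chart_inv psi) \o (psi \o idfun \o chart_inv phi)) v = (h \o chart_inv phi) v.
  by move: (chart_dom_nbhs dq) => /(near_chart _ dp); apply: filterS => v dv /=; rewrite chart_mapK.
have c1 := line_cder (up 1) ((hfun_chart h ap dp).1 hh).
have c2 := line_cder (up 1) (differentiable_comp du hk').
have e1 : 'd (h \o chart_inv phi) (phi Q) (up 1) =
    'd ((h \o chart_inv psi) \o (psi \o idfun \o chart_inv phi)) (phi Q) (up 1).
  apply: cder_uniq c1 _ erefl; apply: (cder_near _ c2).
  have [r r0 rH] := (nearP _ _).1 E; exists r => // s; rewrite subr0 => sr.
  apply: rH; rewrite addrC addKr; have -> : s *: up 1 = up s by apply/rowP => j; rewrite !mxE mulr1.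
  by rewrite rn_up.
apply: etrans e1 _.
have E2 := @diff_comp C _ _ _ (psi \o idfun \o chart_inv phi) (h \o chart_inv psi) (phi Q) du hk'.
have e2 := congr1 (fun f : 'rV[C]_1 -> C => f (up 1)) E2.
apply: etrans e2 _; rewrite uQ.
have e3 : 'd (psi \o idfun \o chart_inv phi) (phi Q) (up 1) = up 1 *m Jc phi psi (@idfun B) Q by rewrite /Jc jac_mul.
apply: etrans (congr1 ('d (h \o chart_inv psi) (psi Q)) e3) _.
have -> : up 1 *m Jc phi psi (@idfun B) Q = Jc phi psi (@idfun B) Q 0 0 *: up 1.
  by apply/rowP => j; rewrite !mxE big_ord1 !mxE mul1r mulr1 (ord1 j).
exact: linearZ.
Qed.

Lemma nh_Jc (phi psi : chart R 1 B) (Q : B) : atlas phi -> atlas psi -> chart_dom phi Q -> chart_dom psi Q ->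
  nh (fun q => Jc phi psi (@idfun B) q 0 0) Q.
Proof.
move=> ap aq dp dq; apply: filterS2 (chart_dom_nbhs dp) (chart_dom_nbhs dq) => q dp' dq'.
by apply: Jc_hfun => //; exact: holomorphic_id.
Qed.

Variables (u x : B -> C).
Hypothesis nB : noforms B.
Hypothesis xh : forall Q, \forall q \near Q, q <> Q -> nh x q.

(** [W] extends over [Q] the coefficient of the form u dx in the chart [phi]; the values of [u] and
    [x] at [Q] itself do not enter. *)
Definition ext (phi : chart R 1 B) (Q : B) (W : B -> C) := nh W Q /\ \forall q \near Q, q <> Q -> W q = u q * dz phi x q.

Hypothesis ext_ex : forall Q, exists W, ext (ch Q) Q W.

Let ext_change phi psi Q W : atlas phi -> atlas psi -> chart_dom phi Q -> chart_dom psi Q ->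
  ext psi Q W -> ext phi Q (fun q => Jc phi psi (@idfun B) q 0 0 * W q).
Proof.
move=> ap aq dp dq [hW WE]; split; first exact: nh_mul (nh_Jc ap aq dp dq) hW.
apply: filterS3 (@filterI _ _ (nbhs_filter Q) _ _ (chart_dom_nbhs dp) (chart_dom_nbhs dq)) WE (xh Q) => q [dp' dq'] e hx qQ.
by rewrite (e qQ) (dz_change ap aq dp' dq' (nh_at (hx qQ))) mulrCA.
Qed.

Let ext_uniq phi Q W W' : ext phi Q W -> ext phi Q W' -> W Q = W' Q.
Proof.
move=> [hW WE] [hW' WE']; apply: nh_limit hW hW' _.
by apply: filterS2 WE WE' => q e e' qQ; rewrite e ?e'.
Qed.

Let ext_phi phi Q : atlas phi -> chart_dom phi Q -> exists W, ext phi Q W.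
Proof.
move=> ap dQ; have [W HW] := ext_ex Q.
by eexists; exact: ext_change ap (ch_atlas Q) dQ (ch_dom Q) HW.
Qed.

Let val phi Q : C := match pselect (exists W, ext phi Q W) with
  left e => projT1 (cid e) Q | right _ => 0 end.

Let valE phi Q W : ext phi Q W -> val phi Q = W Q.
Proof.
move=> HW; rewrite /val; case: pselect => [e|[]]; last by exists W.
by case: cid => W' HW' /=; exact: ext_uniq HW' HW.
Qed.

Let ext_off phi Q W : ext phi Q W -> \forall q \near Q, q <> Q -> ext phi q W.
Proof.
move=> [hW WE]; apply: filterS2 (nh_near hW) (near_near WE) => q hq Wq qQ; split=> //.
by apply: filterS2 Wq (near_ne qQ) => p e pQ _; exact: e.
Qed.

Let val_near phi Q W : ext phi Q W -> \forall q \near Q, val phi q = W q.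
Proof.
move=> HW; apply: filterS (ext_off HW) => q e; have [->|qQ] := pselect (q = Q); first exact: valE.
exact: valE (e qQ).
Qed.

(** The values at each point of the local extensions form a holomorphic 1-form: they do not depend
    on the extension, by continuity, and they transform like dx. *)
Lemma noforms_ext Q W : ext (ch Q) Q W -> \forall q \near Q, W q = 0.
Proof.
move=> HW; pose w phi Q : 'cV[C]_1 := const_mx (val phi Q).
have ow : oneform w.
  split=> [phi q i ap dq|phi psi q ap aq dp dq].
    have [W' HW'] := ext_phi ap dq.
    have hv : hfun_at (val phi) q.
      by apply: nh_at; apply: nh_eq HW'.1; apply: filterS (val_near HW') => p; exact: esym.
    have hd := (hfun_chart (val phi) ap dq).1 hv.
    have -> : (fun v => w phi (chart_inv phi v) i 0 : C) = val phi \o chart_inv phi by apply/funext => v; rewrite mxE.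
    exact: hd.
  have [W' HW'] := ext_phi aq dq.
  have := valE (ext_change ap aq dp dq HW'); rewrite -(valE HW') => e.
  apply/colP => j; rewrite (ord1 j) [LHS]mxE [RHS]mxE big_ord1 [X in _ * X]mxE.
  exact: e.
apply: filterS2 (val_near HW) (chart_dom_nbhs (ch_dom Q)) => q e dq.
have := nB ow (ch_atlas Q) dq => /colP/(_ 0).
by rewrite !mxE e.
Qed.

End Gluing.

Section Compact.
Variables (R : realType) (B : cmanifold R 1).
Local Notation C := (cplx R).

(** The set of points near which [z] holds is open and, by the alternative, closed. *)
Lemma lcc_dichotomy (z : B -> Prop) : lcc B ->
  (forall Q, (\forall q \near Q, z q) \/ (\forall q \near Q, q <> Q -> ~ z q)) ->
  (forall Q, z Q) \/ (forall Q, \forall q \near Q, q <> Q -> ~ z q).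
Proof.
move=> lB H; pose h (Q : B) := `[< \forall q \near Q, z q >].
have hc Q : \forall q \near Q, h q = h Q.
  have [zQ|nz] := H Q.
    have -> : h Q = true by apply/asboolP.
    by apply: filterS (near_near zQ) => q; rewrite /h => zq; apply/asboolP.
  have F q : (\forall p \near q, p <> Q -> ~ z p) -> h q = false.
    move=> nq; apply/negbTE/asboolP => zq.
    have [qQ|qQ] := pselect (q = Q).
      have N : \forall p \near q, p <> q -> ~ z p by rewrite -qQ in nq.
      by have [p [zp _]] := near_neq N zq; apply.
    by have := nbhs_singleton nq; apply => //; exact: nbhs_singleton zq.
  by rewrite (F Q nz); apply: filterS (near_near nz) => q; exact: F.
have hE := lB _ h hc.
have [[Q zQ]|nz] := pselect (exists Q, h Q); [left|right] => Q'.
  by move: zQ; rewrite (hE Q Q') => /asboolP; exact: nbhs_singleton.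
by have [zQ|//] := H Q'; case: nz; exists Q'; apply/asboolP.
Qed.

Lemma compact_finite (z : B -> Prop) : compact [set: B] ->
  (forall Q, \forall q \near Q, q <> Q -> ~ z q) -> exists l : seq B, forall Q, z Q -> Q \in l.
Proof.
move=> cB H; pose F (U : set (seq B)) := exists s : seq B, forall l : seq B, {subset s <= l} -> U l.
have FF : Filter F.
  split=> [|U V [s sU] [t tV]|U V UV [s sU]]; first by exists [::].
    by exists (s ++ t) => l sl; split; [apply: sU|apply: tV] => y yl; apply: sl; rewrite mem_cat yl ?orbT.
  by exists s => l sl; apply: UV; exact: sU.
have /compact_near_coveringP := cB; move=> /(_ _ F (fun l Q => z Q -> Q \in l) FF).
case=> [Q _|l lH].
  exists ([set q | q <> Q -> ~ z q], [set l : seq B | Q \in l]); first split=> /=; first exact: H.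
    by exists [:: Q] => l /(_ Q); rewrite mem_head; exact.
  move=> [q l] /= [nz Ql] zq; have [->//|n] := pselect (q = Q).
  by case: (nz n zq).
by exists l => Q zQ; exact: lH.
Qed.

End Compact.

Lemma pole_algebra (F : fieldType) (a d t s : F) n : - (a * d^-1 * t ^+ n * s) = 0 -> d != 0 -> s != 0 -> t != 0 -> a = 0.
Proof.
move=> /eqP + d0 s0 t0; rewrite oppr_eq0 !mulf_eq0 invr_eq0 (negPf d0) (negPf s0) expf_eq0 (negPf t0) andbF !orbF.
by move=> /eqP.
Qed.

Lemma pole_algebra2 (F : fieldType) (u x d a s : F) n : (2 <= n)%N -> x != 0 -> d != 0 -> u * x ^+ n * d = a ->
  - (a * d^-1 * x^-1 ^+ (n - 2) * s) = u * - (x ^+ 2 * s).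
Proof.
move=> n2 x0 d0 <-; rewrite mulfK// -{1}(subnK n2) exprD exprVn mulrN; congr (- _).
have xn : x ^+ (n - 2) != 0 by rewrite expf_neq0.
by field.
Qed.

Lemma near_diff (R : realType) (H : cplx R -> cplx R) (z : cplx R) (p : cplx R -> Prop) : differentiable H z ->
  (\forall w \near H z, p w) -> \forall w \near z, p (H w).
Proof.
move=> /differentiable_continuous/contP c /nearP[e e0 pe]; have [r r0 rH] := c e e0.
by apply/nearP; exists r => // w /rH; exact: pe.
Qed.

Lemma comp_near (R : realType) (F H : cplx R -> cplx R) (z : cplx R) : (\forall w \near z, differentiable H w) ->
  (\forall w \near H z, differentiable F w) -> \forall w \near z, differentiable (fun w => F (H w)) w.
Proof.
move=> dH dF; have N := near_diff (nbhs_singleton dH) dF.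
by apply: filterS2 dH N => w e1 e2; exact: (@differentiable_comp _ _ _ _ H F w e1 e2).
Qed.

Section CompC.
Variables (R : realType) (B : cmanifold R 1).
Local Notation C := (cplx R).

Lemma hfun_compC (F : C -> C) (h : B -> C) q : hfun_at h q -> differentiable F (h q) -> hfun_at (F \o h) q.
Proof.
rewrite /hfun_at => hq dF; have e : (h \o chart_inv (ch q)) (ch q q) = h q by rewrite /= chart_mapK//; exact: ch_dom.
apply: (@differentiable_comp _ _ _ _ (h \o chart_inv (ch q)) F); first exact: hq.
by rewrite e.
Qed.

Lemma nh_compC (F : C -> C) (h : B -> C) Q : nh h Q -> (\forall w \near h Q, differentiable F w) -> nh (F \o h) Q.
Proof.
move=> hh dF; have hc := nh_cont hh; have N : \forall q \near Q, differentiable F (h q) by exact: hc _ dF.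
by apply: filterS2 hh N => q; exact: hfun_compC.
Qed.

End CompC.

(** * The dual basis at the poles *)

Section Dual.
Variable R : realType.
Local Notation C := (cplx R).
Variable B : cmanifold R 1.
Hypotheses (cB : compact [set: B]) (lB : lcc B) (nB : noforms B).
Variables (d : nat) (P : 'I_d -> B) (x : B -> C).
Hypothesis d0 : (0 < d)%N.
Hypothesis P_inj : injective P.
Hypothesis x_fin : forall Q, fin P Q -> nh x Q.
Hypothesis xP : forall j, x (P j) = 0.
Let t (q : B) := (x q)^-1.
Hypothesis t_nh : forall j, nh t (P j).
Hypothesis t_dz : forall j, dz (ch (P j)) t (P j) != 0.
Hypothesis P_full : forall j, exists n a, lcr P x n a (delta_mx 0 j).

Definition poly_fun (b : B -> C) := exists n v, lcr P x n b v.

Hypothesis A_sep : forall Q Q', fin P Q -> fin P Q' -> Q <> Q' -> exists2 b, poly_fun b & b Q != b Q'.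
Hypothesis A_coord : forall phi Q, atlas phi -> chart_dom phi Q -> fin P Q -> exists2 b, poly_fun b & dz phi b Q != 0.

Let tP j : t (P j) = 0. Proof. by rewrite /t xP invr0. Qed.

Let A_nh b Q : poly_fun b -> fin P Q -> nh b Q.
Proof. by move=> [n [v [H _]]]; exact: H. Qed.

Lemma lcr_widen n k a v : lcr P x n a v -> exists w, lcr P x (n + k) a w.
Proof.
elim: k v => [|k IH] v; first by rewrite addn0; exists v.
move=> /IH[w [h1 h2]]; exists 0; rewrite addnS; split=> // j; have [g [hg gv gE]] := h2 j.
exists (fun q => g q * t q); split; [exact: nh_mul|by rewrite tP mulr0 mxE|].
apply: filterS2 gE (x_neq0 t_nh t_dz j) => q e x0 qP; rewrite e// exprS mulrA -(mulrA (g q)) [t q * _]mulVf ?mulr1//.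
exact: x0.
Qed.

Let A_add a b : poly_fun a -> poly_fun b -> poly_fun (fun q => a q + b q).
Proof.
move=> [n [v Hv]] [m [w Hw]]; have [v' Hv'] := lcr_widen m Hv; have [w' Hw'] := lcr_widen n Hw.
by rewrite addnC in Hw'; exists (n + m)%N, (v' + w'); exact: lcr_add.
Qed.

Let A_mul a b : poly_fun a -> poly_fun b -> poly_fun (fun q => a q * b q).
Proof. by move=> [n [v Hv]] [m [w Hw]]; eexists; eexists; exact: lcr_mul Hv Hw. Qed.

Let A_cst (c : C) : poly_fun (fun=> c).
Proof.
have s : (size (c%:P : {poly C}) <= 1)%N by rewrite size_polyC leq_b1.
have := lcr_poly x_fin xP t_nh t_dz s.
have -> : (fun q => c%:P.[x q]) = fun=> c by apply/funext => q; rewrite hornerC.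
by move=> H; exists 0%N; eexists; exact: H.
Qed.

Let A_x : poly_fun x.
Proof. by exists 1%N; eexists; exact: lcr_x1. Qed.

Let x_near c j : \forall q \near P j, q <> P j -> x q != c.
Proof.
have hk : nh (fun q => 1 - c * t q) (P j) by apply: nh_sub (nh_cst _ _) _; exact: nh_mul (nh_cst _ _) (t_nh j).
have k0 : 1 - c * t (P j) != 0 by rewrite tP mulr0 subr0 oner_neq0.
apply: filterS2 (nh_neq0 hk k0) (x_neq0 t_nh t_dz j) => q h x0 qP; apply: contra_neq h => xc.
by rewrite /t -xc divff ?subrr// x0.
Qed.

Lemma x_isolated c Q : \forall q \near Q, q <> Q -> ~ (fin P q /\ x q = c).
Proof.
have iso Q' : (\forall q \near Q', fin P q /\ x q = c) \/ (\forall q \near Q', q <> Q' -> ~ (fin P q /\ x q = c)).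
  have [fQ|] := pselect (fin P Q').
    have [E|E] := nh_zero (nh_sub (x_fin fQ) (nh_cst c Q')); [left|right].
      by apply: filterS2 (fin_near fQ) E => q fq /eqP; rewrite subr_eq0 => /eqP.
    by apply: filterS E => q e qQ [_ xc]; have := e qQ; rewrite xc subrr eqxx.
  move=> /existsNP[j /contrapT ->]; right.
  by apply: filterS (x_near c j) => q h /h h' [_ xc]; rewrite xc eqxx in h'.
have [H|] := lcc_dichotomy lB iso; last by exact.
by have [/(_ (Ordinal d0))[]] := H (P (Ordinal d0)).
Qed.

Let A_div a c : poly_fun a -> (forall Q, fin P Q -> x Q = c -> divat x c a Q) ->
  exists2 b, poly_fun b & forall Q, fin P Q -> a Q = (x Q - c) * b Q.
Proof.
move=> [n [v [ha Ha]]] H.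
(* The quotient of [a] by x - c; at the zeros of x - c its value is that of a local quotient. *)
pose b Q := if pselect (exists g, nh g Q /\ \forall q \near Q, a q = (x q - c) * g q) is left e
  then projT1 (cid e) Q else a Q / (x Q - c).
have bE Q g : fin P Q -> nh g Q -> (\forall q \near Q, a q = (x q - c) * g q) -> b Q = g Q.
  move=> fQ hg gE; rewrite /b; case: pselect => [e|[]]; last by exists g.
  case: cid => g' [hg' gE'] /=; apply: nh_limit hg' hg _.
  apply: filterS3 gE gE' (@filterI _ _ (nbhs_filter Q) _ _ (fin_near fQ) (x_isolated c Q)) => q e1 e2 [fq nc] qQ.
  have x0 : x q - c != 0 by rewrite subr_eq0; apply/eqP => xc; exact: nc qQ (conj fq xc).
  by apply: (mulfI x0); rewrite -e1 -e2.
have gE Q : fin P Q -> exists2 g, nh g Q & \forall q \near Q, a q = (x q - c) * g q.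
  move=> fQ; have [xc|xc] := eqVneq (x Q) c; first exact: H.
  have hx : nh (fun q => x q - c) Q by exact: nh_sub (x_fin fQ) (nh_cst _ _).
  have x0 : x Q - c != 0 by rewrite subr_eq0.
  exists (fun q => a q * (x q - c)^-1); first exact: nh_mul (ha Q fQ) (nh_inv hx x0).
  by apply: filterS (nh_neq0 hx x0) => q xq; rewrite mulrCA divff ?mulr1.
have bN Q : fin P Q -> exists2 g, nh g Q & \forall q \near Q, b q = g q.
  move=> fQ; have [g hg ge] := gE Q fQ; exists g => //.
  apply: filterS3 (near_near ge) (fin_near fQ) (nh_near hg) => q e fq hq.
  exact: bE e.
have bF Q : fin P Q -> a Q = (x Q - c) * b Q.
  by move=> fQ; have [g hg ge] := gE Q fQ; rewrite (bE Q g fQ hg ge); exact: nbhs_singleton ge.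
exists b => //; exists n, 0; split=> [Q fQ|j].
  by have [g hg ge] := bN Q fQ; apply: nh_eq hg; apply: filterS ge => q; exact: esym.
have [g [hg gv ge]] := Ha j.
have hk : nh (fun q => 1 - c * t q) (P j) by apply: nh_sub (nh_cst _ _) _; exact: nh_mul (nh_cst _ _) (t_nh j).
have k0 : 1 - c * t (P j) != 0 by rewrite tP mulr0 subr0 oner_neq0.
exists (fun q => g q * t q * (1 - c * t q)^-1); split.
- by apply: nh_mul (nh_inv hk k0); exact: nh_mul.
- by rewrite tP mulr0 mul0r mxE.
apply: filterS3 ge (x_near c j) (@filterI _ _ (nbhs_filter (P j)) _ _ (x_neq0 t_nh t_dz j) (@pole_near _ _ _ P j)) => q e xc [x0 fq] qP.
have e2 := bF q (fq qP); rewrite (e qP) in e2.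
have xc0 : x q - c != 0 by rewrite subr_eq0 xc.
apply: (mulfI xc0); rewrite -e2.
have -> : (1 - c * t q) = (x q - c) / x q by rewrite mulrBl divff ?x0.
by rewrite /t; field; rewrite x0// xc0.
Qed.

Lemma fibre_finite c : exists l : seq B, forall Q, fin P Q -> x Q = c -> Q \in l.
Proof.
have [l lH] := compact_finite cB (x_isolated c).
by exists l => Q fQ xQ; exact: lH.
Qed.

(** A complex vector space is not a finite union of kernels of nonzero functionals: [c] avoids the
    finitely many values at which one of them would vanish. *)
Lemma avoid_zeros (L : seq ((B -> C) -> C)) :
  (forall l, l \in L -> (forall (c : C) a b, poly_fun a -> poly_fun b -> l (fun q => a q + c * b q) = l a + c * l b) /\
    exists2 b, poly_fun b & l b != 0) ->
  exists2 y, poly_fun y & forall l, l \in L -> l y != 0.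
Proof.
elim: L => [_|l L IH H]; first by exists (fun=> 0) => //; exact: A_cst.
have [y Ay Hy] : exists2 y, poly_fun y & forall l, l \in L -> l y != 0.
  by apply: IH => l' l'L; apply: H; rewrite in_cons l'L orbT.
have [lin [b Ab lb]] := H l (mem_head _ _).
have [c cN] := ex_notin (- l y / l b :: [seq - l' y / l' b | l' <- L]).
exists (fun q => y q + c * b q); first by apply: A_add => //; exact: A_mul (A_cst c) Ab.
have main l' : l' \in l :: L -> - l' y / l' b \in (- l y / l b :: [seq - l' y / l' b | l' <- L]) ->
    (l' b != 0 \/ l' y != 0) -> l' (fun q => y q + c * b q) != 0.
  move=> l'L bad nz; rewrite ((H l' l'L).1 c y b Ay Ab).
  have [b0|b0] := eqVneq (l' b) 0.
    by rewrite b0 mulr0 addr0; case: nz => //; rewrite b0 eqxx.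
  apply: contraNneq cN => e; suff -> : c = - l' y / l' b by [].
  by apply: (mulIf b0); rewrite mulfVK//; apply/eqP; rewrite -addr_eq0 addrC e.
move=> l'; rewrite in_cons => /orP[/eqP->|l'L].
  by apply: main; [exact: mem_head|exact: mem_head|left].
apply: main; [by rewrite in_cons l'L orbT| |by right; exact: Hy].
by rewrite in_cons; apply/orP; right; apply/mapP; exists l'.
Qed.

(** The functionals to avoid are the derivative at [Q0] and the differences of the values at the
    other points of the fibre and at [Q0]; the fibre is finite. *)
Lemma good_ex phi Q0 : atlas phi -> chart_dom phi Q0 -> fin P Q0 -> exists y, [/\ poly_fun y, dz phi y Q0 != 0 &
  forall Q, fin P Q -> x Q = x Q0 -> Q <> Q0 -> y Q != y Q0].
Proof.
move=> ap dQ fQ; have [l lH] := fibre_finite (x Q0).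
pose L := (fun b => dz phi b Q0) :: [seq (fun b : B -> C => b Q - b Q0) | Q <- l & `[< fin P Q /\ Q <> Q0 >]].
have [y Ay Hy] : exists2 y, poly_fun y & forall l, l \in L -> l y != 0.
  apply: avoid_zeros => f; rewrite in_cons => /orP[/eqP->|].
    split; last exact: A_coord.
    move=> c a b Aa Ab; have ha := nh_at (A_nh Aa fQ); have hb' := nh_at (A_nh Ab fQ).
    have hc := nh_at (nh_cst c Q0).
    apply: etrans (dz_add ap dQ ha (hfun_mul hc hb')) _; congr (_ + _).
    by apply: etrans (dz_mul ap dQ hc hb') _; rewrite dz_cst mulr0 addr0.
  move=> /mapP[Q]; rewrite mem_filter => /andP[/asboolP[fQ' QQ] _] ->; split.
    by move=> c a b _ _; rewrite mulrBr opprD addrACA.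
  have [b Ab bQ] := A_sep fQ' fQ QQ; exists b => //.
  by rewrite subr_eq0.
exists y; split; [exact: Ay|exact: (Hy (fun b => dz phi b Q0) (mem_head _ _))|].
move=> Q fQ' xQ QQ; rewrite -subr_eq0.
have Ql : Q \in [seq Q <- l | `[< fin P Q /\ Q <> Q0 >]].
  by rewrite mem_filter lH// andbT; apply/asboolP.
have mem := map_f (fun Q => (fun b : B -> C => b Q - b Q0)) Ql.
have memL : (fun b : B -> C => b Q - b Q0) \in L by rewrite in_cons mem orbT.
exact: (Hy _ memL).
Qed.

Section Basis.
Variables (eta : 'I_d -> B -> C) (a : 'I_d -> nat) (E : 'M[C]_d).
Hypothesis fam : pole_basis P x eta a E.
Hypothesis mini : forall eta' a' E', pole_basis P x eta' a' E' -> (\sum_i a i <= \sum_i a' i)%N.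

Let A_eta i : poly_fun (eta i).
Proof. by exists (a i), (row i E); exact: fam.1. Qed.

Let A_span b : poly_fun b -> exists p, forall Q, fin P Q -> b Q = combo x eta p Q.
Proof. by move=> [n [v H]]; exact: (comb_span cB lB d0 x_fin xP t_nh t_dz fam mini H). Qed.

Let A_free p : (forall Q, fin P Q -> combo x eta p Q = 0) -> forall i, p i = 0.
Proof. by move=> H; exact: (comb_eq0 x_fin xP t_nh t_dz fam (p := p) H). Qed.

Let mulmat y : poly_fun y -> exists Y : 'M[{poly C}]_d, forall Q, fin P Q ->
  y Q *: ev eta Q = (\matrix_(i, j) (Y i j).[x Q]) *m ev eta Q.
Proof.
move=> Ay; have H i : exists p, forall Q, fin P Q -> y Q * eta i Q = combo x eta p Q.
  by apply: A_span; exact: A_mul.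
have [p pE] := choice H; exists (\matrix_(i, j) p i j) => Q fQ; apply/colP => i.
rewrite [LHS]mxE [ev eta Q i 0]mxE pE// mxE /combo; apply: eq_bigr => j _.
by rewrite !mxE.
Qed.

Definition dual (Q : B) (gam : 'rV[C]_d) := el eta gam Q = 1 /\
  forall Q', fin P Q' -> x Q' = x Q -> Q' <> Q -> divat x (x Q) (el eta gam) Q'.

Lemma dual_ex phi Q : atlas phi -> chart_dom phi Q -> fin P Q -> dz phi x Q != 0 -> exists gam, dual Q gam.
Proof.
move=> ap dQ fQ dx; have [y [Ay dy ys]] := good_ex ap dQ fQ; have [Y YE] := mulmat Ay.
exact: (loc_unram (@fin_near R B d P) A_nh A_eta A_cst A_x A_add A_mul A_div A_span A_free ap dQ fQ Ay dy ys YE dx).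
Qed.

Lemma dz_x_near phi Q : atlas phi -> chart_dom phi Q -> fin P Q -> \forall q \near Q, q <> Q -> dz phi x q != 0.
Proof.
move=> ap dQ fQ; have [y [Ay dy ys]] := good_ex ap dQ fQ; have [Y YE] := mulmat Ay.
exact: (loc_dx (@fin_near R B d P) A_nh A_eta A_cst A_x A_add A_mul A_div A_span A_free ap dQ fQ Ay dy ys YE).
Qed.

Variable i0 : 'I_d.
(** The value at [Q] of the element [i0] of the dual basis. Its values at ramification points and at
    poles do not matter, since these are isolated and [ext] looks at punctured neighbourhoods. *)
Definition coef (Q : B) : C := if pselect (exists gam, dual Q gam) is left e then projT1 (cid e) 0 i0 else 0.

Lemma coef_fin Q : fin P Q -> exists W, ext coef x (ch Q) Q W.
Proof.
move=> fQ; have ap := ch_atlas Q; have dQ := ch_dom Q.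
have [y [Ay dy ys]] := good_ex ap dQ fQ; have [Y YE] := mulmat Ay.
have [W [hW WE]] := loc_form (@fin_near R B d P) A_nh A_eta A_cst A_x A_add A_mul A_div A_span A_free ap dQ fQ Ay dy ys YE i0.
exists W; split=> //; apply: filterS3 WE (dz_x_near ap dQ fQ)
  (@filterI _ _ (nbhs_filter Q) _ _ (fin_near fQ) (chart_dom_nbhs dQ)) => q e dx [fq dq] qQ.
rewrite /coef; case: pselect => [ex|[]]; last exact: (dual_ex ap dq fq (dx qQ)).
by case: cid => gam [g1 g2] /=; exact: e.
Qed.

(** The inverse of the local coordinate [t] at [P l], defined near 0. *)
Lemma sheet l : exists G : C -> C, [/\ \forall w \near (0 : C), differentiable G w, G 0 = cz (ch (P l)) (P l),
  \forall w \near (0 : C), t (cv (ch (P l)) (G w)) = w & \forall q \near P l, G (t q) = cz (ch (P l)) q].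
Proof.
have ap := ch_atlas (P l); have dP := ch_dom (P l); set phi := ch (P l) in ap dP *.
have [rho [e [G [rho0 e0 GH inj]]]] := local_inverse ((nh_cv t ap dP).1 (t_nh l)) (t_dz l).
have f0 : (t \o cv phi) (cz phi (P l)) = 0 by rewrite /= cv_cz.
rewrite f0 in GH.
have N : \forall w \near (0 : C), rn (w - 0) < e by apply/nearP; exists e.
have G0 : G 0 = cz phi (P l).
  have e00 : rn (0 - 0 : C) < e by rewrite subrr rn0.
  have [h1 h2 _] := GH 0 e00; apply: inj => //; first by rewrite subrr rn0.
  by rewrite h2 f0.
exists G; split=> //.
- by apply: filterS N => w we; have [] := GH w we.
- by apply: filterS N => w we; have [_ h _] := GH w we; exact: h.
- have N1 : \forall q \near P l, rn (t q - t (P l)) < e by exact: nh_close (t_nh l) e0.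
  have N2 : \forall q \near P l, rn (cz phi q - cz phi (P l)) < rho.
    apply/(near_cv _ dP); apply: filterS2 (cv_near dP) ((nearP _ (fun z => rn (z - cz phi (P l)) < rho)).2 _) => [z [_ ->] h|]; first exact: h.
    by exists rho.
  apply: filterS3 N1 N2 (chart_dom_nbhs dP) => q h1 h2 dq; rewrite tP in h1.
  have [g1 g2 _] := GH _ h1; apply: inj => //.
  by rewrite g2 /= cv_cz.
Qed.

Let G l := projT1 (cid (sheet l)).
Let GP l : [/\ \forall w \near (0 : C), differentiable (G l) w, G l 0 = cz (ch (P l)) (P l),
  \forall w \near (0 : C), t (cv (ch (P l)) (G l w)) = w & \forall q \near P l, G l (t q) = cz (ch (P l)) q].
Proof. by rewrite /G; case: cid. Qed.
(** For [q] near any of the poles, the point near [P l] at which [x] has the same value as at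
    [q]. *)
Let tau l (q : B) : B := cv (ch (P l)) (G l (t q)).

Let near_G g l : nh g (P l) -> G l 0 = cz (ch (P l)) (P l) -> \forall w \near G l 0, differentiable (g \o cv (ch (P l))) w.
Proof. by move=> hg ->; exact: (nh_cv g (ch_atlas _) (ch_dom _)).1 hg. Qed.

Section AtPole.
Variable k : 'I_d.

Let near_t (p : C -> Prop) : (\forall w \near (0 : C), p w) -> \forall q \near P k, p (t q).
Proof. by move=> H; apply: (nh_cont (t_nh k)); rewrite -/(t (P k)) tP. Qed.

Lemma tau_nh l g : nh g (P l) -> nh (g \o tau l) (P k).
Proof.
move=> hg; have [h1 h2 _ _] := GP l.
have -> : g \o tau l = (fun w => (g \o cv (ch (P l))) (G l w)) \o t by apply/funext => q.
apply: nh_compC (t_nh k) _; rewrite tP.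
exact: (comp_near h1 (near_G hg h2)).
Qed.

Lemma tau_P l : tau l (P k) = P l.
Proof. by rewrite /tau tP; have [_ -> _ _] := GP l; rewrite cv_cz//; exact: ch_dom. Qed.

Lemma tau_cont l (p : B -> Prop) : (\forall q \near P l, p q) -> \forall q \near P k, p (tau l q).
Proof.
move=> /(near_cv _ (ch_dom (P l))) H; have [h1 h2 _ _] := GP l.
rewrite -h2 in H; have N := near_diff (nbhs_singleton h1) H.
exact: (near_t N).
Qed.

Lemma tau_t l : \forall q \near P k, t (tau l q) = t q.
Proof. by have [_ _ h _] := GP l; exact: near_t h. Qed.

Lemma tau_id : \forall q \near P k, tau k q = q.
Proof.
have [_ _ _ h] := GP k; apply: filterS2 h (chart_dom_nbhs (ch_dom (P k))) => q e dq.
by rewrite /tau e cv_cz.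
Qed.

Lemma tau_ne l : l <> k -> \forall q \near P k, tau l q <> q.
Proof.
move=> lk; have PP : P l != P k by apply/eqP => /P_inj.
have hB : hausdorff_space B := @manifold_hausdorff _ _ B.
move: hB; rewrite open_hausdorff => /(_ _ _ PP)[[U V] /= [lU kV] [oU oV /eqP UV]].
have nU : \forall q \near P l, U q by apply: open_nbhs_nbhs; split=> //; exact: set_mem lU.
have nV : \forall q \near P k, V q by apply: open_nbhs_nbhs; split=> //; exact: set_mem kV.
apply: filterS2 (tau_cont nU) nV => q u v e; rewrite e in u.
have : (U `&` V) q by split.
by rewrite UV.
Qed.

Let gw i l := projT1 (cid ((fam.1 i).2 l)).
Let gwP i l : [/\ nh (gw i l) (P l), gw i l (P l) = E i l & \forall q \near P l, q <> P l -> eta i q = gw i l q * x q ^+ a i].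
Proof. by rewrite /gw; case: cid => g [h1 h2 h3]; split=> //=; rewrite h2 mxE. Qed.

Let Gam (q : B) : 'M[C]_d := \matrix_(i, l) gw i l (tau l q).

Let Gam_nh i l : nh (fun q => Gam q i l) (P k).
Proof.
have -> : (fun q => Gam q i l) = gw i l \o tau l by apply/funext => q; rewrite mxE.
by apply: tau_nh; have [] := gwP i l.
Qed.

Let Gam_P : Gam (P k) = E.
Proof. by apply/matrixP => i l; rewrite mxE tau_P; have [] := gwP i l. Qed.

(** At the points [tau l q] of the fibre of [q], the conditions of [dual] form a linear system for
    the numbers gam_i x^(a_i). Its matrix [Gam q] has the value [E] at [P k], and Cramer's rule
    solves it. *)
Lemma dual_pole : \forall q \near P k, q <> P k -> forall gam, dual q gam ->
  gam 0 i0 * x q ^+ a i0 * \det (Gam q) = (\adj (Gam q)) k i0.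
Proof.
have H1 : \forall q \near P k, forall l, l <> k -> tau l q <> q.
  apply: filter_forall => l; have [->|lk] := pselect (l = k); first by apply: nearW.
  by apply: filterS (tau_ne lk) => q h _.
have H2 : \forall q \near P k, forall l, t (tau l q) = t q by apply: filter_forall => l; exact: tau_t.
have H3 : \forall q \near P k, forall l, tau l q <> P l -> fin P (tau l q).
  by apply: filter_forall => l; exact: tau_cont (@pole_near _ _ _ P l).
have H4 : \forall q \near P k, forall l, forall i, tau l q <> P l -> eta i (tau l q) = gw i l (tau l q) * x (tau l q) ^+ a i.
  apply: filter_forall => l; apply: filter_forall => i.
  by have [_ _ h] := gwP i l; exact: tau_cont h.
have HA := @filterI _ _ (nbhs_filter (P k)) _ _ H1 H2.
have HB := @filterI _ _ (nbhs_filter (P k)) _ _ H3 H4.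
have HC := @filterI _ _ (nbhs_filter (P k)) _ _ tau_id (t_neq0 t_nh t_dz k).
apply: filterS3 HA HB HC => q [h1 h2] [h3 h4] [h5 h6] qP gam [g1 g2].
have tn l : tau l q <> P l by move=> e; have := h2 l; rewrite e tP => e'; move: (h6 qP); rewrite -/(t q) -e' eqxx.
have xt l : x (tau l q) = x q by apply: invr_inj; exact: h2.
have row l : \sum_i gam 0 i * x q ^+ a i * Gam q i l = (l == k)%:R.
  have -> : \sum_i gam 0 i * x q ^+ a i * Gam q i l = el eta gam (tau l q).
    rewrite /el mxE; apply: eq_bigr => i _; rewrite !mxE (h4 l i (tn l)) xt -mulrA.
    by congr (_ * _); rewrite mulrC.
  have [->|lk] := eqVneq l k; first by rewrite h5 g1.
  have lk' : l <> k by apply/eqP.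
  have [g _ gE] := g2 (tau l q) (h3 l (tn l)) (xt l) (h1 l lk').
  by rewrite (nbhs_singleton gE) xt subrr mul0r.
have rowM : (\row_i (gam 0 i * x q ^+ a i)) *m Gam q = delta_mx 0 k.
  apply/rowP => l; rewrite mxE [RHS]mxE eqxx -row; apply: eq_bigr => i _.
  by rewrite [X in X * _]mxE.
have := congr1 (fun X => (X *m \adj (Gam q)) 0 i0) rowM.
rewrite -mulmxA mul_mx_adj mul_mx_scalar -rowE [RHS]mxE => <-.
by rewrite [RHS]mxE [RHS]mulrC; congr (_ * _); rewrite mxE.
Qed.

Lemma dz_pole : \forall q \near P k, q <> P k -> dz (ch (P k)) x q = - (x q ^+ 2 * dz (ch (P k)) t q).
Proof.
have ap := ch_atlas (P k); have dP := ch_dom (P k); set phi := ch (P k) in ap dP *.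
have HA := @filterI _ _ (nbhs_filter (P k)) _ _ (nh_near (t_nh k)) (chart_dom_nbhs dP).
apply: filterS3 HA (@pole_near _ _ _ P k) (near_near (x_neq0 t_nh t_dz k)) => q [ht dq] fq x0 qP.
have hx := x_fin (fq qP).
have E1 : \forall p \near q, t p * x p = 1.
  apply: filterS2 (near_ne qP) x0 => p pP h; rewrite /t mulVf//; exact: h.
have := dz_near dq E1; rewrite (dz_mul ap dq (nh_at ht) (nh_at hx)) dz_cst => e.
have xq : x q != 0 by have := nbhs_singleton x0; exact.
move: e; rewrite /t; move: (dz phi x q) (dz phi _ q) => A D e.
apply: (mulfI (invr_neq0 xq)); apply/eqP; rewrite -subr_eq0 mulrN opprK expr2 mulrA mulKf// e.
by [].
Qed.

Hypothesis ai0 : (2 <= a i0)%N.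

Let W (q : B) : C := - ((\adj (Gam q)) k i0 * (\det (Gam q))^-1 * t q ^+ (a i0 - 2) * dz (ch (P k)) t q).

(** By [dual_pole] the coefficient has the factor t^(a_i0), whereas dx = - dt / t^2; this is where
    [2 <= a i0] is needed. If the extended form vanishes near [P k], so does the cofactor of [E] in
    it. *)
Lemma coef_pole : exists W, ext coef x (ch (P k)) (P k) W /\ ((\forall q \near P k, W q = 0) -> (\adj E) k i0 = 0).
Proof.
have ap := ch_atlas (P k); have dP := ch_dom (P k).
have hdet : nh (fun q => \det (Gam q)) (P k) by apply: nh_det => i l; exact: Gam_nh.
have det0 : \det (Gam (P k)) != 0 by rewrite Gam_P; have := fam.2; rewrite unitmxE unitfE.
have htz : nh (dz (ch (P k)) t) (P k) by apply: nh_dz => //; exact: t_nh.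
have hadj : nh (fun q => (\adj (Gam q)) k i0) (P k) by apply: nh_adj => i l; exact: Gam_nh.
have HC := @filterI _ _ (nbhs_filter (P k)) _ _ (nh_neq0 hdet det0) (nh_neq0 htz (t_dz k)).
exists W; split; last first.
  move=> WN; rewrite -Gam_P; apply: (nh_limit hadj (nh_cst 0 _)).
  apply: filterS3 WN HC (t_neq0 t_nh t_dz k) => q w0 [dq tz] t0 qP.
  exact: pole_algebra w0 dq tz (t0 qP).
split.
  have -> : W = fun q => (-1) * ((\adj (Gam q)) k i0 * (\det (Gam q))^-1 * t q ^+ (a i0 - 2) * dz (ch (P k)) t q).
    by apply/funext => q; rewrite mulN1r.
  apply: nh_mul (nh_cst _ _) _; apply: nh_mul htz; apply: nh_mul; last by apply: nh_exp; exact: t_nh.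
  by apply: nh_mul hadj _; exact: nh_inv.
have HA := @filterI _ _ (nbhs_filter (P k)) _ _ dual_pole dz_pole.
have HB := @filterI _ _ (nbhs_filter (P k)) _ _ (@pole_near _ _ _ P k) (x_neq0 t_nh t_dz k).
have HD := @filterI _ _ (nbhs_filter (P k)) _ _ HC (chart_dom_nbhs dP).
apply: filterS3 HA HB HD => q [h1 h2] [h3 h4] [[dq tz] cq] qP.
have x0 := h4 qP.
have dx0 : dz (ch (P k)) x q != 0.
  by rewrite (h2 qP) oppr_eq0 mulf_neq0// expf_neq0.
have [gam Hg] := dual_ex ap cq (h3 qP) dx0.
have cE : coef q * x q ^+ a i0 * \det (Gam q) = (\adj (Gam q)) k i0.
  rewrite /coef; case: pselect => [e|[]]; last by exists gam.
  by case: cid => gam' Hg' /=; exact: h1.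
rewrite (h2 qP); exact: pole_algebra2 ai0 x0 dq cE.
Qed.

End AtPole.

Lemma adj_zero k : (2 <= a i0)%N -> (\adj E) k i0 = 0.
Proof.
move=> ai0.
have x_off Q : \forall q \near Q, q <> Q -> nh x q.
  have [fQ|] := pselect (fin P Q); first by apply: filterS (fin_near fQ) => q fq _; exact: x_fin.
  move=> /existsNP[j /contrapT ->].
  by apply: filterS (@pole_near _ _ _ P j) => q h /h; exact: x_fin.
have ex Q : exists W, ext coef x (ch Q) Q W.
  have [fQ|] := pselect (fin P Q); first exact: coef_fin.
  move=> /existsNP[j /contrapT ->].
  by have [W [HW _]] := coef_pole j ai0; exists W.
have [W [HW W0]] := coef_pole k ai0.
exact: W0 (noforms_ext nB x_off ex HW).
Qed.

End Basis.

Lemma simple_poles j : exists f, lcr P x 1 f (delta_mx 0 j).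
Proof.
have [eta [a [E [fam mini]]]] := min_family P_full.
have a1 i : (a i <= 1)%N.
  rewrite leqNgt; apply/negP => ai; have Z k := adj_zero fam mini k ai.
  have := congr1 (fun M : 'M[C]_d => M i i) (mul_mx_adj E).
  rewrite mxE big1 => [|k _]; last by rewrite Z mulr0.
  rewrite mxE eqxx mulr1n => e; have := fam.2; rewrite unitmxE unitfE -e eqxx.
  by [].
(* All orders are at most 1, so powers of [x] bring every [eta i] to order 1; the row [j] of the
   inverse of [E] combines the leading coefficients to [delta_mx 0 j]. *)
have H i : lcr P x 1 (fun q => (invmx E) j i * (x q ^+ (1 - a i) * eta i q)) ((invmx E) j i *: row i E).
  by apply: lcr_scale; apply: (lcr_shift x_fin xP t_nh t_dz (a1 i)); exact: fam.1.
have S := lcr_sum H; exists (fun q => \sum_i (invmx E) j i * (x q ^+ (1 - a i) * eta i q)).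
suff <- : \sum_i (invmx E) j i *: row i E = delta_mx 0 j by [].
have -> : \sum_i (invmx E) j i *: row i E = row j (invmx E) *m E.
  by rewrite mulmx_sum_row; apply: eq_bigr => i _; rewrite [in RHS]mxE.
by rewrite -row_mul mulVmx ?fam.2// row1.
Qed.

End Dual.

Section Bijective.
Variable R : realType.
Local Notation C := (cplx R).
Variables B N : cmanifold R 1.

(** The inverse is holomorphic by the local inverse theorem in the charts. *)
Lemma biholomorphic_of_local (f : B -> N) : injective f -> (forall y, exists x, f x = y) ->
  (forall Q, exists psi h, [/\ atlas psi, nh h Q, dz (ch Q) h Q != 0 & \forall q \near Q, chart_dom psi (f q) /\ psi (f q) = up (h q)]) ->
  biholomorphic B N.
Proof.
move=> fi fs H; pose g y := projT1 (cid (fs y)).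
have gK : cancel g f by move=> y; rewrite /g; case: cid.
have fK : cancel f g by move=> x; apply: fi; exact: gK.
exists f, g; split=> //.
  apply: holomorphic_of_chart => Q.
  have [psi [h [aq hh _ fE]]] := H Q; have [dq eq0] := nbhs_singleton fE.
  have ap := ch_atlas Q; have dp := ch_dom Q.
  exists (ch Q), psi; split=> //; split; first by apply: filterS fE => q [].
  have E : \forall v \near ch Q Q, (fun v => up ((h \o chart_inv (ch Q)) v)) v = (psi \o f \o chart_inv (ch Q)) v.
    by move/(near_chart _ dp): fE; apply: filterS => v [_ e]; rewrite /= e.
  apply: near_differentiable E _; apply: differentiable_row => j.
  have -> : (fun v => up ((h \o chart_inv (ch Q)) v) 0 j : C) = h \o chart_inv (ch Q) by apply/funext => v; rewrite mxE.
  exact: (hfun_chart h ap dp).1 (nh_at hh).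
apply: holomorphic_of_chart => L; pose Q := g L; have fQ : f Q = L by exact: gK.
have [psi [h [aq hh dh fE]]] := H Q; have [dq eq0] := nbhs_singleton fE.
have ap := ch_atlas Q; have dp := ch_dom Q; set phi := ch Q in ap dp dh.
rewrite fQ in dq eq0.
have [rho [e [G [rho0 e0 GH inj]]]] := local_inverse ((nh_cv h ap dp).1 hh) dh.
have hQ : (h \o cv phi) (cz phi Q) = h Q by rewrite /= cv_cz.
rewrite hQ in GH.
have eQ : rn (h Q - h Q) < e by rewrite subrr rn0.
have GQ : G (h Q) = cz phi Q.
  by have [h1 h2 _] := GH _ eQ; apply: inj => //; [rewrite subrr rn0|rewrite h2 hQ].
have dG : differentiable G (h Q) by have [] := GH _ eQ.
have N1 : \forall w \near h Q, [/\ chart_dom psi (f (cv phi (G w))), psi (f (cv phi (G w))) = up (h (cv phi (G w))),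
    chart_dom phi (cv phi (G w)), cz phi (cv phi (G w)) = G w & h (cv phi (G w)) = w].
  have M1 : \forall z \near G (h Q), chart_dom psi (f (cv phi z)) /\ psi (f (cv phi z)) = up (h (cv phi z)).
    by rewrite GQ; move/(near_cv _ dp): fE.
  have M2 : \forall z \near G (h Q), chart_dom phi (cv phi z) /\ cz phi (cv phi z) = z by rewrite GQ; exact: cv_near.
  have M3 : \forall w \near h Q, rn (w - h Q) < e by apply/nearP; exists e.
  apply: filterS3 (near_diff dG M1) (near_diff dG M2) M3 => w [a1 a2] [a3 a4] a5.
  by split=> //; have [_ a6 _] := GH w a5; exact: a6.
pose lo (v : 'rV[C]_1) : C := v 0 0.
have N2 : \forall v \near (psi L : 'rV[C]_1), [/\ chart_dom psi (f (cv phi (G (lo v)))), psi (f (cv phi (G (lo v)))) = v,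
    chart_dom phi (cv phi (G (lo v))) & cz phi (cv phi (G (lo v))) = G (lo v)].
  rewrite eq0; apply/near_up; apply: filterS N1 => w [a1 a2 a3 a4 a5].
  by rewrite /lo mxE; split=> //; rewrite a2 a5.
have N3 : \forall v \near (psi L : 'rV[C]_1), g (chart_inv psi v) = cv phi (G (lo v)) /\ chart_dom phi (cv phi (G (lo v))) /\ cz phi (cv phi (G (lo v))) = G (lo v).
  apply: filterS2 N2 (chart_near dq) => v [a1 a2 a3 a4] [b1 b2]; split=> //.
  by apply: fi; rewrite gK -[v in LHS]a2 chart_mapK.
have dQ' : chart_dom phi (g L) by [].
exists psi, phi; split=> //; split.
  apply/(near_chart _ dq); apply: filterS N3 => v [-> []].
  by [].
have E : \forall v \near (psi L : 'rV[C]_1), (fun v : 'rV[C]_1 => up (G (lo v))) v = (phi \o g \o chart_inv psi) v.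
  by apply: filterS N3 => v [a1 [_ a2]]; rewrite /= a1 -[RHS]up_lo; congr up; exact: esym a2.
apply: near_differentiable E _; apply: differentiable_row => j.
have -> : (fun v : 'rV[C]_1 => up (G (lo v)) 0 j : C) = G \o lo by apply/funext => v; rewrite mxE.
apply: differentiable_comp; first exact: differentiable_coord.
by rewrite eq0 /lo mxE.
Qed.

End Bijective.

(** * Functions with a single simple pole *)

Section SimplePole.
Variable R : realType.
Local Notation C := (cplx R).
Variable B : cmanifold R 1.
Hypotheses (cB : compact [set: B]) (lB : lcc B).

(** A single simple pole, at [p], where [F] takes the value 0 by convention, so that 1 / F vanishes
    there too. *)
Definition spole (F : B -> C) (p : B) := [/\ forall Q, Q <> p -> nh F Q, F p = 0, nh (fun q => (F q)^-1) p &
  dz (ch p) (fun q => (F q)^-1) p != 0].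

Lemma spole_neq0 F p : spole F p -> \forall q \near p, q <> p -> (F q)^-1 != 0.
Proof.
move=> [_ _ h dh]; have [E|//] := nh_zero h; exfalso.
by move: dh; rewrite (dz_near (ch_dom _) (k := fun=> 0) E) dz_cst eqxx.
Qed.

Lemma spole_avoid F p (c : C) : spole F p -> nh (fun q => 1 - c * (F q)^-1) p /\
  \forall q \near p, 1 - c * (F q)^-1 != 0.
Proof.
move=> [_ F0 h dh]; have hk : nh (fun q => 1 - c * (F q)^-1) p by apply: nh_sub (nh_cst _ _) _; exact: nh_mul (nh_cst _ _) h.
by split=> //; apply: nh_neq0 hk _; rewrite F0 invr0 mulr0 subr0 oner_neq0.
Qed.

Lemma removable_const (K : B -> C) : (forall Q, exists g, nh g Q /\ \forall q \near Q, q <> Q -> K q = g q) ->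
  exists c, forall Q, nh K Q -> K Q = c.
Proof.
move=> H; pose v Q := projT1 (cid (H Q)) Q.
have vE Q g : nh g Q -> (\forall q \near Q, q <> Q -> K q = g q) -> v Q = g Q.
  move=> hg gE; rewrite /v; case: cid => g' [hg' gE'] /=; apply: nh_limit hg' hg _.
  by apply: filterS2 gE gE' => q e e' qQ; rewrite -e ?e'.
have hv : hfun v.
  move=> Q; have [g [hg gE]] := H Q; apply: nh_at; apply: nh_eq (hg).
  apply: filterS2 (nh_near hg) (near_near gE) => q hq gq; have [->|qQ] := pselect (q = Q); first exact: esym (vE Q g hg gE).
  apply: esym; apply: vE hq _; apply: filterS2 gq (near_ne qQ) => r e rQ _; exact: e.
have vc := maximum_principle cB lB hv.
have [[Q0 _]|no] := pselect (exists Q, nh K Q); last by exists 0 => Q hQ; case: no; exists Q.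
exists (v Q0) => Q hQ; rewrite (vc Q0 Q); apply: esym; apply: vE hQ _.
by apply: (@filterE _ (nbhs Q)).
Qed.

Lemma spole_isolated F p (c : C) Q : spole F p -> \forall q \near Q, q <> Q -> ~ (q <> p /\ F q = c).
Proof.
move=> [h1 h2 h3 h4].
have fE q : fin (fun _ : 'I_1 => p) q -> q <> p by move/(_ 0).
have := @x_isolated R B lB 1 (fun=> p) F isT (fun q fq => h1 q (fE q fq)) (fun=> h2) (fun=> h3) (fun=> h4) c Q.
by apply: filterS => q h qQ [qp qc]; apply: (h qQ); split=> // i.
Qed.

(** The zero of each factor cancels the pole of the other, so the product is holomorphic up to
    removable singularities, and constant. It is not zero since the zeros of the factors are
    isolated. *)
Lemma two_poles F H p q : spole F p -> spole H q -> p <> q ->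
  exists2 c, c != 0 & forall Q, Q <> p -> Q <> q -> (F Q - F q) * (H Q - H p) = c.
Proof.
move=> sF sH pq; pose K Q := (F Q - F q) * (H Q - H p).
have hK Q : Q <> p -> Q <> q -> nh K Q.
  move=> Qp Qq; have [h1 _ _ _] := sF; have [h2 _ _ _] := sH.
  by apply: nh_mul; apply: nh_sub (nh_cst _ _); [exact: h1|exact: h2].
have side F' H' p' q' : spole F' p' -> spole H' q' -> p' <> q' ->
    exists g, nh g p' /\ \forall r \near p', r <> p' -> (F' r - F' q') * (H' r - H' p') = g r.
  move=> sF' sH' pq'; have [h1 F0 h3 h4] := sF'; have [k1 _ _ _] := sH'.
  have hd : nh (fun r => H' r - H' p') p' by apply: nh_sub (k1 _ pq') (nh_cst _ _).
  have [||rho hr rE] := nh_div (ch_atlas p') (ch_dom p') hd h3 _ _ h4; first by rewrite subrr.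
    by rewrite F0 invr0.
  have [hk _] := spole_avoid (F' q') sF'.
  exists (fun r => (1 - F' q' * (F' r)^-1) * rho r); split; first exact: nh_mul.
  apply: filterS2 rE (spole_neq0 sF') => r e nz rp; have := nz rp; rewrite invr_eq0 => f0.
  by rewrite e mulrA mulrBl divff.
have ext Q : exists g, nh g Q /\ \forall r \near Q, r <> Q -> K r = g r.
  have [->|Qp] := pselect (Q = p); first exact: side.
  have [->|Qq] := pselect (Q = q).
    have [g [hg gE]] := side H F q p sH sF (fun e => pq (esym e)).
    by exists g; split=> //; apply: filterS gE => r e rq; rewrite /K mulrC e.
  by exists K; split; [exact: hK|apply: (@filterE _ (nbhs Q))].
have [c cE] := removable_const ext; exists c; last by move=> Q Qp Qq; apply: cE; exact: hK.
apply/eqP => c0.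
have [_ av] := spole_avoid (F q) sF; have nz := spole_neq0 sF.
have iso := spole_isolated (H p) p sH.
have N : \forall r \near p, r <> p -> False.
  apply: filterS3 av nz (@filterI _ _ (nbhs_filter p) _ _ iso (near_ne pq)) => r a1 a2 [a3 rq] rp.
  have Kr := cE r (hK r rp rq); move: Kr; rewrite c0 => /eqP; rewrite mulf_eq0 !subr_eq0 => /orP[/eqP e|/eqP e].
    by move: a1; rewrite -e divff ?subrr ?eqxx//; have := a2 rp; rewrite invr_eq0.
  exact: a3 rp (conj rq e).
by have [r [_ rp]] := near_neq N (@filterT _ (nbhs p) _).
Qed.

(** Otherwise 1 / (F - c) would be holomorphic everywhere, hence constant, and equal to its value 0
    at [p]. *)
Lemma spole_surj F p (c : C) : spole F p -> exists2 Q, Q <> p & F Q = c.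
Proof.
move=> sF; have [h1 F0 h3 h4] := sF; apply: contrapT => no.
have ne Q : Q <> p -> F Q - c != 0 by move=> Qp; rewrite subr_eq0; apply/eqP => e; apply: no; exists Q.
pose K Q := (F Q - c)^-1.
have hK Q : Q <> p -> nh K Q by move=> Qp; apply: nh_inv (ne Q Qp); exact: nh_sub (h1 Q Qp) (nh_cst _ _).
have [hk av] := spole_avoid c sF.
have k0 : 1 - c * (F p)^-1 != 0 := nbhs_singleton av.
pose g q := (F q)^-1 * (1 - c * (F q)^-1)^-1.
have hg : nh g p by apply: nh_mul h3 _; exact: nh_inv.
have gE : \forall r \near p, r <> p -> K r = g r.
  apply: filterS2 av (spole_neq0 sF) => r a1 a2 rp; have := a2 rp; rewrite invr_eq0 => f0.
  by rewrite /K /g -invfM; congr (_^-1); rewrite mulrBr mulr1 mulrCA divff ?mulr1.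
have ext Q : exists g, nh g Q /\ \forall r \near Q, r <> Q -> K r = g r.
  have [->|Qp] := pselect (Q = p); first by exists g.
  by exists K; split; [exact: hK|apply: (@filterE _ (nbhs Q))].
have [k kE] := removable_const ext.
have gk : g p = k.
  apply: nh_limit hg (nh_cst k p) _; apply: filterS gE => r e rp; rewrite -e//; exact: kE (hK r rp).
have k00 : k = 0 by rewrite -gk /g F0 invr0 mul0r.
have tt : \forall r \near p, r <> p -> True by apply: (@filterE _ (nbhs p)).
have [r [_ rp _]] := near_neq tt (@filterT _ (nbhs p) _).
have := kE r (hK r rp); rewrite k00 => /eqP; rewrite invr_eq0.
by apply/negP; exact: ne.
Qed.

(** The map [1 : F], with the value [0 : 1] at [p], where 1 / F is the coordinate. *)
Lemma spole_P1 F p : spole F p -> (forall Q Q', Q <> p -> Q' <> p -> F Q = F Q' -> Q = Q') ->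
  (forall Q, Q <> p -> dz (ch Q) F Q != 0) -> biholomorphic B (proj_manifold R 1).
Proof.
move=> sF inj dF; have [h1 F0 h3 h4] := sF.
pose A (i : 'I_2) := affine_chart R i.
pose f Q : proj_manifold R 1 := if pselect (Q = p) then chart_inv (A 1) (up 0) else chart_inv (A 0) (up (F Q)).
have adom i w : chart_dom (A i) (chart_inv (A i) w) by exact: affine_inv_dom.
have aK i w : A i (chart_inv (A i) w) = w by exact: affine_invK.
have at_ i : @atlas R 1 (proj_manifold R 1) (A i) by exists i.
have fp Q : Q <> p -> f Q = chart_inv (A 0) (up (F Q)) by rewrite /f; case: pselect.
have fp0 : f p = chart_inv (A 1) (up 0) by rewrite /f; case: pselect.
have sw (z : C) : z != 0 -> chart_inv (A 0) (up z) = chart_inv (A 1) (up z^-1).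
  move=> z0; rewrite -[RHS](@lineZ _ _ z)//; last exact: homogenize_neq0.
  congr line; apply/rowP => k; rewrite !mxE; case: (unliftP 0 k) => [j ->|->].
    have -> : lift 0 j = 1 :> 'I_2 by apply/val_inj; rewrite /= (ord1 j).
    by rewrite unlift_none mxE mulr1.
  have -> : (0 : 'I_2) = lift 1 0 by apply/val_inj.
  by rewrite liftK mxE divff.
have cf z : f p <> chart_inv (A 0) (up z).
  move=> e; have := adom 0 (up z); rewrite -e fp0 => /(affine_dom_line 0 (homogenize_neq0 _ _)).
  have e1 : (0 : 'I_2) = lift 1 0 by apply/val_inj.
  by rewrite mxE {1}e1 liftK mxE eqxx.
apply: (@biholomorphic_of_local _ _ _ f).
- move=> Q Q'; have [->|Qp] := pselect (Q = p); have [->|Q'p] := pselect (Q' = p); rewrite ?(fp Q)// ?(fp Q')//.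
  + by move=> /cf.
  + by move=> /esym/cf.
  + move=> /(congr1 (A 0)); rewrite !aK => /(congr1 (fun v : 'rV[C]_1 => v 0 0)); rewrite !mxE.
    exact: inj.
- move=> y; have [phi [j _ <-] dy] := proj_atlas_cover y.
  pose z := A j y 0 0.
  have yE : y = chart_inv (A j) (up z) by rewrite /z up_lo chart_mapK.
  have main z' : exists x, f x = chart_inv (A 0) (up z').
    by have [Q Qp <-] := spole_surj z' sF; exists Q; exact: fp.
  case: (unliftP 0 j) => [k jE|jE]; last by rewrite yE jE; exact: main.
  have j1 : j = 1 by rewrite jE; apply/val_inj; rewrite /= (ord1 k).
  rewrite yE j1; have [->|z0] := eqVneq z 0; first by exists p.
  by rewrite -[z]invrK -sw ?invr_eq0//; exact: main.
- move=> Q; have [->|Qp] := pselect (Q = p).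
    exists (A 1), (fun q => (F q)^-1); split; [exact: at_|exact: h3|exact: h4|].
    apply: filterS (spole_neq0 sF) => q nz; have [->|qp] := pselect (q = p); first by rewrite fp0 F0 invr0; split; [exact: adom|exact: aK].
    have := nz qp; rewrite invr_eq0 => f0.
    by rewrite (fp q qp) (sw _ f0); split; [exact: adom|exact: aK].
  exists (A 0), F; split; [exact: at_|exact: h1|exact: dF|].
  by apply: filterS (near_ne Qp) => q qp; rewrite (fp q qp); split; [exact: adom|exact: aK].
Qed.

End SimplePole.

Lemma moebius_algebra (K : fieldType) (F Fp G Gp c : K) : (F - Fp) * (G - Gp) = c -> G != 0 -> 1 - Gp * G^-1 != 0 ->
  F = G^-1 * (c * (1 - Gp * G^-1)^-1) + Fp.
Proof.
move=> <- G0 n0; have e : G - Gp = G * (1 - Gp * G^-1) by rewrite mulrBr mulr1 mulrCA divff ?mulr1.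
by rewrite e mulrA mulfK// mulrCA mulVf// mulr1 subrK.
Qed.

Section Moebius.
Variable R : realType.
Local Notation C := (cplx R).
Variable B : cmanifold R 1.
Hypotheses (cB : compact [set: B]) (lB : lcc B) (nB : noforms B).
Variables (d : nat) (P : 'I_d -> B) (x : B -> C).
Hypothesis d0 : (0 < d)%N.
Hypothesis P_inj : injective P.
Hypothesis x_fin : forall Q, fin P Q -> nh x Q.
Hypothesis xP : forall j, x (P j) = 0.
Let t (q : B) := (x q)^-1.
Hypothesis t_nh : forall j, nh t (P j).
Hypothesis t_dz : forall j, dz (ch (P j)) t (P j) != 0.
Hypothesis P_full : forall j, exists n a, lcr P x n a (delta_mx 0 j).
Hypothesis sep : forall Q Q', fin P Q -> fin P Q' -> Q <> Q' -> exists b v, lcr P x 1 b v /\ b Q != b Q'.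
Hypothesis coord : forall Q, fin P Q -> exists b v, lcr P x 1 b v /\ dz (ch Q) b Q != 0.

Let tP j : t (P j) = 0. Proof. by rewrite /t xP invr0. Qed.

Lemma simple_pole j : exists F, spole F (P j) /\ lcr P x 1 F (delta_mx 0 j).
Proof.
have [||f [hf Hf]] := simple_poles cB lB nB d0 P_inj x_fin xP t_nh t_dz P_full _ _ j.
- move=> Q Q' fQ fQ' n; have [b [v [Hb bQ]]] := sep fQ fQ' n; exists b => //; by exists 1%N, v.
- move=> phi Q ap dQ fQ; have [b [v [Hb bQ]]] := coord fQ; exists b; first by exists 1%N, v.
  apply: contra_neq bQ => b0; rewrite (dz_change (ch_atlas Q) ap (ch_dom Q) dQ (nh_at (Hb.1 Q fQ))) b0 mulr0.
  by [].
(* At the other poles of [x] the leading coefficient of [f] is zero, so the singularity is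
   removable; [F] below takes the limit values there, and 0 at [P j]. *)
have H k : exists rho, k != j -> nh rho (P k) /\ \forall q \near P k, q <> P k -> f q = rho q.
  have [->|kj] := eqVneq k j; first by exists f.
  have [g [hg gv gE]] := Hf k; rewrite mxE (negPf kj) andbF in gv.
  have [rho hr rE] := nh_div (ch_atlas _) (ch_dom _) hg (t_nh k) gv (tP k) (t_dz k).
  exists rho => _; split=> //; apply: filterS3 gE rE (x_neq0 t_nh t_dz k) => q e1 e2 x0 qP.
  have xq := x0 qP; rewrite e1// e2 /t expr1.
  by rewrite mulrAC mulVf// mul1r.
have [rho rhoP] := choice H.
pose F Q := if [pick k | P k == Q] is Some k then (if k == j then 0 else rho k Q) else f Q.
have Ff Q : fin P Q -> F Q = f Q.
  by move=> fQ; rewrite /F; case: pickP => // k /eqP e; case: (fQ k).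
have FP k : F (P k) = if k == j then 0 else rho k (P k).
  rewrite /F; case: pickP => [l /eqP/P_inj -> //|/(_ k)].
  by rewrite eqxx.
have Fj : \forall q \near P j, F q = if q == P j then 0 else f q.
  apply: filterS (@pole_near _ _ _ P j) => q h; case: eqVneq => [->|n]; first by rewrite FP eqxx.
  by apply: Ff; apply: h; apply/eqP.
have hF Q : Q <> P j -> nh F Q.
  move=> QP; have [fQ|] := pselect (fin P Q).
    by apply: nh_eq (hf Q fQ); apply: filterS (fin_near fQ) => q fq; exact: esym (Ff q fq).
  move=> /existsNP[k /contrapT Qk]; have kj : k != j by apply: contra_notN QP => /eqP <-.
  rewrite Qk; have [hr rE] := rhoP k kj; apply: nh_eq hr.
  apply: filterS2 rE (@pole_near _ _ _ P k) => q e h; have [->|qP] := pselect (q = P k); first by rewrite FP (negPf kj).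
  by rewrite Ff ?e//; exact: h.
have [g [hg gv gE]] := Hf j; rewrite mxE !eqxx in gv.
have g1 : g (P j) != 0 by rewrite gv oner_neq0.
have FE : \forall q \near P j, (F q)^-1 = (g q)^-1 * t q.
  apply: filterS2 Fj gE => q -> e; case: eqVneq => [->|n]; first by rewrite tP mulr0 invr0.
  by rewrite e; [rewrite expr1 invfM|exact/eqP].
have FE' : \forall q \near P j, (g q)^-1 * t q = (F q)^-1 by apply: filterS FE => q.
exists F; split; last first.
  split=> [Q fQ|k]; first by apply: hF; exact: fQ.
  have [h [hh hv hE]] := Hf k; exists h; split=> //.
  by apply: filterS2 hE (@pole_near _ _ _ P k) => q e fq qP; rewrite Ff ?e//; exact: fq.
split=> //; first by rewrite FP eqxx.
- by apply: nh_eq FE' _; apply: nh_mul (nh_inv hg g1) (t_nh j).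
- rewrite (dz_near (ch_dom _) FE) (dz_mul (ch_atlas _) (ch_dom _) (nh_at (nh_inv hg g1)) (nh_at (t_nh j))).
  by rewrite tP mul0r addr0 gv invr1 mul1r.
Qed.

(** By [two_poles] every [Fs j] is a Moebius function of [F], and by [span] every function of order
    1 is an affine combination of the [Fs j]. As functions of order 1 separate points and tangent
    directions off the poles, [F] alone does; at the poles the Moebius relation is used directly. *)
Lemma P1_of_simple_poles : biholomorphic B (proj_manifold R 1).
Proof.
have [Fs FsP] := choice simple_pole.
pose j0 := Ordinal d0; set F := Fs j0; set p := P j0.
have sF : spole F p by exact: (FsP j0).1.
have [hF F0 hT dT] := sF.
have fj j Q : fin P Q -> Q <> P j by move=> fQ; exact: fQ.
have span b v : lcr P x 1 b v -> exists k, forall Q, fin P Q -> b Q = k + \sum_j v 0 j * Fs j Q.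
  move=> Hb; have S := lcr_sum (fun j => lcr_scale (v 0 j) (FsP j).2).
  have := lcr_add Hb (lcr_scale (-1) S).
  have -> : v + -1 *: \sum_j v 0 j *: delta_mx 0 j = 0 by rewrite scaleN1r -row_sum_delta subrr.
  move=> /(lcr_drop xP t_nh t_dz)[w /(lcr_cst cB lB d0)[k [kE _]]]; exists k => Q fQ.
  by rewrite -(kE Q fQ) mulN1r subrK.
have cst j : j != j0 -> exists2 c, c != 0 & forall Q, Q <> p -> Q <> P j -> (F Q - F (P j)) * (Fs j Q - Fs j p) = c.
  move=> jj; apply: (two_poles cB lB sF (FsP j).1) => /P_inj e.
  by move: jj; rewrite -e eqxx.
have polej j Q : j != j0 -> Q <> p -> Q <> P j -> F Q <> F (P j).
  move=> jj Qp Qj e; have [c c0 cE] := cst j jj.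
  by have := cE Q Qp Qj; rewrite e subrr mul0r => c00; rewrite -c00 eqxx in c0.
have nonp Q : Q <> p -> ~ fin P Q -> exists2 j, j != j0 & Q = P j.
  move=> Qp /existsNP[j /contrapT Qj]; exists j => //.
  by apply: contra_notN Qp => /eqP e; rewrite Qj e.
apply: (@spole_P1 _ B cB lB F p sF).
- move=> Q Q' Qp Q'p FQ; apply: contrapT => QQ'.
  have [fQ|/(nonp Q Qp)[j jj Qj]] := pselect (fin P Q); last first.
    by apply: (polej j Q' jj Q'p); rewrite -?FQ ?Qj// -Qj => /esym.
  have [fQ'|/(nonp Q' Q'p)[j jj Qj]] := pselect (fin P Q'); last first.
    by apply: (polej j Q jj Qp); rewrite ?FQ -Qj.
  have [b [v [Hb /eqP]]] := sep fQ fQ' QQ'; have [k kE] := span b v Hb; apply.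
  rewrite !kE//; congr (_ + _); apply: eq_bigr => j _; congr (_ * _).
  have [->//|jj] := eqVneq j j0; have [c c0 cE] := cst j jj.
  have e1 := cE Q Qp (fQ j); have e2 := cE Q' Q'p (fQ' j); rewrite -FQ in e2.
  have u0 : F Q - F (P j) != 0 by apply: contra_neq c0 => u0; rewrite -e1 u0 mul0r.
  by apply: (addIr (- Fs j p)); apply: (mulfI u0); rewrite e1.
- move=> Q Qp; have ap := ch_atlas Q; have dQ := ch_dom Q.
  have [fQ|/(nonp Q Qp)[j jj Qj]] := pselect (fin P Q); last first.
    have [c c0 cE] := cst j jj; have sj := (FsP j).1; have [_ Fj0 hTj dTj] := sj.
    have [hk av] := spole_avoid (Fs j p) sj.
    have k0 := nbhs_singleton av.
    pose k q := c * (1 - Fs j p * (Fs j q)^-1)^-1.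
    have hk' : nh k (P j) by apply: nh_mul (nh_cst _ _) _; exact: nh_inv.
    have E : \forall q \near P j, F q = (Fs j q)^-1 * k q + F (P j).
      apply: filterS3 av (spole_neq0 sj) (near_ne (fun e => Qp (etrans Qj e))) => q a1 a2 qp.
      have [->|qj] := pselect (q = P j); first by rewrite Fj0 invr0 mul0r add0r.
      have := cE q qp qj; have := a2 qj; rewrite invr_eq0 => f0 e.
      exact: moebius_algebra e f0 a1.
    rewrite Qj; have dP := ch_dom (P j); have aP := ch_atlas (P j).
    rewrite (dz_near dP E).
    have h1 := nh_at hTj; have h2 := nh_at hk'.
    rewrite (dz_add aP dP (hfun_mul h1 h2) (nh_at (nh_cst _ _))) dz_cst addr0 (dz_mul aP dP h1 h2).
    by rewrite Fj0 invr0 mul0r add0r mulf_neq0// mulf_neq0// invr_neq0.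
  apply/eqP => dF0; have [b [v [Hb /eqP]]] := coord fQ; have [k kE] := span b v Hb; apply.
  have E : \forall q \near Q, b q = k + \sum_j v 0 j * Fs j q by apply: filterS (fin_near fQ) => q; exact: kE.
  have hj j : hfun_at (Fs j) Q by apply: nh_at; have [h _ _ _] := (FsP j).1; apply: h; exact: fQ.
  have hc (c : C) : hfun_at (fun=> c) Q by exact: nh_at (nh_cst c Q).
  have hvj j := hfun_mul (hc (v 0 j)) (hj j).
  have dj j : dz (ch Q) (Fs j) Q = 0.
    have [->//|jj] := eqVneq j j0; have [c c0 cE] := cst j jj.
    have E2 : \forall q \near Q, (F q - F (P j)) * (Fs j q - Fs j p) = c.
      by apply: filterS2 (fin_near fQ) (near_ne Qp) => q fq qp; exact: cE qp (fq j).
    have hF1 := hfun_sub (nh_at (hF Q Qp)) (hc (F (P j))); have hF2 := hfun_sub (hj j) (hc (Fs j p)).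
    have := dz_near dQ E2; rewrite dz_cst (dz_mul ap dQ hF1 hF2).
    rewrite (dz_sub ap dQ (nh_at (hF Q Qp)) (hc _)) (dz_sub ap dQ (hj j) (hc _)) dF0 !dz_cst !subr0 mulr0 addr0.
    move=> /eqP; rewrite mulf_eq0 => /orP[/eqP u0|/eqP u0]; last exact: u0.
    exfalso; apply: (negP c0); apply/eqP; rewrite -(cE Q Qp (fQ j)) u0; exact: mul0r.
  apply: etrans (dz_near dQ E) _.
  apply: etrans (dz_add ap dQ (hc k) (hfun_sum hvj)) _; rewrite dz_cst add0r.
  apply: etrans (dz_sum ap dQ hvj) _; apply: big1 => j _.
  apply: etrans (dz_mul ap dQ (hc (v 0 j)) (hj j)) _.
  by rewrite dj dz_cst !mulr0 addr0.
Qed.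

End Moebius.

Lemma frac_inv (K : fieldType) (a b : K) : b != 0 -> a != 0 -> (a / b) * (b / a) = 1.
Proof. by move=> b0 a0; rewrite mulrA mulfVK// divff. Qed.

Lemma frac_trans (K : fieldType) (a b s : K) : b != 0 -> a / s = b / s * (a / b).
Proof. by move=> b0; rewrite [RHS]mulrC mulrA mulfVK. Qed.

(** * Curves embedded in projective space *)

Section EmbeddedCurve.
Variable R : realType.
Local Notation C := (cplx R).

Lemma avoid_vectors n (l : seq 'rV[C]_n) : (forall r, r \in l -> r != 0) ->
  exists u : 'cV[C]_n, forall r, r \in l -> (r *m u) 0 0 != 0.
Proof.
elim: l => [_|r l IH H]; first by exists 0.
have [u uH] : exists u : 'cV[C]_n, forall r, r \in l -> (r *m u) 0 0 != 0.
  by apply: IH => s sl; apply: H; rewrite in_cons sl orbT.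
have [w rw] := left_inverse_row (H r (mem_head _ _)).
have rw1 : (r *m w) 0 0 = 1 by rewrite rw mxE eqxx.
have [c cN] := ex_notin (- (r *m u) 0 0 :: [seq - (s *m u) 0 0 / (s *m w) 0 0 | s <- l]).
exists (u + c *: w) => s.
have E s' : (s' *m (u + c *: w)) 0 0 = (s' *m u) 0 0 + c * (s' *m w) 0 0 by rewrite mulmxDr -scalemxAr !mxE.
rewrite E in_cons => /orP[/eqP ->|sl].
  rewrite rw1 mulr1; apply: contraNneq cN => e; rewrite in_cons; apply/orP; left.
  by rewrite -addr_eq0 addrC e.
have [w0|w0] := eqVneq ((s *m w) 0 0) 0; first by rewrite w0 mulr0 addr0; exact: uH.
apply: contraNneq cN => e; rewrite in_cons; apply/orP; right; apply/mapP; exists s => //.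
by apply: (mulIf w0); rewrite mulfVK//; apply/eqP; rewrite -addr_eq0 addrC e.
Qed.

Variable B : cmanifold R 1.
Hypotheses (cB : compact [set: B]) (lB : lcc B) (nB : noforms B).
Variables (N : nat) (i : B -> proj_manifold R N).
Hypothesis emb : holomorphic_embedding i.

Let v (Q : B) : 'rV[C]_N.+1 := coords (i Q).
Let L (u : 'cV[C]_N.+1) (Q : B) : C := (v Q *m u) 0 0.

Let v_near Q k : v Q 0 k != 0 -> \forall q \near Q, v q 0 k != 0.
Proof.
have [[ic _] _ _] := emb; move=> vk.
exact: ic (@chart_dom_nbhs _ _ _ (affine_chart R k) (i Q) vk).
Qed.

Let coord_nh Q k j : v Q 0 k != 0 -> nh (fun q => v q 0 j / v q 0 k) Q.
Proof.
have [[ic id] _ _] := emb; move=> vk; have nk := v_near vk.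
case: (unliftP k j) => [j' ->|->]; last first.
  by apply: nh_eq (nh_cst 1 Q); apply: filterS nk => q qk; rewrite divff.
apply: filterS nk => q qk.
have aa : @atlas R N (proj_manifold R N) (affine_chart R k) by exists k.
have D := id _ _ q (ch_atlas q) aa (ch_dom q) qk.
have D' := differentiable_entry j' D.
have -> : (fun q => v q 0 (lift k j') / v q 0 k) = fun q => (affine_chart R k (i q)) 0 j'.
  by apply/funext => r; rewrite mxE.
exact: D'.
Qed.

(** The chosen homogeneous coordinates need not be continuous. Locally they are a nonvanishing
    scalar [e] times holomorphic ones, which suffices for the ratios and the zeros of linear
    forms. *)
Let frame Q : exists e (S : 'cV[C]_N.+1 -> B -> C), (forall u, nh (S u) Q) /\
  \forall q \near Q, e q != 0 /\ forall u, L u q = e q * S u q.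
Proof.
have /rV0Pn[k vk] := coords_neq0 (i Q).
exists (fun q => v q 0 k), (fun u q => \sum_j (v q 0 j / v q 0 k) * u j 0); split.
  by move=> u; apply: nh_sum => j; apply: nh_mul (nh_cst _ _); exact: coord_nh.
apply: filterS (v_near vk) => q qk; split=> // u; rewrite /L mxE mulr_sumr; apply: eq_bigr => j _.
by rewrite mulrA mulrCA divff ?mulr1.
Qed.

Let ratio_nh u w Q : L w Q != 0 -> nh (fun q => L u q / L w q) Q.
Proof.
have [e [S [hS E]]] := frame Q; have [eQ LQ] := nbhs_singleton E.
rewrite LQ mulf_eq0 negb_or => /andP[_ sw].
apply: nh_eq (nh_mul (hS u) (nh_inv (hS w) sw)).
apply: filterS E => q [eq Lq]; rewrite !Lq invfM mulrACA divff ?mul1r//.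
Qed.

Let L_near w Q : L w Q != 0 -> \forall q \near Q, L w q != 0.
Proof.
have [e [S [hS E]]] := frame Q; have [eQ LQ] := nbhs_singleton E.
rewrite LQ mulf_eq0 negb_or => /andP[_ sw].
by apply: filterS2 E (nh_neq0 (hS w) sw) => q [eq Lq] s0; rewrite Lq mulf_neq0.
Qed.

Let L_zero u : (forall Q, L u Q = 0) \/ (forall Q, \forall q \near Q, q <> Q -> L u q <> 0).
Proof.
apply: lcc_dichotomy lB _ => Q; have [e [S [hS E]]] := frame Q.
have [Z|Z] := nh_zero (hS u); [left|right].
  by apply: filterS2 E Z => q [_ ->] ->; rewrite mulr0.
by apply: filterS2 E Z => q [e0 ->] s0 qQ; apply/eqP; rewrite mulf_neq0// s0.
Qed.

Let L_indep a Q0 Q1 : Q0 <> Q1 -> L a Q0 != 0 -> L a Q1 != 0 -> L a Q1 *: v Q0 - L a Q0 *: v Q1 != 0.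
Proof.
have [_ inj _] := emb; move=> Q01 a0 a1; apply/eqP => /eqP; rewrite subr_eq0 => /eqP e; apply: Q01; apply: inj.
rewrite -[i Q0]coordsK -[i Q1]coordsK -(lineZ a1 (coords_neq0 (i Q0))) -(lineZ a0 (coords_neq0 (i Q1))).
by congr line; exact: e.
Qed.

Section Coordinate.
Variables (a b : 'cV[C]_N.+1) (Q0 Q1 : B).
Hypothesis ab : forall Q, L a Q = 0 -> L b Q != 0.
Hypothesis ab01 : L b Q0 * L a Q1 != L b Q1 * L a Q0.
Hypothesis a_zero : forall Q, \forall q \near Q, q <> Q -> L a q <> 0.
Let h q := L b q / L a q.

Lemma critical_finite : exists l : seq B, forall Q, L a Q != 0 -> dz (ch Q) h Q = 0 -> Q \in l.
Proof.
pose z Q := L a Q != 0 /\ dz (ch Q) h Q = 0.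
have change Q q : L a q != 0 -> chart_dom (ch Q) q -> (dz (ch Q) h q = 0 <-> dz (ch q) h q = 0).
  move=> aq dq; have hq := nh_at (ratio_nh b aq).
  split=> e.
    by rewrite (dz_change (ch_atlas q) (ch_atlas Q) (ch_dom q) dq hq) e mulr0.
  by rewrite (dz_change (ch_atlas Q) (ch_atlas q) dq (ch_dom q) hq) e mulr0.
have iso Q : (\forall q \near Q, z q) \/ (\forall q \near Q, q <> Q -> ~ z q).
  have ap := ch_atlas Q; have dQ := ch_dom Q.
  have [a0|a0] := eqVneq (L a Q) 0; last first.
    have [Z|Z] := nh_zero (nh_dz ap dQ (ratio_nh b a0)); [left|right].
      apply: filterS3 Z (L_near a0) (chart_dom_nbhs dQ) => q e aq dq; split; first exact: aq.
      exact: (change Q q aq dq).1.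
    apply: filterS3 Z (L_near a0) (chart_dom_nbhs dQ) => q e aq dq qQ [_ e0].
    exact: (negP (e qQ)) (introT eqP ((change Q q aq dq).2 e0)).
  (* At a zero of [a] the inverse ratio a / b is used: its derivative is nonzero at nearby points
     other than [Q], and there it vanishes if and only if that of [h] does. *)
  right; have b0 := ab a0; have hk := ratio_nh a b0.
  have [Z|Z] := nh_zero (nh_dz ap dQ hk).
    exfalso; have E := dz_zero_const ap dQ hk Z.
    have F : \forall q \near Q, q <> Q -> False.
      apply: filterS3 E (L_near b0) (a_zero Q) => q e bq aq qQ.
      move: e; rewrite a0 mul0r => /eqP; rewrite mulf_eq0 invr_eq0 (negPf bq) orbF => /eqP.
      exact: aq.
    by have [r [_ rp]] := near_neq F (@filterT _ (nbhs Q) _).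
  have HA := @filterI _ _ (nbhs_filter Q) _ _ (chart_dom_nbhs dQ) (near_near (L_near b0)).
  have HB := @filterI _ _ (nbhs_filter Q) _ _ (a_zero Q) (nh_near hk).
  apply: filterS3 Z HA HB => q e [dq bn] [aq hkq] qQ [a1 e0'].
  have e0 := (change Q q a1 dq).2 e0'.
  have bq := nbhs_singleton bn.
  have E : \forall r \near q, (L a r / L b r) * h r = 1.
    by apply: filterS2 bn (L_near a1) => r br ar; exact: frac_inv.
  have := dz_near dq E; rewrite (dz_mul (ch_atlas Q) dq (nh_at hkq) (nh_at (ratio_nh b a1))) dz_cst e0 mulr0 add0r.
  move=> /eqP; rewrite mulf_eq0 (negPf (e qQ)) orbF /h mulf_eq0 invr_eq0 (negPf bq) (negPf a1).
  by [].
have [all|fin_] := lcc_dichotomy lB iso.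
  exfalso; have hh : hfun h by move=> Q; apply: nh_at; exact: ratio_nh (all Q).1.
  have := maximum_principle cB lB hh Q0 Q1; rewrite /h => e; move/eqP: ab01; apply.
  have a0 := (all Q0).1; have a1 := (all Q1).1.
  by apply/eqP; rewrite -(eqr_div _ _ a0 a1) e.
have [l lH] := compact_finite cB fin_; exists l => Q aQ dQ; exact: lH.
Qed.

(** [c] avoids the finitely many critical values of b / a, so that s = b - c a has only simple zeros
    and a / s only simple poles. *)
Lemma hyperplane_section : exists s (l : seq B), [/\ (0 < size l)%N, uniq l, forall Q, (L s Q == 0) = (Q \in l) &
  forall Q, Q \in l -> L a Q != 0 /\ (forall phi, atlas phi -> chart_dom phi Q -> dz phi (fun q => L s q / L a q) Q != 0)].
Proof.
have [lc lcH] := critical_finite.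
have [c cN] := ex_notin [seq h Q | Q <- lc].
pose s := b - c *: a; have sE Q : L s Q = L b Q - c * L a Q by rewrite /L /s mulmxBr -scalemxAr !mxE.
have s_a Q : L s Q = 0 -> L a Q != 0.
  move=> s0; apply/eqP => a0; have := ab a0; move: s0; rewrite sE a0 mulr0 subr0 => ->.
  by rewrite eqxx.
(* A relation a = k s at both points would force equality in [ab01]. It shows that [s] has a zero,
   for otherwise a / s would be constant. *)
have cross k : (forall Q, Q = Q0 \/ Q = Q1 -> L a Q = k * L s Q) -> (L a Q0 != 0 \/ L a Q1 != 0) -> False.
  move=> H nz; have e0 := H Q0 (or_introl erefl); have e1 := H Q1 (or_intror erefl).
  move/eqP: ab01; apply.
  have k0 : k != 0 by apply/eqP => k0; move: nz; rewrite e0 e1 k0 !mul0r eqxx; case.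
  have alg (u z w p q : C) : k * p = u + w * u -> k * q = z + w * z -> k * (p * z) = k * (q * u).
    by move=> e2 e3; rewrite !mulrA e2 e3; ring.
  apply: (mulfI k0).
  have b0 : k * L b Q0 = L a Q0 + k * c * L a Q0 by rewrite [X in X + _]e0 sE; ring.
  have b1 : k * L b Q1 = L a Q1 + k * c * L a Q1 by rewrite [X in X + _]e1 sE; ring.
  exact: (alg _ _ _ _ _ b0 b1).
have nz01 : L a Q0 != 0 \/ L a Q1 != 0.
  have [a0|] := eqVneq (L a Q0) 0; last by left.
  have [a1|] := eqVneq (L a Q1) 0; last by right.
  by move: ab01; rewrite a0 a1 !mulr0 eqxx.
have [all|iso] := L_zero s.
  exfalso; move/eqP: ab01; apply.
  have bE Q : L b Q = c * L a Q by apply/eqP; rewrite -subr_eq0 -sE all.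
  rewrite (bE Q0) (bE Q1); exact: mulrAC.
have [l lH] := compact_finite cB iso.
exists s, (undup [seq Q <- l | L s Q == 0]).
have lE Q : (L s Q == 0) = (Q \in undup [seq Q <- l | L s Q == 0]).
  rewrite mem_undup mem_filter; apply/idP/andP => [e|[]//].
  by split=> //; apply: lH; exact/eqP.
split; [|exact: undup_uniq|exact: lE|].
  rewrite lt0n size_eq0; apply/eqP => l0.
  have nz Q : L s Q != 0 by rewrite lE l0.
  have hx : hfun (fun q => L a q / L s q) by move=> Q; apply: nh_at; exact: ratio_nh.
  apply: (cross (L a Q0 / L s Q0)) nz01 => Q _.
  by rewrite (maximum_principle cB lB hx Q0 Q) divfK.
move=> Q; rewrite -lE => /eqP s0; have a0 := s_a Q s0; split; first exact: a0.
move=> phi ap dQ; apply/eqP => e.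
have hq := nh_at (ratio_nh b a0); have hs := nh_at (ratio_nh s a0).
have E : \forall q \near Q, L s q / L a q = h q - c.
  by apply: filterS (L_near a0) => q aq; rewrite sE /h mulrBl mulfK.
have e2 : dz (ch Q) h Q = 0.
  have := dz_near (ch_dom Q) E; rewrite (dz_sub (ch_atlas Q) (ch_dom Q) hq (nh_at (nh_cst c Q))) dz_cst subr0 => <-.
  by rewrite (dz_change (ch_atlas Q) ap (ch_dom Q) dQ hs) e mulr0.
move/negP: cN; apply; apply/mapP; exists Q; first exact: lcH a0 e2.
by apply/eqP; rewrite /h -subr_eq0 -[X in X - _](mulfK a0) -mulrBl -oppr_eq0 -mulNr opprB -sE s0 mul0r.
Qed.

End Coordinate.

Theorem embedded_curve_P1 (Q0 : B) : biholomorphic B (proj_manifold R 1).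
Proof.
have /rV0Pn[k vk] := coords_neq0 (i Q0).
pose a : 'cV[C]_N.+1 := delta_mx k 0.
have a0 : L a Q0 != 0 by rewrite /L /a -colE mxE.
have [all|a_zero] := L_zero a; first by move: a0; rewrite all eqxx.
have [Q1 [_ Q10 /eqP a1]] := near_neq (a_zero Q0) (@filterT _ (nbhs Q0) _).
have [la laH] := compact_finite cB a_zero.
(* [b] has no common zero with [a], and b / a separates [Q0] from [Q1]. *)
have [b bH] : exists b : 'cV[C]_N.+1, forall r, r \in (L a Q1 *: v Q0 - L a Q0 *: v Q1) :: [seq v Q | Q <- la] -> (r *m b) 0 0 != 0.
  apply: avoid_vectors => r; rewrite in_cons => /orP[/eqP ->|/mapP[Q _ ->]]; last exact: coords_neq0.
  by apply: L_indep => // e; apply: Q10.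
have ab Q : L a Q = 0 -> L b Q != 0.
  by move=> aQ; apply: bH; rewrite in_cons map_f ?orbT//; exact: laH.
have ab01 : L b Q0 * L a Q1 != L b Q1 * L a Q0.
  have E (c d : C) (X Y : 'M[C]_1) : (c *: X - d *: Y) 0 0 = X 0 0 * c - Y 0 0 * d.
    by rewrite !mxE; congr (_ - _); exact: mulrC.
  apply: contraNneq (bH _ (mem_head _ _)) => e; rewrite mulmxBl -!scalemxAl E subr_eq0; apply/eqP; exact: e.
have [s [l [l0 ul lE lH]]] := hyperplane_section ab ab01 a_zero.
pose P (j : 'I_(size l)) := nth Q0 l j.
have Pl j : P j \in l by exact: mem_nth.
have P_inj : injective P by move=> j j' /eqP; rewrite nth_uniq// => /eqP/val_inj.
pose x q := L a q / L s q.
have finE Q : fin P Q -> L s Q != 0.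
  move=> fQ; rewrite lE; apply/negP => /(nthP Q0)[j jl jQ].
  by apply: (fQ (Ordinal jl)); rewrite /P /= jQ.
have sP j : L s (P j) = 0 by apply/eqP; rewrite lE.
have aP j : L a (P j) != 0 by have [] := lH _ (Pl j).
have x_fin Q : fin P Q -> nh x Q by move=> /finE; exact: ratio_nh.
have xP j : x (P j) = 0 by rewrite /x sP invr0 mulr0.
have xV : (fun q => (x q)^-1) = fun q => L s q / L a q by apply/funext => q; rewrite /x invfM invrK mulrC.
have t_nh j : nh (fun q => (x q)^-1) (P j) by rewrite xV; exact: (ratio_nh s (aP j)).
have t_dz j : dz (ch (P j)) (fun q => (x q)^-1) (P j) != 0.
  by rewrite xV; have [_] := lH _ (Pl j); apply; [exact: ch_atlas|exact: ch_dom].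
pose m u q := L u q / L s q.
have m_lcr u : lcr P x 1 (m u) (\row_k (L u (P k) / L a (P k))).
  split=> [Q /finE|j]; first exact: ratio_nh.
  exists (fun q => L u q / L a q); split; [exact: (ratio_nh u (aP j))|rewrite mxE; exact: erefl|].
  by apply: filterS (L_near (aP j)) => q aq _; rewrite expr1 /m /x mulrA divfK.
have P_full j : exists n f, lcr P x n f (delta_mx 0 j).
  (* Products of ratios of linear forms: for each pole in [r] a factor is inserted that kills its
     leading coefficient and keeps the one at [P j]. *)
  have H (r : seq 'I_(size l)) : j \notin r -> exists n f w, [/\ lcr P x n f w, w 0 j != 0 & forall k, k \in r -> w 0 k = 0].
    elim: r => [_|k' r IH].
      have aj : (\row_k (L a (P k) / L a (P k)) : 'rV[C]_(size l)) 0 j != 0.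
        rewrite mxE (divff (aP j)); exact: oner_neq0.
      by exists 1%N, (m a), (\row_k (L a (P k) / L a (P k))); split; [exact: (m_lcr a)|exact: aj|].
    rewrite in_cons negb_or => /andP[jk /IH[n [f [w [Hw wj wr]]]]].
    have PP : line (v (P j)) <> line (v (P k')).
      have [_ inj _] := emb; rewrite /v !coordsK => /inj/P_inj e.
      by move: jk; rewrite e eqxx.
    have [u [uj uk]] := separating_form (coords_neq0 _) (coords_neq0 _) PP.
    have := lcr_mul Hw (m_lcr u) => Hm; do 3 eexists; split; first exact: Hm.
      rewrite !mxE; exact: (mulf_neq0 wj (mulf_neq0 uj (invr_neq0 (aP j)))).
    move=> k''; rewrite in_cons !mxE => /orP[/eqP ->|/wr ->]; last by rewrite mul0r.
    by rewrite [L u _]uk mul0r mulr0.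
  have [|n [f [w [Hw wj wr]]]] := H [seq k <- enum 'I_(size l) | k != j].
    by rewrite mem_filter eqxx.
  exists n, (fun q => (w 0 j)^-1 * f q).
  suff -> : delta_mx 0 j = (w 0 j)^-1 *: w by exact: lcr_scale.
  apply/rowP => k'; rewrite !mxE eqxx; case: (eqVneq k' j) => [->|kj]; first by rewrite mulVf.
  have -> : w 0 k' = 0 by apply: wr; rewrite mem_filter kj mem_enum.
  by rewrite andbF mulr0.
apply: (P1_of_simple_poles cB lB nB l0 P_inj x_fin xP t_nh t_dz P_full).
- move=> Q Q' /finE sQ /finE sQ' QQ'.
  have PP : line (v Q) <> line (v Q').
    by have [_ inj _] := emb; rewrite /v !coordsK => /inj.
  have [u [uj uk]] := separating_form (coords_neq0 _) (coords_neq0 _) PP.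
  exists (m u); eexists; split; first exact: m_lcr.
  rewrite /m [L u Q']uk mul0r; exact: (mulf_neq0 uj (invr_neq0 sQ)).
- move=> Q fQ; have sQ := finE Q fQ; apply: contrapT => no.
  (* If all these derivatives vanish, so do those of the affine coordinates of [i] at [Q], contrary
     to the injectivity of its differential. *)
  have m0 u : dz (ch Q) (m u) Q = 0.
    by apply/eqP/negPn/negP => n; apply: no; exists (m u); eexists; split; [exact: m_lcr|exact: n].
  have /rV0Pn[k' vk'] := coords_neq0 (i Q).
  have ap := ch_atlas Q; have dQ := ch_dom Q.
  have r0 j : dz (ch Q) (fun q => v q 0 j / v q 0 k') Q = 0.
    have E : \forall q \near Q, m (delta_mx j 0) q = m (delta_mx k' 0) q * (v q 0 j / v q 0 k').
      apply: filterS (v_near vk') => q qk; rewrite /m /L -!colE ![(col _ _) 0 0]mxE.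
      exact: frac_trans.
    have h1 := nh_at (ratio_nh (delta_mx k' 0) sQ); have h2 := nh_at (coord_nh j vk').
    have := dz_near dQ E; rewrite (dz_mul ap dQ h1 h2) !m0 mulr0 addr0 => /esym/eqP.
    rewrite mulf_eq0 => /orP[|/eqP //]; rewrite /m /L -colE [(col _ _) 0 0]mxE mulf_eq0 invr_eq0 (negPf sQ) orbF.
    by rewrite (negPf vk').
  have aa : @atlas R N (proj_manifold R N) (affine_chart R k') by exists k'.
  have [[_ id] _ di] := emb.
  have D := id _ _ Q ap aa dQ vk'; have := di _ _ Q ap aa dQ vk'.
  move=> /(_ (up 1) 0) H.
  have u10 : up 1 = 0 :> 'rV[C]_1.
    apply: H; apply/rowP => j; rewrite linear0.
    apply: etrans (esym (diff_entry (up 1) j D)) _.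
    have e := dzE ap dQ (nh_at (coord_nh (lift k' j) vk')); rewrite r0 in e.
    have E : (fun w => (affine_chart R k' \o i \o chart_inv (ch Q)) w 0 j : C) = (fun q => v q 0 (lift k' j) / v q 0 k') \o chart_inv (ch Q).
      by apply/funext => w; rewrite mxE.
    by rewrite E -e mxE.
  by have := congr1 (fun r : 'rV[C]_1 => r 0 0) u10; rewrite !mxE => /eqP; rewrite oner_eq0.
Qed.

End EmbeddedCurve.

Lemma half_le0 (R : realType) (a : R) : a <= 2^-1 * a -> a <= 0.
Proof. by lra. Qed.

(** * Retracts onto curves and rectangular bands *)

Section Retract.
Variable R : realType.
Local Notation C := (cplx R).

Lemma rn_row_le m (h : 'rV[C]_m) (c : R) : 0 <= c -> (forall j, rn (h 0 j : C) <= c) -> rn h <= c.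
Proof.
move=> c0 H; have cC : (0 : C) <= c%:C%C by rewrite lecR.
suff : `|h| <= c%:C%C by rewrite rnE lecR.
rewrite [leLHS]/Num.norm /= mx_normE.
have -> : c%:C%C = (NngNum cC)%:num by [].
rewrite num_le; apply/bigmax_leP; split=> [|i _]; first by rewrite -num_le /=.
have -> : i.1 = 0 by exact: ord1.
by rewrite -num_le /= rnE lecR; exact: H.
Qed.

Lemma idem_rank1 m (E : 'M[C]_m) : E *m E = E -> \rank E = 1%N ->
  exists (rho : 'cV[C]_m) (e : 'rV[C]_m), E = rho *m e /\ e *m rho = 1%:M.
Proof.
move=> EE r1; suff H r : \rank E = r -> exists (X : 'M[C]_(m, r)) (Y : 'M[C]_(r, m)), E = X *m Y /\ Y *m X = 1%:M by exact: H.
move=> <-; exists (col_base E), (row_base E); split; first by rewrite mulmx_base.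
have [X XE] := row_freeP (row_base_free E); have [Y YE] := row_fullP (col_base_full E).
by apply: (idem_factor XE YE); rewrite mulmx_base.
Qed.

Lemma open_rnball (V : normedModType C) (a : V) (t : R) : open [set v : V | rn (v - a) < t].
Proof.
rewrite openE => v /= vt.
have N : \forall w \near v, rn (w - a) < t.
  apply/nearP; exists (t - rn (v - a)); first by rewrite subr_gt0.
  by move=> w wv; apply: le_lt_trans (rn_tri v w a) _; rewrite -ltrBrDr.
exact: N.
Qed.

Section Functional.
Variables (m : nat) (rho : 'cV[C]_m).
Definition lam (v : 'rV[C]_m) : C := (v *m rho) 0 0.

Lemma lam_lin s v w : lam (v + s *: w) = lam v + s * lam w.
Proof. by rewrite /lam mulmxDl -scalemxAl !mxE. Qed.

Lemma lamB v w : lam (v - w) = lam v - lam w.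
Proof. by rewrite -scaleN1r lam_lin mulN1r. Qed.

Lemma lam_differentiable v : differentiable lam v.
Proof.
have -> : lam = \sum_j (fun v : 'rV[C]_m => v 0 j * rho j 0 : C) by apply/funext => w; rewrite fct_sumE /lam mxE.
apply: differentiable_sum => j; apply: differentiableM; [exact: differentiable_coord|exact: differentiable_cst].
Qed.

Lemma diff_lam v h : 'd lam v h = lam h.
Proof.
have c1 := line_cder h (lam_differentiable v).
apply: (cder_uniq c1 (b := lam h) (g := fun s : C => lam (v + s *: h))) => //.
move=> e e0; exists 1 => // s _; rewrite add0r scale0r addr0 lam_lin [lam v + _]addrC addrK subrr rn0.
by rewrite mulr_ge0 ?rn_ge0// ltW.
Qed.

End Functional.

Lemma near_line m (p e : 'rV[C]_m) (P : 'rV[C]_m -> Prop) (s : C) : (\forall v \near p + s *: e, P v) ->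
  \forall r \near s, P (p + r *: e).
Proof.
move=> /nearP[d d0 dH]; apply/nearP; have e1 : 0 < 1 + rn e by rewrite ltr_pwDl// rn_ge0.
exists (d / (1 + rn e)); first by rewrite divr_gt0.
move=> r; rewrite ltr_pdivlMr// => rs; apply: dH.
rewrite opprD addrACA subrr add0r -scalerBl rnZ; apply: le_lt_trans rs.
by rewrite ler_wpM2l ?rn_ge0// lerDr.
Qed.

Lemma line_differentiable m (p e : 'rV[C]_m) (G : C -> C) (w : C) : differentiable G w ->
  differentiable (fun w => p + G w *: e) w.
Proof.
move=> dG; apply: differentiable_row => j.
have -> : (fun v => (p + G v *: e) 0 j : C) = (fun v => p 0 j + G v * e 0 j) by apply/funext => v; rewrite !mxE.
apply: differentiableD; first exact: differentiable_cst.
by apply: differentiableM; [exact: dG|exact: differentiable_cst].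
Qed.

Variables (m : nat) (M : cmanifold R m) (psi : M -> M).
Hypotheses (hpsi : holomorphic psi) (idem : forall x, psi (psi x) = psi x).

Definition fixT : Type := {x : M | `[< psi x = x >]}.
HB.instance Definition _ := Choice.copy fixT {x : M | `[< psi x = x >]}.
Definition fixval (y : fixT) : M := sval y.
Definition fix_space : topologicalType := initial_topology fixval.
Let iv (y : fix_space) : M := fixval y.

Lemma fix_iv y : psi (iv y) = iv y.
Proof. by rewrite /iv /fixval; case: y => x /= /asboolP. Qed.

Lemma iv_inj : injective iv.
Proof. by move=> y z e; apply: val_inj; exact: e. Qed.

Definition fix_retr (x : M) : fix_space := exist _ (psi x) (asboolT (idem x)).

Lemma iv_cont : continuous iv.
Proof. exact: initial_continuous. Qed.

Lemma cont_fix (U : topologicalType) (f : U -> fix_space) u : {for u, continuous (iv \o f)} -> {for u, continuous f}.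
Proof.
move=> fc A [B [[V oV VB] Bu BA]].
have nV : nbhs (iv (f u)) V by apply: open_nbhs_nbhs; split=> //; move: Bu; rewrite -VB.
have N : \forall z \near u, V ((iv \o f) z) by exact: fc V nV.
change (nbhs u (f @^-1` A)); apply: (@filterS _ (nbhs u) _ _ _ _ N) => z Vz.
by apply: BA; rewrite -VB; exact: Vz.
Qed.

Lemma fix_hausdorff : hausdorff_space fix_space.
Proof.
move=> y z yz; apply: iv_inj; apply: (@manifold_hausdorff _ _ M) => A B nA nB.
have [w [wA wB]] := yz _ _ (iv_cont nA) (iv_cont nB).
by exists (iv w).
Qed.

(** Charts of the submanifold structure: the inverse is holomorphic into [M], and [c] is locally
    induced by a differentiable map on a chart of [M]. These two halves compose to the compatibility
    of any two such charts. *)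
Definition good (c : chart R 1 fix_space) :=
  (forall y phi, chart_dom c y -> atlas phi -> chart_dom phi (iv y) -> differentiable (phi \o iv \o chart_inv c) (c y)) /\
  (forall y, chart_dom c y -> exists phi (u : 'rV[C]_m -> 'rV[C]_1), [/\ atlas phi, chart_dom phi (iv y), differentiable u (phi (iv y)) &
    \forall z \near y, c z = u (phi (iv z))]).

Lemma good_compatible c1 c2 y : good c1 -> good c2 -> chart_dom c1 y -> chart_dom c2 y ->
  differentiable (c2 \o chart_inv c1) (c1 y).
Proof.
move=> [g1 _] [_ g2] d1 d2; have [phi [u [ap dp du E]]] := g2 y d2.
have E' : \forall v \near c1 y, (u \o (phi \o iv \o chart_inv c1)) v = (c2 \o chart_inv c1) v.
  by have := chart_inv_cvg d1 E; apply: filterS => v /= ->.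
apply: near_differentiable E' _; apply: differentiable_comp; first exact: g1.
by rewrite /= chart_mapK.
Qed.

Hypothesis rank1 : forall phi x, psi x = x -> atlas phi -> chart_dom phi x -> \rank (Jc phi phi psi x) = 1%N.

Section GoodChart.
Variable b : fix_space.
Let x0 := iv b.
Let phi := ch x0.
Let p0 := phi x0.
Let ap : atlas phi. Proof. exact: ch_atlas. Qed.
Let dp : chart_dom phi x0. Proof. exact: ch_dom. Qed.
Let fx : psi x0 = x0. Proof. exact: fix_iv. Qed.
Let Psi : 'rV[C]_m -> 'rV[C]_m := phi \o psi \o chart_inv phi.
Let dp' : chart_dom phi (psi x0). Proof. by rewrite fx. Qed.
Let Psi0 : Psi p0 = p0. Proof. by rewrite /Psi /p0 /= chart_mapK// fx. Qed.
Let E := Jc phi phi psi x0.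

Let nd : \forall v \near p0, differentiable Psi v.
Proof. exact: holo_near_chart. Qed.

Let EE : E *m E = E.
Proof.
have := Jc_chain hpsi hpsi ap ap ap dp dp'; rewrite fx => /(_ dp'); rewrite -/E => <-.
by congr (Jc _ _ _ _); apply/funext => x; rewrite /= idem.
Qed.

Let factor := idem_rank1 EE (rank1 fx ap dp).
Let rho : 'cV[C]_m := projT1 (cid factor).
Let e : 'rV[C]_m := projT1 (cid (projT2 (cid factor))).
Let re : E = rho *m e /\ e *m rho = 1%:M.
Proof. exact: projT2 (cid (projT2 (cid factor))). Qed.

Let dPsi h : 'd Psi p0 h = h *m E. Proof. by rewrite -jac_mul. Qed.

(* Differences of nearby fixed points are nearly multiples of [e], which [rho] does not kill. *)
Lemma fix_injective : exists2 r, 0 < r & forall y y', psi y = y -> psi y' = y' -> chart_dom phi y -> chart_dom phi y' ->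
  rn (phi y - p0) < r -> rn (phi y' - p0) < r -> lam rho (phi y) = lam rho (phi y') -> y = y'.
Proof.
have h2 : (0 : R) < 2^-1 by rewrite invr_gt0.
have H j : exists2 r, 0 < r & forall z w, rn (z - p0) < r -> rn (w - p0) < r ->
    rn (Psi z 0 j - Psi w 0 j - 'd (fun v => Psi v 0 j : C) p0 (z - w)) <= 2^-1 * rn (z - w).
  by apply: strict_diff h2 _; apply: filterS nd => v; exact: differentiable_entry.
have [f fH] := choice (fun j => (exists2P _ _).1 (H j)).
pose r := \big[Num.min/1]_j f j.
have r0 : 0 < r by apply/bigmin_gtP; split=> // j _; have [] := fH j.
exists r => // y y' fy fy' dy dy' ny ny' ly.
have PE z : psi z = z -> chart_dom phi z -> Psi (phi z) = phi z by move=> fz dz; rewrite /Psi /= chart_mapK// fz.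
pose D := phi y - phi y'.
have DE : D *m E = 0.
  rewrite re.1 mulmxA; have -> : D *m rho = 0; last by rewrite mul0mx.
  have l0 := lamB rho (phi y) (phi y'); rewrite ly subrr in l0.
  by apply/matrixP => i j; rewrite !ord1 [RHS]mxE; exact: l0.
have main : rn D <= 2^-1 * rn D.
  apply: rn_row_le => [|j]; first by rewrite mulr_ge0 ?rn_ge0// ltW.
  have [_ /(_ (phi y) (phi y'))] := fH j.
  have rj : r <= f j by exact: bigmin_le_cond.
  move=> /(_ (lt_le_trans ny rj) (lt_le_trans ny' rj)); rewrite !PE//.
  have -> : 'd (fun v => Psi v 0 j : C) p0 (phi y - phi y') = 0.
    apply: etrans (diff_entry (phi y - phi y') j (nbhs_singleton nd)) _.
    by rewrite dPsi -/D DE mxE.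
  by rewrite subr0 /D !mxE.
have D0 : D = 0.
  apply/eqP; rewrite -rn_eq0 eq_le rn_ge0 andbT.
  exact: half_le0 main.
by rewrite -(chart_mapK dy) -(chart_mapK dy'); congr (chart_inv _ _); apply/eqP; rewrite -subr_eq0 -/D D0.
Qed.

(** The curve of the points psi(p0 + s e) consists of fixed points. The functional [lam rho] is a
    coordinate on it, with derivative 1 at the start because [e *m rho = 1%:M]; [G] reparametrizes
    the curve by this coordinate, and [fix_injective] shows that it covers all fixed points
    nearby. *)
Lemma good_chart : exists2 c, good c & chart_dom c b.
Proof.
have [r r0 inj] := fix_injective.
pose ln (s : C) : 'rV[C]_m := p0 + s *: e.
have ln0 : ln 0 = p0 by rewrite /ln scale0r addr0.
pose zeta (s : C) : C := lam rho (Psi (ln s)).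
pose w0 := lam rho p0.
have z0 : zeta 0 = w0 by rewrite /zeta ln0 Psi0.
have nz : \forall s \near (0 : C), differentiable zeta s.
  have H : \forall v \near ln 0, differentiable Psi v by rewrite ln0.
  have := near_line H; apply: filterS => s ds.
  have d0 : differentiable (id : C -> C) s by [].
  have d1 := @line_differentiable m p0 e id s d0.
  have d2 := @differentiable_comp C _ _ _ ln Psi s d1 ds.
  exact: (@differentiable_comp C _ _ _ (Psi \o ln) (lam rho) s d2 (lam_differentiable _ _)).
have dz1 : derive1 zeta 0 = 1.
  have dP := nbhs_singleton nd.
  have dl := lam_differentiable rho (Psi p0).
  have c1 := line_cder e (@differentiable_comp C _ _ _ Psi (lam rho) p0 dP dl).
  have -> : derive1 zeta 0 = 'd (lam rho \o Psi) p0 e.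
    by have /cderP[_ <-] := c1.
  have e1 := congr1 (fun g : 'rV[C]_m -> C => g e) (@diff_comp C _ _ _ Psi (lam rho) p0 dP dl).
  apply: etrans e1 _; apply: etrans (diff_lam rho (Psi p0) _) _.
  rewrite dPsi /lam re.1 !mulmxA re.2 mul1mx re.2 mxE eqxx.
  by [].
have dz0 : derive1 zeta 0 != 0 by rewrite dz1 oner_neq0.
have [q [d [G [q0 d0 GH Ginj]]]] := local_inverse nz dz0.
rewrite z0 in GH.
have w00 : rn (w0 - w0) < d by rewrite subrr rn0.
have G0 : G w0 = 0.
  have [h1 h2 _] := GH w0 w00; have q00 : rn ((0 : C) - 0) < q by rewrite subrr rn0.
  exact: (Ginj _ _ h1 q00 (etrans h2 (esym z0))).
have dG0 : differentiable G w0 by have [] := GH w0 w00.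
pose kap w := psi (chart_inv phi (ln (G w))).
pose V : set M := chart_dom phi `&` phi @^-1` [set v | rn (v - p0) < r].
have oball k (a : 'rV[C]_k) (t : R) : open [set v : 'rV[C]_k | rn (v - a) < t] by exact: open_rnball.
have oV : open V.
  by apply: open_pointwise_preimage (oball _ _ _); [exact: chart_dom_open|exact: chart_map_continuous].
have Vx0 : V x0 by split=> //=; rewrite /p0 subrr rn0.
have nV : \forall x \near psi x0, V x by rewrite fx; apply: open_nbhs_nbhs.
have near_G (P : 'rV[C]_m -> Prop) : (\forall v \near p0, P v) -> \forall w \near w0, P (ln (G w)).
  move=> H; have H1 : \forall v \near ln 0, P v by rewrite ln0.
  have H2 := near_line H1; rewrite -G0 in H2; exact: near_diff dG0 H2.
have N1 : \forall w \near w0, V (kap w).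
  have H : \forall x \near x0, V (psi x) by exact: hpsi.1 x0 V nV.
  exact: near_G _ ((near_chart (fun x => V (psi x)) dp).1 H).
have N2 : \forall w \near w0, chart_dom phi (chart_inv phi (ln (G w))) /\ phi (chart_inv phi (ln (G w))) = ln (G w).
  by apply: (near_G (fun v => chart_dom phi (chart_inv phi v) /\ phi (chart_inv phi v) = v)); exact: chart_near.
have N3 : \forall w \near w0, rn (w - w0) < d by apply/nearP; exists d.
have N : \forall w \near w0, [/\ V (kap w), chart_dom phi (chart_inv phi (ln (G w))),
   phi (chart_inv phi (ln (G w))) = ln (G w), zeta (G w) = w & differentiable G w].
  by apply: filterS3 N1 N2 N3 => w a1 [a2 a3] a4; have [b1 b2 b3] := GH w a4; split.
have [d' d'0 dH] := (nearP _ _).1 N.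
have dPsi1 w : rn (w - w0) < d' -> differentiable (fun w => ln (G w)) w.
  by move=> /dH[_ _ _ _ dG]; exact: line_differentiable.
have lamk w : rn (w - w0) < d' -> lam rho (phi (kap w)) = w by move=> /dH[_ _ _ zE _]; exact: zE.
have kap_cont w : rn (w - w0) < d' -> {for w, continuous kap}.
  move=> h; have [_ a2 a3 _ _] := dH w h.
  apply: (@continuous_comp _ _ _ (fun w => chart_inv phi (ln (G w))) psi); last exact: hpsi.1.
  apply: (@continuous_comp _ _ _ (fun w => ln (G w)) (chart_inv phi)).
    exact: differentiable_continuous (dPsi1 w h).
  by apply: chart_inv_continuous; exists (chart_inv phi (ln (G w))).
pose cdom : set fix_space := iv @^-1` (V `&` (lam rho \o phi) @^-1` [set w | rn (w - w0) < d']).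
pose cmap (y : fix_space) : 'rV[C]_1 := up (lam rho (phi (iv y))).
pose cinv (v : 'rV[C]_1) : fix_space := fix_retr (chart_inv phi (ln (G (v 0 0)))).
have lphi_cont x : V x -> {for x, continuous (lam rho \o phi)}.
  move=> [dx _]; apply: continuous_comp; first exact: chart_map_continuous.
  exact: differentiable_continuous (lam_differentiable _ _).
have odom : open cdom.
  apply: open_comp; first by move=> y _; exact: iv_cont.
  apply: open_pointwise_preimage => //.
  exact: (@open_rnball C).
have img : cmap @` cdom = [set v : 'rV[C]_1 | rn (v - up w0) < d'].
  apply/seteqP; split=> v /=.
    by move=> [y [_ /= yd] <-]; rewrite /cmap upB rn_up.
  rewrite -(up_lo v) upB rn_up => vd; have [a1 a2 a3 a4 a5] := dH _ vd.
  exists (cinv v); last by rewrite /cmap -[iv _]/(kap (v 0 0)) lamk// up_lo.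
  split; first exact: a1.
  have l := lamk _ vd; change (rn (lam rho (phi (kap (v 0 0))) - w0) < d'); rewrite l; exact: vd.
have oimg : open (cmap @` cdom) by rewrite img; exact: oball.
have mapK y : cdom y -> cinv (cmap y) = y.
  move=> [[dy /= ny] /= wy]; apply: iv_inj; rewrite -[iv (cinv _)]/(kap (cmap y 0 0)) /cmap mxE.
  have [[b1 /= b2] _ _ _ _] := dH _ wy.
  exact: (inj _ _ (idem _) (fix_iv y) b1 dy b2 ny (lamk _ wy)).
have mapc y : cdom y -> {for y, continuous cmap}.
  move=> [Vy _]; apply: continuous_row => j.
  have -> : (fun y => cmap y 0 j : C) = (lam rho \o phi) \o iv by apply/funext => z; rewrite mxE.
  exact: (@continuous_comp _ _ C iv (lam rho \o phi) y (@iv_cont y) (lphi_cont _ Vy)).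
have invc v : (cmap @` cdom) v -> {for v, continuous cinv}.
  rewrite img /= -{1}(up_lo v) upB rn_up => vd; apply: cont_fix.
  apply: (@continuous_comp _ _ _ (fun v : 'rV[C]_1 => v 0 0 : C) kap); first exact: coord_continuous.
  exact: kap_cont.
exists (Chart odom oimg mapK mapc invc); last by split=> //=; rewrite -/x0 -/p0 subrr rn0.
split=> [y th [Vy /= wy] at_ dt|y [Vy _]]; last first.
  exists phi, (fun v => up (lam rho v)); split; [exact: ap|by case: Vy| |by apply: (@filterE _ (nbhs y))].
  apply: differentiable_row => j; have -> : (fun v => up (lam rho v) 0 j : C) = lam rho by apply/funext => v; rewrite mxE.
  exact: lam_differentiable.
have cy : cmap y 0 0 = lam rho (phi (iv y)) by rewrite /cmap mxE.
have yk : kap (cmap y 0 0) = iv y.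
  by have := congr1 iv (mapK y (conj Vy wy)).
rewrite -cy in wy; have [_ b2 b3 _ _] := dH _ wy.
have D1 := hpsi.2 phi th (chart_inv phi (ln (G (cmap y 0 0)))) ap at_ b2; rewrite b3 in D1.
have {}D1 : differentiable (th \o psi \o chart_inv phi) (ln (G (cmap y 0 0))) by apply: D1; rewrite -/(kap _) yk.
have D2 := @differentiable_comp C _ _ _ (fun w => ln (G w)) (th \o psi \o chart_inv phi) _ (dPsi1 _ wy) D1.
exact: (@differentiable_comp C _ _ _ (fun v : 'rV[C]_1 => v 0 0 : C) _ (cmap y) (differentiable_coord _ _ _) D2).
Qed.

End GoodChart.

Definition fix_manifold : cmanifold R 1 := CManifold fix_hausdorff good_chart good_compatible.

Lemma holomorphic_fixval : holomorphic (iv : fix_manifold -> M).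
Proof. by split=> [|c phi y [g _] ap dy dp]; [exact: iv_cont|exact: g]. Qed.

Lemma holomorphic_retr : holomorphic (fix_retr : M -> fix_manifold).
Proof.
split=> [x|phi c x ap [_ g] dx dy]; first by apply: cont_fix; exact: hpsi.1.
have [th [u [at_ dt du E]]] := g _ dy.
have fc : {for x, continuous fix_retr} by apply: cont_fix; exact: hpsi.1.
have E1 : \forall z \near x, c (fix_retr z) = u (th (psi z)) by exact: fc _ E.
have E2 : \forall v \near phi x, (u \o (th \o psi \o chart_inv phi)) v = (c \o fix_retr \o chart_inv phi) v.
  by move/(near_chart _ dx): E1; apply: filterS => v e1; exact: esym e1.
apply: near_differentiable E2 _; apply: differentiable_comp; first exact: hpsi.2 ap at_ dx dt.
by rewrite /= chart_mapK.
Qed.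

Lemma retrK : cancel (iv : fix_manifold -> M) fix_retr.
Proof. by move=> y; apply: iv_inj; exact: fix_iv. Qed.

Lemma retract_curve : exists (D : cmanifold R 1) (i : D -> M) (q : M -> D),
  [/\ holomorphic i, holomorphic q, cancel i q & forall x, i (q x) = psi x].
Proof.
exists fix_manifold, iv, fix_retr; split;
  [exact: holomorphic_fixval|exact: holomorphic_retr|exact: retrK|by []].
Qed.

End Retract.

(** * The rectangular band law *)

Section Band.
Variable R : realType.
Local Notation C := (cplx R).

Lemma idem_absorb m k n (A : 'M[C]_(m, k)) (A' : 'M[C]_(k, m)) (B' : 'M[C]_(k, n)) (D : 'M[C]_(n, k)) :
  A' *m A + B' *m D = 1%:M -> A *m B' = 0 -> A = A *m (A' *m A).
Proof.
move=> e z; have := congr1 (mulmx A) e.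
by rewrite mulmx1 mulmxDr mulmxA mulmxA z mul0mx addr0 -mulmxA => ->.
Qed.

Lemma mx_kill3 m k l n (A : 'M[C]_(m, k)) (P : 'M[C]_k) (X : 'M[C]_(k, l)) (Y : 'M[C]_(l, k)) (Z : 'M[C]_(k, n)) :
  A = A *m P -> P = X *m Y -> Y *m Z = 0 -> A *m Z = 0.
Proof. by move=> -> -> YZ; rewrite -!mulmxA YZ !mulmx0. Qed.

Lemma complement_mx m (P Q : 'M[C]_m) : P + Q = 1%:M -> Q = 1%:M - P.
Proof. by move=> <-; rewrite addrC addKr. Qed.

Section Projectors.
Variables (m n m' n' : nat) (M : cmanifold R m) (N : cmanifold R n) (M' : cmanifold R m') (N' : cmanifold R n').
Variables (F : prod_manifold M N -> prod_manifold M' N') (G : prod_manifold M' N' -> prod_manifold M N).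
Hypothesis FG : pairiso F G.
Hypotheses (nM : noforms M) (nN : noforms N) (nM' : noforms M') (nN' : noforms N').

Lemma dAA_indep phi phi' th' (p : prod_manifold M N) : atlas phi -> atlas phi' -> atlas th' ->
  chart_dom phi p.1 -> chart_dom phi' (F p).1 -> chart_dom th' (F p).1 -> dAA F G phi phi' p = dAA F G phi th' p.
Proof.
move=> ap ap' at' dp dp' dt'.
have pE : (p.1, p.2) = p by rewrite -surjective_pairing.
have FE : ((F p).1, (F p).2) = F p by rewrite -surjective_pairing.
have GE : G (F p) = p by exact: (iso_FK FG p).
have h1 : holomorphic (fun x : M => (F (x, p.2)).1).
  exact: holomorphic_comp (holomorphic_comp (holomorphic_inl M p.2) (iso_F FG)) (@holomorphic_fst _ _ _ _ _).
have h2 : holomorphic (fun x : M' => (G (x, (F p).2)).1).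
  exact: holomorphic_comp (holomorphic_comp (holomorphic_inl M' (F p).2) (iso_G FG)) (@holomorphic_fst _ _ _ _ _).
have d1 : chart_dom phi' (F (p.1, p.2)).1 by rewrite pE.
have d1' : chart_dom th' (F (p.1, p.2)).1 by rewrite pE.
have d2 : chart_dom phi (G ((F p).1, (F p).2)).1 by rewrite FE GE.
have e2 : dA F phi phi' p = dA F phi th' p *m Jc th' phi' (@idfun M') (F p).1.
  by have := Jc_chain h1 (holomorphic_id M') ap at' ap' dp d1' d1; rewrite pE.
have e3 : dA' F G phi' phi p = Jc phi' th' (@idfun M') (F p).1 *m dA' F G th' phi p.
  exact: (Jc_chain (holomorphic_id M') h2 ap' at' ap dp' dt' d2).
have t1 := Jc_trans at' ap' dt' dp'.
by rewrite /dAA e2 e3 !mulmxA -(mulmxA (dA F phi th' p)) t1 mulmx1.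
Qed.

Lemma rank_dAA phi phi' (p : prod_manifold M N) : atlas phi -> atlas phi' ->
  chart_dom phi p.1 -> chart_dom phi' (F p).1 -> \rank (dAA F G phi phi' p) = rk F G p.
Proof.
move=> ap ap' dp dp'; have e := rkE FG nM nN nM' nN' ap ap' dp dp'.
have i := dAA_idem FG nM nN nM' nN' ap ap' dp dp'.
by rewrite (idem_trace i) in e; apply/eqP; rewrite -(eqr_nat C); apply/eqP.
Qed.

Lemma dAA_hfun phi phi' (p : prod_manifold M N) i l : atlas phi -> atlas phi' ->
  chart_dom phi p.1 -> chart_dom phi' (F p).1 ->
  hfun_at (M := prod_manifold M N) (fun q => dAA F G phi phi' q i l) p.
Proof.
move=> ap ap' dp dp'; have GE : G (F p) = p by exact: (iso_FK FG p).
have hf : holomorphic (fun q : prod_manifold M N => (F q).1).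
  exact: holomorphic_comp (iso_F FG) (@holomorphic_fst _ _ _ _ _).
have hh : holomorphic (fun q : prod_manifold M' N' => (G q).1).
  exact: holomorphic_comp (iso_G FG) (@holomorphic_fst _ _ _ _ _).
have -> : (fun q => dAA F G phi phi' q i l) = (fun q => \sum_j dA F phi phi' q i j * dA' F G phi' phi q j l).
  by apply/funext => q; rewrite [LHS]mxE.
apply: hfun_sum => j; apply: hfun_mul.
  exact: (Jc_inl_hfun hf i j ap ap' (q := p) dp dp').
have H : hfun_at (M := prod_manifold M' N') (fun q => Jc phi' phi (fun x => (G (x, q.2)).1) q.1 j l) (F p).
  by apply: (Jc_inl_hfun hh j l ap' ap (q := F p) dp'); rewrite /= GE.
exact: (hfun_comp (iso_F FG) H).
Qed.

(* For fixed [x] it is an endomorphism of one tangent space, so that its entries are functions on [N]. *)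
Lemma dAA_const phi x y y' : compact [set: N] -> lcc N -> atlas phi -> chart_dom phi x ->
  dAA F G phi (ch (F (x, y)).1) (x, y) = dAA F G phi (ch (F (x, y')).1) (x, y').
Proof.
move=> cN lN ap dp; apply/matrixP => i l.
apply: (maximum_principle (h := fun y => dAA F G phi (ch (F (x, y)).1) (x, y) i l) cN lN) => {y y'} y.
have ap' := ch_atlas (F (x, y)).1; have dp' := ch_dom (F (x, y)).1; set phi' := ch (F (x, y)).1 in ap' dp'.
have hx := holomorphic_inr N x.
have hfx : holomorphic (fun y : N => (F (x, y)).1).
  exact: holomorphic_comp (holomorphic_comp hx (iso_F FG)) (@holomorphic_fst _ _ _ _ _).
have H := hfun_comp hx (dAA_hfun i l ap ap' (p := (x, y)) dp dp').
have N1 : \forall z \near y, chart_dom phi' (F (x, z)).1 by exact: hfx.1 (chart_dom_nbhs dp').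
have N2 : \forall z \near y, dAA F G phi phi' (x, z) i l = dAA F G phi (ch (F (x, z)).1) (x, z) i l.
  apply: filterS N1 => z dz.
  have e := dAA_indep (p := (x, z)) ap ap' (ch_atlas _) dp dz (ch_dom _).
  exact: (congr1 (fun X : 'M[C]_m => X i l) e).
exact: near_hfun N2 H.
Qed.

End Projectors.

Section Rectangular.
Variables (m n m' n' : nat) (M : cmanifold R m) (N : cmanifold R n) (M' : cmanifold R m') (N' : cmanifold R n').
Variables (F : prod_manifold M N -> prod_manifold M' N') (G : prod_manifold M' N' -> prod_manifold M N).
Hypothesis FG : pairiso F G.
Hypotheses (nM : noforms M) (nN : noforms N) (nM' : noforms M') (nN' : noforms N').
Hypotheses (lM : lcc M) (cN' : compact [set: N']) (lN' : lcc N').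
Variable y0 : N.
Let f0 (x : M) := (F (x, y0)).1.
Let g0 (x : M) := (F (x, y0)).2.

Let hf0 : holomorphic f0.
Proof. exact: holomorphic_comp (holomorphic_comp (holomorphic_inl M y0) (iso_F FG)) (@holomorphic_fst _ _ _ _ _). Qed.
Let hg0 : holomorphic g0.
Proof. exact: holomorphic_comp (holomorphic_comp (holomorphic_inl M y0) (iso_F FG)) (@holomorphic_snd _ _ _ _ _). Qed.

(** The derivative is A at [p1] times B' at [p2], two points whose images under [F] have the same
    first component [f0 x]. As A = A (A' A) and the projector A' A at [f0 x] does not depend on the
    point of N', it can be taken at [p2], where A B' = 0. *)
Lemma cross_derivative0 v phi psi x : atlas phi -> atlas psi -> chart_dom phi x -> chart_dom psi (G (f0 x, v)).2 ->
  Jc phi psi (fun x => (G (f0 x, v)).2) x = 0.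
Proof.
move=> ap aq dp dq; pose p1 : prod_manifold M N := (x, y0).
have hk : holomorphic (fun u : M' => (G (u, v)).2).
  exact: holomorphic_comp (holomorphic_comp (holomorphic_inl M' v) (iso_G FG)) (@holomorphic_snd _ _ _ _ _).
have ap' := ch_atlas (f0 x); have dp' := ch_dom (f0 x); set phi' := ch (f0 x) in ap' dp'.
apply: etrans (Jc_chain hf0 hk ap ap' aq dp dp' dq) _.
pose p2 := G (f0 x, v); have Fp2 : F p2 = (f0 x, v) by exact: (iso_GK FG).
have GF := pairiso_inv FG; have GFp1 : G (F p1) = p1 by exact: (iso_FK FG).
have dq1 : chart_dom phi' (F p1).1 by exact: dp'.
have [[_ _ _] _ [AA _ _] _] := iso_blocks FG nM nN nM' nN' (p := p1) ap (ch_atlas p1.2) ap' (ch_atlas (F p1).2) dp (ch_dom _) dq1 (ch_dom _).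
have [[_ AB1 _] _ _ _] := iso_blocks FG nM nN nM' nN' (p := p1) ap (ch_atlas p1.2) ap' (ch_atlas (F p1).2) dp (ch_dom _) dq1 (ch_dom _).
have dq2 : chart_dom phi' (F p2).1 by rewrite Fp2; exact: dp'.
have [[_ AB2 _] _ _ _] := iso_blocks FG nM nN nM' nN' (p := p2) (ch_atlas p2.1) aq ap' (ch_atlas (F p2).2) (ch_dom _) dq dq2 (ch_dom _).
have PP : dA' F G phi' phi p1 *m dA F phi phi' p1 = dA' F G phi' (ch p2.1) p2 *m dA F (ch p2.1) phi' p2.
  have e := dAA_const GF (x := f0 x) (g0 x) v cN' lN' ap' dp'.
  have Fp1 : (f0 x, g0 x) = F p1 by rewrite /f0 /g0 -surjective_pairing.
  have s1 : chart_dom phi (G (f0 x, g0 x)).1 by rewrite Fp1 GFp1.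
  rewrite (dAA_indep GF (p := (f0 x, g0 x)) ap' (ch_atlas _) ap dp' (ch_dom _) s1) in e.
  rewrite /dAA /dA /dA' /= in e; rewrite /dA /dA' Fp2 /=.
  move: e; rewrite -/p2 Fp1 GFp1 /=; apply: etrans.
  by rewrite /p1 /= -/(g0 x).
have A1 := idem_absorb AA AB1.
have BE : Jc phi' psi (fun u => (G (u, v)).2) (f0 x) = dB' F G phi' psi p2 by rewrite /dB' Fp2.
have K := mx_kill3 A1 PP AB2.
exact: (eq_ind_r (fun X => Jc phi phi' f0 x *m X = 0) K BE).
Qed.

(** The value does not depend on [x], and is clear for x = x'. Hence the image of the slice [y0] is
    a product subset: it contains the point with the first component of one of its points and the
    second component of another. *)
Lemma cross_const x x' : (G (f0 x, g0 x')).2 = y0.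
Proof.
have hk : holomorphic (fun x => (G (f0 x, g0 x')).2).
  have h : holomorphic (fun u : M' => (G (u, g0 x')).2).
    exact: holomorphic_comp (holomorphic_comp (holomorphic_inl M' (g0 x')) (iso_G FG)) (@holomorphic_snd _ _ _ _ _).
  exact: holomorphic_comp hf0 h.
have e := Jc0_const hk lM (fun phi psi x ap aq dp dq => cross_derivative0 ap aq dp dq) x x'.
by rewrite e /f0 /g0 -surjective_pairing (iso_FK FG).
Qed.

Definition band (p : prod_manifold M M) : M := (G (f0 p.1, g0 p.2)).1.

Lemma band_holo : holomorphic band.
Proof.
have h1 := holomorphic_comp (@holomorphic_fst _ _ _ M M) hf0; have h2 := holomorphic_comp (@holomorphic_snd _ _ _ M M) hg0.
exact: holomorphic_comp (holomorphic_comp (holomorphic_pair h1 h2) (iso_G FG)) (@holomorphic_fst _ _ _ _ _).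
Qed.

Lemma band_F x x' : F (band (x, x'), y0) = (f0 x, g0 x').
Proof. by rewrite /band /= -[in X in F (_, X)](cross_const x x') -surjective_pairing (iso_GK FG). Qed.

Lemma band_f x x' : f0 (band (x, x')) = f0 x. Proof. by rewrite /f0 band_F. Qed.
Lemma band_g x x' : g0 (band (x, x')) = g0 x'. Proof. by rewrite /g0 band_F. Qed.

Lemma bandxx x : band (x, x) = x.
Proof. by rewrite /band /= /f0 /g0 -surjective_pairing (iso_FK FG). Qed.

Lemma bandl x y z : band (band (x, y), z) = band (x, z).
Proof. by rewrite {1}/band /= band_f. Qed.

Lemma bandr x y z : band (x, band (y, z)) = band (x, z).
Proof. by rewrite {1}/band /= band_g. Qed.

(** At a fixed point the jacobian of [x |-> band (x, x0)] is the projector A A'; in [band_rankr]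
    that of [x |-> band (x0, x)] is the complement B C'. *)
Lemma band_rankl x0 phi x : band (x, x0) = x -> atlas phi -> chart_dom phi x ->
  \rank (Jc phi phi (fun x => band (x, x0)) x) = rk F G (x, y0).
Proof.
move=> fx ap dp; have gx : g0 x = g0 x0 by rewrite -{1}fx band_g.
have ap' := ch_atlas (f0 x); have dp' := ch_dom (f0 x); set phi' := ch (f0 x) in ap' dp'.
have hh : holomorphic (fun u : M' => (G (u, g0 x0)).1).
  exact: holomorphic_comp (holomorphic_comp (holomorphic_inl M' (g0 x0)) (iso_G FG)) (@holomorphic_fst _ _ _ _ _).
have dp2 : chart_dom phi (G (f0 x, g0 x0)).1 by have : chart_dom phi (band (x, x0)) by rewrite fx.
have e : Jc phi phi (fun x => band (x, x0)) x = dAA F G phi phi' (x, y0).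
  apply: etrans (Jc_chain hf0 hh ap ap' ap dp dp' dp2) _.
  by rewrite /dAA /dA /dA' /= -/(g0 x) gx.
by rewrite e; exact: (rank_dAA FG nM nN nM' nN' (p := (x, y0)) ap ap' dp dp').
Qed.

Lemma band_rankr x0 phi x : band (x0, x) = x -> atlas phi -> chart_dom phi x ->
  (\rank (Jc phi phi (fun x => band (x0, x)) x) + rk F G (x, y0) = m)%N.
Proof.
move=> fx ap dp; have gx : f0 x = f0 x0 by rewrite -{1}fx band_f.
have ap' := ch_atlas (f0 x); have dp' := ch_dom (f0 x); set phi' := ch (f0 x) in ap' dp'.
have aq' := ch_atlas (g0 x); have dq' := ch_dom (g0 x); set psi' := ch (g0 x) in aq' dq'.
have hh : holomorphic (fun u : N' => (G (f0 x0, u)).1).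
  exact: holomorphic_comp (holomorphic_comp (holomorphic_inr N' (f0 x0)) (iso_G FG)) (@holomorphic_fst _ _ _ _ _).
have dp2 : chart_dom phi (G (f0 x0, g0 x)).1 by have : chart_dom phi (band (x0, x)) by rewrite fx.
have e : Jc phi phi (fun x => band (x0, x)) x = dB F phi psi' (x, y0) *m dC' F G psi' phi (x, y0).
  apply: etrans (Jc_chain hg0 hh ap aq' ap dp dq' dp2) _.
  by rewrite /dB /dC' /= -/(f0 x) gx.
have [[AA _ _] _ _ _] := iso_blocks FG nM nN nM' nN' (p := (x, y0)) ap (ch_atlas y0) ap' aq' dp (ch_dom _) dp' dq'.
have E1 : dB F phi psi' (x, y0) *m dC' F G psi' phi (x, y0) = 1%:M - dAA F G phi phi' (x, y0).
  exact: complement_mx AA.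
have i := dAA_idem FG nM nN nM' nN' (p := (x, y0)) ap ap' dp dp'.
have i2 : (1%:M - dAA F G phi phi' (x, y0)) *m (1%:M - dAA F G phi phi' (x, y0)) = 1%:M - dAA F G phi phi' (x, y0).
  by rewrite mulmxBl mul1mx mulmxBr mulmx1 i subrr subr0.
have t := idem_trace i2; rewrite linearB /= mxtrace1 (rkE FG nM nN nM' nN' (p := (x, y0)) ap ap' dp dp') in t.
rewrite e E1; apply/eqP; rewrite -(eqr_nat C) natrD -t subrK.
by [].
Qed.

End Rectangular.
End Band.

(** Both traces equal the size minus the trace of B' C. *)
Lemma trace_blocks (F : comRingType) n (A A' B' Cc D D' : 'M[F]_n) : A' *m A + B' *m Cc = 1%:M -> D *m D' + Cc *m B' = 1%:M ->
  \tr (D *m D') = \tr (A *m A').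
Proof.
move=> /(congr1 mxtrace) e1 /(congr1 mxtrace) e2; rewrite !linearD /= in e1 e2.
by apply: (addIr (\tr (Cc *m B'))); rewrite e2 -e1 mxtrace_mulC [\tr (B' *m _)]mxtrace_mulC.
Qed.

Lemma natr_C_inj (F : numDomainType) (a b : nat) : a%:R = b%:R :> F -> a = b.
Proof. by move/eqP; rewrite eqr_nat => /eqP. Qed.

Section Rigid.
Variable R : realType.
Local Notation C := (cplx R).

Lemma biholomorphic_sym m n (M : cmanifold R m) (N : cmanifold R n) : biholomorphic M N -> biholomorphic N M.
Proof. by move=> [f [g [hf hg fK gK]]]; exists g, f. Qed.

Lemma biholomorphic_trans l m n (L : cmanifold R l) (M : cmanifold R m) (N : cmanifold R n) :
  biholomorphic L M -> biholomorphic M N -> biholomorphic L N.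
Proof.
move=> [f [f' [hf hf' fK f'K]]] [g [g' [hg hg' gK g'K]]]; exists (g \o f), (f' \o g'); split.
- exact: holomorphic_comp hf hg.
- exact: holomorphic_comp hg' hf'.
- exact: can_comp gK fK.
- exact: can_comp f'K g'K.
Qed.

Lemma biholomorphic_prod m n m' n' (M : cmanifold R m) (N : cmanifold R n) (M' : cmanifold R m') (N' : cmanifold R n') :
  biholomorphic M M' -> biholomorphic N N' -> biholomorphic (prod_manifold M N) (prod_manifold M' N').
Proof.
move=> [f [f' [hf hf' fK f'K]]] [g [g' [hg hg' gK g'K]]].
exists (fun p => (f p.1, g p.2)), (fun p => (f' p.1, g' p.2)); split.
- exact: holomorphic_pair (holomorphic_comp (@holomorphic_fst _ _ _ M N) hf) (holomorphic_comp (@holomorphic_snd _ _ _ M N) hg).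
- exact: holomorphic_pair (holomorphic_comp (@holomorphic_fst _ _ _ M' N') hf') (holomorphic_comp (@holomorphic_snd _ _ _ M' N') hg').
- by move=> [x y] /=; rewrite fK gK.
- by move=> [x y] /=; rewrite f'K g'K.
Qed.

(* What is used of del Pezzo surfaces; unlike [del_pezzo] it passes to holomorphic retracts, in particular to factors. *)
Definition rigid m (M : cmanifold R m) := [/\ compact [set: M], lcc M, noforms M &
  exists N (e : M -> proj_manifold R N), holomorphic_embedding e].

Lemma del_pezzo_rigid (S : cmanifold R 2) : del_pezzo S -> rigid S.
Proof.
move=> dS; have [[cS [N [e He]]] sS _] := dS; split=> //.
- exact: simply_connected_lcc sS.
- exact: del_pezzo_noforms.
- by exists N, e.
Qed.

Lemma retract_embedding m n k (M : cmanifold R m) (D : cmanifold R n) (P : cmanifold R k) (i : D -> M) (q : M -> D) (e : M -> P) :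
  holomorphic i -> holomorphic q -> cancel i q -> holomorphic_embedding e -> holomorphic_embedding (e \o i).
Proof.
move=> hi hq iK [he ie de]; split; [exact: holomorphic_comp hi he|exact: inj_comp ie (can_inj iK)|].
move=> phi psi x ap aq dp dq h h' E.
have at_ := ch_atlas (i x); have dt := ch_dom (i x); set th := ch (i x) in at_ dt.
have dp' : chart_dom phi (q (i x)) by rewrite iK.
have E1 := Jc_chain hi he ap at_ aq dp dt dq.
have E2 := Jc_chain hi hq ap at_ ap dp dt dp'.
have qi : q \o i = idfun by apply/funext => z /=; rewrite iK.
rewrite qi (Jc_id ap dp) in E2.
have inj1 := de th psi (i x) at_ aq dt dq.
have H : h *m Jc phi th i x = h' *m Jc phi th i x.
  apply: inj1; rewrite -!jac_mul -/(Jc th psi e (i x)) -!mulmxA -E1.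
  by rewrite /Jc !jac_mul.
by rewrite -[h]mulmx1 -[h']mulmx1 E2 !mulmxA H.
Qed.

Lemma retract_rigid m n (M : cmanifold R m) (D : cmanifold R n) (i : D -> M) (q : M -> D) :
  holomorphic i -> holomorphic q -> cancel i q -> rigid M -> rigid D.
Proof.
move=> hi hq iK [cM lM nM [N [e He]]]; split.
- have -> : [set: D] = q @` [set: M] by apply/seteqP; split=> // y _; exists (i y).
  by apply: continuous_compact => //; apply: continuous_subspaceT; exact: hq.1.
- exact: lcc_image hq.1 iK lM.
- exact: noforms_retract hi hq iK nM.
- by exists N, (e \o i); exact: retract_embedding hi hq iK He.
Qed.

Lemma biholomorphic_rigid m n (M : cmanifold R m) (D : cmanifold R n) : biholomorphic M D -> rigid M -> rigid D.
Proof. by move=> [f [g [hf hg _ gK]]]; exact: retract_rigid hg hf gK. Qed.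

Lemma rigid_P1 (D : cmanifold R 1) (Q : D) : rigid D -> biholomorphic D (proj_manifold R 1).
Proof. by move=> [cD lD nD [N [e He]]]; exact: (embedded_curve_P1 cD lD nD He Q). Qed.

Lemma rank1_P1xP1 (S T S' T' : cmanifold R 2) (F : prod_manifold S T -> prod_manifold S' T') (G : prod_manifold S' T' -> prod_manifold S T)
    (x0 : S) (y0 : T) : pairiso F G -> rigid S -> rigid T -> rigid S' -> rigid T' -> rk F G (x0, y0) = 1%N ->
  biholomorphic S (prod_manifold (proj_manifold R 1) (proj_manifold R 1)).
Proof.
move=> FG rS rT rS' rT' r1; have [cS lS nS _] := rS; have [cT lT nT _] := rT.
have [_ _ nS' _] := rS'; have [cT' lT' nT' _] := rT'.
have rc x : rk F G (x, y0) = 1%N by rewrite (rk_const FG nS nT nS' nT' lS lT _ (x0, y0)).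
pose b := band F G y0; have hb_ : holomorphic b := band_holo FG y0.
have bxx x : b (x, x) = x := bandxx FG y0 x.
have bl x y z : b (b (x, y), z) = b (x, z) := bandl FG nS nT nS' nT' lS cT' lT' y0 x y z.
have br x y z : b (x, b (y, z)) = b (x, z) := bandr FG nS nT nS' nT' lS cT' lT' y0 x y z.
pose psi x := b (x, x0); pose chi x := b (x0, x).
have hpsi : holomorphic psi := holomorphic_comp (holomorphic_inl S x0) hb_.
have hchi : holomorphic chi := holomorphic_comp (holomorphic_inr S x0) hb_.
have [D1 [i1 [q1 [hi1 hq1 iK1 e1]]]] : exists (D : cmanifold R 1) (i : D -> S) (q : S -> D),
    [/\ holomorphic i, holomorphic q, cancel i q & forall x, i (q x) = psi x].
  apply: retract_curve hpsi _ _ => [x|phi x fx ap dp]; first by rewrite /psi bl.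
  by apply: etrans (band_rankl FG nS nT nS' nT' lS cT' lT' fx ap dp) (rc x).
have [D2 [i2 [q2 [hi2 hq2 iK2 e2]]]] : exists (D : cmanifold R 1) (i : D -> S) (q : S -> D),
    [/\ holomorphic i, holomorphic q, cancel i q & forall x, i (q x) = chi x].
  apply: retract_curve hchi _ _ => [x|phi x fx ap dp]; first by rewrite /chi br.
  have := band_rankr FG nS nT nS' nT' lS cT' lT' fx ap dp; rewrite rc addn1.
  by move=> [].
have b1 := rigid_P1 (q1 x0) (retract_rigid hi1 hq1 iK1 rS).
have b2 := rigid_P1 (q2 x0) (retract_rigid hi2 hq2 iK2 rS).
apply: biholomorphic_trans (biholomorphic_prod b1 b2).
(* In a rectangular band x = (x x0) (x0 x), so the images of the two idempotents serve as
   coordinates and the law itself as the inverse map. *)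
exists (fun x => (q1 x, q2 x)), (fun p => b (i1 p.1, i2 p.2)); split.
- exact: holomorphic_pair hq1 hq2.
- exact: holomorphic_comp (holomorphic_pair (holomorphic_comp (@holomorphic_fst _ _ _ D1 D2) hi1) (holomorphic_comp (@holomorphic_snd _ _ _ D1 D2) hi2)) hb_.
- by move=> x /=; rewrite e1 e2 /psi /chi bl br bxx.
- move=> [d1 d2] /=; congr (_, _).
  + by apply: (can_inj iK1); rewrite e1 /psi bl -[b (i1 d1, x0)]/(psi (i1 d1)) -e1 iK1.
  + by apply: (can_inj iK2); rewrite e2 /chi br -[b (x0, i2 d2)]/(chi (i2 d2)) -e2 iK2.
Qed.

Lemma rk_swap (S T S' T' : cmanifold R 2) (F : prod_manifold S T -> prod_manifold S' T') (G : prod_manifold S' T' -> prod_manifold S T)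
    (x : S) (y : T) : pairiso F G -> noforms S -> noforms T -> noforms S' -> noforms T' ->
  rk (M := T) (N := S) (M' := T') (N' := S') (swapped F) (swapped G) (y, x) = rk F G (x, y).
Proof.
move=> FG nS nT nS' nT'; have FG' := pairiso_swap FG.
have ap := ch_atlas x; have aq := ch_atlas y; have ap' := ch_atlas (F (x, y)).1; have aq' := ch_atlas (F (x, y)).2.
have dp := ch_dom x; have dq := ch_dom y; have dp' := ch_dom (F (x, y)).1; have dq' := ch_dom (F (x, y)).2.
have t1 := rkE FG nS nT nS' nT' (p := (x, y)) ap ap' dp dp'.
have t2 := rkE FG' nT nS nT' nS' (p := (y, x)) aq aq' dq dq'.
have [[_ _ _] [DD _ _] [AA _ _] _] := iso_blocks FG nS nT nS' nT' (p := (x, y)) ap aq ap' aq' dp dq dp' dq'.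
have E : dAA (swapped F) (swapped G) (ch y) (ch (F (x, y)).2) (y, x) =
    dD F (ch y) (ch (F (x, y)).2) (x, y) *m dD' F G (ch (F (x, y)).2) (ch y) (x, y).
  by [].
exact: natr_C_inj (etrans (esym t2) (etrans (congr1 mxtrace E) (etrans (trace_blocks AA DD) t1))).
Qed.

End Rigid.

(** * Automorphism groups *)

Section Semidirect.
Local Open Scope group_scope.
Variables (G N H : groupType) (i : N -> G) (j : H -> G).
Hypotheses (iM : {morph i : x y / x * y}) (jM : {morph j : x y / x * y}).

(** Every element is a product of values of [i] and [j], so normality has to be checked for
    conjugation by [j h] alone. *)
Lemma semidirect_of : injective i -> injective j -> (forall h x, exists y, j h * i x = i y * j h) ->
  (forall x y, i x = j y -> y = 1) -> (forall g, exists x y, g = i x * j y) -> internal_semidirect i j.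
Proof.
move=> ii ij ij_conj cap dec.
have j1 : j 1 = 1 by apply: (mulgI (j 1)); rewrite -jM !mulg1.
have iV x : (i x)^-1 = i x^-1.
  have i1 : i 1 = 1 by apply: (mulgI (i 1)); rewrite -iM !mulg1.
  by apply: (mulgI (i x)); rewrite mulgV -iM mulgV i1.
split=> // [g x|x y e]; last by rewrite e (cap _ _ e).
have [z [h ->]] := dec g; have [y E] := ij_conj h x; exists (z * y * z^-1).
by rewrite invMg !iM -iV -!mulgA; congr (_ * _); rewrite !mulgA E mulgK.
Qed.

End Semidirect.

Section Splitting.
Variable R : realType.

Lemma split_factors m n m' n' (M : cmanifold R m) (N : cmanifold R n) (M' : cmanifold R m') (N' : cmanifold R n')
    (F : prod_manifold M N -> prod_manifold M' N') (G : prod_manifold M' N' -> prod_manifold M N) (x0 : M) (y0 : N) :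
  pairiso F G -> (forall x x' y, (F (x, y)).2 = (F (x', y)).2) -> (forall x y y', (F (x, y)).1 = (F (x, y')).1) ->
  exists (a : M -> M') (a' : M' -> M) (b : N -> N') (b' : N' -> N),
  [/\ [/\ holomorphic a, holomorphic a', cancel a a' & cancel a' a], [/\ holomorphic b, holomorphic b', cancel b b' & cancel b' b]
    & forall x y, F (x, y) = (a x, b y)].
Proof.
move=> FG ix iy; have hF := iso_F FG; have hG := iso_G FG.
pose u0 := (F (x0, y0)).1; pose v0 := (F (x0, y0)).2.
exists (fun x => (F (x, y0)).1), (fun u => (G (u, v0)).1), (fun y => (F (x0, y)).2), (fun v => (G (u0, v)).2).
have FE x y : F (x, y) = ((F (x, y)).1, (F (x, y)).2) by rewrite -surjective_pairing.
have GE p : G p = ((G p).1, (G p).2) by rewrite -surjective_pairing.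
split; last by move=> x y; rewrite FE (ix x x0) (iy x y y0).
- split.
  + exact: holomorphic_comp (holomorphic_comp (holomorphic_inl M y0) hF) (@holomorphic_fst _ _ _ M' N').
  + exact: holomorphic_comp (holomorphic_comp (holomorphic_inl M' v0) hG) (@holomorphic_fst _ _ _ M N).
  + by move=> x; rewrite /v0 (ix x0 x) -FE (iso_FK FG).
  + by move=> u; rewrite (iy _ y0 (G (u, v0)).2) -GE (iso_GK FG).
- split.
  + exact: holomorphic_comp (holomorphic_comp (holomorphic_inr N x0) hF) (@holomorphic_snd _ _ _ M' N').
  + exact: holomorphic_comp (holomorphic_comp (holomorphic_inr N' u0) hG) (@holomorphic_snd _ _ _ M N).
  + by move=> y; rewrite /u0 (iy x0 y0 y) -FE (iso_FK FG).
  + by move=> v; rewrite (ix x0 (G (u0, v)).1) -GE (iso_GK FG).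
Qed.

Lemma prod_aut_inj m n (M : cmanifold R m) (N : cmanifold R n) (x0 : M) (y0 : N) : injective (@prod_aut R m n M N).
Proof.
move=> [a b] [c d] e; have E x y : (a x, b y) = (c x, d y) := congr1 (fun g : autgroup (prod_manifold M N) => g (x, y)) e.
congr (_, _); apply: aut_eq => z; first by have [] := E z y0.
by have [] := E x0 z.
Qed.

Lemma aut_pairiso m n (M : cmanifold R m) (N : cmanifold R n) (g : autgroup (prod_manifold M N)) : pairiso (aut_fun g) (aut_inv g).
Proof. by split; [exact: aut_holomorphic|exact: aut_inv_holomorphic|exact: autK|exact: aut_invK]. Qed.

Lemma prod_aut_of_split m n (M : cmanifold R m) (N : cmanifold R n) (x0 : M) (y0 : N) (g : autgroup (prod_manifold M N)) :
  (forall x x' y, (g (x, y)).2 = (g (x', y)).2) -> (forall x y y', (g (x, y)).1 = (g (x, y')).1) ->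
  exists h, g = prod_aut h.
Proof.
move=> ix iy; have [a [a' [b [b' [[h1 h2 h3 h4] [k1 k2 k3 k4] E]]]]] := split_factors x0 y0 (aut_pairiso g) ix iy.
by exists (MkAut h1 h2 h3 h4, MkAut k1 k2 k3 k4); apply: aut_eq => -[x y]; rewrite E.
Qed.

Local Notation P1 := (proj_manifold R 1).

(* The cases are the ranks 2, 0 and 1 of the block of the jacobian of [g] from the first factor to itself. *)
Lemma surface_cases (S T : cmanifold R 2) (x0 : S) (y0 : T) (g : autgroup (prod_manifold S T)) : rigid S -> rigid T ->
  [\/ exists h, g = prod_aut h,
      biholomorphic T S /\ exists a b, forall x y, g (x, y) = (a y, b x)
    | biholomorphic S (prod_manifold P1 P1) /\ biholomorphic T (prod_manifold P1 P1)].
Proof.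
move=> rS rT; have [cS lS nS _] := rS; have [cT lT nT _] := rT.
have FG := aut_pairiso g.
have rc p : rk g (aut_inv g) p = rk g (aut_inv g) (x0, y0) by exact: (rk_const FG nS nT nS nT lS lT).
have : (rk g (aut_inv g) (x0, y0) <= 2)%N by exact: rank_leq_row.
case E : (rk g (aut_inv g) (x0, y0)) => [|[|[|r]]] // _; rewrite E in rc.
- constructor 2; have [i1 i2] := iso_zero FG nS nT nS nT lS lT rc.
  have i2' := i2 erefl.
  (* Precomposed with the exchange of factors, [g] becomes a map that splits. *)
  pose F' (p : prod_manifold T S) : prod_manifold S T := g (p.2, p.1).
  pose G' (p : prod_manifold S T) : prod_manifold T S := ((aut_inv g p).2, (aut_inv g p).1).
  have FG' : pairiso F' G'.
    split.
    - exact: holomorphic_comp (swap_holo T S) (aut_holomorphic g).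
    - exact: holomorphic_comp (aut_inv_holomorphic g) (swap_holo S T).
    - by move=> [y x]; rewrite /G' /F' /= autK.
    - by move=> p; rewrite /G' /F' /= -surjective_pairing aut_invK.
  have [a [a' [b [b' [[h1 h2 h3 h4] _ FE]]]]] := split_factors y0 x0 FG' (fun y y' x => i2' x y y') (fun y x x' => i1 x x' y).
  split; first by exists a, a'.
  by exists a, b => x y; exact: FE y x.
- constructor 3; split; first exact: (rank1_P1xP1 FG rS rT rS rT E).
  apply: (rank1_P1xP1 (x0 := y0) (y0 := x0) (pairiso_swap FG) rT rS rT rS).
  by rewrite (rk_swap x0 y0 FG nS nT nS nT).
- constructor 1; have [i1 i2] := iso_full FG nS nT nS nT lS lT rc.
  exact: prod_aut_of_split x0 y0 g i1 i2.
Qed.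

Lemma swap_semidirect (S : cmanifold R 2) (x0 : S) : rigid S -> ~ biholomorphic S (prod_manifold P1 P1) ->
  internal_semidirect (@prod_aut R 2 2 S S) (@swap_action R 2 S).
Proof.
move=> rS nP; have [y0 yx] := other_point x0.
have s0 : swap_action S 0 = 1%g by [].
have s1 (p : prod_manifold S S) : swap_action S 1 p = (p.2, p.1) by [].
have two (e : 'Z_2) : e = 0 \/ e = 1.
  by case: e => [[|[|k]]] klt //; [left|right]; exact: val_inj.
have ne1 h : prod_aut h <> swap_action S 1.
  move=> e; have E x y : (h.1 x, h.2 y) = (y, x) := congr1 (fun g : autgroup (prod_manifold S S) => g (x, y)) e.
  have [e1 _] := E x0 x0; have [e2 _] := E x0 y0.
  exact: yx (etrans (esym e2) e1).
apply: semidirect_of; [exact: prod_autM|exact: swap_actionM|exact: prod_aut_inj| | | | ].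
- have s01 : swap_action S 0 <> swap_action S 1.
    by move=> e; apply: (ne1 1%g); rewrite -e s0; apply: aut_eq => -[].
  move=> d e; have [->|->] := two d; have [->|->] := two e => //.
  by move/esym.
- move=> e h; have [->|->] := two e.
    by exists h; rewrite s0 mulg1 mul1g.
  exists (h.2, h.1); apply: aut_eq => p; apply: etrans (s1 _) _.
  exact: (esym (congr1 (prod_aut (h.2, h.1)) (s1 p))).
- move=> h e E; have [->//|e1] := two e.
  by case: (ne1 h); rewrite E e1.
- move=> g; have [[h ->]|[_ [a [b E]]]|[/nP //]] := surface_cases x0 x0 g rS rS.
    by exists h, 0; rewrite s0 mulg1.
  have [h hE] : exists h, (g * swap_action S 1%R)%g = prod_aut h.
    have ge (x y : S) : aut_fun (g * swap_action S 1%R)%g ((x, y) : prod_manifold S S) = (a x, b y).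
      have e : g (swap_action S 1 (x, y)) = g (y, x) := congr1 (aut_fun g) (s1 (x, y)).
      exact: (etrans e (E y x)).
    apply: (prod_aut_of_split x0 x0) => [x x' y|x y y'].
      exact: etrans (congr1 snd (ge x y)) (esym (congr1 snd (ge x' y))).
    exact: etrans (congr1 fst (ge x y)) (esym (congr1 fst (ge x y'))).
  have ss : (swap_action S 1%R * swap_action S 1%R)%g = 1%g by apply: aut_eq => -[].
  by exists h, 1; rewrite -hE -mulgA ss mulg1.
Qed.

End Splitting.

(** * Automorphisms of a fourfold power of a curve *)

Section Fourfold.
Variable R : realType.
Variable X : cmanifold R 1.
Hypothesis rX : rigid X.
Variables (w0 w1 : X).
Hypothesis w01 : w1 <> w0.
Local Notation XX := (prod_manifold X X).
Local Notation Y := (prod_manifold X XX).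
Local Notation Q := (fourfold X).
Local Notation co := (@fourfold_coord R 1 X).
Local Notation of_ := (@fourfold_of R 1 X).

(** Sets the first coordinate apart; together with the transpositions [sw] it sets any coordinate
    apart. *)
Let reg (x : Q) : prod_manifold X Y := (x.1.1, (x.1.2, x.2)).
Let reg' (p : prod_manifold X Y) : Q := ((p.1, p.2.1), p.2.2).

Let hreg : holomorphic reg.
Proof.
have h1 := @holomorphic_fst R _ _ XX XX; have h2 := @holomorphic_snd R _ _ XX XX.
have k1 := @holomorphic_fst R _ _ X X; have k2 := @holomorphic_snd R _ _ X X.
exact: holomorphic_pair (holomorphic_comp h1 k1) (holomorphic_pair (holomorphic_comp h1 k2) h2).
Qed.

Let hreg' : holomorphic reg'.
Proof.
have h1 := @holomorphic_fst R _ _ X Y; have h2 := @holomorphic_snd R _ _ X Y.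
have k1 := @holomorphic_fst R _ _ X XX; have k2 := @holomorphic_snd R _ _ X XX.
exact: holomorphic_pair (holomorphic_pair h1 (holomorphic_comp h2 k1)) (holomorphic_comp h2 k2).
Qed.

Let regK : cancel reg reg'. Proof. by move=> [[a b] [c d]]. Qed.
Let reg'K : cancel reg' reg. Proof. by move=> [a [b [c d]]]. Qed.

Let co_inj x y : (forall i, co x i = co y i) -> x = y.
Proof. by move=> e; rewrite -[x]fourfold_coordK -[y]fourfold_coordK; congr of_; exact/funext. Qed.

Let reg1 x : (reg x).1 = co x ord0. Proof. by []. Qed.

Let reg2 x y : (reg x).2 = (reg y).2 <-> forall j, j != ord0 -> co x j = co y j.
Proof.
split=> [[e1 e2]|H].
  case: x y e1 e2 => [[a b] [c d]] [[a' b'] [c' d']] /= -> [-> ->].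
  by case=> [[|[|[|[|k]]]] klt].
case: x y H => [[a b] [c d]] [[a' b'] [c' d']] H.
have e1 : b = b' := H (@Ordinal 4 1 isT) isT; have e2 : c = c' := H (@Ordinal 4 2 isT) isT.
have e3 : d = d' := H (@Ordinal 4 3 isT) isT.
by rewrite /reg /= e1 e2 e3.
Qed.

Let sw (i : 'I_4) : autgroup Q := fourfold_perm X (tperm ord0 i).
Let swE i x j : co (sw i x) j = co x (tperm ord0 i j).
Proof. exact: fourfold_ofK. Qed.
Let swK i : cancel (sw i) (sw i).
Proof. by move=> x; apply: co_inj => j; rewrite !swE tpermK. Qed.

Section Automorphism.
Variable g : autgroup Q.

(** [g] with the input coordinate [i] and the output coordinate [k] in front, so that its first
    jacobian block is the entry (i, k). *)
Let H i k (p : prod_manifold X Y) : prod_manifold X Y := reg (sw k (g (sw i (reg' p)))).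
Let H' i k (p : prod_manifold X Y) : prod_manifold X Y := reg (sw i (aut_inv g (sw k (reg' p)))).

Let HP i k : pairiso (H i k) (H' i k).
Proof.
split.
- exact: holomorphic_comp (holomorphic_comp (holomorphic_comp (holomorphic_comp hreg' (aut_holomorphic (sw i))) (aut_holomorphic g)) (aut_holomorphic (sw k))) hreg.
- exact: holomorphic_comp (holomorphic_comp (holomorphic_comp (holomorphic_comp hreg' (aut_holomorphic (sw k))) (aut_inv_holomorphic g)) (aut_holomorphic (sw i))) hreg.
- by move=> p; rewrite /H /H' regK swK autK swK reg'K.
- by move=> p; rewrite /H /H' regK swK aut_invK swK reg'K.
Qed.

Let HE i k x : H i k (reg (sw i x)) = reg (sw k (g x)).
Proof. by rewrite /H regK swK. Qed.

Let nX : noforms X. Proof. by have [] := rX. Qed.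
Let lX : lcc X. Proof. by have [] := rX. Qed.
Let nY : noforms Y. Proof. by apply: noforms_prod nX _; exact: noforms_prod. Qed.
Let lY : lcc Y. Proof. by apply: lcc_prod lX _; exact: lcc_prod. Qed.

Definition off i (x y : Q) := forall j, j != i -> co x j = co y j.

Let off_reg i x y : off i x y -> (reg (sw i x)).2 = (reg (sw i y)).2.
Proof.
move=> o; apply/reg2 => j j0; rewrite !swE; apply: o.
by rewrite -[X in _ != X](tpermL ord0 i) (inj_eq perm_inj).
Qed.

Let reg_off k x y : (reg (sw k x)).2 = (reg (sw k y)).2 -> off k x y.
Proof.
move=> /reg2 o j jk; have := o (tperm ord0 k j); rewrite !swE !tpermK; apply.
by rewrite -[X in _ != X](tpermR ord0 k) (inj_eq perm_inj).
Qed.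

Let at_reg i x y : co x i = co y i -> (reg (sw i x)).1 = (reg (sw i y)).1.
Proof. by move=> e; rewrite !reg1 !swE !tpermL. Qed.

(** The block is 1 x 1, so the rank is either full or zero, and [iso_full] or [iso_zero] applies.
    For rank 0 only the first half of [iso_zero] is available, the second factors being of dimension
    3. *)
Lemma coord_cases i k :
  ((forall x y, co x i = co y i -> co (g x) k = co (g y) k) /\ (forall x y, off i x y -> off k (g x) (g y))) \/
  (forall x y, off i x y -> co (g x) k = co (g y) k).
Proof.
have FG := HP i k; pose p0 := reg (of_ (fun=> w0)).
have rc p : rk (H i k) (H' i k) p = rk (H i k) (H' i k) p0 by exact: (rk_const FG nX nY nX nY lX lY).
have gk x : co (g x) k = (H i k (reg (sw i x))).1 by rewrite HE reg1 swE tpermL.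
have sp (p : prod_manifold X Y) : p = (p.1, p.2) by rewrite -surjective_pairing.
have : (rk (H i k) (H' i k) p0 <= 1)%N by exact: rank_leq_row.
case E : (rk (H i k) (H' i k) p0) => [|[|r]] // _; rewrite E in rc; [right|left].
  have [i1 _] := iso_zero FG nX nY nX nY lX lY rc.
  move=> x y o; rewrite !gk (sp (reg (sw i x))) (sp (reg (sw i y))) (off_reg o); exact: i1.
have [i1 i2] := iso_full FG nX nY nX nY lX lY rc.
split=> x y o.
  rewrite !gk (sp (reg (sw i x))) (sp (reg (sw i y))) (at_reg o); exact: i2.
apply: reg_off; rewrite -!(HE i k) (sp (reg (sw i x))) (sp (reg (sw i y))) (off_reg o); exact: i1.
Qed.

Lemma coord_nonconstant k : ~ forall x y, co (g x) k = co (g y) k.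
Proof.
move=> c; have := c (aut_inv g (of_ (fun=> w1))) (aut_inv g (of_ (fun=> w0))).
by rewrite !aut_invK !fourfold_ofK.
Qed.

(** If all the entries (i, k) had rank 0, the output [k] would not change when [x] is turned into
    [y] one coordinate at a time, and would be constant. *)
Lemma coord_source k : exists i, (forall x y, co x i = co y i -> co (g x) k = co (g y) k) /\ (forall x y, off i x y -> off k (g x) (g y)).
Proof.
apply: contrapT => no; apply: (@coord_nonconstant k) => x y.
have ign i x' y' : off i x' y' -> co (g x') k = co (g y') k.
  by have [h|h] := coord_cases i k; [case: no; exists i|exact: h].
pose mix n := of_ (fun j : 'I_4 => if (j < n)%N then co y j else co x j).
have step n : (n < 4)%N -> co (g (mix n)) k = co (g (mix n.+1)) k.
  move=> n4; apply: (ign (Ordinal n4)) => j jn; rewrite !fourfold_ofK.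
  by rewrite ltnS [(j <= n)%N]leq_eqVlt (_ : (j == n :> nat) = false) //; apply/negbTE.
have m0 : mix 0%N = x by apply: co_inj => j; rewrite fourfold_ofK.
have m4 : mix 4 = y by apply: co_inj => j; rewrite fourfold_ofK ltn_ord.
rewrite -[in LHS]m0 -[in RHS]m4.
exact: etrans (step 0%N isT) (etrans (step 1%N isT) (etrans (step 2 isT) (step 3 isT))).
Qed.

Lemma aut_fourfold : exists (a : {ffun 'I_4 -> autgroup X}) (s : 'S_4), g = (fourfold_aut a * fourfold_perm X s)%g.
Proof.
have [sig sigP] := choice coord_source.
have s_inj : injective sig.
  (* If two outputs had the same source, a change of this input would change [k] alone, while [k']
     depends on this input alone; so [k'] would be constant. *)
  move=> k k' e; apply/eqP/negPn/negP => kk'; apply: (@coord_nonconstant k') => x y.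
  pose z := of_ (fun j => if j == sig k' then co x j else co y j).
  have -> : co (g x) k' = co (g z) k' by apply: (sigP k').1; rewrite fourfold_ofK eqxx.
  apply: (sigP k).2; last by rewrite eq_sym.
  by move=> j jk; rewrite fourfold_ofK -e (negPf jk).
pose s := perm s_inj; have sE k : s k = sig k by rewrite permE.
pose d (z : X) : Q := of_ (fun=> z).
have hd : holomorphic d.
  have hi := holomorphic_id X; have hp : holomorphic (fun z : X => (z, z) : XX) := holomorphic_pair hi hi.
  exact: (holomorphic_pair hp hp).
(* As the output [k] depends on the input [s k] alone, it can be read off on the diagonal. *)
pose a k (z : X) : X := co (g (d z)) k; pose a' k (w : X) : X := co (aut_inv g (d w)) (s k).
have aE k x : co (g x) k = a k (co x (s k)).
  by apply: (sigP k).1; rewrite /d fourfold_ofK sE.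
have ha k : holomorphic (a k) by exact: (holomorphic_comp (holomorphic_comp hd (aut_holomorphic g)) (@holomorphic_fourfold_coord R 1 X k)).
have ha' k : holomorphic (a' k) by exact: (holomorphic_comp (holomorphic_comp hd (aut_inv_holomorphic g)) (@holomorphic_fourfold_coord R 1 X (s k))).
have a'K k : cancel (a' k) (a k) by move=> w; rewrite /a' -aE aut_invK /d fourfold_ofK.
have ai k : injective (a k).
  move=> z z' e; pose x t := of_ (fun j => if j == s k then t else w0).
  have gx : g (x z) = g (x z').
    apply: co_inj => k'; rewrite !aE !fourfold_ofK; case: (eqVneq (s k') (s k)) => [/perm_inj ->|//].
    exact: e.
  have := congr1 (fun q => co q (s k)) (can_inj (autK g) gx).
  by rewrite !fourfold_ofK eqxx.
have aK k : cancel (a k) (a' k) by move=> z; apply: (ai k); exact: (a'K k (a k z)).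
exists [ffun k => MkAut (ha k) (ha' k) (aK k) (a'K k)], s; apply: aut_eq => x; apply: co_inj => k.
apply: etrans (aE k x) _; apply: esym.
apply: etrans (fourfold_autE _ _ _) _; rewrite ffunE.
by congr (a k _); exact: fourfold_ofK.
Qed.

End Automorphism.

Lemma fourfold_semidirect : internal_semidirect (@fourfold_aut R 1 X) (@fourfold_perm R 1 X).
Proof.
have pE s x k : co (fourfold_perm X s x) k = co x (s k) by exact: fourfold_ofK.
have cap a s : fourfold_aut a = fourfold_perm X s -> s = 1%g.
  move=> e; apply/permP => k; rewrite perm1; apply/eqP/negPn/negP => sk.
  have E x : a k (co x k) = co x (s k) by rewrite -pE -e fourfold_autE.
  have e1 := E (of_ (fun j => if j == s k then w1 else w0)); have e2 := E (of_ (fun=> w0)).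
  rewrite !fourfold_ofK eq_sym (negPf sk) eqxx in e1; rewrite !fourfold_ofK in e2.
  by apply: w01; rewrite -e1 e2.
apply: semidirect_of.
- move=> a b; apply: aut_eq => x; apply: co_inj => k.
  apply: etrans (fourfold_autE _ _ _) _; rewrite ffunE; apply: esym.
  by apply: etrans (fourfold_autE _ _ _) _; rewrite fourfold_autE.
- exact: fourfold_permM.
- move=> a b e; apply/ffunP => k; apply: aut_eq => z.
  have := congr1 (fun g : autgroup Q => co (g (of_ (fun=> z))) k) e.
  by rewrite !fourfold_autE fourfold_ofK.
- move=> s s' e; have := cap 1%g (s * s'^-1)%g.
  have -> : fourfold_perm X (s * s'^-1)%g = fourfold_aut 1%g; last first.
    by move=> /(_ erefl)/eqP; rewrite -eq_mulgV1 => /eqP.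
  rewrite fourfold_permM e -fourfold_permM mulgV; apply: aut_eq => x; apply: co_inj => k.
  by rewrite pE perm1 fourfold_autE ffunE.
- move=> s a; exists [ffun k => a (s k)]; apply: aut_eq => x; apply: co_inj => k.
  apply: etrans (pE s _ k) _; apply: etrans (fourfold_autE _ _ _) _; apply: esym.
  by apply: etrans (fourfold_autE _ _ _) _; rewrite ffunE pE.
- by move=> a s /cap.
- exact: aut_fourfold.
Qed.

End Fourfold.

Theorem theorem7p5 (R : realType) (S1 S2 : cmanifold R 2)
    (S1_del_pezzo : del_pezzo S1) (S2_del_pezzo : del_pezzo S2) :
  let P1 := proj_manifold R 1 in
  let P1xP1 := prod_manifold P1 P1 in
  [/\ ~ biholomorphic S1 S2 -> group_isomorphism (@prod_aut R 2 2 S1 S2),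
      forall S : cmanifold R 2,
        biholomorphic S1 S -> biholomorphic S2 S -> ~ biholomorphic S P1xP1 ->
        internal_semidirect (@prod_aut R 2 2 S S) (@swap_action R 2 S)
    & biholomorphic S1 P1xP1 -> biholomorphic S2 P1xP1 ->
        internal_semidirect (@fourfold_aut R 1 P1) (@fourfold_perm R 1 P1)].
Proof.
move=> P1 P1xP1; have r1 := del_pezzo_rigid S1_del_pezzo; have r2 := del_pezzo_rigid S2_del_pezzo.
have [_ [[x0 _] _ _] _] := S1_del_pezzo; have [_ [[y0 _] _ _] _] := S2_del_pezzo.
split=> [n12|S b1 b2 nP|b1 b2].
- split; first exact: prod_autM.
  have surj (g : autgroup (prod_manifold S1 S2)) : exists h, g = prod_aut h.
    have [//|[b _]|[b1 b2]] := surface_cases x0 y0 g r1 r2; case: n12.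
      exact: biholomorphic_sym.
    by apply: biholomorphic_trans b1 _; exact: biholomorphic_sym.
  have [f fK] := choice surj; exists f => [h|g]; last by rewrite -fK.
  by apply: (prod_aut_inj x0 y0); rewrite -fK.
- have [f _] := b1; exact: swap_semidirect (f x0) (biholomorphic_rigid b1 r1) nP.
- have rP : rigid P1xP1 := biholomorphic_rigid b1 r1.
  have [f _] := b1; pose q : P1 := (f x0).1.
  (* P1 gets its rigidity, in particular the absence of 1-forms, from the given surface, as a
     retract of P1xP1. *)
  have rX : rigid P1.
    apply: (retract_rigid (holomorphic_inl P1 q) (@holomorphic_fst _ _ _ P1 P1) _ rP).
    by move=> z.
  have [w1 w01] := other_point q.
  exact: fourfold_semidirect rX q w1 w01.
Qed.
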